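(* For the ConjRelReach problem (defined in the context), let $l_{\not\approx}$ denote the number of predicates whose comparison operator is $\not\approx_\epsilon$ with $\epsilon>0$. Then: (a) restricted to instances where the number of different target sets $|\{T_{1,1},\dots,T_{m,l}\}|$ is at most a constant, the problem is strongly NP-complete (instances with $l_{\not\approx}>0$ allowed), and it is in PTIME if additionally $l_{\not\approx}=0$; (b) restricted to instances where all target sets are absorbing, the problem is strongly NP-complete (instances with $l_{\not\approx}>0$ allowed), and it is in PTIME if additionally $l_{\not\approx}=0$; (c) restricted to instances with $n=m\cdot l$, i.e., each probability operator has its own scheduler quantifier, the problem is in PTIME (whether or not $l_{\not\approx}>0$).
   Context: A Markov decision process (MDP) is a triple $\mathcal{M}=(S,\mathit{Act},\mathbf{P})$ with finite non-empty $S,\mathit{Act}$ and $\mathbf{P}:S\times\mathit{Act}\times S\to[0,1]$ such that each state has a non-empty set $\mathit{Act}(s)$ of enabled actions $\alpha$ with $\sum_{s'}\mathbf{P}(s,\alpha,s')=1$, and $\sum_{s'}\mathbf{P}(s,\alpha,s')=0$ for other actions. A state $s$ is absorbing if $\mathbf{P}(s,\alpha,s)=1$ for all $\alpha\in\mathit{Act}(s)$; a set is absorbing if all its states are. A (general) scheduler maps finite paths to distributions over actions enabled in the last state. $\Pr^\sigma_s(\mathbf{F}\,T)$ is the probability under $\sigma$ from $s$ of eventually reaching $T$. $r\approx_\epsilon r'$ iff $|r-r'|\le\epsilon$; $r\not\approx_\epsilon r'$ iff $|r-r'|>\epsilon$. ConjRelReach: given an MDP $\mathcal{M}$, naturals $l,m,n$,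 rationals $q_{i,j}$ ($1\le i\le m$, $1\le j\le l$) and $q_1,\dots,q_l$, states $s_{i,j}$, indices $k_{i,j}$ with $\{k_{i,j}\mid i,j\}=\{1,\dots,n\}$, target sets $T_{i,j}\subseteq S$, and operators $\bowtie_j\in\{>,\ge,\approx_\epsilon,\not\approx_\epsilon\mid\epsilon\in\mathbb{Q}_{\ge0}\}$, decide whether there exist general schedulers $\sigma_1,\dots,\sigma_n$ with $\bigwedge_{j=1}^l\sum_{i=1}^m q_{i,j}\Pr^{\sigma_{k_{i,j}}}_{s_{i,j}}(\mathbf{F}\,T_{i,j})\bowtie_j q_j$. Strongly NP-complete means in NP and NP-hard even when all numbers are encoded in unary. *)

(* Defs.v *)
From HB Require Import structures.
From mathcomp Require Import all_boot all_order all_algebra.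
From mathcomp Require Import all_classical all_reals all_analysis.

Set Implicit Arguments.
Unset Strict Implicit.
Unset Printing Implicit Defensive.

Import Order.TTheory GRing.Theory Num.Theory.

Local Open Scope classical_set_scope.
Local Open Scope ring_scope.

(** * Markov decision processes *)

(* States are 'I_nS.+1 and actions 'I_nA.+1, so both sets are finite and
   non-empty.  Probabilities are rational because MDPs are part of the input
   of a decision problem. *)
Record mdp (nS nA : nat) := MDP {
  trans : 'I_nS.+1 -> 'I_nA.+1 -> 'I_nS.+1 -> rat;
  trans_01 : forall s a t, 0 <= trans s a t <= 1;
  trans_sum : forall s a,
    \sum_t trans s a t = 1 \/ \sum_t trans s a t = 0;
  trans_total : forall s, exists a, \sum_t trans s a t = 1 }.

Section MDP.
Variables (nS nA : nat) (M : mdp nS nA).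
Local Notation S := 'I_nS.+1.
Local Notation Act := 'I_nA.+1.

Definition enabled (s : S) (a : Act) : Prop := \sum_t trans M s a t = 1.

Definition absorbing (s : S) : Prop :=
  forall a, enabled s a -> trans M s a s = 1.

(* A finite path s_0 a_0 s_1 a_1 ... s_k is given by its sequence of pairs
   (s_0, a_0), ..., (s_(k-1), a_(k-1)) and its last state s_k.  The values of a
   scheduler on sequences that are not paths of M never matter. *)
Record scheduler (R : realType) := Scheduler {
  choose_act : seq (S * Act) -> S -> Act -> R;
  choose_act_ge0 : forall h s a, 0 <= choose_act h s a;
  choose_act_sum1 : forall h s, \sum_a choose_act h s a = 1;
  choose_act_enabled : forall h s a, ~ enabled s a -> choose_act h s a = 0 }.

End MDP.

HB.instance Definition _ n := isPointed.Build 'I_n.+1 ord0.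

Definition infpath (nS nA : nat) := nat -> ('I_nS.+1 * 'I_nA.+1)%type.
HB.instance Definition _ nS nA := Pointed.on (infpath nS nA).

Definition cylinder nS nA (p : seq ('I_nS.+1 * 'I_nA.+1)) :
    set (infpath nS nA) :=
  [set u | mkseq u (size p) = p].

Definition cylinders nS nA : set (set (infpath nS nA)) :=
  range (@cylinder nS nA).

Definition path_space nS nA := g_sigma_algebraType (@cylinders nS nA).
HB.instance Definition _ nS nA := Measurable.on (path_space nS nA).

Section CylinderProbability.
Variables (R : realType) (nS nA : nat) (M : mdp nS nA).
Variables (sigma : scheduler M R) (s0 : 'I_nS.+1).
Local Notation X := ('I_nS.+1 * 'I_nA.+1)%type.

Definition next_state_prob (h : seq X) (s : 'I_nS.+1) : R :=
  if h is x :: h' then let: (t, a) := last x h' in ratr (trans M t a s)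
  else (s == s0)%:R.

(* The factor contributed by the pair y = (s_k, a_k) that follows h. *)
Definition step_prob (h : seq X) (y : X) : R :=
  next_state_prob h y.1 * choose_act sigma h y.1 y.2.

Definition cylinder_prob (p : seq X) : R :=
  \prod_(i < size p) step_prob (take i p) (nth point p i).

End CylinderProbability.

(** * Existence of the path measure *)

(* Sets of infinite paths that depend on finitely many coordinates form an
   algebra; every consistent weight on finite prefixes is a premeasure on it,
   to which Caratheodory extension applies. *)
Definition fd_path (nS nA : nat) := infpath nS nA.
HB.instance Definition _ nS nA := Pointed.on (fd_path nS nA).

Section FiniteDependence.
Variables (nS nA : nat).
Local Notation X := ('I_nS.+1 * 'I_nA.+1)%type.
Local Notation U := (fd_path nS nA).
Implicit Types (A B : set U) (u v : U) (p : seq X).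

Definition dep n A := forall u v, mkseq u n = mkseq v n -> A u -> A v.
Definition fin_dep : set (set U) := [set A | exists n, dep n A].

Lemma mkseq_leq u v m n : (m <= n)%N -> mkseq u n = mkseq v n ->
  mkseq u m = mkseq v m.
Proof.
move=> mn /(congr1 (take m)).
by rewrite /mkseq -!map_take take_iota (minn_idPl mn).
Qed.

Lemma dep_leq m n A : (m <= n)%N -> dep m A -> dep n A.
Proof. by move=> mn dA u v /(mkseq_leq mn); exact: dA. Qed.

Lemma fin_dep0 : fin_dep set0. Proof. by exists 0%N. Qed.

Lemma fin_depU : setU_closed fin_dep.
Proof.
move=> A B [m dA] [n dB]; exists (maxn m n) => u v uv [Au|Bu].
  by left; exact: (dep_leq (leq_maxl m n) dA) uv Au.
by right; exact: (dep_leq (leq_maxr m n) dB) uv Bu.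
Qed.

Lemma fin_depC : setC_closed fin_dep.
Proof. by move=> A [n dA]; exists n => u v uv nAu Av; apply/nAu/(dA v u). Qed.

Definition fd_display : measure_display.
Proof. exact: default_measure_display. Qed.

HB.instance Definition _ :=
  @isAlgebraOfSets.Build fd_display U fin_dep fin_dep0 fin_depU fin_depC.

Lemma mkseqS u n : mkseq u n.+1 = rcons (mkseq u n) (u n).
Proof. by rewrite /mkseq -(addn1 n) iotaD map_cat /= add0n cats1. Qed.

Lemma fin_dep_compact (G : nat -> set U) :
  (forall n, fin_dep (G n)) -> (forall m n, (m <= n)%N -> G n `<=` G m) ->
  (forall n, G n !=set0) -> (\bigcap_n G n) !=set0.
Proof.
move=> dG decG G0.
pose good p := forall n, exists2 u, G n u & mkseq u (size p) = p.
have good0 : good [::] by move=> n; have [u Gu] := G0 n; exists u.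
have goodS p : good p -> exists x, good (rcons p x).
  move=> gp; apply: contrapT => /forallNP ng.
  have /choice[N NP] : forall x, exists n,
      forall u, G n u -> mkseq u (size p).+1 <> rcons p x.
    move=> x; have /existsNP[n nP] := ng x; exists n => u Gu up.
    by apply: nP; exists u => //; rewrite size_rcons.
  have [u Gu up] := gp (\max_(x : X) N x)%N.
  apply: (NP (u (size p)) u); last by rewrite mkseqS up.
  exact: decG (leq_bigmax (u (size p))) _ Gu.
have /choice[nx nxP] : forall p, exists x, good p -> good (rcons p x).
  move=> p; have [gp|ngp] := pselect (good p); last by exists point.
  by have [x gx] := goodS p gp; exists x.
pose pre := fix pre n :=
  if n is n'.+1 then rcons (pre n') (nx (pre n')) else [::].
have gpre n : good (pre n) by elim: n => //= n IH; exact: nxP.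
pose w : U := fun n => nx (pre n).
have wE n : mkseq w n = pre n by elim: n => //= n IH; rewrite mkseqS IH.
exists w => n _; have [k dk] := dG n.
have [u Gu up] := gpre k n.
apply: dk Gu; rewrite wE -[RHS]up -wE; congr mkseq.
by rewrite size_mkseq.
Qed.

Lemma fin_dep_bigcup (F : nat -> set U) : (forall n, fin_dep (F n)) ->
  fin_dep (\bigcup_n F n) ->
  exists N, \bigcup_n F n = \bigcup_(n < N) F n.
Proof.
move=> dF dUF; apply: contrapT => /forallNP nP.
pose G N := (\bigcup_n F n) `\` (\bigcup_(n < N) F n).
have [|m n mn|N|w wG] := @fin_dep_compact G.
- move=> N; apply: (@measurableD _ U) => //.
  by rewrite bigcup_mkord; apply: (@bigsetU_measurable _ U) => k _; exact: dF.
- move=> u [Fu nFu]; split=> // -[k /= km Fk]; apply: nFu; exists k => //=.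
  exact: leq_trans km mn.
- apply/set0P/negP => /eqP G0; apply: (nP N); apply/seteqP; split.
    by rewrite -setD_eq0.
  by move=> u [k _ Fk]; exists k.
- have [[k _ Fk] _] := wG 0%N I.
  by have [_] := wG k.+1 I; apply; exists k => //=.
Qed.

End FiniteDependence.

Lemma probability_of_measure d (T : measurableType d) (R : realType)
    (mu : {measure set T -> \bar R}) : mu setT = 1%E ->
  exists P : probability T R, P = mu :> (set T -> \bar R).
Proof.
move=> muT.
exists (mnormalize mu (\d_point : probability T R) : probability T R).
apply/funext => A; rewrite /= /mnormalize.
have -> /= : mu [set: T] = 1%E by [].
by rewrite onee_eq0 /= invr1 mule1.
Qed.

Section PrefixWeight.
Variables (R : realType) (nS nA : nat).
Local Notation X := ('I_nS.+1 * 'I_nA.+1)%type.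
Local Notation U := (fd_path nS nA).
Variable w : seq X -> R.
Hypothesis w_nil : w [::] = 1.
Hypothesis w_ge0 : forall p, 0 <= w p.
Hypothesis w_rcons : forall p, \sum_x w (rcons p x) = w p.
Implicit Types (A B : set U) (p : seq X).

Let pad p : U := nth point p.

Let pad_size p : mkseq (pad p) (size p) = p.
Proof. exact: mkseq_nth. Qed.

Let pad_rcons p x : mkseq (pad (rcons p x)) (size p) = p.
Proof.
have := pad_size (rcons p x); rewrite size_rcons mkseqS.
by move=> /rcons_inj[].
Qed.

Let mass A := fix mass n p : R :=
  if n is n'.+1 then \sum_x mass n' (rcons p x)
  else if `[< A (pad p) >] then w p else 0.

Let mass_ge0 A n p : 0 <= mass A n p.
Proof.
elim: n p => [|n IH] p /=; first by case: ifP.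
by apply: sumr_ge0 => x _.
Qed.

Let mass_dep A n p : dep (size p) A ->
  mass A n p = if `[< A (pad p) >] then w p else 0.
Proof.
elim: n p => //= n IH p dA.
under eq_bigr => x _.
  rewrite IH; last by rewrite size_rcons; exact: dep_leq dA.
  have -> : `[< A (pad (rcons p x)) >] = `[< A (pad p) >].
    by apply: asbool_equiv_eq; split; apply: dA; rewrite pad_rcons pad_size.
  over.
by case: ifP => _; [exact: w_rcons | rewrite big1].
Qed.

Let mass_stable A n m p : dep (n + size p) A ->
  mass A (n + m) p = mass A n p.
Proof.
elim: n p => [|n IH] p dA; first by rewrite add0n mass_dep.
rewrite addSn /=; apply: eq_bigr => x _; apply: IH.
by rewrite size_rcons addnS -addSn.
Qed.

Let mass_disj A n p : (forall u, mkseq u (size p) = p -> ~ A u) ->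
  mass A n p = 0.
Proof.
elim: n p => [|n IH] p noA /=.
  by case: asboolP => // /noA; rewrite pad_size => /(_ erefl).
apply: big1 => x _; apply: IH => u; rewrite size_rcons mkseqS.
by move=> /rcons_inj[+ _]; exact: noA.
Qed.

Let massU A B n p : A `&` B = set0 ->
  mass (A `|` B) n p = mass A n p + mass B n p.
Proof.
move=> AB; elim: n p => [|n IH] p /=; last first.
  by rewrite -big_split; apply: eq_bigr => x _; exact: IH.
case: (asboolP (A (pad p))) => Ap; case: (asboolP (B (pad p))) => Bp;
  case: asboolP => ABp; rewrite ?addr0 ?add0r //.
- by have : (A `&` B) (pad p) by []; rewrite AB.
- by case: ABp; left.
- by case: ABp; left.
- by case: ABp; right.
- by case: ABp.
Qed.

Let level A : nat := xget 0%N [set n | dep n A].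

Let levelP A : fin_dep A -> dep (level A) A.
Proof. by move=> [n dA]; rewrite /level; case: xgetP => [? -> //|/(_ n)]. Qed.

Definition prefix_mass (A : set U) : \bar R := (mass A (level A) [::])%:E.

Let prefix_massE A n : dep n A -> prefix_mass A = (mass A n [::])%:E.
Proof.
move=> dA; have dl : dep (level A) A by apply: levelP; exists n.
congr EFin; have [ln|/ltnW ln] := leqP n (level A).
  by rewrite -(subnKC ln) mass_stable// addn0; exact: dA.
by rewrite -[in RHS](subnKC ln) mass_stable// addn0; exact: dl.
Qed.

Let prefix_mass0 : prefix_mass set0 = 0%E.
Proof. by rewrite (@prefix_massE _ 0%N)//=; case: asboolP. Qed.

Let prefix_mass_ge0 A : (0 <= prefix_mass A)%E.
Proof. by rewrite lee_fin. Qed.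

Let mass_bigcup (F : nat -> set U) N n : trivIset setT F ->
  mass (\bigcup_(k < N) F k) n [::] = \sum_(k < N) mass (F k) n [::].
Proof.
move=> tF; elim: N => [|N IH].
  rewrite big_ord0 bigcup_mkord big_ord0.
  by apply: mass_disj => u _ [].
rewrite big_ord_recr /= -IH !bigcup_mkord big_ord_recr /= massU//.
rewrite -bigcup_mkord; apply/seteqP; split=> // u [[k /= kN Fk] FN].
move/trivIsetP: tF => /(_ k N I I); rewrite ltn_eqF// => /(_ isT).
by move/seteqP => [/(_ u)] /=; tauto.
Qed.

Let prefix_mass_sigma_additive : semi_sigma_additive prefix_mass.
Proof.
move=> F mF tF mUF.
have [N UFN] := fin_dep_bigcup mF mUF.
apply: cvg_near_cst; near=> m.
have Nm : (N <= m)%N by near: m; exact: nbhs_infty_ge.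
have Um : \bigcup_n F n = \bigcup_(n < m) F n.
  apply/seteqP; split; last by move=> u [k _ Fk]; exists k.
  by rewrite UFN => u [k /= kN Fk]; exists k => //=; exact: leq_trans kN Nm.
pose n := maxn (level (\bigcup_n F n)) (\max_(k < m) level (F k))%N.
rewrite (@prefix_massE _ n); last exact: dep_leq (leq_maxl _ _) (levelP mUF).
rewrite Um mass_bigcup// big_mkord -sumEFin; apply: eq_bigr => k _.
apply: prefix_massE; apply: dep_leq (levelP (mF k)).
by apply: leq_trans (leq_maxr _ _); exact: (leq_bigmax k).
Unshelve. all: by end_near. Qed.

HB.instance Definition _ := @isMeasure.Build _ U R prefix_mass
  prefix_mass0 prefix_mass_ge0 prefix_mass_sigma_additive.

Let dep_cylinder p : dep (size p) (@cylinder nS nA p : set U).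
Proof. by move=> u v uv up; rewrite /cylinder /= -uv. Qed.

Let mass_cylinder q p :
  mass (@cylinder nS nA (q ++ p)) (size p) q = w (q ++ p).
Proof.
elim: p q => [|x p IH] q /=.
  by rewrite cats0; case: asboolP => //; case; exact: pad_size.
rewrite (bigD1 x) //= -cat_rcons IH big1 ?addr0// => y yx.
apply: mass_disj => u; rewrite size_rcons mkseqS => /rcons_inj[uq uy].
move/(congr1 (fun s => nth point s (size q))).
rewrite nth_mkseq ?size_cat ?size_rcons ?ltnS ?addSn ?ltnS ?leq_addr// uy.
by rewrite nth_cat size_rcons ltnSn nth_rcons ltnn eqxx => yx';
  rewrite yx' eqxx in yx.
Qed.

Lemma prefix_mass_cylinder p : prefix_mass (@cylinder nS nA p) = (w p)%:E.
Proof.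
by rewrite (prefix_massE (@dep_cylinder p)) (mass_cylinder [::]).
Qed.

Let fd_id : g_sigma_algebraType (@measurable _ U) -> path_space nS nA := idfun.

Let measurable_fd_id : measurable_fun setT fd_id.
Proof.
apply: (@measurability _ _ _ _ setT fd_id (@cylinders nS nA)) => //.
move=> _ [_ [p _ <-] <-]; rewrite setTI; apply: sub_sigma_algebra.
by exists (size p); exact: dep_cylinder.
Qed.

Lemma prefix_weight_measure : exists mu : probability (path_space nS nA) R,
  forall p, mu (cylinder p) = (w p)%:E.
Proof.
pose nu_of : {measure set (path_space nS nA) -> \bar R} :=
  pushforward (measure_extension prefix_mass) fd_id.
pose nu := nu_of measurable_fd_id.
have nuE p : nu (cylinder p) = (w p)%:E.
  rewrite /nu /nu_of /= /pushforward /= /measure_extension.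
  rewrite -(prefix_mass_cylinder p) measurable_mu_extE//.
  by exists (size p); exact: dep_cylinder.
have nuT : nu setT = 1%E.
  have <- : cylinder [::] = setT :> set (infpath nS nA) by apply/seteqP; split.
  by rewrite nuE w_nil.
have [P PE] := probability_of_measure nuT.
by exists P => p; rewrite -nuE -PE.
Qed.

End PrefixWeight.

Section PathMeasure.
Variables (R : realType) (nS nA : nat) (M : mdp nS nA).
Variables (sigma : scheduler M R) (s0 : 'I_nS.+1).
Local Notation X := ('I_nS.+1 * 'I_nA.+1)%type.
Local Notation step := (step_prob sigma s0).
Local Notation cprob := (cylinder_prob sigma s0).
Implicit Types (h p : seq X).

Lemma step_prob_ge0 h y : 0 <= step h y.
Proof.
rewrite mulr_ge0 ?choose_act_ge0// /next_state_prob.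
case: h => [|x h]; first by rewrite ler0n.
by case: (last x h) => t a; rewrite ler0q; case/andP: (trans_01 M t a y.1).
Qed.

Lemma cylinder_prob_ge0 p : 0 <= cprob p.
Proof. by apply: prodr_ge0 => i _; exact: step_prob_ge0. Qed.

Lemma cylinder_prob_rcons p x : cprob (rcons p x) = cprob p * step p x.
Proof.
rewrite /cylinder_prob size_rcons big_ord_recr /= nth_rcons ltnn eqxx.
rewrite -cats1 take_size_cat//; congr (_ * _); apply: eq_bigr => i _.
by rewrite nth_cat ltn_ord take_cat ltn_ord.
Qed.

Lemma step_prob_sum h :
  \sum_(y : X) step h y = \sum_s next_state_prob R M s0 h s.
Proof.
rewrite -(pair_bigA _ (fun s a => step h (s, a))) /=; apply: eq_bigr => s _.
by rewrite /step_prob /= -mulr_sumr choose_act_sum1 mulr1.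
Qed.

Lemma cylinder_prob_sum p : \sum_x cprob (rcons p x) = cprob p.
Proof.
under eq_bigr do rewrite cylinder_prob_rcons.
rewrite -mulr_sumr step_prob_sum /next_state_prob.
case: (lastP p) => [|p' [t a]].
  by rewrite (bigD1 s0)//= eqxx big1 ?addr0 ?mulr1// => s /negbTE ->.
have -> : rcons p' (t, a) = head (t, a) p' :: behead (rcons p' (t, a)).
  by case: p'.
have -> : last (head (t, a) p') (behead (rcons p' (t, a))) = (t, a).
  by case: p' => // y p'; rewrite /= last_rcons.
rewrite -rmorph_sum /=.
have -> : head (t, a) p' :: behead (rcons p' (t, a)) = rcons p' (t, a).
  by case: p'.
have [->|ta0] := trans_sum M t a; first by rewrite rmorph1 mulr1.
rewrite ta0 rmorph0 mulr0 cylinder_prob_rcons /step_prob.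
rewrite choose_act_enabled ?mulr0// /enabled /= ta0 => /eqP.
by rewrite eq_sym oner_eq0.
Qed.

(* By the pi-lambda theorem mu is the only such probability measure. *)
Lemma path_measure_exists : exists mu : probability (path_space nS nA) R,
  forall p, mu (cylinder p) = (cprob p)%:E.
Proof.
apply: prefix_weight_measure; first by rewrite /cylinder_prob big_ord0.
- exact: cylinder_prob_ge0.
- exact: cylinder_prob_sum.
Qed.

Definition path_measure : probability (path_space nS nA) R :=
  sval (cid path_measure_exists).

Lemma path_measure_cylinder p : path_measure (cylinder p) = (cprob p)%:E.
Proof. exact: (svalP (cid path_measure_exists)). Qed.

Definition reach_event (T : {set 'I_nS.+1}) : set (path_space nS nA) :=
  [set u | exists i, (u i).1 \in T].

Lemma measurable_reach_event T : measurable (reach_event T).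
Proof.
pose F k : set (path_space nS nA) := if unpickle k is Some p then
  if has (fun x : X => x.1 \in T) p then cylinder p else set0 else set0.
have -> : reach_event T = \bigcup_k F k.
  apply/seteqP; split=> [u [i ui]|u [k _]].
    exists (pickle (mkseq u i.+1)) => //; rewrite /F pickleK.
    rewrite ifT; first by rewrite /cylinder /mkset size_mkseq.
    apply/hasP; exists (u i) => //; apply/mapP; exists i => //.
    by rewrite mem_iota add0n ltnSn.
  rewrite /F; case: unpickle => // p; case: ifP => // /hasP[x xp xT].
  rewrite /cylinder /= => up; move: xp; rewrite -up => /mapP[i _ xE].
  by exists i; rewrite -xE.
apply: bigcupT_measurable => k; rewrite /F; case: unpickle => // p.
by case: ifP => // _; apply: sub_sigma_algebra; exists p.
Qed.

Definition reach_prob (T : {set 'I_nS.+1}) : R :=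
  fine (path_measure (reach_event T)).

End PathMeasure.

(** * The problem ConjRelReach *)

Inductive comparison :=
  | CmpGt | CmpGe | CmpApprox of rat | CmpNapprox of rat.

Definition tolerance_ge0 (o : comparison) : bool :=
  match o with CmpApprox e | CmpNapprox e => 0 <= e | _ => true end.

Definition compare (R : realType) (o : comparison) (x y : R) : bool :=
  match o with
  | CmpGt => x > y
  | CmpGe => x >= y
  | CmpApprox e => `|x - y| <= ratr e
  | CmpNapprox e => `|x - y| > ratr e
  end.

(* [num_preds], [num_terms] and [num_scheds] are the numbers l, m and n; the
   schedulers sigma_1, ..., sigma_n are indexed from 0. *)
Record instance := Instance {
  max_state : nat;
  max_action : nat;
  model : mdp max_state max_action;
  num_preds : nat;
  num_terms : nat;
  num_scheds : nat;
  coef : 'I_num_terms -> 'I_num_preds -> rat;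
  bound : 'I_num_preds -> rat;
  start_state : 'I_num_terms -> 'I_num_preds -> 'I_max_state.+1;
  sched : 'I_num_terms -> 'I_num_preds -> 'I_num_scheds;
  sched_onto : forall k, exists i j, sched i j = k;
  target : 'I_num_terms -> 'I_num_preds -> {set 'I_max_state.+1};
  op : 'I_num_preds -> comparison;
  op_ge0 : forall j, tolerance_ge0 (op j) }.

Definition satisfiable (R : realType) (I : instance) : Prop :=
  exists sigma : 'I_(num_scheds I) -> scheduler (model I) R,
  forall j : 'I_(num_preds I),
    compare (op j)
      (\sum_(i < num_terms I) ratr (coef i j) *
         reach_prob (sigma (sched i j)) (start_state i j) (target i j))
      (ratr (bound j)).

Definition num_targets (I : instance) : nat :=
  #|[set target i j | i : 'I_(num_terms I), j : 'I_(num_preds I)]%SET|.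

Definition num_napprox (I : instance) : nat :=
  #|[set j : 'I_(num_preds I)
      | if op j is CmpNapprox e then 0 < e else false]%SET|.

Definition absorbing_targets (I : instance) : Prop :=
  forall i j s, s \in @target I i j -> absorbing (model I) s.

(** * Encoding of instances as bit strings *)

Definition number_code := nat -> seq bool.

Definition unary_code : number_code := fun k => rcons (nseq k true) false.

(* Little-endian binary digits, each preceded by a continuation bit, so that
   the code is prefix-free. *)
Definition binary_code : number_code := fun k =>
  rcons (flatten [seq [:: true; odd (k %/ 2 ^ i)]
                 | i <- iota 0 (trunc_log 2 k).+1]) false.

Section Encoding.
Variable num : number_code.

Definition enc_int (z : int) : seq bool := (z < 0) :: num `|z|%N.

Definition enc_rat (q : rat) : seq bool := enc_int (numq q) ++ num `|denq q|%N.

Definition enc_comparison (o : comparison) : seq bool :=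
  match o with
  | CmpGt => [:: false; false]
  | CmpGe => [:: false; true]
  | CmpApprox e => [:: true, false & enc_rat e]
  | CmpNapprox e => [:: true, true & enc_rat e]
  end.

Definition enc_set k (A : {set 'I_k}) : seq bool :=
  [seq i \in A | i <- enum 'I_k].

Definition enc_family k (f : 'I_k -> seq bool) : seq bool :=
  flatten [seq f i | i <- enum 'I_k].

Definition enc_family2 k1 k2 (f : 'I_k1 -> 'I_k2 -> seq bool) : seq bool :=
  enc_family (fun i => enc_family (f i)).

Definition enc_mdp nS nA (M : mdp nS nA) : seq bool :=
  num nS ++ num nA ++
  enc_family2 (fun s a => enc_family (fun t => enc_rat (trans M s a t))).

Definition enc_instance (I : instance) : seq bool :=
  enc_mdp (model I) ++
  num (num_preds I) ++ num (num_terms I) ++ num (num_scheds I) ++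
  enc_family2 (fun i j => enc_rat (@coef I i j)) ++
  enc_family (fun j => enc_rat (@bound I j)) ++
  enc_family2 (fun i j => num (@start_state I i j)) ++
  enc_family2 (fun i j => num (@sched I i j)) ++
  enc_family2 (fun i j => enc_set (@target I i j)) ++
  enc_family (fun j => enc_comparison (@op I j)).

End Encoding.

Definition language := seq bool -> Prop.

Definition ConjRelReach (R : realType) (restriction : instance -> Prop)
    (num : number_code) : language := fun w =>
  exists I : instance,
    [/\ w = enc_instance num I, restriction I & satisfiable R I].

(** * Deterministic multi-tape Turing machines and complexity classes *)

(* A cell is blank (None), a bit, or one of finitely many auxiliary symbols. *)
Definition cell (G : finType) : finType := option (bool + G)%type.

Inductive move := MoveLeft | MoveStay | MoveRight.

(* [tm_verdict q] is [None] unless the machine halts in [q]; the boolean tells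
   whether it then accepts. *)
Record TM := {
  tm_tapes : nat;
  tm_sym : finType;
  tm_state : finType;
  tm_init : tm_state;
  tm_verdict : tm_state -> option bool;
  tm_delta : tm_state -> {ffun 'I_tm_tapes.+1 -> cell tm_sym} ->
    tm_state * ('I_tm_tapes.+1 -> cell tm_sym * move) }.

(* The two-way infinite tape ... l_1 l_0 r_0 r_1 ... with the head on r_0 is
   the pair (l, r); all cells beyond the two lists are blank. *)
Definition tape (G : finType) := (seq (cell G) * seq (cell G))%type.

Definition tape_read G (t : tape G) : cell G := head None t.2.

Definition tape_act G (t : tape G) (x : cell G * move) : tape G :=
  let: (l, r) := (t.1, x.1 :: behead t.2) in
  match x.2 with
  | MoveLeft => (behead l, head None l :: r)
  | MoveStay => (l, r)
  | MoveRight => (head None r :: l, behead r)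
  end.

Section Run.
Variable M : TM.

Definition config :=
  (tm_state M * ('I_(tm_tapes M).+1 -> tape (tm_sym M)))%type.

Definition halted (c : config) : bool := tm_verdict c.1 != None.
Definition accepting (c : config) : bool := tm_verdict c.1 == Some true.

Definition tm_step (c : config) : config :=
  if halted c then c else
  let: (q, act) := tm_delta c.1 [ffun i => tape_read (c.2 i)] in
  (q, fun i => tape_act (c.2 i) (act i)).

Definition tm_start (w : seq bool) : config :=
  (tm_init M, fun i => ([::], if i == ord0 then [seq Some (inl b) | b <- w]
                              else [::])).

Definition tm_run (t : nat) (w : seq bool) : config :=
  iter t tm_step (tm_start w).

Fixpoint leading_bits (r : seq (cell (tm_sym M))) : seq bool :=
  if r is Some (inl b) :: r' then b :: leading_bits r' else [::].

(* The output is the maximal block of bits on the first tape, from the head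
   rightwards. *)
Definition tm_output (c : config) : seq bool := leading_bits (c.2 ord0).2.

End Run.

Definition poly_bound (k len : nat) : nat := (len ^ k + k)%N.

Definition PTIME (L : language) : Prop :=
  exists (M : TM) (k : nat), forall w,
    let c := tm_run M (poly_bound k (size w)) w in
    halted c /\ (accepting c <-> L w).

Definition poly_computable (f : seq bool -> seq bool) : Prop :=
  exists (M : TM) (k : nat), forall w,
    let c := tm_run M (poly_bound k (size w)) w in
    halted c /\ tm_output c = f w.

Definition pair_code (w u : seq bool) : seq bool :=
  flatten [seq [:: true; b] | b <- w] ++ false :: u.

Definition NP (L : language) : Prop :=
  exists (V : language) (k : nat), PTIME V /\
    forall w, L w <->
      exists2 u, (size u <= poly_bound k (size w))%N & V (pair_code w u).

Definition poly_reducible (L L' : language) : Prop :=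
  exists2 f, poly_computable f & forall w, L w <-> L' (f w).

Definition NP_hard (L : language) : Prop :=
  forall L', NP L' -> poly_reducible L' L.

Definition strongly_NP_complete (L : number_code -> language) : Prop :=
  NP (L binary_code) /\ NP_hard (L unary_code).

(* Main.v *)
Require Import Defs.
From HB Require Import structures.
From mathcomp Require Import all_boot all_order all_algebra all_fingroup.
From mathcomp Require Import all_classical all_reals all_analysis.
From mathcomp Require Import zify ring lra.

(* Membership: on the product of the MDP with a record of the targets visited so
   far, of which there are polynomially many when the targets are few or
   absorbing, or when every scheduler serves a single term, the achievable
   vectors of reachability probabilities are the values of flows, hence the
   solutions of a linear program over the rationals.  The program is solved by a
   rescaled perceptron.  Each comparison of the form |x - q| > e with e > 0 is a
   disjunction of two strict inequalities: the side is guessed in general, while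
   if every term has its own scheduler the predicates are independent and are
   decided separately.  If e = 0 it only excludes a
   hyperplane, and a convex set avoids finitely many hyperplanes as soon as it is
   contained in none of them.

   Hardness: the predicate |x - 1/2| > 1/2 - 1/(K + 2) forces a probability to be
   nearly Boolean, so that clauses of at most K + 1 literals become linear
   inequalities; the tableau of a polynomial-time verifier gives clauses of a
   width that depends only on the number of tapes.

   Machines are obtained from programs on four stacks, which evaluate
   functions on binary trees in polynomial time. *)

Set Implicit Arguments.
Unset Strict Implicit.
Unset Printing Implicit Defensive.

Import Order.TTheory GRing.Theory Num.Theory.

(** * Stack programs *)

(** The obstacle on the probabilistic side is that a scheduler runs for ever, so its occupation
    measures are infinite, while a linear program needs finite quantities. Each scheduler is
    therefore described by two flows: a transient one, [y], and a circulation [r] of total mass one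
    into which [y] drains. The record of visited targets only grows, so a circulation cannot change
    it, and the mass of [r] on the records that contain a target is the probability of reaching that
    target. Values are attained exactly, and not only approached, because a finitely generated cone
    is closed. Strict inequalities determine the form of the programs: they are homogenised, and a
    solution of A x = 0, x >= 0 of largest support shows at once which coordinates can be positive.
    This answer is the same over every ordered field, so integer arithmetic settles a question about
    reals. In the reduction from an NP problem the MDP is fixed and the tolerance depends on the
    verifier only; what grows is the number of predicates and schedulers. Hence hardness survives
    unary encoding. *)

Module StackPrograms.

Definition ssym : Type := (bool + unit)%type.
(** Delimits a piece of data inside a stack, so that a loop moving it knows where to stop. *)
Definition mark : ssym := inr tt.

Inductive sidx := X0 | X1 | X2 | X3.

Definition stacks := (seq ssym * seq ssym * seq ssym * seq ssym)%type.

Definition sget (s : stacks) (i : sidx) : seq ssym :=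
  match i with X0 => s.1.1.1 | X1 => s.1.1.2 | X2 => s.1.2 | X3 => s.2 end.

Definition sset (s : stacks) (i : sidx) (u : seq ssym) : stacks :=
  match i with
  | X0 => (u, s.1.1.2, s.1.2, s.2) | X1 => (s.1.1.1, u, s.1.2, s.2)
  | X2 => (s.1.1.1, s.1.1.2, u, s.2) | X3 => (s.1.1.1, s.1.1.2, s.1.2, u)
  end.

Definition stop (s : stacks) (i : sidx) : option ssym := ohead (sget s i).

Inductive com :=
  | CPush of sidx & ssym | CPop of sidx | CSeq of com & com
  | CIf of sidx & (option ssym -> bool) & com & com
  | CWhile of sidx & (option ssym -> bool) & com.

(** The number counts transitions of the compiled machine. A push takes two, because a transition
    writes before it moves; a branch that is taken and a round of a loop also pay for the closing
    jump. *)
Inductive exec : com -> stacks -> stacks -> nat -> Prop :=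
  | EPush i a s : exec (CPush i a) s (sset s i (a :: sget s i)) 2
  | EPop i s : exec (CPop i) s (sset s i (behead (sget s i))) 1
  | ESeq c1 c2 s1 s2 s3 t1 t2 : exec c1 s1 s2 t1 -> exec c2 s2 s3 t2 ->
      exec (CSeq c1 c2) s1 s3 (t1 + t2)
  | EIfT i (f : option ssym -> bool) c1 c2 s s' t : f (stop s i) -> exec c1 s s' t ->
      exec (CIf i f c1 c2) s s' t.+2
  | EIfF i (f : option ssym -> bool) c1 c2 s s' t : ~~ f (stop s i) -> exec c2 s s' t ->
      exec (CIf i f c1 c2) s s' t.+1
  | EWhileT i (f : option ssym -> bool) c s1 s2 s3 t1 t2 : f (stop s1 i) -> exec c s1 s2 t1 ->
      exec (CWhile i f c) s2 s3 t2 -> exec (CWhile i f c) s1 s3 (t1 + t2).+2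
  | EWhileF i (f : option ssym -> bool) c s : ~~ f (stop s i) -> exec (CWhile i f c) s s 1.

Notation scell := (cell unit).

Record instr := Instr {
  itape : sidx; iact : scell -> scell * move; inext : scell -> nat }.

Definition ijump n := Instr X0 (fun c => (c, MoveStay)) (fun=> n).

Fixpoint clen (c : com) : nat :=
  match c with
  | CPush _ _ => 2 | CPop _ => 1 | CSeq c1 c2 => clen c1 + clen c2
  | CIf _ _ c1 c2 => (clen c1 + (clen c2).+1).+1
  | CWhile _ _ c => (clen c).+2
  end.

(** Jump targets are absolute, so the code depends on the address [b] where it is placed. A push
    first moves left onto a blank cell and then writes there. *)
Fixpoint flat (b : nat) (c : com) : seq instr :=
  match c with
  | CPush i a => [:: Instr i (fun x => (x, MoveLeft)) (fun=> b.+1);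
                     Instr i (fun=> (Some a, MoveStay)) (fun=> b.+2)]
  | CPop i => [:: Instr i (fun=> (None, MoveRight)) (fun=> b.+1)]
  | CSeq c1 c2 => flat b c1 ++ flat (b + clen c1) c2
  | CIf i f c1 c2 =>
      Instr i (fun x => (x, MoveStay))
            (fun x => if f x then b.+1 else (b + clen c1).+2) ::
      flat b.+1 c1 ++ ijump (b + clen c1 + clen c2).+2 ::
      flat (b + clen c1).+2 c2
  | CWhile i f c =>
      Instr i (fun x => (x, MoveStay))
            (fun x => if f x then b.+1 else (b + clen c).+2) ::
      flat b.+1 c ++ [:: ijump b]
  end.

Lemma size_flat b c : size (flat b c) = clen c.
Proof.
elim: c b => //= [c1 IH1 c2 IH2|i f c1 IH1 c2 IH2|i f c IH] b;
  by rewrite ?size_cat ?IH1 /= ?size_cat ?IH2 ?IH /= ?addn1 ?addnS.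
Qed.

Definition tape_of (i : sidx) : 'I_4 :=
  match i with X0 => inord 0 | X1 => inord 1 | X2 => inord 2 | X3 => inord 3 end.

Lemma tape_of_inj : injective tape_of.
Proof.
by move=> [] [] //= /(congr1 val); rewrite /= !inordK.
Qed.

(** * Simulation of stack programs by a four-tape machine *)

Section FlatMachine.
Variable code : seq instr.
Local Notation sz := (size code).

(* State [size code] rejects and state [(size code).+1] accepts. *)
Definition flat_delta (q : 'I_sz.+2) (r : {ffun 'I_4 -> scell}) :
    'I_sz.+2 * ('I_4 -> scell * move) :=
  let ins := nth (ijump 0) code q in
  let x := r (tape_of (itape ins)) in
  (inord (inext ins x),
   fun k => if k == tape_of (itape ins) then iact ins x else (r k, MoveStay)).

Definition flat_machine : TM :=
  @Build_TM 3 unit 'I_sz.+2 ord0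
    (fun q => if q < sz then None else Some (val q == sz.+1)) flat_delta.

(** A stack lies from the head rightwards with only blanks to its left: a pop erases the cell it
    leaves, and a push always moves onto a blank. *)
Definition tape_rep (t : tape unit) (u : seq scell) :=
  (exists n, t.1 = nseq n None) /\ (exists n, t.2 = u ++ nseq n None).

(** The contents are cells and not symbols, because between the two instructions of a push the top
    cell is blank. *)
Definition crep (c : config flat_machine) (pc : nat) (s : sidx -> seq scell) :=
  val c.1 = pc /\ forall i, tape_rep (c.2 (tape_of i)) (s i).

Lemma tape_rep_read t u : tape_rep t u -> tape_read t = head None u.
Proof. by move=> [_ [n]]; rewrite /tape_read => ->; case: u; case: n. Qed.

Definition code_at (b : nat) (p : seq instr) :=
  b + size p <= sz /\ forall k, k < size p ->
    nth (ijump 0) code (b + k) = nth (ijump 0) p k.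

Lemma code_at_cat b p q : code_at b (p ++ q) ->
  code_at b p /\ code_at (b + size p) q.
Proof.
rewrite /code_at size_cat => -[ls H]; split; split; try lia.
  by move=> k lk; rewrite H ?nth_cat ?lk //; lia.
move=> k lk; rewrite -addnA H ?nth_cat; last lia.
by rewrite ltnNge leq_addr /= addKn.
Qed.

Lemma code_at_cons b x p : code_at b (x :: p) ->
  (b < sz /\ nth (ijump 0) code b = x) /\ code_at b.+1 p.
Proof.
move=> [/= ls H]; split; [split|split]; try lia.
  by have := H 0 isT; rewrite addn0.
by move=> k lk; have := H k.+1 lk; rewrite addSnnS.
Qed.

Lemma tape_rep_keep t u : tape_rep t u ->
  tape_rep (tape_act t (head None u, MoveStay)) u.
Proof.
rewrite /tape_rep /tape_act /= => -[[a ->] [b ->]]; split; first by exists a.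
by case: u => [|y u] /=; [case: b => [|b] /=;
   [exists 1|exists b.+1] | exists b].
Qed.

Lemma tape_rep_pop t u : tape_rep t u ->
  tape_rep (tape_act t (None, MoveRight)) (behead u).
Proof.
rewrite /tape_rep /tape_act /= => -[[a ->] [b ->]]; split; first by exists a.+1.
by case: u => [|y u] /=; [exists b.-1; case: b|exists b].
Qed.

Lemma tape_rep_left t u : tape_rep t u ->
  tape_rep (tape_act t (head None u, MoveLeft)) (None :: u).
Proof.
rewrite /tape_rep /tape_act /= => -[[a ->] [b ->]].
split; first by exists a.-1; case: a.
have -> : head None (nseq a None) = None :> scell by case: a.
by case: u => [|y u] /=; [case: b => [|b] /=;
   [exists 1|exists b.+1] | exists b].
Qed.

Lemma tape_rep_write t u a : tape_rep t u ->
  tape_rep (tape_act t (a, MoveStay)) (a :: behead u).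
Proof.
rewrite /tape_rep /tape_act /= => -[[n ->] [b ->]]; split; first by exists n.
by case: u => [|y u] /=; [exists b.-1; case: b|exists b].
Qed.

(** Reduces an instruction to its effect on one tape; on the other tapes the machine rewrites the
    cell that it reads. *)
Lemma crep_step c pc s x s' n : crep c pc s -> pc < sz ->
  nth (ijump 0) code pc = x -> inext x (head None (s (itape x))) = n ->
  n <= sz.+1 ->
  (forall t, tape_rep t (s (itape x)) ->
     tape_rep (tape_act t (iact x (head None (s (itape x))))) (s' (itape x))) ->
  (forall j, j <> itape x -> s' j = s j) ->
  crep (tm_step c) n s'.
Proof.
move=> [cpc cr] lpc nx en ln h1 h2.
have hh : halted c = false by rewrite /halted /= cpc lpc.
rewrite /tm_step hh /= /flat_delta /= cpc nx !ffunE.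
have rd j : tape_read (c.2 (tape_of j)) = head None (s j).
  by rewrite (tape_rep_read (cr j)).
split=> /=; first by rewrite rd en inordK.
move=> j; have [/tape_of_inj ->|/eqP] := eqVneq (tape_of j) (tape_of (itape x)).
  by rewrite ?eqxx rd; apply: h1; exact: cr.
move=> ne; have nj : j <> itape x by move=> e; apply: ne; rewrite e.
move/eqP: (ne) => /negbTE ne'; rewrite ?ne'.
rewrite h2 // ffunE rd; exact: tape_rep_keep.
Qed.

Definition cells (s : stacks) (i : sidx) : seq scell := map Some (sget s i).

Lemma head_cells s i : head None (cells s i) = stop s i.
Proof. by rewrite /cells /stop; case: (sget s i). Qed.

Lemma crep_jump c pc s n : crep c pc (cells s) -> pc < sz ->
  nth (ijump 0) code pc = ijump n -> n <= sz.+1 -> crep (tm_step c) n (cells s).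
Proof.
move=> cr l e ln; apply: (crep_step cr l e) => //= t; exact: tape_rep_keep.
Qed.

Lemma crep_branch c pc s i g : crep c pc (cells s) -> pc < sz ->
  nth (ijump 0) code pc = Instr i (fun x => (x, MoveStay)) g ->
  g (stop s i) <= sz.+1 -> crep (tm_step c) (g (stop s i)) (cells s).
Proof.
move=> cr l e ln; rewrite -head_cells.
apply: (crep_step cr l e) => //=; rewrite ?head_cells // => t.
by rewrite -head_cells; exact: tape_rep_keep.
Qed.

Lemma crep_pop c pc s i : crep c pc (cells s) -> pc < sz ->
  nth (ijump 0) code pc = Instr i (fun=> (None, MoveRight)) (fun=> pc.+1) ->
  crep (tm_step c) pc.+1 (cells (sset s i (behead (sget s i)))).
Proof.
move=> cr l e; apply: (crep_step cr l e) => //=; first by lia.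
  move=> t /tape_rep_pop; rewrite /cells.
  by case: i {e} => /=; rewrite behead_map.
by move=> j; rewrite /cells; case: i {e}; case: j.
Qed.

Lemma crep_push c pc s i a : crep c pc (cells s) ->
  code_at pc (flat pc (CPush i a)) ->
  crep (tm_step (tm_step c)) pc.+2 (cells (sset s i (a :: sget s i))).
Proof.
move=> cr /code_at_cons [[l1 n1] /code_at_cons [[l2 n2] _]].
(* The tapes between the two instructions of the push. *)
pose mid := fun j => if tape_of j == tape_of i then None :: cells s j else cells s j.
have cr1 : crep (tm_step c) pc.+1 mid.
  apply: (crep_step cr l1 n1) => //=; try lia.
    by rewrite /mid eqxx => t; exact: tape_rep_left.
  by move=> j ji; rewrite /mid; case: eqP => // /tape_of_inj.
apply: (crep_step cr1 l2 n2) => //=; try lia.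
  move=> t /tape_rep_write /=; rewrite /mid eqxx /cells => /(_ (Some a)).
  by case: i {n1 n2 mid cr1}.
move=> j ji; rewrite /mid; case: eqP => [/tape_of_inj//|_].
by rewrite /cells; case: i ji {n1 n2 mid cr1}; case: j.
Qed.

(** The induction is on the execution and not on the command, since each round of a loop runs the
    same code at the same address. *)
Lemma flat_exec c s s' t : exec c s s' t -> forall b k, code_at b (flat b c) ->
  crep k b (cells s) -> crep (iter t (@tm_step flat_machine) k) (b + clen c) (cells s').
Proof.
elim=> {c s s' t}.
- by move=> i a s b k ca cr; rewrite addn2; exact: crep_push.
- move=> i s b k /= /code_at_cons [[l e] _] cr; rewrite addn1.
  exact: (crep_pop cr l e).
- move=> c1 c2 s1 s2 s3 t1 t2 _ IH1 _ IH2 b k /= /code_at_cat [ca1].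
  rewrite size_flat => ca2 cr.
  by rewrite addnC iterD addnA; apply: IH2 => //; exact: IH1.
- move=> i f c1 c2 s s' t ft _ IH b k ca cr.
  move: ca; rewrite [flat _ _]/= => /code_at_cons [[l0 e0]].
  move=> /code_at_cat [ca1]; rewrite size_flat => /code_at_cons [[l1 e1] ca2].
  have [ls _] := ca2; rewrite size_flat in ls.
  rewrite iterS iterSr [X in crep _ X](_ : _ = (b + clen c1 + clen c2).+2);
    last by rewrite /=; lia.
  apply: (crep_jump (pc := b.+1 + clen c1)) => //; last by lia.
  apply: IH => //.
  by have := crep_branch cr l0 e0; rewrite ft; apply; lia.
- move=> i f c1 c2 s s' t ft _ IH b k ca cr.
  move: ca; rewrite [flat _ _]/= => /code_at_cons [[l0 e0]].
  move=> /code_at_cat [ca1]; rewrite size_flat => /code_at_cons [[l1 e1] ca2].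
  have [ls _] := ca2; rewrite size_flat in ls.
  rewrite iterSr [X in crep _ X](_ : _ = (b + clen c1).+2 + clen c2);
    last by rewrite /=; lia.
  apply: IH; first by have -> : (b + clen c1).+2 = (b.+1 + clen c1).+1 by lia.
  by have := crep_branch cr l0 e0; rewrite (negbTE ft); apply; lia.
- move=> i f c s1 s2 s3 t1 t2 ft _ IH1 _ IH2 b k ca cr.
  move: (ca); rewrite [flat _ _]/= => /code_at_cons [[l0 e0]].
  move=> /code_at_cat [ca1]; rewrite size_flat => /code_at_cons [[l1 e1] _].
  rewrite (_ : (t1 + t2).+2 = t2 + t1.+2); last by lia.
  rewrite iterD; apply: IH2 => //.
  rewrite iterS iterSr.
  apply: (crep_jump (pc := b.+1 + clen c)) => //; last by lia.
  apply: IH1 => //.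
  by have := crep_branch cr l0 e0; rewrite ft; apply; lia.
- move=> i f c s ft b k ca cr.
  move: ca; rewrite [flat _ _]/= => /code_at_cons [[l0 e0]].
  move=> /code_at_cat [ca1]; rewrite size_flat => /code_at_cons [[l1 e1] _].
  rewrite [X in crep _ X](_ : _ = (b + clen c).+2); last by rewrite /=; lia.
  by have := crep_branch cr l0 e0; rewrite (negbTE ft); apply; lia.
Qed.

End FlatMachine.

Definition raw_bits (w : seq bool) : seq ssym := map inl w.

Lemma crep_start code w :
  crep (tm_start (flat_machine code) w) 0 (cells (raw_bits w, [::], [::], [::])).
Proof.
split=> // i; split; first by exists 0.
exists 0; rewrite cats0 /= /tm_start /= /cells.
case: i => /=; rewrite -val_eqE /= inordK //= /raw_bits -map_comp.
exact: eq_map.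
Qed.

Lemma iter_halted (M : TM) n m (c : config M) : n <= m ->
  halted (iter n (@tm_step M) c) ->
  iter m (@tm_step M) c = iter n (@tm_step M) c.
Proof.
move=> /subnKC <- hh; elim: (m - n) => [|k IH]; first by rewrite addn0.
by rewrite addnS /= IH /tm_step hh.
Qed.

Lemma com_decides (c : com) (L : language) k :
  (forall w, exists t s, [/\ exec c (raw_bits w, [::], [::], [::]) s t,
     t.+1 <= poly_bound k (size w) &
     stop s X0 = Some (inl true) <-> L w]) -> PTIME L.
Proof.
move=> H.
(* The program is followed by one test. State [n.+1] lies just behind the code and rejects; the next
   state accepts. *)
pose g (n : nat) (x : scell) : nat := if x is Some (inl true) then n.+2 else n.+1.
pose code := flat 0 c ++ [:: Instr X0 (fun x => (x, MoveStay)) (g (clen c))].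
have szc : size code = (clen c).+1 by rewrite size_cat size_flat addn1.
exists (flat_machine code), k => w /=.
have [t [s [ex tb acc]]] := H w.
have ca : code_at code 0 (flat 0 c).
  by split=> [|j lj]; rewrite ?szc ?size_flat // add0n nth_cat lj.
have := flat_exec ex ca (crep_start code w); rewrite add0n => cr.
have nl : nth (ijump 0) code (clen c) = Instr X0 (fun x => (x, MoveStay)) (g (clen c)).
  by rewrite nth_cat size_flat ltnn subnn.
have := crep_branch cr _ nl; rewrite -iterS szc => /(_ (leqnn _)).
have gb : g (clen c) (stop s X0) <= (clen c).+2 by rewrite /g; case: stop => // -[[]|].
move=> /(_ gb) [vq _].
have hh : halted (iter t.+1 (@tm_step _) (tm_start (flat_machine code) w)).
  by rewrite /halted /= vq szc /g; case: stop => [[[]|[]]|]; rewrite ?ltnn ?ltnNge ?leqnSn.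
rewrite /tm_run (iter_halted tb hh); split=> //.
rewrite /accepting /= vq szc -acc.
by rewrite /g; case: stop => [[[]|[]]|]; rewrite ?ltnn ?[_ < _]ltnNge ?leqnSn /= ?eqxx ?(ltn_eqF (ltnSn _)); split.
Qed.

Lemma com_computes (c : com) (f : seq bool -> seq bool) k :
  (forall w, exists t s, [/\ exec c (raw_bits w, [::], [::], [::]) s t,
     t <= poly_bound k (size w) & sget s X0 = raw_bits (f w)]) ->
  poly_computable f.
Proof.
move=> H; pose code := flat 0 c.
exists (flat_machine code), k => w /=.
have [t [s [ex tb es]]] := H w.
have ca : code_at code 0 (flat 0 c) by [].
have := flat_exec ex ca (crep_start code w); rewrite add0n => -[cr1 cr2].
have hh : halted (iter t (@tm_step _) (tm_start (flat_machine code) w)).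
  by rewrite /halted /= cr1 size_flat ltnn.
rewrite /tm_run (iter_halted tb hh); split=> //.
rewrite /tm_output; have -> : ord0 = tape_of X0 by apply: val_inj; rewrite /= inordK.
have [_ [n ->]] := cr2 X0; rewrite /cells es /raw_bits.
by elim: (f w) => [|b u /= ->] //=; case: n.
Qed.

End StackPrograms.
Import StackPrograms.

(** * Polynomial-time functions on binary trees *)

Module TreeFunctions.

(** The shift keeps the base at least 2, so the bounds are monotone in both arguments and absorb
    constants, sums and products. *)
Definition pb (k n : nat) : nat := n.+2 ^ k.

Definition pol (p : nat -> nat) := exists k, forall n, p n <= pb k n.

Lemma leq_exp2rW m n k : m <= n -> m ^ k <= n ^ k.
Proof. by move=> mn; elim: k => // k IH; rewrite !expnS leq_mul. Qed.

Lemma pb_mono k m n : m <= n -> pb k m <= pb k n.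
Proof. by move=> mn; rewrite /pb leq_exp2rW. Qed.

Lemma pb_monok k l n : k <= l -> pb k n <= pb l n.
Proof. by move=> kl; rewrite /pb leq_pexp2l. Qed.

Lemma pol_pb k : pol (pb k). Proof. by exists k. Qed.

Lemma pol_leq p q : (forall n, p n <= q n) -> pol q -> pol p.
Proof. by move=> pq [k H]; exists k => n; exact: leq_trans (pq n) (H n). Qed.

Lemma pol_const c : pol (fun=> c).
Proof.
exists c => n; rewrite /pb; apply: (leq_trans (ltnW (ltn_expl c (ltnSn 1)))).
exact: leq_exp2rW.
Qed.

Lemma pol_id : pol id. Proof. by exists 1 => n; rewrite /pb expn1; lia. Qed.

Lemma pol_mul p q : pol p -> pol q -> pol (fun n => p n * q n).
Proof.
move=> [k H] [l H']; exists (k + l) => n; rewrite /pb expnD.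
exact: leq_mul (H n) (H' n).
Qed.

Lemma pol_add p q : pol p -> pol q -> pol (fun n => p n + q n).
Proof.
move=> [k H] [l H']; exists (k + l).+1 => n.
have h1 : p n <= pb (k + l) n by apply: leq_trans (H n) (pb_monok _ (leq_addr _ _)).
have h2 : q n <= pb (k + l) n by apply: leq_trans (H' n) (pb_monok _ (leq_addl _ _)).
by rewrite /pb expnS -!/(pb _ _); nia.
Qed.

Lemma pol_comp k p : pol p -> pol (fun n => pb k (p n)).
Proof.
move=> [l H]; exists (l.+2 * k) => n.
rewrite /pb expnM; apply: leq_exp2rW; rewrite !expnS.
have := H n; rewrite /pb.
have : 0 < n.+2 ^ l by rewrite expn_gt0.
nia.
Qed.

Lemma pol_exp k p : pol p -> pol (fun n => p n ^ k).
Proof.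
by move=> hp; apply: pol_leq (pol_comp k hp) => n; apply: leq_exp2rW; lia.
Qed.

Lemma pol_poly_bound p : pol p -> exists k, forall n, p n <= poly_bound k n.
Proof.
(* The constant [3 ^ k] covers lengths 0 and 1. From length 2 on, n + 2 is at most n ^ 2, so the
   exponent [2 * k] suffices. *)
move=> [k H]; exists (3 ^ k + 2 * k) => n; apply: leq_trans (H n) _.
rewrite /pb /poly_bound; case: n => [|[|n]].
- by have := @leq_exp2rW 2 3 k isT; lia.
- lia.
- apply: leq_trans (leq_addr _ _).
  have e : n.+4 ^ k <= n.+2 ^ (2 * k).
    by rewrite expnM; apply: leq_exp2rW; rewrite expnS expn1; nia.
  by apply: leq_trans e _; rewrite leq_pexp2l // leq_addl.
Qed.

Ltac pols := repeat first [ apply: pol_add | apply: pol_mul | apply: pol_const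
  | apply: pol_id | apply: pol_pb | apply: pol_comp | apply: pol_exp ].

Definition runs c s s' n := exists2 t, exec c s s' t & t <= n.

Lemma runs_leq c s s' m n : runs c s s' m -> m <= n -> runs c s s' n.
Proof. by move=> [t e l] mn; exists t => //; exact: leq_trans l mn. Qed.

Lemma runs_push i a s : runs (CPush i a) s (sset s i (a :: sget s i)) 2.
Proof. by exists 2 => //; constructor. Qed.

Lemma runs_pop i s : runs (CPop i) s (sset s i (behead (sget s i))) 1.
Proof. by exists 1 => //; constructor. Qed.

Lemma runs_seq c1 c2 s1 s2 s3 n1 n2 : runs c1 s1 s2 n1 -> runs c2 s2 s3 n2 ->
  runs (CSeq c1 c2) s1 s3 (n1 + n2).
Proof.
move=> [t1 e1 l1] [t2 e2 l2]; exists (t1 + t2); last exact: leq_add.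
by econstructor; eauto.
Qed.

Lemma runs_if i (f : option ssym -> bool) c1 c2 s s' n :
  runs (if f (stop s i) then c1 else c2) s s' n ->
  runs (CIf i f c1 c2) s s' n.+2.
Proof.
case: (boolP (f (stop s i))) => ft [t e l].
  by exists t.+2; [exact: EIfT|lia].
by exists t.+1; [exact: EIfF|lia].
Qed.

Lemma runs_whileT i (f : option ssym -> bool) c s1 s2 s3 n1 n2 :
  f (stop s1 i) -> runs c s1 s2 n1 ->
  runs (CWhile i f c) s2 s3 n2 -> runs (CWhile i f c) s1 s3 (n1 + n2).+2.
Proof.
move=> ft [t1 e1 l1] [t2 e2 l2]; exists (t1 + t2).+2; last by lia.
exact: (EWhileT ft e1 e2).
Qed.

Lemma runs_whileF i (f : option ssym -> bool) c s :
  ~~ f (stop s i) -> runs (CWhile i f c) s s 1.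
Proof. by move=> ft; exists 1 => //; exact: EWhileF. Qed.

Notation "c1 ;; c2" := (CSeq c1 c2) (at level 90, right associativity).
Definition skip := CWhile X0 (fun=> false) (CPop X0).
Definition is1 (x : option ssym) := if x is Some (inl b) then b else false.
Definition nomark (x : option ssym) := if x is Some (inr _) then false else true.

Lemma runs_skip s : runs skip s s 1. Proof. exact: runs_whileF. Qed.

Inductive U := L | N of U & U.

(** Preorder makes the code prefix-free, so that trees can lie next to each other on a stack without
    separators. *)
Fixpoint enc (u : U) : seq bool :=
  if u is N a b then true :: enc a ++ enc b else [:: false].

Definition usz u := size (enc u).
Definition ecode u : seq ssym := raw_bits (enc u).

Lemma uszN a b : usz (N a b) = (usz a + usz b).+1.
Proof. by rewrite /usz /= size_cat. Qed.

Lemma usz_gt0 u : 0 < usz u. Proof. by case: u. Qed.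

Lemma ecodeN a b : ecode (N a b) = inl true :: ecode a ++ ecode b.
Proof. by rewrite /ecode /raw_bits /= map_cat. Qed.

(** Moves the tree on top of [X0], reversed, onto stack [j] above a mark. The end of the tree is
    found by counting on [X2] the subtrees still to be read: an inner node adds one, a leaf removes
    one. *)
Definition mvout j :=
  CPush j mark ;; CPush X2 mark ;; CPush X2 (inl true) ;;
  CWhile X2 nomark
    (CIf X0 is1 (CPop X0 ;; CPush j (inl true) ;; CPush X2 (inl true))
                (CPop X0 ;; CPush j (inl false) ;; CPop X2)) ;;
  CPop X2.

Definition mvback i j :=
  CWhile i nomark (CIf i is1 (CPop i ;; CPush j (inl true))
                             (CPop i ;; CPush j (inl false))) ;; CPop i.

Definition mvall i j :=
  CWhile i isSome (CIf i is1 (CPop i ;; CPush j (inl true))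
                             (CPop i ;; CPush j (inl false))).

Definition vdrop := mvout X1 ;; CWhile X1 nomark (CPop X1) ;; CPop X1.

Definition vswap := mvout X1 ;; mvout X3 ;; mvback X1 X0 ;; mvback X3 X0.

(** Unwinding the reversed code fills [X0] and [X3] at the same time; the copy on [X3] then takes
    two more reversals to reach [X0] in the right order. *)
Definition vdup := mvout X1 ;; CPush X3 mark ;;
  (CWhile X1 nomark
     (CIf X1 is1 (CPop X1 ;; CPush X0 (inl true) ;; CPush X3 (inl true))
                 (CPop X1 ;; CPush X0 (inl false) ;; CPush X3 (inl false))) ;;
   CPop X1) ;;
  CPush X1 mark ;; mvback X3 X1 ;; mvback X1 X0.

Section Moves.
Variables (i j : sidx) (F : seq ssym -> seq ssym -> stacks).
Hypotheses (F1 : forall a b, sget (F a b) i = a)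
  (F2 : forall a b, sget (F a b) j = b)
  (F3 : forall a b c, sset (F a b) i c = F c b)
  (F4 : forall a b c, sset (F a b) j c = F a c).

(** [F] views the state as a function of the two stacks involved, so that one proof serves every
    pair of stacks. *)
Lemma runs_mv1 x a b :
  runs (CIf i is1 (CPop i ;; CPush j (inl true)) (CPop i ;; CPush j (inl false)))
    (F (inl x :: a) b) (F a (inl x :: b)) 5.
Proof.
apply: runs_if; rewrite /stop F1 /=.
case: x => /=.
  have := runs_seq (runs_pop i (F (inl true :: a) b)) (runs_push j (inl true) _).
  by rewrite F3 F1 F2 F4.
have := runs_seq (runs_pop i (F (inl false :: a) b)) (runs_push j (inl false) _).
by rewrite F3 F1 F2 F4.
Qed.

Lemma runs_mvback w a b :
  runs (mvback i j) (F (raw_bits w ++ mark :: a) b) (F a (raw_bits (rev w) ++ b))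
    (7 * size w + 2).
Proof.
rewrite /mvback (_ : _ + 2 = (7 * size w).+1 + 1); last lia.
apply: (@runs_seq _ _ _ (F (mark :: a) (raw_bits (rev w) ++ b))); last first.
  by have := runs_pop i (F (mark :: a) (raw_bits (rev w) ++ b)); rewrite F3 F1.
elim: w b => [|x w IH] b /=; first by apply: runs_whileF; rewrite /stop F1.
rewrite rev_cons -cats1 /raw_bits map_cat -catA /=.
have := IH (inl x :: b); set s3 := F (mark :: a) _ => IH'.
apply: runs_leq (runs_whileT _ (runs_mv1 x _ b) IH') _; last by lia.
by rewrite /stop F1.
Qed.

Lemma runs_mvall w b :
  runs (mvall i j) (F (raw_bits w) b) (F [::] (raw_bits (rev w) ++ b))
    (7 * size w + 1).
Proof.
elim: w b => [|x w IH] b /=; first by apply: runs_whileF; rewrite /stop F1.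
rewrite rev_cons -cats1 /raw_bits map_cat -catA /=.
have := IH (inl x :: b); set s3 := F [::] _ => IH'.
apply: runs_leq (runs_whileT _ (runs_mv1 x _ b) IH') _; last by lia.
by rewrite /stop F1.
Qed.

End Moves.

Section MoveOut.
Variables (j : sidx) (F : seq ssym -> seq ssym -> seq ssym -> stacks).
Hypotheses (F1 : forall a b c, sget (F a b c) X0 = a)
  (F2 : forall a b c, sget (F a b c) j = b)
  (F3 : forall a b c, sget (F a b c) X2 = c)
  (F4 : forall a b c x, sset (F a b c) X0 x = F x b c)
  (F5 : forall a b c x, sset (F a b c) j x = F a x c)
  (F6 : forall a b c x, sset (F a b c) X2 x = F a b x).

Let body := CIf X0 is1 (CPop X0 ;; CPush j (inl true) ;; CPush X2 (inl true))
                       (CPop X0 ;; CPush j (inl false) ;; CPop X2).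

Let loop := CWhile X2 nomark body.

(** The rest of the run is a premise. In this continuation form the two induction hypotheses of a
    node simply chain, while the counter keeps track of the subtrees that remain. *)
Lemma runs_mvout_loop x a b c s n :
  runs loop (F a (raw_bits (rev (enc x)) ++ b) c) s n ->
  runs loop (F (ecode x ++ a) b (inl true :: c)) s (n + 9 * usz x).
Proof.
elim: x a b c n => [|x IHx y IHy] a b c n.
  move=> H; apply: runs_leq (@runs_whileT _ _ _ _ _ _ 6 _ _ _ H) _; last by rewrite /usz /=; lia.
    by rewrite /stop F3.
  apply: runs_leq (@runs_if _ _ _ _ _ _ 4 _) _ => //; rewrite /stop F1 /=.
  have := runs_seq (runs_pop X0 (F (inl false :: a) b (inl true :: c)))
    (runs_seq (runs_push j (inl false) _) (runs_pop X2 _)).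
  by rewrite !(F1, F2, F3, F4, F5, F6).
rewrite ecodeN uszN /= rev_cons rev_cat -cats1 /raw_bits !map_cat -!catA /= => H.
have := IHx (ecode y ++ a) (inl true :: b) (inl true :: c) _ (IHy _ _ _ _ H).
rewrite /= => H'; apply: runs_leq (@runs_whileT _ _ _ _ _ _ 7 _ _ _ H') _; last by lia.
  by rewrite /stop F3.
apply: runs_leq (@runs_if _ _ _ _ _ _ 5 _) _ => //; rewrite /stop F1 /=.
have := runs_seq (runs_pop X0 (F (inl true :: ecode x ++ ecode y ++ a) b (inl true :: c)))
  (runs_seq (runs_push j (inl true) _) (runs_push X2 (inl true) _)).
by rewrite !(F1, F2, F3, F4, F5, F6).
Qed.

Lemma runs_mvout x a b c :
  runs (mvout j) (F (ecode x ++ a) b c) (F a (raw_bits (rev (enc x)) ++ mark :: b) c)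
    (9 * usz x + 8).
Proof.
have H0 : runs loop (F a (raw_bits (rev (enc x)) ++ mark :: b) (mark :: c))
    (F a (raw_bits (rev (enc x)) ++ mark :: b) (mark :: c)) 1.
  by apply: runs_whileF; rewrite /stop F3.
have h1 := runs_push j mark (F (ecode x ++ a) b c).
have h2 := runs_push X2 mark (F (ecode x ++ a) (mark :: b) c).
have h3 := runs_push X2 (inl true) (F (ecode x ++ a) (mark :: b) (mark :: c)).
have h4 := runs_pop X2 (F a (raw_bits (rev (enc x)) ++ mark :: b) (mark :: c)).
rewrite F5 F2 in h1; rewrite F6 F3 in h2; rewrite F6 F3 in h3; rewrite F6 F3 /= in h4.
have := runs_seq h1 (runs_seq h2 (runs_seq h3 (runs_seq (runs_mvout_loop H0) h4))).
by move=> H; apply: runs_leq H _; lia.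
Qed.

End MoveOut.

Definition st4 a b c d : stacks := (a, b, c, d).

Lemma runs_out1 x a b c d : runs (mvout X1) (st4 (ecode x ++ a) b c d)
  (st4 a (raw_bits (rev (enc x)) ++ mark :: b) c d) (9 * usz x + 8).
Proof. exact: (@runs_mvout X1 (fun a b c => st4 a b c d)). Qed.

Lemma runs_out3 x a b c d : runs (mvout X3) (st4 (ecode x ++ a) b c d)
  (st4 a b c (raw_bits (rev (enc x)) ++ mark :: d)) (9 * usz x + 8).
Proof. exact: (@runs_mvout X3 (fun a d c => st4 a b c d)). Qed.

Lemma runs_back10 x a b c d : runs (mvback X1 X0)
  (st4 a (raw_bits (rev (enc x)) ++ mark :: b) c d) (st4 (ecode x ++ a) b c d)
  (7 * usz x + 2).
Proof.
have := @runs_mvback X1 X0 (fun b a => st4 a b c d) _ _ _ _ (rev (enc x)) b a.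
by rewrite revK size_rev; apply.
Qed.

Lemma runs_back30 x a b c d : runs (mvback X3 X0)
  (st4 a b c (raw_bits (rev (enc x)) ++ mark :: d)) (st4 (ecode x ++ a) b c d)
  (7 * usz x + 2).
Proof.
have := @runs_mvback X3 X0 (fun d a => st4 a b c d) _ _ _ _ (rev (enc x)) d a.
by rewrite revK size_rev; apply.
Qed.

Lemma runs_back31 x a b c d : runs (mvback X3 X1)
  (st4 a b c (ecode x ++ mark :: d)) (st4 a (raw_bits (rev (enc x)) ++ b) c d)
  (7 * usz x + 2).
Proof. exact: (@runs_mvback X3 X1 (fun d b => st4 a b c d)). Qed.

Lemma runs_vswap x y a b c d :
  runs vswap (st4 (ecode x ++ ecode y ++ a) b c d) (st4 (ecode y ++ ecode x ++ a) b c d)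
    (16 * usz x + 16 * usz y + 20).
Proof.
have H := runs_seq (runs_out1 x (ecode y ++ a) b c d)
  (runs_seq (runs_out3 y _ _ _ _) (runs_seq (runs_back10 _ _ _ _ _) (runs_back30 _ _ _ _ _))).
by apply: runs_leq H _; lia.
Qed.

Lemma runs_vdrop x a b c d :
  runs vdrop (st4 (ecode x ++ a) b c d) (st4 a b c d) (12 * usz x + 10).
Proof.
apply: (runs_leq (m := 9 * usz x + 8 + ((3 * usz x).+1 + 1))); last lia.
apply: runs_seq (runs_out1 x a b c d) _.
apply: (@runs_seq _ _ _ (st4 a (mark :: b) c d));
  last exact: (runs_pop X1 (st4 a (mark :: b) c d)).
rewrite -[usz x](size_rev (enc x)); elim: (rev (enc x)) => [|y w IH] /=.
  exact: runs_whileF.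
apply: (runs_leq (runs_whileT (n1 := 1) _ _ IH)) => //; last by rewrite mulnS; lia.
exact: (runs_pop X1 (st4 a (inl y :: raw_bits w ++ mark :: b) c d)).
Qed.

Lemma runs_vdup x a b c d :
  runs vdup (st4 (ecode x ++ a) b c d) (st4 (ecode x ++ ecode x ++ a) b c d)
    (32 * usz x + 18).
Proof.
have H w a' d' : runs (CWhile X1 nomark
     (CIf X1 is1 (CPop X1 ;; CPush X0 (inl true) ;; CPush X3 (inl true))
                 (CPop X1 ;; CPush X0 (inl false) ;; CPush X3 (inl false))))
    (st4 a' (raw_bits w ++ mark :: b) c d')
    (st4 (raw_bits (rev w) ++ a') (mark :: b) c (raw_bits (rev w) ++ d')) (9 * size w + 1).
  elim: w a' d' => [|y w IH] a' d' /=; first exact: runs_whileF.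
  rewrite rev_cons -cats1 /raw_bits map_cat -!catA /=.
  apply: (runs_leq (runs_whileT (n1 := 7) _ _ (IH (inl y :: a') (inl y :: d')))) => //;
    last by rewrite mulnS; lia.
  apply: runs_if; rewrite /stop /=.
  case: y => /=; first exact: (runs_seq (runs_pop X1 _) (runs_seq (runs_push X0 _ _) (runs_push X3 _ _))).
  exact: (runs_seq (runs_pop X1 _) (runs_seq (runs_push X0 _ _) (runs_push X3 _ _))).
have h1 := runs_out1 x a b c d.
have h2 := runs_push X3 mark (st4 a (raw_bits (rev (enc x)) ++ mark :: b) c d).
have h3 := H (rev (enc x)) a (mark :: d); rewrite revK size_rev in h3.
have h4 := runs_pop X1 (st4 (ecode x ++ a) (mark :: b) c (ecode x ++ mark :: d)).
have h5 := runs_push X1 mark (st4 (ecode x ++ a) b c (ecode x ++ mark :: d)).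
have h6 := runs_back31 x (ecode x ++ a) (mark :: b) c d.
have h7 := runs_back10 x (ecode x ++ a) b c d.
apply: runs_leq (runs_seq h1 (runs_seq h2 (runs_seq (runs_seq h3 h4)
  (runs_seq h5 (runs_seq h6 h7))))) _.
by rewrite -/(usz x); lia.
Qed.

(* [fpr i o]: a single program turns the tree [i x] into [o x] for all [x]. *)
Definition fpr (X : Type) (i o : X -> U) := exists c k, forall x,
  usz (o x) <= pb k (usz (i x)) /\
  forall r0 r1 r2 r3, runs c (st4 (ecode (i x) ++ r0) r1 r2 r3)
    (st4 (ecode (o x) ++ r0) r1 r2 r3) (pb k (usz (i x))).

Lemma fprI X (i o : X -> U) c p : pol p -> (forall x, usz (o x) <= p (usz (i x)) /\
    forall r0 r1 r2 r3, runs c (st4 (ecode (i x) ++ r0) r1 r2 r3)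
      (st4 (ecode (o x) ++ r0) r1 r2 r3) (p (usz (i x)))) -> fpr i o.
Proof.
move=> [k pk] H; exists c, k => x; have [h1 h2] := H x; split.
  exact: leq_trans h1 (pk _).
by move=> *; apply: runs_leq (h2 _ _ _ _) (pk _).
Qed.

Lemma fpr_reindex X Y (g : Y -> X) (i o : X -> U) :
  fpr i o -> fpr (fun y => i (g y)) (fun y => o (g y)).
Proof. by move=> [c [k H]]; exists c, k => y; exact: H. Qed.

Lemma fpr_id X (i : X -> U) : fpr i i.
Proof.
apply: (@fprI _ _ _ skip (fun n => n + 1)); first by pols.
by move=> x; split=> [|*]; [lia|apply: runs_leq (runs_skip _) _; lia].
Qed.

Lemma fpr_comp X (i m o : X -> U) : fpr i m -> fpr m o -> fpr i o.
Proof.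
move=> [c1 [k1 H1]] [c2 [k2 H2]].
apply: (@fprI _ _ _ (c1 ;; c2) (fun n => pb k1 n + pb k2 (pb k1 n))); first by pols.
move=> x; have [s1 r1] := H1 x; have [s2 r2] := H2 x.
have le := pb_mono k2 s1; split; first by lia.
by move=> *; apply: runs_leq (runs_seq (r1 _ _ _ _) (r2 _ _ _ _)) _; lia.
Qed.

Lemma fpr_pair X (i f g : X -> U) : fpr i f -> fpr i g -> fpr i (fun x => N (f x) (g x)).
Proof.
move=> [c1 [k1 H1]] [c2 [k2 H2]].
(* The second component is computed first, because the code of the pair has the first one on top. *)
apply: (@fprI _ _ _ (vdup ;; c2 ;; vswap ;; c1 ;; CPush X0 (inl true))
  (fun n => 50 * n + 17 * pb k1 n + 17 * pb k2 n + 100)); first by pols.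
move=> x; have [s1 r1] := H1 x; have [s2 r2] := H2 x.
split; first by rewrite uszN; lia.
move=> a b c d; rewrite ecodeN.
have h1 := runs_vdup (i x) a b c d.
have h2 := r2 (ecode (i x) ++ a) b c d.
have h3 := runs_vswap (g x) (i x) a b c d.
have h4 := r1 (ecode (g x) ++ a) b c d.
have h5 := runs_push X0 (inl true) (st4 (ecode (f x) ++ ecode (g x) ++ a) b c d).
rewrite cat_cons -catA.
by apply: runs_leq (runs_seq h1 (runs_seq h2 (runs_seq h3 (runs_seq h4 h5)))) _; lia.
Qed.

Definition ufst u := if u is N a _ then a else L.
Definition usnd u := if u is N _ b then b else L.

Lemma fpr_fst X (f : X -> U) : fpr f (fun x => ufst (f x)).
Proof.
apply: (@fprI _ _ _ (CIf X0 is1 (CPop X0 ;; vswap ;; vdrop) skip) (fun n => 50 * n + 100));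
  first by pols.
move=> x; case: (f x) => [|{}x y]; split=> [|a b c d]; [by []| |by rewrite uszN /=; lia|].
  by apply: runs_leq (runs_if (n := 1) _) _ => //; rewrite /stop /=; exact: runs_skip.
rewrite ecodeN uszN; apply: runs_leq (runs_if (n := 30 * (usz x + usz y) + 90) _) _; last by lia.
rewrite /stop /= -catA.
have h1 := runs_pop X0 (st4 (inl true :: ecode x ++ ecode y ++ a) b c d).
have h2 := runs_vswap x y a b c d.
have h3 := runs_vdrop y (ecode x ++ a) b c d.
by apply: runs_leq (runs_seq h1 (runs_seq h2 h3)) _; lia.
Qed.

Lemma fpr_snd X (f : X -> U) : fpr f (fun x => usnd (f x)).
Proof.
apply: (@fprI _ _ _ (CIf X0 is1 (CPop X0 ;; vdrop) skip) (fun n => 50 * n + 100));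
  first by pols.
move=> x; case: (f x) => [|{}x y]; split=> [|a b c d]; [by []| |by rewrite uszN /=; lia|].
  by apply: runs_leq (runs_if (n := 1) _) _ => //; rewrite /stop /=; exact: runs_skip.
rewrite ecodeN uszN; apply: runs_leq (runs_if (n := 30 * (usz x + usz y) + 90) _) _; last by lia.
rewrite /stop /= -catA.
have h1 := runs_pop X0 (st4 (inl true :: ecode x ++ ecode y ++ a) b c d).
have h3 := runs_vdrop x (ecode y ++ a) b c d.
by apply: runs_leq (runs_seq h1 h3) _; lia.
Qed.

Lemma fpr_leaf X (i : X -> U) : fpr i (fun=> L).
Proof.
apply: (@fprI _ _ _ (vdrop ;; CPush X0 (inl false)) (fun n => 12 * n + 20)); first by pols.
move=> x; split=> [|a b c d]; first by rewrite /usz /=; lia.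
have h1 := runs_vdrop (i x) a b c d.
have h2 := runs_push X0 (inl false) (st4 a b c d).
by apply: runs_leq (runs_seq h1 h2) _; lia.
Qed.

Lemma fpr_const X (i : X -> U) u : fpr i (fun=> u).
Proof. by elim: u => [|a IHa b IHb]; [exact: fpr_leaf|exact: fpr_pair]. Qed.

Lemma fpr_cond X (i f g h : X -> U) : fpr i f -> fpr i g -> fpr i h ->
  fpr i (fun x => if f x is L then g x else h x).
Proof.
move=> [c1 [k1 H1]] [c2 [k2 H2]] [c3 [k3 H3]].
apply: (@fprI _ _ _ (vdup ;; c1 ;; CIf X0 is1 (vdrop ;; c3) (CPop X0 ;; c2))
  (fun n => 32 * n + 13 * pb k1 n + pb k2 n + pb k3 n + 100)); first by pols.
move=> x; have [s1 r1] := H1 x; have [s2 r2] := H2 x; have [s3 r3] := H3 x.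
split=> [|a b c d]; first by case: (f x); lia.
have h1 := runs_vdup (i x) a b c d.
have h2 := r1 (ecode (i x) ++ a) b c d.
apply: runs_leq (runs_seq h1 (runs_seq h2 (runs_if
   (n := 12 * pb k1 (usz (i x)) + pb k2 (usz (i x)) + pb k3 (usz (i x)) + 20) _))) _; last by lia.
case: (f x) s1 => [|u v] s1; rewrite ?ecodeN /stop /=.
  have h3 := runs_pop X0 (st4 (inl false :: ecode (i x) ++ a) b c d).
  by apply: runs_leq (runs_seq h3 (r2 _ _ _ _)) _; lia.
have h3 := runs_vdrop (N u v) (ecode (i x) ++ a) b c d.
by rewrite ecodeN /= in h3; apply: runs_leq (runs_seq h3 (r3 _ _ _ _)) _; lia.
Qed.

Fixpoint ulen u := if u is N _ b then (ulen b).+1 else 0.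

(** The right spine of [l] is a unary counter that lies above the current value. The sizes of all
    intermediate values are bounded by hypothesis: iterating a polynomial-time step may square the
    size in each round. *)
Lemma fpr_iter X A (cA : A -> U) (f : A -> A) (i l : X -> U) (s : X -> A) k :
  fpr cA (fun a => cA (f a)) -> fpr i l -> fpr i (fun x => cA (s x)) ->
  (forall x j, j <= ulen (l x) -> usz (cA (iter j f (s x))) <= pb k (usz (i x))) ->
  fpr i (fun x => cA (iter (ulen (l x)) f (s x))).
Proof.
move=> [c1 [k1 H1]] fl fs.
have [c0 [k0 H0]] := fpr_pair fl fs => Hk.
pose m n := pb k0 n + pb k n.
pose q n := 100 * m n + pb k1 (pb k n) + 100.
apply: (@fprI _ _ _ (c0 ;; CPop X0 ;;
   (CWhile X0 is1 (CPop X0 ;; vdrop ;; vswap ;; c1 ;; vswap)) ;; CPop X0)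
  (fun n => m n + m n * q n + 20)); first by rewrite /q /m; pols.
move=> x; have {}Hk := Hk x; have [s0 r0] := H0 x; split=> [|a b c d].
  by apply: leq_trans (Hk _ (leqnn _)) _; rewrite /m; lia.
move: (r0 a b c d) Hk s0; clear H0 fl fs r0.
move: (l x) (s x) => {l s} l s r0 Hk s0.
set n := usz (i x) in Hk s0 r0 *.
rewrite ecodeN /= -catA in r0.
have r2 := runs_pop X0 (st4 (inl true :: ecode l ++ ecode (cA s) ++ a) b c d).
have r4 := runs_pop X0 (st4 (inl false :: ecode (cA (iter (ulen l) f s)) ++ a) b c d).
have ln : usz l <= m n by rewrite uszN in s0; rewrite /m; lia.
suff r3 : runs (CWhile X0 is1 (CPop X0 ;; vdrop ;; vswap ;; c1 ;; vswap))
    (st4 (ecode l ++ ecode (cA s) ++ a) b c d)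
    (st4 (inl false :: ecode (cA (iter (ulen l) f s)) ++ a) b c d) (usz l * q n + 1).
  apply: runs_leq (runs_seq r0 (runs_seq r2 (runs_seq r3 r4))) _.
  by rewrite /m in ln *; nia.
clearbody n; elim: l s {r0 r2 r4 s0} Hk ln => [|y _ l IH] s Hk ln.
  by apply: runs_leq (runs_whileF _ _) _ => //; lia.
rewrite ecodeN [ulen _]/= iterSr cat_cons -catA.
have k0' := Hk 0 isT; have k1' := Hk 1 isT; rewrite /= in k0' k1'.
rewrite uszN in ln *.
have [] := H1 s => sx rx.
have := pb_mono k1 k0' => lx.
have h1 := runs_pop X0 (st4 (inl true :: ecode y ++ ecode l ++ ecode (cA s) ++ a) b c d).
have h2 := runs_vdrop y (ecode l ++ ecode (cA s) ++ a) b c d.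
have h3 := runs_vswap l (cA s) a b c d.
have h4 := rx (ecode l ++ a) b c d.
have h5 := runs_vswap (cA (f s)) l a b c d.
apply: (runs_leq (runs_whileT _ (runs_seq h1 (runs_seq h2 (runs_seq h3 (runs_seq h4 h5))))
   (IH (f s) _ _))) => //; last by rewrite /q /m in ln *; nia.
  by move=> j jl; rewrite -iterSr; apply: Hk.
by lia.
Qed.

Definition ubool (b : bool) := if b then N L L else L.
Definition ubits (w : seq bool) := foldr (fun b u => N (ubool b) u) L w.

Lemma usz_ubits w : usz (ubits w) <= 4 * size w + 1.
Proof. by elim: w => //= b w IH; rewrite uszN; case: b; rewrite /usz /= -/(usz _); lia. Qed.

Definition conv_in := mvall X0 X1 ;; CPush X0 (inl false) ;;
  CWhile X1 isSome (CIf X1 is1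
    (CPop X1 ;; CPush X0 (inl false) ;; CPush X0 (inl false) ;; CPush X0 (inl true) ;; CPush X0 (inl true))
    (CPop X1 ;; CPush X0 (inl false) ;; CPush X0 (inl true))).

Lemma runs_conv_in w : runs conv_in (st4 (raw_bits w) [::] [::] [::])
  (st4 (ecode (ubits w)) [::] [::] [::]) (30 * size w + 10).
Proof.
have h1 := @runs_mvall X0 X1 (fun a b => st4 a b [::] [::])
  (fun _ _ => erefl) (fun _ _ => erefl) (fun _ _ _ => erefl) (fun _ _ _ => erefl) w [::].
have h2 := runs_push X0 (inl false) (st4 [::] (raw_bits (rev w)) [::] [::]).
rewrite cats0 in h1.
have h3 v u : runs (CWhile X1 isSome (CIf X1 is1
    (CPop X1 ;; CPush X0 (inl false) ;; CPush X0 (inl false) ;; CPush X0 (inl true) ;; CPush X0 (inl true))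
    (CPop X1 ;; CPush X0 (inl false) ;; CPush X0 (inl true))))
    (st4 (ecode (ubits u)) (raw_bits v) [::] [::])
    (st4 (ecode (ubits (rev v ++ u))) [::] [::] [::]) (13 * size v + 1).
  elim: v u => [|x v IH] u; first exact: runs_whileF.
  rewrite rev_cons -cats1 -catA.
  apply: (runs_leq (runs_whileT (n1 := 11) _ _ (IH (x :: u)))) => //; last by rewrite /= mulnS; lia.
  apply: runs_if; rewrite /stop /=; case: x => /=; rewrite ecodeN.
    exact: (runs_seq (runs_pop X1 _) (runs_seq (runs_push X0 _ _) (runs_seq (runs_push X0 _ _)
       (runs_seq (runs_push X0 _ _) (runs_push X0 _ _))))).
  by apply: runs_leq (runs_seq (runs_pop X1 _) (runs_seq (runs_push X0 _ _) (runs_push X0 _ _))) _.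
have := h3 (rev w) [::]; rewrite revK cats0 size_rev => {}h3.
by apply: runs_leq (runs_seq h1 (runs_seq h2 h3)) _; lia.
Qed.

Definition vflat := mvout X1 ;; CPush X0 (inl false) ;;
  CWhile X1 nomark (CIf X1 is1
    (CPop X1 ;; CPush X0 (inl false) ;; CPush X0 (inl false) ;; CPush X0 (inl true) ;; CPush X0 (inl true))
    (CPop X1 ;; CPush X0 (inl false) ;; CPush X0 (inl true))) ;; CPop X1.

(** Turns a code into data. Its length then gives unary counters that are polynomial in the input,
    and comparing codes decides equality of encoded values. *)
Lemma fpr_flat X (f : X -> U) : fpr f (fun x => ubits (enc (f x))).
Proof.
apply: (@fprI _ _ _ vflat (fun n => 30 * n + 20)); first by pols.
move=> x; move: (f x) => {f}x; split=> [|a b c d].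
  by have := usz_ubits (enc x); rewrite -/(usz x); lia.
have h1 := runs_out1 x a b c d.
have h2 := runs_push X0 (inl false) (st4 a (raw_bits (rev (enc x)) ++ mark :: b) c d).
have h3 v u : runs (CWhile X1 nomark (CIf X1 is1
    (CPop X1 ;; CPush X0 (inl false) ;; CPush X0 (inl false) ;; CPush X0 (inl true) ;; CPush X0 (inl true))
    (CPop X1 ;; CPush X0 (inl false) ;; CPush X0 (inl true))))
    (st4 (ecode (ubits u) ++ a) (raw_bits v ++ mark :: b) c d)
    (st4 (ecode (ubits (rev v ++ u)) ++ a) (mark :: b) c d) (13 * size v + 1).
  elim: v u => [|y v IH] u; first exact: runs_whileF.
  rewrite rev_cons -cats1 -catA.
  apply: (runs_leq (runs_whileT (n1 := 11) _ _ (IH (y :: u)))) => //; last by rewrite /= mulnS; lia.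
  apply: runs_if; rewrite [stop _ _]/= [is1 _]/=; case: y.
    exact: (runs_seq (runs_pop X1 _) (runs_seq (runs_push X0 _ _) (runs_seq (runs_push X0 _ _)
       (runs_seq (runs_push X0 _ _) (runs_push X0 _ _))))).
  by apply: runs_leq (runs_seq (runs_pop X1 _) (runs_seq (runs_push X0 _ _) (runs_push X0 _ _))) _.
have := h3 (rev (enc x)) [::]; rewrite revK cats0 size_rev => {}h3.
have h4 := runs_pop X1 (st4 (ecode (ubits (enc x)) ++ a) (mark :: b) c d).
by apply: runs_leq (runs_seq h1 (runs_seq h2 (runs_seq h3 h4))) _; rewrite -/(usz x); lia.
Qed.

Lemma enc_prefix a b r r' : enc a ++ r = enc b ++ r' -> a = b /\ r = r'.
Proof.
elim: a b r r' => [|a1 IH1 a2 IH2] [|b1 b2] r r' //=; first by case.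
by case; rewrite -!catA => /IH1 [-> /IH2 [-> ->]].
Qed.

Lemma enc_inj : injective enc.
Proof. by move=> a b e; have [] := @enc_prefix a b [::] [::]; rewrite ?e. Qed.

Definition conv_out :=
  CWhile X0 is1 (CPop X0 ;; CIf X0 is1
     (CPop X0 ;; CPop X0 ;; CPop X0 ;; CPush X1 (inl true)) (CPop X0 ;; CPush X1 (inl false))) ;;
  CPop X0 ;; mvall X1 X0.

Lemma runs_conv_out w : runs conv_out (st4 (ecode (ubits w)) [::] [::] [::])
  (st4 (raw_bits w) [::] [::] [::]) (30 * size w + 10).
Proof.
have H u : runs (CWhile X0 is1 (CPop X0 ;; CIf X0 is1
     (CPop X0 ;; CPop X0 ;; CPop X0 ;; CPush X1 (inl true)) (CPop X0 ;; CPush X1 (inl false))))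
   (st4 (ecode (ubits w)) (raw_bits u) [::] [::])
   (st4 [:: inl false] (raw_bits (rev w ++ u)) [::] [::]) (10 * size w + 1).
  elim: w u => [|x w IH] u; first exact: runs_whileF.
  rewrite rev_cons -cats1 -catA /= ecodeN.
  apply: (runs_leq (runs_whileT (n1 := 8) _ _ (IH (x :: u)))) => //; last by rewrite mulnS; lia.
  apply: (runs_leq (runs_seq (runs_pop X0 _) (runs_if (n := 5) _))) => //.
  rewrite /stop /=; case: x => /=.
    exact: (runs_seq (runs_pop X0 _) (runs_seq (runs_pop X0 _) (runs_seq (runs_pop X0 _) (runs_push X1 _ _)))).
  by apply: runs_leq (runs_seq (runs_pop X0 _) (runs_push X1 _ _)) _.
have h1 := @runs_mvall X1 X0 (fun b a => st4 a b [::] [::]) _ _ _ _ (rev w) [::].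
have := H [::]; rewrite !cats0 => {}H.
apply: (runs_leq (runs_seq H (runs_seq (runs_pop X0 _) _))).
  by rewrite revK cats0 in h1; apply: h1.
by rewrite size_rev; lia.
Qed.

Theorem fpr_PTIME F (A : language) : fpr ubits F ->
  (forall w, F w <> L <-> A w) -> PTIME A.
Proof.
move=> [c [k H]] HA.
have [K HK] : exists K, forall n, 30 * n + 20 + pb k (4 * n + 1) <= poly_bound K n.
  by apply: pol_poly_bound; pols.
apply: (@com_decides (conv_in ;; c) _ K) => w.
have [_ /(_ [::] [::] [::] [::])] := H w; rewrite !cats0 => r.
have [t e l] := runs_seq (runs_conv_in w) r.
exists t; eexists; split; first exact: e.
  have := pb_mono k (usz_ubits w); have := HK (size w); lia.
by rewrite -HA /stop /=; case: (F _).
Qed.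

Theorem fpr_poly_computable (f : seq bool -> seq bool) :
  fpr ubits (fun w => ubits (f w)) -> poly_computable f.
Proof.
move=> [c [k H]].
have [K HK] : exists K, forall n, 30 * n + 30 + 31 * pb k (4 * n + 1) <= poly_bound K n.
  by apply: pol_poly_bound; pols.
apply: (@com_computes (conv_in ;; c ;; conv_out) _ K) => w.
have [s /(_ [::] [::] [::] [::])] := H w; rewrite !cats0 => r.
have [t e l] := runs_seq (runs_conv_in w) (runs_seq r (runs_conv_out (f w))).
exists t; eexists; split; first exact: e; last by [].
have := pb_mono k (usz_ubits w); have := HK (size w).
have : size (f w) <= usz (ubits (f w)).
  by elim: (f w) => //= b u IH; rewrite uszN; lia.
lia.
Qed.

End TreeFunctions.
Import TreeFunctions.

(** * Polynomial-time functions on encoded data *)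

Module EncodedFunctions.

(** Injectivity is what makes equality testable on codes. *)
Class Enc (A : Type) := { code : A -> U; code_inj : injective code }.

Definition sz {A} {e : Enc A} (a : A) : nat := usz (code a).

Definition fpc {A B} {eA : Enc A} {eB : Enc B} (f : A -> B) :=
  fpr (fun a => code a) (fun a => code (f a)).

#[export] Instance Enc_U : Enc U. Proof. by exists id. Defined.

#[export] Instance Enc_unit : Enc unit.
Proof. by exists (fun=> L); case; case. Defined.

#[export] Instance Enc_bool : Enc bool.
Proof. by exists ubool; case; case. Defined.

#[export] Instance Enc_prod A B {eA : Enc A} {eB : Enc B} : Enc (A * B).
Proof.
exists (fun p => N (code p.1) (code p.2)).
by move=> [a b] [c d] /= [] /(@code_inj _ eA) -> /(@code_inj _ eB) ->.
Defined.

#[export] Instance Enc_seq A {eA : Enc A} : Enc (seq A).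
Proof.
exists (foldr (fun a u => N (code a) u) L).
by elim=> [|a l IH] [|b m] //= [] /(@code_inj _ eA) -> /IH ->.
Defined.

#[export] Instance Enc_option A {eA : Enc A} : Enc (option A).
Proof.
exists (fun o => if o is Some a then N (code a) L else L).
by case=> [a|] [b|] //= [] /(@code_inj _ eA) ->.
Defined.

Lemma szP A B {eA : Enc A} {eB : Enc B} (a : A) (b : B) :
  sz (a, b) = (sz a + sz b).+1.
Proof. exact: uszN. Qed.

Lemma sz_cons A {eA : Enc A} a (l : seq A) : sz (a :: l) = (sz a + sz l).+1.
Proof. exact: uszN. Qed.

Lemma sz_nil A {eA : Enc A} : sz ([::] : seq A) = 1. Proof. by []. Qed.

Lemma sz_gt0 A {eA : Enc A} (a : A) : 0 < sz a. Proof. exact: usz_gt0. Qed.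

Lemma sz_bool (b : bool) : sz b <= 3. Proof. by case: b. Qed.

Section Basic.
Variables (X A B C : Type).
Context {eX : Enc X} {eA : Enc A} {eB : Enc B} {eC : Enc C}.

Lemma fpc_id : fpc (fun x : X => x). Proof. exact: fpr_id. Qed.

Lemma fpc_comp (f : X -> A) (g : A -> B) : fpc f -> fpc g -> fpc (fun x => g (f x)).
Proof. by move=> hf hg; apply: fpr_comp hf _; exact: fpr_reindex hg. Qed.

Lemma fpc_const (b : B) : fpc (fun x : X => b). Proof. exact: fpr_const. Qed.

Lemma fpc_pair (f : X -> A) (g : X -> B) : fpc f -> fpc g -> fpc (fun x => (f x, g x)).
Proof. exact: fpr_pair. Qed.

Lemma fpc_fst (f : X -> A * B) : fpc f -> fpc (fun x => (f x).1).
Proof. by move=> hf; apply: fpr_comp hf (fpr_fst _). Qed.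

Lemma fpc_snd (f : X -> A * B) : fpc f -> fpc (fun x => (f x).2).
Proof. by move=> hf; apply: fpr_comp hf (fpr_snd _). Qed.

Lemma fpr_eq (i o o' : X -> U) : (forall x, o x = o' x) -> fpr i o -> fpr i o'.
Proof. by move=> /funext ->. Qed.

Lemma eq_fpc (f g : X -> A) : (forall x, f x = g x) -> fpc f -> fpc g.
Proof. by move=> /funext ->. Qed.

Lemma fpc_if (b : X -> bool) (f g : X -> A) : fpc b -> fpc f -> fpc g ->
  fpc (fun x => if b x then f x else g x).
Proof.
move=> hb hf hg; apply: fpr_eq (fpr_cond hb hg hf) => x.
by rewrite /=; case: (b x).
Qed.

Lemma fpc_cons (f : X -> A) (l : X -> seq A) : fpc f -> fpc l ->
  fpc (fun x => f x :: l x).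
Proof. exact: fpr_pair. Qed.

Lemma fpc_behead (l : X -> seq A) : fpc l -> fpc (fun x => behead (l x)).
Proof.
by move=> hl; apply: fpr_eq (fpr_comp hl (fpr_snd _)) => x; case: (l x).
Qed.

Lemma fpc_nilp (l : X -> seq A) : fpc l -> fpc (fun x => nilp (l x)).
Proof.
move=> hl; apply: fpr_eq (fpr_cond hl (fpr_const _ (N L L)) (fpr_const _ L)) => x.
by case: (l x).
Qed.

Lemma fpc_head (d : A) (l : X -> seq A) : fpc l -> fpc (fun x => head d (l x)).
Proof.
move=> hl; apply: fpr_eq (fpr_cond hl (fpr_const _ (code d)) (fpr_comp hl (fpr_fst _))) => x.
by case: (l x).
Qed.

Lemma fpc_Some (f : X -> A) : fpc f -> fpc (fun x => Some (f x)).
Proof. by move=> hf; exact: fpr_pair hf (fpr_const _ L). Qed.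

Lemma fpc_isSome (f : X -> option A) : fpc f -> fpc (fun x => isSome (f x)).
Proof.
move=> hf; apply: fpr_eq (fpr_cond hf (fpr_const _ L) (fpr_const _ (N L L))) => x.
by rewrite /=; case: (f x).
Qed.

Lemma fpc_odflt (d : A) (f : X -> option A) : fpc f -> fpc (fun x => odflt d (f x)).
Proof.
move=> hf; apply: fpr_eq (fpr_cond hf (fpr_const _ (code d)) (fpr_comp hf (fpr_fst _))) => x.
by rewrite /=; case: (f x).
Qed.

Lemma fpc_sz (f : X -> A) : fpc f -> exists k, forall x, sz (f x) <= pb k (sz x).
Proof. by move=> [c [k H]]; exists k => x; case: (H x). Qed.

Lemma fpc_enc (f : X -> A) : fpc f -> fpc (fun x => enc (code (f x))).
Proof. by move=> hf; apply: fpr_comp hf (fpr_flat _). Qed.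

End Basic.

Lemma size_sz A {eA : Enc A} (l : seq A) : size l < sz l.
Proof. by elim: l => //= a l IH; rewrite sz_cons; lia. Qed.

Lemma mem_sz (A : eqType) {eA : Enc A} (l : seq A) a : a \in l -> sz a < sz l.
Proof.
by elim: l => //= b l IH; rewrite inE sz_cons => /orP [/eqP ->|/IH]; lia.
Qed.

Lemma sz_drop A {eA : Enc A} (l : seq A) j : sz (drop j l) <= sz l.
Proof. by elim: l j => [|a l IH] [|j] //=; have := IH j; rewrite sz_cons; lia. Qed.

Lemma sz_take A {eA : Enc A} (l : seq A) j : sz (take j l) <= sz l.
Proof. by elim: l j => [|a l IH] [|j] //=; rewrite ?sz_cons ?sz_nil; have := IH j; lia. Qed.

Lemma sz_cat A {eA : Enc A} (l m : seq A) : sz (l ++ m) < sz l + sz m.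
Proof. by elim: l => [|a l IH] /=; rewrite ?sz_cons ?sz_nil; lia. Qed.

Lemma sz_rev A {eA : Enc A} (l : seq A) : sz (rev l) = sz l.
Proof.
have H : forall m : seq A, sz (catrev l m) + 1 = sz l + sz m.
  by elim: l => [|a l IH] m /=; rewrite ?IH ?sz_cons ?sz_nil; lia.
by have := H [::]; rewrite sz_nil /rev; lia.
Qed.

Lemma ulen_code A {eA : Enc A} (l : seq A) : ulen (code l) = size l.
Proof. by elim: l => //= a l ->. Qed.

Lemma sz_seq_bound A {eA : Enc A} (l : seq A) n : (forall i, i < size l ->
  forall d, sz (nth d l i) <= n) -> sz l <= size l * n.+1 + 1.
Proof.
elim: l => //= a l IH H; rewrite sz_cons.
have := H 0 isT a; have := IH (fun i => H i.+1); rewrite /=; nia.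
Qed.

Section Iteration.
Variables (X A S : Type).
Context {eX : Enc X} {eA : Enc A} {eS : Enc S}.

Lemma fpc_iter (f : S -> S) (s : X -> S) (l : X -> seq A) (p : nat -> nat) :
  fpc f -> fpc s -> fpc l -> pol p ->
  (forall x j, j <= size (l x) -> sz (iter j f (s x)) <= p (sz x)) ->
  fpc (fun x => iter (size (l x)) f (s x)).
Proof.
move=> hf hs hl [k pk] H.
have := @fpr_iter X S code f code (fun x => code (l x)) s k hf hl hs.
move=> W; apply: fpr_eq (W _) => x; first by rewrite ulen_code.
by move=> j; rewrite ulen_code => /H; move=> h; exact: leq_trans h (pk _).
Qed.

End Iteration.

Section Fold.
Variables (X A S : Type).
Context {eX : Enc X} {eA : Enc A} {eS : Enc S}.
Variable f : X -> S -> A -> S.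

Lemma fpc_foldl (s : X -> S) (l : X -> seq A) (p : nat -> nat) :
  fpc (fun q : X * S * A => f q.1.1 q.1.2 q.2) -> fpc s -> fpc l -> pol p ->
  (forall x j, j <= size (l x) -> sz (foldl (f x) (s x) (take j (l x))) <= p (sz x)) ->
  fpc (fun x => foldl (f x) (s x) (l x)).
Proof.
move=> hf hs hl hp H.
(* A default for [head] exists unless the element type is empty, and then all lists are empty. *)
have [[d]|nA] := pselect (inhabited A); last first.
  apply: eq_fpc hs => x; case: (l x) => // a u.
  by case: nA; constructor.
pose step (t : X * seq A * S) := (t.1.1, behead t.1.2,
  if nilp t.1.2 then t.2 else f t.1.1 t.2 (head d t.1.2)).
have E x j : j <= size (l x) -> iter j step (x, l x, s x) =
    (x, drop j (l x), foldl (f x) (s x) (take j (l x))).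
  elim: j => [|j IH] lj; first by rewrite drop0 take0.
  rewrite /= IH ?(ltnW lj) // /step /= (drop_nth d lj) /= ?drop0.
  by rewrite (take_nth d lj) -cats1 foldl_cat.
have [kl Hl] := fpc_sz hl.
apply: (@eq_fpc _ _ _ _ (fun x => (iter (size (l x)) step (x, l x, s x)).2)).
  by move=> x; rewrite E // take_size.
apply: fpc_snd; apply: (fpc_iter (f := step) (s := fun x => (x, l x, s x)) (l := l)
   (p := fun n => n + pb kl n + p n + 2)) => //.
- apply: fpc_pair; first apply: fpc_pair.
  + exact/fpc_fst/fpc_fst/fpc_id.
  + exact/fpc_behead/fpc_snd/fpc_fst/fpc_id.
  + apply: fpc_if; first exact/fpc_nilp/fpc_snd/fpc_fst/fpc_id.
      exact/fpc_snd/fpc_id.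
    apply: (fpc_comp (f := fun t : X * seq A * S => (t.1.1, t.2, head d t.1.2))) hf.
    apply: fpc_pair; first apply: fpc_pair.
    * exact/fpc_fst/fpc_fst/fpc_id.
    * exact/fpc_snd/fpc_id.
    * exact/fpc_head/fpc_snd/fpc_fst/fpc_id.
- by apply: fpc_pair hs; apply: fpc_pair hl; exact: fpc_id.
- by pols.
- move=> x j lj; rewrite E // !szP; cbv beta.
  by pose proof (H x j lj); pose proof (Hl x); pose proof (sz_drop (l x) j); lia.
Qed.

End Fold.

Ltac fp_core := first [ assumption | exact: fpc_id | exact: fpc_const
  | apply: fpc_fst | apply: fpc_snd | apply: fpc_pair | apply: fpc_if
  | apply: fpc_cons | apply: fpc_behead | apply: fpc_nilp | apply: fpc_head
  | apply: fpc_Some | apply: fpc_isSome | apply: fpc_odflt | apply: fpc_enc ].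
Ltac fp_lib := fail.
Ltac fpa := repeat first [ fp_lib | fp_core ].

Section Lists.
Variables (X A B : Type).
Context {eX : Enc X} {eA : Enc A} {eB : Enc B}.

Lemma fpc_catrev (l m : X -> seq A) : fpc l -> fpc m -> fpc (fun x => catrev (l x) (m x)).
Proof.
move=> hl hm; have [kl Hl] := fpc_sz hl; have [km Hm] := fpc_sz hm.
have E (u v : seq A) : foldl (fun s a => a :: s) v u = catrev u v.
  by elim: u v => //= a u IH v.
apply: eq_fpc (fpc_foldl (f := fun _ s a => a :: s) (p := fun n => pb kl n + pb km n) _ hm hl _ _).
- by move=> x; rewrite E.
- by fpa.
- by pols.
- move=> x j lj; rewrite E catrevE.
  pose proof (sz_cat (rev (take j (l x))) (m x)) as H; rewrite sz_rev in H.
  by pose proof (sz_take (l x) j); have := Hl x; have := Hm x; lia.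
Qed.

Lemma fpc_rev (l : X -> seq A) : fpc l -> fpc (fun x => rev (l x)).
Proof. by move=> hl; apply: fpc_catrev => //; exact: fpc_const. Qed.

End Lists.

Section Lists2.
Variables (X A B : Type).
Context {eX : Enc X} {eA : Enc A} {eB : Enc B}.

Lemma fpc_cat (l m : X -> seq A) : fpc l -> fpc m -> fpc (fun x => l x ++ m x).
Proof.
move=> hl hm; apply: eq_fpc (fpc_catrev (fpc_rev hl) hm) => x.
by rewrite catrevE revK.
Qed.

End Lists2.

Section ListMap.
Variables (X A B : Type).
Context {eX : Enc X} {eA : Enc A} {eB : Enc B}.

Lemma fpc_map (F : X -> A -> B) (l : X -> seq A) :
  fpc (fun q : X * A => F q.1 q.2) -> fpc l -> fpc (fun x => [seq F x a | a <- l x]).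
Proof.
move=> hF hl; have [kF HF] := fpc_sz hF; have [kl Hl] := fpc_sz hl.
have E x u v : foldl (fun s a => F x a :: s) v u = catrev [seq F x a | a <- u] v.
  by elim: u v => //= a u IH v.
apply: eq_fpc (fpc_rev (fpc_foldl (f := fun x s a => F x a :: s) (s := fun=> [::])
  (p := fun n => pb kl n * (pb kF (n + pb kl n + 1)).+1 + 1) _ (fpc_const _) hl _ _)).
- by move=> x; rewrite E catrevE cats0 revK.
- apply: fpc_cons; last by fpa.
  by apply: (fpc_comp (f := fun q : X * seq B * A => (q.1.1, q.2))) hF; fpa.
- by pols; apply: pol_leq (pol_add (pol_comp kF (pol_add (pol_add pol_id (pol_pb kl)) (pol_const 1))) (pol_const 1)) => n; lia.
- move=> x j lj; rewrite E catrevE cats0 sz_rev.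
  set m := [seq _ | _ <- _].
  have lm : size m <= pb kl (sz x).
    by rewrite size_map size_take; pose proof (size_sz (l x)); have := Hl x; case: ifP; lia.
  apply: leq_trans (@sz_seq_bound _ _ m (pb kF (sz x + pb kl (sz x) + 1)) _) _; last first.
    by rewrite leq_add2r leq_mul2r lm orbT.
  move=> i im d; rewrite /m; move: im; rewrite /m size_map => im.
  case El : (l x) (lj) (im) => [|a0 l']; first by [].
  rewrite -El => _ _; rewrite (nth_map a0) // .
  apply: leq_trans (HF (x, _)) (pb_mono _ _); rewrite szP.
  have := Hl x.
  have h1 : sz (take j (l x)) <= sz (l x) by exact: sz_take.
  have h2 : sz (nth a0 (take j (l x)) i) < sz (take j (l x)).
    elim: (take _ _) i im {lm h1} => //= b u IH [|i] im; rewrite sz_cons /=; first by lia.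
    by have := IH i im; lia.
  lia.
Qed.

Lemma fpc_flatten (l : X -> seq (seq A)) : fpc l -> fpc (fun x => flatten (l x)).
Proof.
move=> hl; have [kl Hl] := fpc_sz hl.
have E (u : seq (seq A)) (v : seq A) : foldl (fun s a => s ++ a) v u = v ++ flatten u.
  by elim: u v => [|a u IH] v /=; rewrite ?cats0 ?IH ?catA.
apply: eq_fpc (fpc_foldl (f := fun _ s a => s ++ a) (s := fun=> [::]) (p := pb kl) _ (fpc_const _) hl _ _).
- by move=> x; rewrite E.
- by apply: fpc_cat; fpa.
- by pols.
- move=> x j lj; rewrite E /=.
  have : sz (take j (l x)) <= pb kl (sz x) by apply: leq_trans (sz_take _ _) (Hl x).
  have : sz (flatten (take j (l x))) <= sz (take j (l x)).
    elim: (take _ _) => //= a u IH; rewrite sz_cons; pose proof (sz_cat a (flatten u)); lia.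
  lia.
Qed.

End ListMap.

Section Lists3.
Variables (X A B : Type).
Context {eX : Enc X} {eA : Enc A} {eB : Enc B}.

Lemma fpc_flatmap (F : X -> A -> seq B) (l : X -> seq A) :
  fpc (fun q : X * A => F q.1 q.2) -> fpc l ->
  fpc (fun x => flatten [seq F x a | a <- l x]).
Proof. by move=> hF hl; apply/fpc_flatten/fpc_map. Qed.

End Lists3.

Section ListFilter.
Variables (X A : Type).
Context {eX : Enc X} {eA : Enc A}.

Lemma fpc_filter (P : X -> A -> bool) (l : X -> seq A) :
  fpc (fun q : X * A => P q.1 q.2) -> fpc l -> fpc (fun x => [seq a <- l x | P x a]).
Proof.
move=> hP hl.
apply: eq_fpc (fpc_flatmap (F := fun x a => if P x a then [:: a] else [::]) _ hl).
  by move=> x; elim: (l x) => //= a u ->; case: ifP.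
by fpa.
Qed.

End ListFilter.

Section Lists4.
Variables (X A B : Type).
Context {eX : Enc X} {eA : Enc A} {eB : Enc B}.

Lemma fpc_foldlb (f : X -> bool -> A -> bool) (s : X -> bool) (l : X -> seq A) :
  fpc (fun q : X * bool * A => f q.1.1 q.1.2 q.2) -> fpc s -> fpc l ->
  fpc (fun x => foldl (f x) (s x) (l x)).
Proof.
move=> hf hs hl; apply: (fpc_foldl (p := fun=> 3)) => //; first by pols.
by move=> *; exact: sz_bool.
Qed.

Lemma fpc_all (P : X -> A -> bool) (l : X -> seq A) :
  fpc (fun q : X * A => P q.1 q.2) -> fpc l -> fpc (fun x => all (P x) (l x)).
Proof.
move=> hP hl.
apply: eq_fpc (fpc_foldlb (f := fun x b a => if b then P x a else false) (s := fun=> true) _ _ hl).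
- move=> x; rewrite -[RHS]andTb; elim: (l x) true => [|a u IH] b /=; rewrite ?andbT // IH.
  by case: b.
- fpa; apply: (fpc_comp (f := fun q : X * bool * A => (q.1.1, q.2))) hP; fpa.
- by fpa.
Qed.

Lemma fpc_has (P : X -> A -> bool) (l : X -> seq A) :
  fpc (fun q : X * A => P q.1 q.2) -> fpc l -> fpc (fun x => has (P x) (l x)).
Proof.
move=> hP hl.
apply: eq_fpc (fpc_foldlb (f := fun x b a => if b then true else P x a) (s := fun=> false) _ _ hl).
- move=> x; rewrite -[RHS]orFb; elim: (l x) false => [|a u IH] b /=; rewrite ?orbF // IH.
  by case: b.
- fpa; apply: (fpc_comp (f := fun q : X * bool * A => (q.1.1, q.2))) hP; fpa.
- by fpa.
Qed.

End Lists4.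

Lemma fpc_negb X {eX : Enc X} (b : X -> bool) : fpc b -> fpc (fun x => ~~ b x).
Proof.
move=> hb; apply: eq_fpc (fpc_if hb (fpc_const false) (fpc_const true)) => x.
by case: (b x).
Qed.

Lemma fpc_andb X {eX : Enc X} (b c : X -> bool) : fpc b -> fpc c -> fpc (fun x => b x && c x).
Proof.
move=> hb hc; apply: eq_fpc (fpc_if hb hc (fpc_const false)) => x.
by case: (b x).
Qed.

Lemma fpc_orb X {eX : Enc X} (b c : X -> bool) : fpc b -> fpc c -> fpc (fun x => b x || c x).
Proof.
move=> hb hc; apply: eq_fpc (fpc_if hb (fpc_const true) hc) => x.
by case: (b x).
Qed.

Lemma fpc_eqb X {eX : Enc X} (b c : X -> bool) : fpc b -> fpc c -> fpc (fun x => b x == c x).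
Proof.
move=> hb hc; apply: eq_fpc (fpc_if hb hc (fpc_negb hc)) => x.
by case: (b x); case: (c x).
Qed.

Section Equality.
Variables (X : Type).
Context {eX : Enc X}.

Lemma fpc_eqbits (l m : X -> seq bool) : fpc l -> fpc m -> fpc (fun x => l x == m x).
Proof.
move=> hl hm; have [km Hm] := fpc_sz hm.
pose f (s : bool * seq bool) (b : bool) :=
  (s.1 && (~~ nilp s.2 && (head true s.2 == b)), behead s.2).
have E u s : foldl f s u = (s.1 && (take (size u) s.2 == u), drop (size u) s.2).
  elim: u s => [|a u IH] [c v] /=; first by rewrite take0 drop0 andbT.
  by rewrite IH; case: c; case: v => [|d v] //=; rewrite ?eqseq_cons.
apply: (@eq_fpc _ _ _ _ (fun x => (foldl f (true, m x) (l x)).1 && nilp (foldl f (true, m x) (l x)).2)).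
  move=> x; rewrite E /= /nilp size_drop subn_eq0.
  apply/andP/eqP => [[/eqP e h]|->]; last by rewrite take_size eqxx.
  by rewrite -e take_oversize.
have hf : fpc (fun x => foldl f (true, m x) (l x)).
  apply: (fpc_foldl (f := fun _ => f) (p := fun n => pb km n + 4)) => //.
  - by fpa; repeat (first [apply: fpc_andb|apply: fpc_negb|apply: fpc_eqb]; fpa).
  - by fpa.
  - by pols.
  - move=> x j lj; rewrite E szP.
    apply: (@leq_trans (3 + sz (m x)).+1); last by have := Hm x; lia.
    by rewrite ltnS; apply: leq_add; [exact: sz_bool|exact: sz_drop].
by apply: fpc_andb; fpa.
Qed.

End Equality.

Section Equality2.
Variables (X : Type).
Context {eX : Enc X}.

Lemma fpc_eq (A : eqType) {eA : Enc A} (f g : X -> A) : fpc f -> fpc g ->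
  fpc (fun x => f x == g x).
Proof.
move=> hf hg; apply: eq_fpc (fpc_eqbits (fpc_enc hf) (fpc_enc hg)) => x.
by apply/eqP/eqP => [/enc_inj /(@code_inj _ eA)|->].
Qed.

End Equality2.

Section Equality3.
Variables (X : Type).
Context {eX : Enc X}.

Lemma fpc_mem (A : eqType) {eA : Enc A} (f : X -> A) (l : X -> seq A) : fpc f -> fpc l ->
  fpc (fun x => f x \in l x).
Proof.
move=> hf hl; apply: (@eq_fpc _ _ _ _ (fun x => has (fun a => f x == a) (l x))).
  by move=> x; rewrite -has_pred1; apply: eq_has => a /=; rewrite eq_sym.
apply: fpc_has => //; apply: fpc_eq; fpa.
by apply: (fpc_comp (f := fst)) hf; fpa.
Qed.

End Equality3.

Ltac fp_lib ::= first [ apply: fpc_negb | apply: fpc_andb | apply: fpc_orb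
  | apply: fpc_eq | apply: fpc_mem
  | apply: fpc_rev | apply: fpc_cat | apply: fpc_map | apply: fpc_flatten
  | apply: fpc_filter | apply: fpc_all | apply: fpc_has ].

End EncodedFunctions.
Import EncodedFunctions.

(** * Binary arithmetic in polynomial time *)

Module BinaryArithmetic.

Ltac fp_lib ::= first [ apply: fpc_negb | apply: fpc_andb | apply: fpc_orb
  | apply: fpc_eq | apply: fpc_mem
  | apply: fpc_rev | apply: fpc_cat | apply: fpc_map | apply: fpc_flatten
  | apply: fpc_filter | apply: fpc_all | apply: fpc_has ].
Ltac fpa ::= repeat (cbv beta; first [ apply: fpc_nilp | fp_lib | fp_core ]).

Definition bval (l : seq bool) : nat := foldr (fun (b : bool) v => b + v.*2) 0 l.

Fixpoint nbits_rec (fuel n : nat) : seq bool :=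
  if fuel is f.+1 then if n == 0 then [::] else odd n :: nbits_rec f n./2 else [::].

Definition nbits n := nbits_rec n n.

Lemma nbits_recE f n : n <= f -> nbits_rec f n = nbits n.
Proof.
move=> nf; rewrite /nbits.
have H k j m : m <= k -> m <= j -> nbits_rec k m = nbits_rec j m.
  elim: k j m => [|k IH] [|j] [|m] //= mk mj; congr (_ :: _).
  apply: IH; have := odd_double_half m; rewrite uphalf_half -addnn; case: (odd m); lia.
exact: H.
Qed.

Lemma nbitsE n : nbits n = if n == 0 then [::] else odd n :: nbits n./2.
Proof.
case: n => // n; rewrite {1}/nbits /= nbits_recE //.
by rewrite uphalf_half; have := odd_double_half n; rewrite -addnn; case: (odd n); lia.
Qed.

Lemma nat_half_ind (P : nat -> Prop) : P 0 -> (forall n, 0 < n -> P n./2 -> P n) -> forall n, P n.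
Proof.
move=> P0 IH n; elim: n {-2}n (leqnn n) => [|m IHm] n; first by rewrite leqn0 => /eqP ->.
case: n => // n lm; apply: IH => //; apply: IHm.
by have := odd_double_half n.+1; rewrite -addnn; lia.
Qed.

Lemma bval_nbits n : bval (nbits n) = n.
Proof.
elim/nat_half_ind: n => // n n0 IH; rewrite nbitsE gtn_eqF //= IH.
exact: odd_double_half.
Qed.

(** With canonical binary digits the size of a code is proportional to the bit length, so polynomial
    bounds on sizes are bounds on bit lengths. *)
#[export] Instance Enc_nat : Enc nat.
Proof.
exists (fun n => ubits (nbits n)) => m n e.
have := @code_inj _ (@Enc_seq _ Enc_bool) (nbits m) (nbits n) e => /(congr1 bval).
by rewrite !bval_nbits.
Defined.

Lemma size_nbits_leq n k : n < 2 ^ k -> size (nbits n) <= k.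
Proof.
elim/nat_half_ind: n k => // n n0 IH [|k]; first by rewrite expn0; lia.
rewrite nbitsE gtn_eqF //= ltnS expnS => h; apply: IH.
by have := odd_double_half n; rewrite -addnn; lia.
Qed.

Lemma bval_lt l : bval l < 2 ^ size l.
Proof. by elim: l => //= b l IH; rewrite expnS -addnn; case: b => /=; lia. Qed.

Lemma lt_nbits n : n < 2 ^ size (nbits n).
Proof. by rewrite -{1}(bval_nbits n) bval_lt. Qed.

Lemma sz_bits (l : seq bool) : sz l <= 4 * size l + 1.
Proof. exact: usz_ubits. Qed.

Lemma sz_nat_leq (n k : nat) : n < 2 ^ k -> sz n <= 4 * k + 1.
Proof. by move=> /size_nbits_leq h; apply: leq_trans (sz_bits _) _; lia. Qed.

Lemma lt_sz (n : nat) : n < 2 ^ sz n.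
Proof.
apply: leq_trans (lt_nbits n) _; rewrite leq_exp2l //.
exact/ltnW/(size_sz (nbits n)).
Qed.

Lemma fpc_nbits X {eX : Enc X} (f : X -> nat) : fpc f -> fpc (fun x => nbits (f x)).
Proof. by []. Qed.

(** Removes the zeros at the most significant end: only a list without them is the code of a
    number. *)
Definition bnorm (l : seq bool) : seq bool :=
  foldl (fun s b => if nilp s && ~~ b then [::] else b :: s) [::] (rev l).

Lemma bnormE l : bnorm l = nbits (bval l).
Proof.
rewrite /bnorm foldl_rev; elim: l => //= b l ->.
rewrite [RHS]nbitsE; case: b => /=; rewrite ?add0n ?add1n.
  by rewrite andbF /= odd_double uphalf_double.
rewrite andbT double_eq0 odd_double doubleK.
case: (bval l =P 0) => [->|/eqP] //=.
by rewrite [nbits _]nbitsE => /negbTE -> /=.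
Qed.

Lemma fpc_bval X {eX : Enc X} (l : X -> seq bool) : fpc l -> fpc (fun x => bval (l x)).
Proof.
move=> hl; have [k Hk] := fpc_sz hl.
have : fpc (fun x => bnorm (l x)).
  apply: (fpc_foldl (f := fun _ s b => if nilp s && ~~ b then [::] else b :: s)
    (p := fun n => 4 * pb k n + 1)); [fpa|by fpa|by fpa|by pols|].
  move=> x j lj; apply: leq_trans (sz_bits _) _.
  rewrite leq_add2r leq_mul2l /=.
  apply: leq_trans (_ : size (take j (rev (l x))) <= _); last first.
    rewrite size_take size_rev; have := Hk x; pose proof (size_sz (l x)).
    by case: ifP; rewrite size_rev in lj; lia.
  set f := (fun _ _ => _).
  have B u s : size (foldl f s u) <= size s + size u.
    elim: u s => [|b u IH] s /=; first by rewrite addn0.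
    by apply: leq_trans (IH _) _; rewrite /f; case: ifP => _ /=; lia.
  exact: B.
by apply: fpr_eq => x; rewrite /= bnormE.
Qed.

(** One position of a ripple-carry adder; the digits of the sum accumulate in reverse order. *)
Definition rstep (s : seq bool * seq bool * bool * seq bool) :=
  let a := head false s.1.1.1 in let b := head false s.1.1.2 in
  let c := s.1.2 in
  (behead s.1.1.1, behead s.1.1.2, (a && b) || (c && (a || b)), (a (+) (b (+) c)) :: s.2).

Lemma rstep_iter k l m c :
  let t := iter k rstep (l, m, c, [::]) in
  [/\ bval (rev t.2) + 2 ^ k * (t.1.2 + bval t.1.1.1 + bval t.1.1.2) =
      c + bval l + bval m,
      t.1.1.1 = drop k l, t.1.1.2 = drop k m & size t.2 = k].
Proof.
elim: k => [|k]; first by rewrite /= !drop0 expn0; split=> //; lia.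
rewrite iterS; move: (iter k _ _) => [[[l' m'] c'] acc] /= [IH el em ea].
have bvr u b : bval (rev (b :: u)) = bval (rev u) + 2 ^ size u * b.
  rewrite rev_cons -(size_rev u); elim: (rev u) => [|x v IHv] /=; first by rewrite expn0; case: b.
  by rewrite IHv expnS -!addnn; case: x; lia.
have bvd u : bval u = head false u + 2 * bval (behead u).
  by case: u => //= b u; rewrite mul2n.
split; last by rewrite ea.
- rewrite bvr ea -IH expnS [bval l']bvd [bval m']bvd.
  by case: (head false l') (head false m') (c') => [] [] [] /=; lia.
- by rewrite el -drop1 drop_drop add1n.
- by rewrite em -drop1 drop_drop add1n.
Qed.

Lemma fpc_ripple X {eX : Enc X} (l m : X -> seq bool) (c : X -> bool) A {eA : Enc A}
    (n : X -> seq A) : fpc l -> fpc m -> fpc c -> fpc n ->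
  fpc (fun x => iter (size (n x)) rstep (l x, m x, c x, [::])).
Proof.
move=> hl hm hc hn.
have [kl Hl] := fpc_sz hl; have [km Hm] := fpc_sz hm; have [kn Hn] := fpc_sz hn.
apply: (fpc_iter (p := fun n => pb kl n + pb km n + 4 * pb kn n + 10)) => //.
- have hh (q : seq bool * seq bool * bool * seq bool -> seq bool) : fpc q -> fpc (fun s => head false (q s)).
    by move=> hq; fpa.
  have h1 := hh _ (fpc_fst (fpc_fst (fpc_fst (fpc_id (X := seq bool * seq bool * bool * seq bool))))).
  have h2 := hh _ (fpc_snd (fpc_fst (fpc_fst (fpc_id (X := seq bool * seq bool * bool * seq bool))))).
  have hx (a b : seq bool * seq bool * bool * seq bool -> bool) : fpc a -> fpc b -> fpc (fun s => a s (+) b s).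
    move=> ha hb; apply: eq_fpc (fpc_if ha (fpc_negb hb) hb) => s.
    by case: (a s).
  rewrite /rstep; apply: fpc_pair; first (apply: fpc_pair; first by fpa).
    by fpa.
  by apply: fpc_cons; [apply: (hx); [|apply: (hx)]; fpa|fpa].
- by fpa.
- by pols.
- move=> x j lj; have [] := rstep_iter j (l x) (m x) (c x).
  case: (iter _ _ _) => [[[l' m'] c'] acc] /= _ -> -> ea; rewrite !szP.
  pose proof (sz_drop (l x) j); pose proof (sz_drop (m x) j); pose proof (sz_bool c').
  pose proof (sz_bits acc); pose proof (size_sz (n x)).
  by have := Hl x; have := Hm x; have := Hn x; lia.
Qed.

Lemma fpc_addn X {eX : Enc X} (f g : X -> nat) : fpc f -> fpc g -> fpc (fun x => f x + g x).
Proof.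
move=> hf hg.
pose n x := true :: nbits (f x) ++ nbits (g x).
have hn : fpc n by apply: fpc_cons; [fpa|apply: fpc_cat; exact: fpc_nbits].
have := fpc_ripple (fpc_nbits hf) (fpc_nbits hg) (fpc_const false) hn.
move=> /fpc_snd /fpc_rev /fpc_bval; apply: eq_fpc => x.
have [] := rstep_iter (size (n x)) (nbits (f x)) (nbits (g x)) false.
case: (iter _ _ _) => [[[l' m'] c'] acc] /= e el em _; move: e; rewrite el em.
rewrite !bval_nbits !drop_oversize /n /= ?size_cat; try lia.
have h1 := lt_nbits (f x); have h2 := lt_nbits (g x).
have := @leq_pexp2l 2 _ _ isT (leq_addr (size (nbits (g x))) (size (nbits (f x)))).
have := @leq_pexp2l 2 _ _ isT (leq_addl (size (nbits (f x))) (size (nbits (g x)))).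
by rewrite expnS; case: c' => /=; lia.
Qed.

(** Subtraction in two's complement: the digits of [m] are inverted and padded with ones, and the
    incoming carry is one. The outgoing carry is then the comparison of [m] with [n]. *)
Definition bsub (n m : nat) :=
  let m' := [seq ~~ b | b <- nbits m] ++ [seq true | b <- nbits n] in
  iter (size m') rstep (nbits n, m', true, [::]).

Lemma bsubE n m : (bsub n m).1.2 = (m <= n) /\
  (m <= n -> bval (rev (bsub n m).2) = n - m).
Proof.
rewrite /bsub; set m' := _ ++ _.
have bm : bval m' + m + 1 = 2 ^ size m'.
  rewrite /m' -{2}(bval_nbits m); elim: (nbits m) => [|b u IH] /=.
    by elim: (nbits n) => //= b u; rewrite expnS -addnn; lia.
  by rewrite expnS -!addnn; case: b => /=; lia.
have nm : n < 2 ^ size m'.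
  apply: leq_trans (lt_nbits n) _; rewrite leq_exp2l // size_cat !size_map; lia.
have [] := rstep_iter (size m') (nbits n) m' true.
case: (iter _ _ _) => [[[l' m''] c'] acc] /= e el em sa; move: e; rewrite el em.
have := bval_lt (rev acc); rewrite size_rev sa bval_nbits.
rewrite !drop_oversize //; last by rewrite size_cat !size_map; lia.
by case: c' => /=; rewrite ?addn0 ?muln0 ?muln1 => *; split; lia.
Qed.

Lemma fpc_bsub X {eX : Enc X} (f g : X -> nat) : fpc f -> fpc g -> fpc (fun x => bsub (f x) (g x)).
Proof.
move=> hf hg.
have hm : fpc (fun x => [seq ~~ b | b <- nbits (g x)] ++ [seq true | b <- nbits (f x)]).
  by apply: fpc_cat; apply: fpc_map; [fpa|exact: fpc_nbits|fpa|exact: fpc_nbits].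
exact: (fpc_ripple (fpc_nbits hf) hm (fpc_const true) hm).
Qed.

Lemma fpc_leq X {eX : Enc X} (f g : X -> nat) : fpc f -> fpc g -> fpc (fun x => f x <= g x).
Proof.
move=> hf hg; have := fpc_bsub hg hf => /fpc_fst /fpc_snd; apply: eq_fpc => x.
by have [] := bsubE (g x) (f x).
Qed.

Lemma fpc_subn X {eX : Enc X} (f g : X -> nat) : fpc f -> fpc g -> fpc (fun x => f x - g x).
Proof.
move=> hf hg; have h := fpc_bsub hf hg.
apply: (eq_fpc (f := fun x => if g x <= f x then bval (rev (bsub (f x) (g x)).2) else 0)).
  by move=> x; case: leqP => [l|]; [have [_ ->] := bsubE (f x) (g x)|lia].
by apply: fpc_if; [exact: fpc_leq|exact/fpc_bval/fpc_rev/fpc_snd|fpa].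
Qed.

Lemma fpc_succn X {eX : Enc X} (f : X -> nat) : fpc f -> fpc (fun x => (f x).+1).
Proof. by move=> hf; apply: eq_fpc (fpc_addn hf (fpc_const 1)) => x; rewrite addn1. Qed.

Definition hbits (n : nat) := rev (nbits n).

Definition hval (l : seq bool) := foldl (fun a (b : bool) => a + a + b) 0 l.

Lemma hval_rcons l b : hval (rcons l b) = hval l + hval l + b.
Proof. by rewrite /hval -cats1 foldl_cat. Qed.

Lemma hval_lt l : hval l < 2 ^ size l.
Proof.
elim/last_ind: l => // l b IH; rewrite hval_rcons size_rcons expnS.
by case: b => /=; lia.
Qed.

Lemma hval_hbits n : hval (hbits n) = n.
Proof.
rewrite -{2}(bval_nbits n) /hbits /hval foldl_rev.
by elim: (nbits n) => //= b u ->; rewrite -addnn addnC.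
Qed.

Lemma fpc_hbits X {eX : Enc X} (f : X -> nat) : fpc f -> fpc (fun x => hbits (f x)).
Proof. by move=> hf; apply: fpc_rev; exact: fpc_nbits. Qed.

Lemma size_hbits_sz (n : nat) : size (hbits n) <= sz n.
Proof. by rewrite size_rev; exact/ltnW/(size_sz (nbits n)). Qed.

Lemma fpc_muln X {eX : Enc X} (f g : X -> nat) : fpc f -> fpc g -> fpc (fun x => f x * g x).
Proof.
move=> hf hg; have [kf Hf] := fpc_sz hf; have [kg Hg] := fpc_sz hg.
have E n l : foldl (fun a (b : bool) => a + a + (if b then n else 0)) 0 l = hval l * n.
  elim/last_ind: l => // l b IH; rewrite -cats1 foldl_cat IH cats1 hval_rcons /=.
  by case: b => /=; lia.
apply: (eq_fpc (f := fun x => foldl (fun a (b : bool) => a + a + (if b then g x else 0)) 0 (hbits (f x)))).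
  by move=> x; rewrite E hval_hbits.
apply: (fpc_foldl (f := fun x a (b : bool) => a + a + (if b then g x else 0))
  (p := fun n => 4 * (pb kf n + pb kg n) + 1)).
- apply: fpc_addn; first by apply: fpc_addn; fpa.
  apply: fpc_if; [by fpa| |by fpa].
  by apply: (fpc_comp (f := fun q : X * nat * bool => q.1.1)) hg; fpa.
- by fpa.
- exact: fpc_hbits.
- by pols.
- move=> x j lj; rewrite E; apply: sz_nat_leq.
  apply: leq_trans (_ : 2 ^ size (take j (hbits (f x))) * 2 ^ sz (g x) <= _).
    have := hval_lt (take j (hbits (f x))); have := lt_sz (g x); nia.
  rewrite -expnD leq_exp2l //; apply: leq_add; last exact: Hg.
  rewrite size_take; have := size_hbits_sz (f x); have := Hf x; case: ifP; lia.
Qed.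

Lemma fpc_edivn X {eX : Enc X} (f g : X -> nat) : fpc f -> fpc g ->
  fpc (fun x => edivn (f x) (g x)).
Proof.
move=> hf hg; have [kf Hf] := fpc_sz hf; have [kg Hg] := fpc_sz hg.
(* Long division from the most significant digit, with the current quotient and remainder as
   state. *)
pose st d (s : nat * nat) (b : bool) : nat * nat :=
  let r := s.2 + s.2 + b in let q := s.1 + s.1 in
  if d <= r then (q.+1, r - d) else (q, r).
have E d l : 0 < d -> foldl (st d) (0, 0) l = edivn (hval l) d.
  move=> d0; elim/last_ind: l => [|l b IH]; first by rewrite edivn_def div0n mod0n.
  rewrite -cats1 foldl_cat IH cats1 hval_rcons /= /st edivn_def /=.
  have e := divn_eq (hval l) d; have lt := ltn_pmod (hval l) d0.
  set q := hval l %/ d in e *; set r := hval l %% d in e lt *.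
  case: leqP => h.
    have -> : hval l + hval l + b = (q + q).+1 * d + (r + r + b - d) by case: b h => /=; lia.
    by rewrite edivn_eq //; case: b h => /=; lia.
  have -> : hval l + hval l + b = (q + q) * d + (r + r + b) by lia.
  by rewrite edivn_eq.
apply: (eq_fpc (f := fun x => if g x == 0 then (0, f x) else foldl (st (g x)) (0, 0) (hbits (f x)))).
  by move=> x; case: posnP => [->|d0] //; rewrite E // hval_hbits.
apply: fpc_if; [by fpa|by fpa|].
apply: (fpc_foldl (f := fun x => st (g x)) (p := fun n => 8 * pb kf n + 10)).
- have hg1 : fpc (fun q : X * (nat * nat) * bool => g q.1.1).
    by apply: (fpc_comp (f := fun q : X * (nat * nat) * bool => q.1.1)) hg; fpa.
  have hr : fpc (fun q : X * (nat * nat) * bool => q.1.2.2 + q.1.2.2 + q.2).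
    apply: fpc_addn; first by apply: fpc_addn; fpa.
    by apply: (eq_fpc (f := fun q : X * (nat * nat) * bool => if q.2 then 1 else 0)); [case=> ? []|fpa].
  have hq : fpc (fun q : X * (nat * nat) * bool => q.1.2.1 + q.1.2.1) by apply: fpc_addn; fpa.
  apply: fpc_if; first exact: fpc_leq.
    by apply: fpc_pair; [exact: fpc_succn|exact: fpc_subn].
  exact: fpc_pair.
- by fpa.
- exact: fpc_hbits.
- by pols.
- move=> x j lj.
  have B l : (foldl (st (g x)) (0, 0) l).1 < 2 ^ size l /\ (foldl (st (g x)) (0, 0) l).2 < 2 ^ size l.
    elim/last_ind: l => // l b; rewrite -cats1 foldl_cat size_cat addn1 expnS /=.
    by case: (foldl _ _ _) => q r /= [h1 h2]; rewrite /st /=; case: ifP => _ /=; case: b => /=; lia.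
  have := B (take j (hbits (f x))); case: (foldl _ _ _) => q r /= [h1 h2]; rewrite szP.
  have := sz_nat_leq h1; have := sz_nat_leq h2.
  have : size (take j (hbits (f x))) <= pb kf (sz x).
    by rewrite size_take; have := size_hbits_sz (f x); have := Hf x; case: ifP; lia.
  lia.
Qed.

Lemma fpc_divn X {eX : Enc X} (f g : X -> nat) : fpc f -> fpc g -> fpc (fun x => f x %/ g x).
Proof. by move=> hf hg; exact: fpc_fst (fpc_edivn hf hg). Qed.

Lemma fpc_modn X {eX : Enc X} (f g : X -> nat) : fpc f -> fpc g -> fpc (fun x => f x %% g x).
Proof.
move=> hf hg; apply: eq_fpc (fpc_snd (fpc_edivn hf hg)) => x.
by rewrite edivn_def.
Qed.

Definition zmk (b : bool) (n : nat) : int := if b then (- Posz n)%R else Posz n.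

Lemma zmkE (z : int) : z = zmk (z < 0)%R `|z|%N.
Proof. by case: z. Qed.

#[export] Instance Enc_int : Enc int.
Proof.
exists (fun z : int => code (z < 0, `|z|%N)%R) => m n e.
have [] := @code_inj _ (@Enc_prod _ _ Enc_bool Enc_nat) _ _ e.
by move=> h1 h2; rewrite (zmkE m) (zmkE n) h1 h2.
Defined.

Lemma fpc_zmk X {eX : Enc X} (b : X -> bool) (n : X -> nat) : fpc b -> fpc n ->
  fpc (fun x => zmk (b x) (n x)).
Proof.
(* The code of an integer contains the sign of its value, so the sign bit of a zero has to be
   cleared. *)
move=> hb hn; have : fpc (fun x => (b x && (n x != 0), n x)) by fpa.
by apply: fpr_eq => x; rewrite /code /=; case: (b x) => //=; case: (n x).
Qed.

Lemma fpc_sgz X {eX : Enc X} (f : X -> int) : fpc f -> fpc (fun x => f x < 0)%R.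
Proof. by move=> hf; apply: fpr_comp hf (fpr_fst _). Qed.

Lemma fpc_absz X {eX : Enc X} (f : X -> int) : fpc f -> fpc (fun x => `|f x|%N).
Proof. by move=> hf; apply: fpr_comp hf (fpr_snd _). Qed.

Lemma fpc_Posz X {eX : Enc X} (f : X -> nat) : fpc f -> fpc (fun x => Posz (f x)).
Proof. by move=> hf; apply: eq_fpc (fpc_zmk (fpc_const false) hf). Qed.

Lemma fpc_oppz X {eX : Enc X} (f : X -> int) : fpc f -> fpc (fun x => - f x)%R.
Proof.
move=> hf; apply: eq_fpc (fpc_zmk (fpc_negb (fpc_sgz hf)) (fpc_absz hf)) => x.
by rewrite /zmk; case: (f x) => n /=; lia.
Qed.

Lemma fpc_addz X {eX : Enc X} (f g : X -> int) : fpc f -> fpc g -> fpc (fun x => f x + g x)%R.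
Proof.
move=> hf hg; have sf := fpc_sgz hf; have sg := fpc_sgz hg.
have af := fpc_absz hf; have ag := fpc_absz hg.
apply: (eq_fpc (f := fun x => if (f x < 0)%R == (g x < 0)%R then zmk (f x < 0)%R (`|f x| + `|g x|)%N
  else if (`|g x| <= `|f x|)%N then zmk (f x < 0)%R (`|f x| - `|g x|)%N
  else zmk (g x < 0)%R (`|g x| - `|f x|)%N)).
  by move=> x; rewrite /zmk; case: (f x) (g x) => m [] n /=; try case: leqP; lia.
apply: fpc_if; [by fpa|by apply: fpc_zmk => //; exact: fpc_addn|].
by apply: fpc_if; [exact: fpc_leq|apply: fpc_zmk => //; exact: fpc_subn|apply: fpc_zmk => //; exact: fpc_subn].
Qed.

Lemma fpc_mulz X {eX : Enc X} (f g : X -> int) : fpc f -> fpc g -> fpc (fun x => f x * g x)%R.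
Proof.
move=> hf hg; have sf := fpc_sgz hf; have sg := fpc_sgz hg.
have af := fpc_absz hf; have ag := fpc_absz hg.
apply: (eq_fpc (f := fun x => zmk (~~ ((f x < 0)%R == (g x < 0)%R)) (`|f x| * `|g x|)%N)).
  by move=> x; rewrite /zmk; case: (f x) (g x) => m [] n /=; nia.
by apply: fpc_zmk; [fpa|exact: fpc_muln].
Qed.

Lemma fpc_lez X {eX : Enc X} (f g : X -> int) : fpc f -> fpc g -> fpc (fun x => f x <= g x)%R.
Proof.
move=> hf hg; apply: eq_fpc (fpc_negb (fpc_sgz (fpc_addz hg (fpc_oppz hf)))) => x.
by apply/idP/idP; lia.
Qed.

(** Rounds towards zero; the solver relies on it only for exact quotients, through [zdivK]. *)
Definition zdiv (a d : int) : int := zmk (~~ ((a < 0)%R == (d < 0)%R)) (`|a| %/ `|d|)%N.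

Lemma fpc_zdiv X {eX : Enc X} (f g : X -> int) : fpc f -> fpc g -> fpc (fun x => zdiv (f x) (g x)).
Proof.
move=> hf hg; apply: fpc_zmk; last by apply: fpc_divn; exact: fpc_absz.
by apply: fpc_negb; apply: fpc_eq; exact: fpc_sgz.
Qed.

Lemma zdivK (a d : int) : (d != 0 -> zdiv (a * d) d = a)%R.
Proof.
rewrite /zdiv /zmk => d0.
rewrite abszM mulnK; last by rewrite absz_gt0.
case: d d0 a => [[|d]|d] // _ [[|a]|a] //=; try (rewrite ?mul0r /=; lia); case: eqP; nia.
Qed.

Lemma sz_int_leq (z : int) k : (`|z| < 2 ^ k)%N -> sz z <= 4 * k + 5.
Proof.
move=> /sz_nat_leq h; have -> : sz z = sz ((z < 0)%R, `|z|%N) by [].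
rewrite szP; pose proof (sz_bool (z < 0)%R); lia.
Qed.

Lemma lt_sz_int (z : int) : (`|z| < 2 ^ sz z)%N.
Proof.
apply: leq_trans (lt_sz _) _; rewrite leq_exp2l //.
have -> : sz z = sz ((z < 0)%R, `|z|%N) by []; rewrite szP; lia.
Qed.

Definition sumz (l : seq int) : int := (\sum_(z <- l) z)%R.

Lemma sumz_bound (l : seq int) : (`|sumz l| < 2 ^ sz l)%N.
Proof.
rewrite /sumz; elim: l => [|z l IH]; first by rewrite big_nil.
rewrite big_cons sz_cons expnS.
have h := lt_sz_int z.
have e1 : (2 ^ sz z <= 2 ^ (sz z + sz l))%N by rewrite leq_exp2l // leq_addr.
have e2 : (2 ^ sz l <= 2 ^ (sz z + sz l))%N by rewrite leq_exp2l // leq_addl.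
move: IH; move: (\sum_(i <- l) i)%R => S IH; lia.
Qed.

Lemma fpc_sumz X {eX : Enc X} (l : X -> seq int) : fpc l -> fpc (fun x => sumz (l x)).
Proof.
move=> hl; have [k Hk] := fpc_sz hl.
have E0 (u : seq int) (a : int) : foldl +%R a u = (a + sumz u)%R.
  rewrite /sumz; elim: u a => [|z u IH] a /=; first by rewrite big_nil addr0.
  by rewrite IH big_cons addrA.
have E (u : seq int) : foldl +%R 0%R u = sumz u by rewrite E0 add0r.
apply: (eq_fpc (f := fun x => foldl +%R 0%R (l x))); first by move=> x; rewrite E.
apply: (fpc_foldl (f := fun _ => +%R) (p := fun n => 4 * pb k n + 5)).
- by apply: fpc_addz; fpa.
- by fpa.
- by [].
- by pols.
- move=> x j lj; rewrite E; apply: sz_int_leq; apply: leq_trans (sumz_bound _) _.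
  by rewrite leq_exp2l //; apply: leq_trans (sz_take _ _) (Hk x).
Qed.

Definition prodl (l : seq nat) : nat := \prod_(n <- l) n.

Lemma prodl_bound (l : seq nat) : prodl l < 2 ^ sz l.
Proof.
rewrite /prodl; elim: l => [|z l IH]; first by rewrite big_nil.
rewrite big_cons sz_cons expnS expnD; have h := lt_sz z.
have : 0 < 2 ^ sz l by rewrite expn_gt0.
have : 0 < 2 ^ sz z by rewrite expn_gt0.
nia.
Qed.

Lemma fpc_prodl X {eX : Enc X} (l : X -> seq nat) : fpc l -> fpc (fun x => prodl (l x)).
Proof.
move=> hl; have [k Hk] := fpc_sz hl.
have E0 u a : foldl muln a u = a * prodl u.
  rewrite /prodl; elim: u a => [|z u IH] a /=; first by rewrite big_nil muln1.
  by rewrite IH big_cons mulnA.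
have E u : foldl muln 1 u = prodl u by rewrite E0 mul1n.
apply: (eq_fpc (f := fun x => foldl muln 1 (l x))); first by move=> x; rewrite E.
apply: (fpc_foldl (f := fun _ => muln) (p := fun n => 4 * pb k n + 1)).
- by apply: fpc_muln; fpa.
- by fpa.
- by [].
- by pols.
- move=> x j lj; rewrite E; apply: sz_nat_leq; apply: leq_trans (prodl_bound _) _.
  by rewrite leq_exp2l //; apply: leq_trans (sz_take _ _) (Hk x).
Qed.

Lemma sz_nat_id (n : nat) : sz n <= 4 * n + 1.
Proof. by apply: sz_nat_leq; exact: ltn_expl. Qed.

Definition idx A (l : seq A) := iota 0 (size l).

Section Index.
Variables (X A : Type).
Context {eX : Enc X} {eA : Enc A}.

Lemma fpc_idx (l : X -> seq A) : fpc l -> fpc (fun x => idx (l x)).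
Proof.
move=> hl; have [k Hk] := fpc_sz hl.
have E (u : seq A) n m : foldl (fun (s : nat * seq nat) _ => (s.1.+1, s.1 :: s.2)) (n, m) u
    = (n + size u, catrev (iota n (size u)) m).
  by elim: u n m => [|a u IH] n m /=; rewrite ?addn0 // IH addSnnS.
apply: (eq_fpc (f := fun x => rev (foldl (fun (s : nat * seq nat) (_ : A) => (s.1.+1, s.1 :: s.2)) (0, [::]) (l x)).2)).
  by move=> x; rewrite E /= catrevE cats0 revK.
apply: fpc_rev; apply: fpc_snd.
apply: (fpc_foldl (f := fun _ (s : nat * seq nat) (_ : A) => (s.1.+1, s.1 :: s.2))
  (p := fun n => 4 * pb k n + 1 + (pb k n * (4 * pb k n + 2) + 1) + 1)).
- by apply: fpc_pair; [apply: fpc_succn; fpa|fpa].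
- by fpa.
- by [].
- by pols.
- move=> x j lj; rewrite E szP /= add0n catrevE cats0 sz_rev size_take_min.
  set n := minn _ _.
  have nl : n <= pb k (sz x) by rewrite /n; pose proof (size_sz (l x)); have := Hk x; lia.
  have h1 := sz_nat_id n.
  have h2 := @sz_seq_bound _ _ (iota 0 n) (4 * n + 1); rewrite size_iota in h2.
  have {}h2 : sz (iota 0 n) <= n * (4 * n + 1).+1 + 1.
    by apply: h2 => i li d; rewrite nth_iota // add0n; apply: leq_trans (sz_nat_id _) _; lia.
  nia.
Qed.

Lemma fpc_size (l : X -> seq A) : fpc l -> fpc (fun x => size (l x)).
Proof.
move=> hl; have [k Hk] := fpc_sz hl.
have E (u : seq A) n : foldl (fun s _ => s.+1) n u = n + size u.
  by elim: u n => [|a u IH] n /=; rewrite ?addn0 // IH addSnnS.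
apply: (eq_fpc (f := fun x => foldl (fun s (_ : A) => s.+1) 0 (l x))).
  by move=> x; rewrite E.
apply: (fpc_foldl (f := fun _ s (_ : A) => s.+1) (p := fun n => 4 * pb k n + 1)).
- by apply: fpc_succn; fpa.
- by fpa.
- by [].
- by pols.
- move=> x j lj; rewrite E; apply: leq_trans (sz_nat_id _) _.
  by rewrite add0n size_take_min; pose proof (size_sz (l x)); have := Hk x; lia.
Qed.

Lemma fpc_nth (d : A) (l : X -> seq A) (i : X -> nat) : fpc l -> fpc i ->
  fpc (fun x => nth d (l x) (i x)).
Proof.
move=> hl hi; have [k Hk] := fpc_sz hl.
pose f i (s : nat * A) a := (s.1.+1, if s.1 == i then a else s.2).
have E j (u : seq A) n b : foldl (f j) (n, b) u = (n + size u, if n <= j then nth b u (j - n) else b).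
  elim: u n b => [|a u IH] n b /=; first by rewrite addn0 nth_nil; case: ifP.
  rewrite IH /f /= addSnnS; congr (_, _).
  by case: (ltngtP n j) => h //; [rewrite -(subnSK h)|rewrite h subnn].
apply: (eq_fpc (f := fun x => (foldl (f (i x)) (0, d) (l x)).2)).
  by move=> x; rewrite E subn0.
apply: fpc_snd.
apply: (fpc_foldl (f := fun x => f (i x)) (p := fun n => 4 * pb k n + 1 + (pb k n + sz d) + 1)).
- have hi1 : fpc (fun q : X * (nat * A) * A => i q.1.1).
    by apply: (fpc_comp (f := fun q : X * (nat * A) * A => q.1.1)) hi; fpa.
  by apply: fpc_pair; [apply: fpc_succn; fpa|fpa].
- by fpa.
- by [].
- by pols.
- move=> x j lj; rewrite E szP /= add0n subn0 size_take_min.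
  have h1 := sz_nat_id (minn j (size (l x))); pose proof (size_sz (l x)).
  have : sz (nth d (take j (l x)) (i x)) <= sz (l x) + sz d.
    pose proof (sz_take (l x) j).
    have : sz (nth d (take j (l x)) (i x)) <= sz (take j (l x)) + sz d; last by lia.
    elim: (take _ _) (i x) {h1} => [|a u IH] [|n] /=; rewrite ?sz_cons; try lia.
    by have := IH n; lia.
  have := Hk x; lia.
Qed.

End Index.

Create HintDb fpdb.

Ltac fp_if f := lazymatch type of f with ?T -> _ =>
  let b := constr:(fun x : T => ltac:(let y := eval cbv beta in (f x) in
    lazymatch y with match ?b with true => _ | false => _ end => exact b end)) in
  let u := constr:(fun x : T => ltac:(let y := eval cbv beta in (f x) in
    lazymatch y with match _ with true => ?u | false => _ end => exact u end)) in
  let v := constr:(fun x : T => ltac:(let y := eval cbv beta in (f x) in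
    lazymatch y with match _ with true => _ | false => ?v end => exact v end)) in
  refine (@fpc_if _ _ _ _ b u v _ _ _) end.

(* Syntactic dispatch on the head of the body of the function; the variants
   [g (h x)] look up an already established [fpc g]. *)
Ltac fp_lam := lazymatch goal with
  | |- @fpc _ _ _ _ ?f => lazymatch f with
    | (fun x => x) => exact: fpc_id
    | (fun x => fst (@?a x)) => refine (@fpc_fst _ _ _ _ _ _ a _)
    | (fun x => snd (@?a x)) => refine (@fpc_snd _ _ _ _ _ _ a _)
    | (fun x => (@?a x, @?b x)) => refine (@fpc_pair _ _ _ _ _ _ a b _ _)
    | (fun x => nilp (@?a x)) => refine (@fpc_nilp _ _ _ _ a _)
    | (fun x => cons (@?a x) (@?b x)) => refine (@fpc_cons _ _ _ _ a b _ _)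
    | (fun x => behead (@?a x)) => refine (@fpc_behead _ _ _ _ a _)
    | (fun x => head ?d (@?a x)) => refine (@fpc_head _ _ _ _ d a _)
    | (fun x => Some (@?a x)) => refine (@fpc_Some _ _ _ _ a _)
    | (fun x => isSome (@?a x)) => refine (@fpc_isSome _ _ _ _ a _)
    | (fun x => odflt ?d (@?a x)) => refine (@fpc_odflt _ _ _ _ d a _)
    | (fun x => enc (code (@?a x))) => refine (@fpc_enc _ _ _ _ a _)
    | (fun x => negb (@?a x)) => refine (@fpc_negb _ _ a _)
    | (fun x => andb (@?a x) (@?b x)) => refine (@fpc_andb _ _ a b _ _)
    | (fun x => orb (@?a x) (@?b x)) => refine (@fpc_orb _ _ a b _ _)
    | (fun x => addn (@?a x) (@?b x)) => refine (@fpc_addn _ _ a b _ _)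
    | (fun x => S (@?a x)) => refine (@fpc_succn _ _ a _)
    | (fun x => muln (@?a x) (@?b x)) => refine (@fpc_muln _ _ a b _ _)
    | (fun x => subn (@?a x) (@?b x)) => refine (@fpc_subn _ _ a b _ _)
    | (fun x => divn (@?a x) (@?b x)) => refine (@fpc_divn _ _ a b _ _)
    | (fun x => modn (@?a x) (@?b x)) => refine (@fpc_modn _ _ a b _ _)
    | (fun x => leq (@?a x) (@?b x)) => refine (@fpc_leq _ _ a b _ _)
    | (fun x => GRing.add (@?a x) (@?b x)) => refine (@fpc_addz _ _ a b _ _)
    | (fun x => GRing.mul (@?a x) (@?b x)) => refine (@fpc_mulz _ _ a b _ _)
    | (fun x => GRing.opp (@?a x)) => refine (@fpc_oppz _ _ a _)
    | (fun x => Order.le (@?a x) (@?b x)) => refine (@fpc_lez _ _ a b _ _)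
    | (fun x => zdiv (@?a x) (@?b x)) => refine (@fpc_zdiv _ _ a b _ _)
    | (fun x => Posz (@?a x)) => refine (@fpc_Posz _ _ a _)
    | (fun x => absz (@?a x)) => refine (@fpc_absz _ _ a _)
    | (fun x => zmk (@?a x) (@?b x)) => refine (@fpc_zmk _ _ a b _ _)
    | (fun x => sumz (@?a x)) => refine (@fpc_sumz _ _ a _)
    | (fun x => prodl (@?a x)) => refine (@fpc_prodl _ _ a _)
    | (fun x => idx (@?a x)) => refine (@fpc_idx _ _ _ _ a _)
    | (fun x => size (@?a x)) => refine (@fpc_size _ _ _ _ a _)
    | (fun x => nth ?d (@?a x) (@?b x)) => refine (@fpc_nth _ _ _ _ d a b _ _)
    | (fun x => nbits (@?a x)) => refine (@fpc_nbits _ _ a _)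
    | (fun x => bval (@?a x)) => refine (@fpc_bval _ _ a _)
    | (fun x => rev (@?a x)) => refine (@fpc_rev _ _ _ _ a _)
    | (fun x => (@?a x) ++ (@?b x)) => refine (@fpc_cat _ _ _ _ a b _ _)
    | (fun x => flatten (@?a x)) => refine (@fpc_flatten _ _ _ _ a _)
    | (fun x => map (@?F x) (@?a x)) => refine (@fpc_map _ _ _ _ _ _ F a _ _)
    | (fun x => seq.filter (@?F x) (@?a x)) => refine (@fpc_filter _ _ _ _ F a _ _)
    | (fun x => all (@?F x) (@?a x)) => refine (@fpc_all _ _ _ _ F a _ _)
    | (fun x => has (@?F x) (@?a x)) => refine (@fpc_has _ _ _ _ F a _ _)
    | (fun x => eq_op (@?a x) (@?b x)) => refine (@fpc_eq _ _ _ _ a b _ _)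
    | (fun x => in_mem (@?a x) (mem (@?b x))) => refine (@fpc_mem _ _ _ _ a b _ _)
    | _ => first
      [ fp_if f
      | match f with (fun x => ?g (@?a x)) =>
          refine (@fpc_comp _ _ _ _ _ _ a g _ _);
          [|first [assumption|solve [eauto 2 with fpdb typeclass_instances nocore]]] end
      | match f with (fun x => ?g (@?a x) (@?b x)) =>
          refine (@fpc_comp _ _ _ _ _ _ (fun x => (a x, b x)) (fun q => g q.1 q.2) _ _);
          [|first [assumption|solve [eauto 2 with fpdb typeclass_instances nocore]]] end
      | match f with (fun x => ?g (@?a x) (@?b x) (@?c x)) =>
          refine (@fpc_comp _ _ _ _ _ _ (fun x => (a x, b x, c x)) (fun q => g q.1.1 q.1.2 q.2) _ _);
          [|first [assumption|solve [eauto 2 with fpdb typeclass_instances nocore]]] end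
      | solve [eauto 2 with fpdb typeclass_instances nocore] ]
    end
  end.
Ltac fp1 := cbv beta; first
  [ match goal with H : @fpc _ _ _ _ ?g |- @fpc _ _ _ _ ?g => exact H end
  | match goal with |- @fpc _ _ _ _ (fun _ => ?b) => refine (@fpc_const _ _ _ _ b) end
  | lazymatch goal with
    | |- @fpc _ _ _ _ (fun x => _) => fp_lam
    | |- @fpc _ _ _ _ ?f => first [ solve [eauto 2 with fpdb typeclass_instances nocore]
        | refine (@eq_fpc _ _ _ _ (fun x => f x) f (fun x => erefl) _); fp_lam ]
    end ].
Ltac fpa ::= repeat fp1.

End BinaryArithmetic.
Import BinaryArithmetic.

(** * Linear feasibility: basic solutions and rescaled perceptron *)

Module Perceptron.

(** * Determinant bounds and basic solutions of integer systems *)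

Section Basic.
Variable R : realFieldType.
Local Open Scope ring_scope.

Lemma det_bound n (D : 'M[R]_n) (M : R) : 0 <= M -> (forall i j, `|D i j| <= M) ->
  `|\det D| <= n`!%:R * M ^+ n.
Proof.
move=> M0 HM; rewrite /determinant; apply: le_trans (ler_norm_sum _ _ _) _.
apply: (@le_trans _ _ (\sum_(s : 'S_n) M ^+ n)).
  apply: ler_sum => s _; rewrite normrM normrX normrN1 expr1n mul1r normr_prod.
  rewrite -[in X in _ <= X](card_ord n) -prodr_const; apply: ler_prod => i _.
  by rewrite normr_ge0 HM.
by rewrite sumr_const card_Sn mulr_natl.
Qed.

Lemma adj_bound n (D : 'M[R]_n) (M : R) i j : 1 <= M -> (forall i j, `|D i j| <= M) ->
  `|\adj D i j| <= n`!%:R * M ^+ n.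
Proof.
move=> M1 HM; have M0 : 0 <= M by apply: le_trans M1.
rewrite mxE /cofactor normrM normrX normrN1 expr1n mul1r.
case: n D i j HM => [|n] D i j HM; first by case: i.
apply: le_trans (det_bound M0 _) _; first by move=> *; rewrite !mxE.
rewrite factS natrM exprS; apply: ler_pM; rewrite ?ler0n ?exprn_ge0 //.
  by rewrite ler_peMl ?ler0n // ler1n.
by rewrite ler_peMl ?exprn_ge0.
Qed.

(** By Leibniz's formula a cofactor is at most n! M ^ n, and Cramer's rule adds up at most n of
    them. *)
Definition cbound (n : nat) (M : R) : R := n`!%:R * M ^+ n * n%:R.

(** Carathéodory's argument. Take [w] of least support; a nonzero kernel vector on that support
    could be subtracted from [w] until a coordinate vanishes, which would shrink the support. *)
Lemma support_minimal m n (B : 'M[R]_(m, n)) (v : 'cV[R]_n) : (forall j, 0 <= v j 0) ->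
  exists w : 'cV[R]_n, [/\ B *m w = B *m v, forall j, 0 <= w j 0,
    forall j, v j 0 = 0 -> w j 0 = 0 &
    forall u : 'cV[R]_n, (forall j, w j 0 = 0 -> u j 0 = 0) -> B *m u = 0 -> u = 0].
Proof.
move=> v0.
pose P k := exists w : 'cV[R]_n, [/\ B *m w = B *m v, forall j, 0 <= w j 0,
    forall j, v j 0 = 0 -> w j 0 = 0 & #|[set j | w j 0 != 0]| = k].
have exP : exists k, `[< P k >] by exists #|[set j | v j 0 != 0]|; apply/asboolP; exists v.
case: (ex_minnP exP) => k /asboolP [w [wB w0 ws wk]] kmin.
have {}kmin w' : B *m w' = B *m v -> (forall j, 0 <= w' j 0) ->
    (forall j, v j 0 = 0 -> w' j 0 = 0) -> leq k #|[set j | w' j 0 != 0]|.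
  by move=> *; apply: kmin; apply/asboolP; exists w'.
exists w; split=> // u uw Bu; apply: contrapT => un0.
wlog [a ua] : u uw Bu un0 / exists a, 0 < u a 0.
  move=> W; have [[a ua]|nu] := pselect (exists a, 0 < u a 0); first by apply: (W u) => //; exists a.
  apply: (W (- u)); first by move=> j wj; rewrite mxE uw ?oppr0.
  - by rewrite mulmxN Bu oppr0.
  - by move=> /eqP; rewrite oppr_eq0 => /eqP.
  have [a ua] : exists a, u a 0 != 0.
    apply: contrapT => h; apply: un0; apply/matrixP => a z; rewrite (ord1 z) mxE.
    by apply/eqP; apply: contra_notT h => h; exists a.
  exists a; rewrite mxE oppr_gt0 lt_neqAle ua /= leNgt.
  by apply/negP => h; apply: nu; exists a.
(* Ratio test: [b] is the coordinate that reaches zero first when multiples of [u] are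
   subtracted. *)
have [b ub bmin] : exists2 b, 0 < u b 0 & forall c, 0 < u c 0 -> w b 0 / u b 0 <= w c 0 / u c 0.
  case: (arg_minP (fun c => w c 0 / u c 0) (ua : (fun c => 0 < u c 0) a)) => b ub h.
  by exists b.
pose t := w b 0 / u b 0.
have t0 : 0 <= t by rewrite divr_ge0 // ltW.
pose w' := w - t *: u.
have w'E j : w' j 0 = w j 0 - t * u j 0 by rewrite !mxE.
have k1 : B *m w' = B *m v by rewrite /w' mulmxBr -scalemxAr Bu scaler0 subr0.
have k2 j : 0 <= w' j 0.
  rewrite w'E subr_ge0; have [uc|uc] := ltP 0 (u j 0); last by rewrite (le_trans _ (w0 _)) // mulr_ge0_le0.
  by rewrite -ler_pdivlMr //; exact: bmin.
have k3 j : v j 0 = 0 -> w' j 0 = 0 by move=> vj; rewrite w'E (ws j vj) uw ?mulr0 ?subr0 // ws.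
have := kmin w' k1 k2 k3; rewrite leqNgt => /negP; apply.
rewrite -wk; apply: proper_card; apply/properP; split.
  apply/fintype.subsetP => j; rewrite !inE w'E; apply: contraNN => /eqP wj.
  by rewrite wj uw ?mulr0 ?subr0.
exists b; first by rewrite inE; apply: contraTneq ub => /uw ->; rewrite ltxx.
by rewrite inE w'E /t divfK ?subrr ?eqxx // gt_eqF.
Qed.

Section Bound.
Variables (m n : nat) (B : 'M[int]_(m, n)) (M : R).
Hypotheses (M1 : 1 <= M) (HM : forall i j, `|B i j|%:~R <= M).
Local Notation BR := (map_mx (intr : int -> R) B).

(** Independent columns contain a nonsingular square block. Its determinant is a nonzero integer, so
    the division in Cramer's rule cannot increase the cofactors. *)
Lemma indep_bound s (f : 'I_s -> 'I_n) (w : 'cV[R]_s) (e : R) : injective f ->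
  (forall u : 'cV[R]_s, colsub f BR *m u = 0 -> u = 0) ->
  (forall i, `|(colsub f BR *m w) i 0| <= e) -> forall j, `|w j 0| <= cbound n M * e.
Proof.
move=> finj ind we j.
have fA : row_full (colsub f BR).
  rewrite /row_full -mxrank_tr -/(row_free _) -kermx_eq0.
  apply/eqP/row_matrixP => i; rewrite row0.
  have := ind (row i (kermx (colsub f BR)^T))^T.
  rewrite -[X in X *m _](trmxK (colsub f BR)) -trmx_mul -row_mul mulmx_ker row0 trmx0.
  by move=> /(_ erefl) /(congr1 trmx); rewrite trmxK trmx0.
have sn : (s <= n)%N by have := leq_card f finj; rewrite !card_ord.
set g := fullrankfun fA; set D := rowsub g (colsub f BR).
have Du : D \in unitmx by exact: fullrowsub_unit.
have DE : D = map_mx intr (\matrix_(a, b) B (g a) (f b)).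
  by apply/matrixP => a b; rewrite !mxE.
have d1 : 1 <= `|\det D|.
  have : \det D != 0 by move: Du; rewrite unitmxE unitfE.
  rewrite DE det_map_mx -intr_norm intr_eq0 -[1]/(1%:~R) ler_int.
  by lia.
have ew : w = (\det D)^-1 *: (\adj D *m (D *m w)).
  by rewrite mulmxA mul_adj_mx mul_scalar_mx scalerA mulVf ?scale1r // -unitfE -unitmxE.
have Dw i : `|(D *m w) i 0| <= e.
  by have := we (g i); rewrite /D mul_rowsub_mx !mxE.
have e0 : 0 <= e by apply: le_trans (Dw j).
rewrite ew mxE normrM normfV.
apply: (@le_trans _ _ (`|(\adj D *m (D *m w)) j 0|)).
  by rewrite ler_piMl // invf_le1 // (lt_le_trans ltr01).
rewrite mxE; apply: le_trans (ler_norm_sum _ _ _) _.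
apply: (@le_trans _ _ (\sum_(k < s) (s`!%:R * M ^+ s) * e)).
  apply: ler_sum => k _; rewrite normrM; apply: ler_pM => //.
  by apply: adj_bound => // a b; rewrite DE !mxE -intr_norm.
rewrite sumr_const card_ord -[_ *+ s]mulr_natr /cbound.
rewrite (mulrAC _ e) ler_wpM2r //.
apply: ler_pM; rewrite ?mulr_ge0 ?ler0n ?exprn_ge0 ?(le_trans ler01) //; last by rewrite ler_nat.
apply: ler_pM; rewrite ?ler0n ?exprn_ge0 ?(le_trans ler01) //; last by rewrite ler_weXn2l.
rewrite ler_nat.
move: sn; elim: (n) => [|k IH]; first by case: (s).
by rewrite leq_eqVlt => /orP [/eqP <- //|h]; rewrite factS (leq_trans (IH h)) // leq_pmull.
Qed.

Lemma basic_solution (v : 'cV[R]_n) (e : R) : 0 <= e -> (forall j, 0 <= v j 0) ->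
  (forall i, `|(BR *m v) i 0| <= e) ->
  exists v' : 'cV[R]_n, [/\ BR *m v' = BR *m v, forall j, 0 <= v' j 0,
    forall j, v j 0 = 0 -> v' j 0 = 0 & forall j, v' j 0 <= cbound n M * e].
Proof.
move=> e0 v0 ve.
have [w [wB w0 ws wi]] := support_minimal BR v0.
exists w; split=> //.
set S := [set j | w j 0 != 0].
pose f : 'I_#|S| -> 'I_n := enum_val.
have finj : injective f by exact: enum_val_inj.
pose ext (u : 'cV[R]_#|S|) : 'cV[R]_n := \col_j (\sum_(a | f a == j) u a 0).
have extf u a : ext u (f a) 0 = u a 0.
  by rewrite mxE (big_pred1 a) // => b /=; rewrite (inj_eq finj).
have ext0 u j : j \notin S -> ext u j 0 = 0.
  by move=> jS; rewrite mxE big_pred0 // => a; apply: contraNF jS => /eqP <-; exact: enum_valP.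
have Bext u : BR *m ext u = colsub f BR *m u.
  apply/matrixP => i z; rewrite !mxE (ord1 z).
  under eq_bigr => j _ do rewrite [ext u j 0]mxE mulr_sumr.
  rewrite (exchange_big_dep xpredT) //=; apply: eq_bigr => a _.
  by rewrite (big_pred1 (f a)) ?mxE // => j; rewrite eq_sym.
have ind (u : 'cV[R]_#|S|) : colsub f BR *m u = 0 -> u = 0.
  rewrite -Bext => /(wi (ext u)) h; apply/matrixP => a z; rewrite (ord1 z) [RHS]mxE -(extf u).
  by rewrite h ?mxE // => j wj; rewrite ext0 // inE wj eqxx.
have wE : w = ext (\col_a w (f a) 0).
  apply/matrixP => j z; rewrite (ord1 z); have [jS|jS] := boolP (j \in S).
    by rewrite -(enum_rankK_in jS jS) -/(f _) extf mxE.
  by rewrite ext0 //; apply/eqP; move: jS; rewrite inE negbK.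
move=> j; have [jS|jS] := boolP (j \in S).
  rewrite -(enum_rankK_in jS jS) -/(f _).
  apply: le_trans (ler_norm _) _.
  have := @indep_bound _ f (\col_a w (f a) 0) e finj ind.
  rewrite -Bext -wE wB => /(_ ve (enum_rank_in jS j)); by rewrite mxE.
have -> : w j 0 = 0 by apply/eqP; move: jS; rewrite inE negbK.
by rewrite mulr_ge0 // /cbound !mulr_ge0 ?ler0n ?exprn_ge0 // (le_trans ler01).
Qed.

End Bound.
End Basic.

(** * The potential argument for one phase of the perceptron *)

Section Perceptron.
Variable R : realFieldType.
Local Open Scope ring_scope.

Definition dot n (u v : 'cV[R]_n) : R := \sum_i u i 0 * v i 0.

Lemma dotE n (u v : 'cV[R]_n) : dot u v = (u^T *m v) 0 0.
Proof. by rewrite mxE; apply: eq_bigr => i _; rewrite mxE. Qed.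

Lemma dotC n (u v : 'cV[R]_n) : dot u v = dot v u.
Proof. by apply: eq_bigr => i _; rewrite mulrC. Qed.

Lemma dotDr n (u v w : 'cV[R]_n) : dot u (v + w) = dot u v + dot u w.
Proof. by rewrite !dotE mulmxDr mxE. Qed.

Lemma dotDl n (u v w : 'cV[R]_n) : dot (u + v) w = dot u w + dot v w.
Proof. by rewrite dotC dotDr !(dotC w). Qed.

Lemma dotZr n a (u v : 'cV[R]_n) : dot u (a *: v) = a * dot u v.
Proof. by rewrite !dotE -scalemxAr mxE. Qed.

Lemma dot_sq_ge n (u : 'cV[R]_n) k : u k 0 ^+ 2 <= dot u u.
Proof.
rewrite /dot (bigD1 k) //= -expr2 lerDl; apply: sumr_ge0 => i _.
by rewrite -expr2 sqr_ge0.
Qed.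

Lemma dot_ge0 n (u : 'cV[R]_n) : 0 <= dot u u.
Proof. by apply: sumr_ge0 => i _; rewrite -expr2 sqr_ge0. Qed.

Lemma dot_delta n (u : 'cV[R]_n) k : dot (delta_mx k 0) u = u k 0.
Proof.
rewrite /dot (bigD1 k) //= big1 => [|i ik]; rewrite !mxE ?eqxx ?mul1r ?addr0 //.
by rewrite (negbTE ik) mul0r.
Qed.

Variables (m n : nat) (B : 'M[R]_(m, n)) (K : R).
(** A positive definite matrix that fixes the kernel of [B]. For large [K] its inverse approximates
    the orthogonal projection onto that kernel, without any division inside the matrix itself. *)
Definition gram : 'M[R]_n := 1%:M + K ^+ 2 *: (B^T *m B).
Implicit Types (x y u v w : 'cV[R]_n).

Lemma dot_gram u v : dot u (gram *m v) = dot u v + K ^+ 2 * dot (B *m u) (B *m v).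
Proof.
rewrite /gram mulmxDl mul1mx dotDr -scalemxAl dotZr; congr (_ + _ * _).
by rewrite !dotE trmx_mul !mulmxA.
Qed.

Lemma dot_gramC u v : dot u (gram *m v) = dot (gram *m u) v.
Proof. by rewrite dot_gram [RHS]dotC dot_gram dotC [dot (B *m _) _]dotC. Qed.

Lemma gram_sq v : dot v v <= dot v (gram *m v).
Proof. by rewrite dot_gram lerDl mulr_ge0 ?sqr_ge0 ?dot_ge0. Qed.

Lemma gram_sqB v : K ^+ 2 * dot (B *m v) (B *m v) <= dot v (gram *m v).
Proof. by rewrite dot_gram lerDr dot_ge0. Qed.

Lemma gram_unit : gram \in unitmx.
Proof.
rewrite -row_full_unit /row_full -mxrank_tr -/(row_free _) -kermx_eq0.
apply/eqP/row_matrixP => i; rewrite row0.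
set r := row i _.
have h : gram *m r^T = 0.
  by rewrite -[gram]trmxK -trmx_mul /r -row_mul mulmx_ker row0 trmx0.
have := gram_sq r^T; rewrite h.
have -> : dot r^T 0 = 0 by rewrite /dot big1 // => j _; rewrite [X in _ * X]mxE mulr0.
move=> le0; apply/matrixP => a b; rewrite (ord1 a) [RHS]mxE.
have := dot_sq_ge r^T b; rewrite [r^T b 0]mxE => h2.
by apply/eqP; rewrite -sqrf_eq0 eq_le sqr_ge0 andbT (le_trans h2 le0).
Qed.

(** The squared norm of [y] in the metric of the inverse of [gram]; it plays the part of the squared
    length in the convergence proof of the perceptron. *)
Definition pot y := dot y (invmx gram *m y).

Lemma gram_inv y : gram *m (invmx gram *m y) = y.
Proof. by rewrite mulKVmx // gram_unit. Qed.

Lemma potE y : pot y = dot (invmx gram *m y) (gram *m (invmx gram *m y)).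
Proof. by rewrite gram_inv dotC. Qed.

(** The increase is 2 v_k + w_k. The first term is at most 2 by the choice of [k]; the second, a
    diagonal entry of the inverse, is at most 1 because [gram] dominates the identity. *)
Lemma pot_step y k : (invmx gram *m y) k 0 <= 1 -> pot (y + delta_mx k 0) <= pot y + 3.
Proof.
set v := invmx gram *m y => vk; set d := delta_mx k 0; set w := invmx gram *m d.
have wk : w k 0 <= 1.
  have h : w k 0 ^+ 2 <= w k 0.
    apply: le_trans (dot_sq_ge w k) _; apply: le_trans (gram_sq w) _.
    by rewrite gram_inv dotC dot_delta.
  by rewrite leNgt; apply/negP => h1; move: h; rewrite expr2 leNgt ltr_pMr ?h1 // (lt_trans ltr01).
rewrite /pot mulmxDr -/v -/w dotDr !dotDl dot_delta dot_delta.
have -> : dot y w = v k 0 by rewrite -(gram_inv y) -dot_gramC gram_inv dotC dot_delta.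
lra.
Qed.

Lemma pot0 : pot 0 = 0.
Proof. by rewrite /pot mulmx0 /dot big1 // => i _; rewrite mxE mul0r. Qed.

(** As [gram] fixes [x], the products of [x] with [y] and with [v] agree. The latter is of order
    sqrt (n T) since the potential is at most 3 T, while the former is at least x_k y_k with y_k >=
    T / n. Once T is at least 12 n ^ 3 this leaves x_k at most one half. *)
Lemma pot_cut x y k (T : R) : B *m x = 0 -> (forall j, 0 <= x j 0 <= 1) ->
  (forall j, 0 <= y j 0) -> pot y <= 3 * T -> 12 * n%:R ^+ 3 <= T -> T <= y k 0 * n%:R ->
  x k 0 <= 2^-1.
Proof.
move=> Bx x01 y0 pT Tn yk; rewrite leNgt; apply/negP => xk.
have n0 : 0 < n%:R :> R by rewrite ltr0n (leq_ltn_trans _ (ltn_ord k)).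
have T0 : 0 < T by apply: lt_le_trans Tn; rewrite mulr_gt0 // exprn_gt0.
set v := invmx gram *m y.
have e1 : dot x y = dot x v.
  by rewrite -{1}(gram_inv y) dot_gram Bx [dot 0 _]big1 ?mulr0 ?addr0 // => i _; rewrite mxE mul0r.
have e2 : x k 0 * y k 0 <= dot x y.
  rewrite /dot (bigD1 k) //= lerDl sumr_ge0 // => i _; rewrite mulr_ge0 //.
  by case/andP: (x01 i).
have e3 : dot v v <= 3 * T.
  by apply: le_trans (gram_sq v) _; apply: le_trans pT; rewrite potE.
(* A weighted inequality between means stands in for Cauchy-Schwarz and its square root; this weight
   makes the two bounds equal when T is 12 n ^ 3. *)
pose t := T / (2 * n%:R ^+ 2).
have t0 : 0 < t by rewrite divr_gt0 // mulr_gt0 // exprn_gt0.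
have e4 : dot x v <= (t * n%:R + dot v v / t) / 2.
  apply: (@le_trans _ _ (\sum_i (t + v i 0 ^+ 2 / t) / 2)).
    apply: ler_sum => i _; have /andP [h1 h2] := x01 i.
    (* 2 x v <= t x^2 + v^2 / t <= t + v^2 / t *)
    rewrite ler_pdivlMr //.
    have : 0 <= (t * x i 0 - v i 0) ^+ 2 / t by rewrite divr_ge0 ?sqr_ge0 ?ltW.
    have -> : (t * x i 0 - v i 0) ^+ 2 / t = t * x i 0 ^+ 2 - 2 * (x i 0 * v i 0) + v i 0 ^+ 2 / t.
      by field; rewrite gt_eqF.
    have : 0 <= t * (1 - x i 0) * (1 + x i 0).
      by apply: mulr_ge0; [apply: mulr_ge0|]; lra.
    lra.
  rewrite -mulr_suml big_split /= sumr_const card_ord -[t *+ _]mulr_natr.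
  by rewrite /dot mulr_suml; under [X in _ <= (_ + X) / _]eq_bigr do rewrite -expr2.
have e5 : T / n%:R <= y k 0 by rewrite ler_pdivrMr.
have e6 : T / n%:R / 2 < x k 0 * y k 0.
  have y1 : 0 < y k 0 by apply: lt_le_trans e5; rewrite divr_gt0.
  by apply: (@le_lt_trans _ _ (2^-1 * y k 0)); [rewrite mulrC ler_pM2l // invr_gt0|rewrite ltr_pM2r].
have e7 : dot v v / t <= 6 * n%:R ^+ 2.
  rewrite ler_pdivrMr // /t; apply: le_trans e3 _.
  by rewrite le_eqVlt; apply/orP; left; apply/eqP; field; rewrite gt_eqF.
have e8 : t * n%:R = T / n%:R / 2 by rewrite /t; field; rewrite gt_eqF.
have e9 : 12 * n%:R ^+ 2 <= T / n%:R.
  by rewrite ler_pdivlMr // -mulrA -exprSr.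
clear Bx x01 y0; lra.
Qed.

End Perceptron.

(** * Rescaling between phases, vanishing coordinates and rounding *)

Section Rescaling.
Variable R : realFieldType.
Local Open Scope ring_scope.
Variables (m n : nat) (A : 'M[int]_(m, n)) (M : R) (Lb : nat).
Hypotheses (M1 : 1 <= M) (HM : forall i j, `|A i j|%:~R <= M).
Hypothesis HL : cbound n M * M + 1 <= 2 ^+ Lb.
Local Notation AR := (map_mx (intr : int -> R) A).
Implicit Types (e : 'I_n -> nat) (x y : 'cV[R]_n).

(** Substitutes x_j = z_j / 2 ^ e_j and clears denominators with 2 ^ Lb, which keeps the matrix
    integral. A column whose exponent exceeds [Lb] is erased, as its coordinate is zero in every
    solution. *)
Definition scaled e : 'M[int]_(m, n) :=
  \matrix_(i, j) (A i j * (if (e j <= Lb)%N then 2 ^+ (Lb - e j) else 0)).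

(** What the phases have learnt so far. It also says that the rescaled solutions are still in the
    unit box, which is what the next phase asks for. *)
Definition Inv e := forall x, AR *m x = 0 -> (forall j, 0 <= x j 0 <= 1) ->
  forall j, x j 0 * 2 ^+ (e j) <= 1.

Lemma Inv0 : Inv (fun=> 0%N).
Proof. by move=> x _ x01 j; rewrite expr0 mulr1; case/andP: (x01 j). Qed.

(** A solution that is positive at [k] gives one in the box whose value at [k] is 1 / (cbound n M M
    + 1), by the bound on basic solutions. That is at least 2 ^ -Lb, against the invariant. *)
Lemma Inv_vanish e x k : Inv e -> (Lb < e k)%N -> AR *m x = 0 ->
  (forall j, 0 <= x j 0) -> x k 0 = 0.
Proof.
move=> ie ek Ax x0; apply/eqP; rewrite eq_le x0 andbT leNgt; apply/negP => xk.
pose x1 : 'cV[R]_n := \col_j (if j == k then 0 else x j 0 / x k 0).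
have xE : (x k 0)^-1 *: x = x1 + delta_mx k 0.
  apply/matrixP => j z; rewrite (ord1 z) !mxE; case: eqP => [->|_] /=.
    by rewrite mulVf ?gt_eqF // add0r.
  by rewrite addr0 mulrC.
have Ax1 : AR *m x1 = - (AR *m delta_mx k 0).
  by apply/eqP; rewrite -subr_eq0 opprK -mulmxDr -xE -scalemxAr Ax scaler0.
have x10 j : 0 <= x1 j 0 by rewrite mxE; case: ifP => // _; rewrite divr_ge0.
have M0 : 0 <= M by apply: le_trans M1.
have Ab i : `|(AR *m x1) i 0| <= M.
  rewrite Ax1 mxE normrN -colE !mxE -intr_norm; exact: HM.
have [v' [vA v0 vs vb]] := basic_solution M1 HM M0 x10 Ab.
pose c := cbound n M * M + 1.
have c1 : 1 <= c by rewrite lerDr mulr_ge0 // /cbound !mulr_ge0 ?ler0n ?exprn_ge0.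
(* Coordinate [k] is normalised to 1, the other ones are replaced by a basic solution, and all of it
   is scaled into the box. *)
pose z := c^-1 *: (v' + delta_mx k 0).
have c0 : 0 < c by apply: lt_le_trans c1.
have zk : z k 0 = c^-1.
  by rewrite !mxE !eqxx (vs k) ?add0r ?mulr1 // mxE eqxx.
have := ie z; rewrite -scalemxAr mulmxDr vA Ax1 addNr scaler0 => /(_ erefl).
have z01 j : 0 <= z j 0 <= 1.
  rewrite !mxE; apply/andP; split.
    by rewrite mulr_ge0 ?invr_ge0 ?(ltW c0) // addr_ge0 // ler0n.
  rewrite mulrC ler_pdivrMr // mul1r /c lerD // ?vb //.
  by case: (_ && _); rewrite ?ler01.
move=> /(_ z01 k); rewrite zk; apply/negP; rewrite -ltNge mulrC ltr_pdivlMr // mul1r.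
apply: le_lt_trans HL _; rewrite ltr_eXn2l //; lra.
Qed.

Section Step.
Variables (e : 'I_n -> nat) (K T : R).
Local Notation B := (map_mx (intr : int -> R) (scaled e)).
Hypotheses (ie : Inv e) (K0 : 0 < K).

Lemma scaled_feasible x : AR *m x = 0 -> (forall j, 0 <= x j 0) ->
  B *m (\col_j (2 ^+ (e j) * x j 0)) = 0.
Proof.
move=> Ax x0; apply/matrixP => i z; rewrite (ord1 z) [RHS]mxE.
have e1 : 2 ^+ Lb * (AR *m x) i 0 = 0 by rewrite Ax mxE mulr0.
rewrite [LHS]mxE -[RHS]e1 [(AR *m x) i 0]mxE mulr_sumr; apply: eq_bigr => j _; rewrite !mxE.
case: leqP => h; last by rewrite mulr0 rmorph0 mul0r (Inv_vanish ie h Ax x0) !mulr0.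
rewrite rmorphM rmorphXn /= -[in X in _ = X](subnK h) exprD.
by ring.
Qed.

Lemma Inv_step y k : (forall j, 0 <= y j 0) -> pot B K y <= 3 * T ->
  12 * n%:R ^+ 3 <= T -> T <= y k 0 * n%:R ->
  Inv (fun j => if j == k then (e j).+1 else e j).
Proof.
move=> y0 py Tn yk x Ax x01 j; have x0 i : 0 <= x i 0 by case/andP: (x01 i).
case: eqP => [->|_]; last exact: ie.
have := @pot_cut _ _ _ B K _ y k T (scaled_feasible Ax x0) _ y0 py Tn yk.
rewrite mxE exprS => W.
have : 2 ^+ e k * x k 0 <= 2^-1; last by lra.
apply: W => i; rewrite mxE mulrC ie // andbT mulr_ge0 // exprn_ge0 //; lra.
Qed.

(** Rounding to an exact solution. The image of [v] has entries at most 2 T / K, so for large K a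
    basic vector [v'] with the same image has all coordinates below 1. Then v - v' lies in the
    kernel and is positive wherever v exceeds 1, which is on all surviving coordinates. *)
Lemma Done_feasible y : (forall j, 0 <= y j 0) -> (forall j, (Lb < e j)%N -> y j 0 = 0) ->
  pot B K y <= 3 * T -> 1 <= T -> cbound n (M * 2 ^+ Lb) * (2 * T) < K ->
  (forall j, (e j <= Lb)%N -> 1 < (invmx (gram B K) *m y) j 0) ->
  exists x, [/\ AR *m x = 0, forall j, 0 <= x j 0 & forall j, 0 < x j 0 <-> (e j <= Lb)%N].
Proof.
move=> y0 ys py T1 HK vpos; set v := invmx (gram B K) *m y.
have B0 j : (Lb < e j)%N -> forall i, B i j = 0.
  by move=> h i; rewrite !mxE leqNgt h /= mulr0 rmorph0.
have v0 j : (Lb < e j)%N -> v j 0 = 0.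
  move=> h; have := gram_inv B K y; rewrite -/v /gram mulmxDl mul1mx.
  move=> /(congr1 (fun z : 'cV[R]_n => z j 0)); rewrite mxE ys // -scalemxAl -mulmxA.
  rewrite [X in _ + X]mxE [X in _ * X]mxE big1 ?mulr0 ?addr0 // => i _.
  by rewrite mxE B0 // mul0r.
have vge j : 0 <= v j 0.
  by have [h|h] := leqP (e j) Lb; [apply: ltW; apply: lt_trans (vpos j h)|rewrite v0].
pose ee := 2 * T / K.
have ee0 : 0 <= ee by rewrite divr_ge0 ?ltW // mulr_gt0 // (lt_le_trans ltr01).
have Bv i : `|(B *m v) i 0| <= ee.
  rewrite ler_pdivlMr //.
  have h : (K * (B *m v) i 0) ^+ 2 <= 3 * T.
    apply: le_trans py; rewrite potE; apply: le_trans (gram_sqB _ _ _).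
    by rewrite exprMn ler_wpM2l ?sqr_ge0 // dot_sq_ge.
  have h2 : (K * (B *m v) i 0) ^+ 2 <= (2 * T) ^+ 2.
    by apply: le_trans h _; rewrite exprMn expr2; nra.
  rewrite mulrC -(ger0_norm (ltW K0)) -normrM -ler_sqr ?nnegrE ?normr_ge0 //; last by lra.
  by rewrite real_normK // num_real.
have MB i j : `|scaled e i j|%:~R <= M * 2 ^+ Lb.
  rewrite mxE normrM rmorphM /=; apply: ler_pM; rewrite ?ler0z ?normr_ge0 //.
  case: leqP => h; last by rewrite normr0 exprn_ge0.
  rewrite normrX rmorphXn /= ler_weXn2l //; last by exact: leq_subr.
  by rewrite -[1]/(1%:~R) ler_int.
have MB1 : 1 <= M * 2 ^+ Lb.
  by rewrite -[1]mulr1 ler_pM // exprn_ege1 //; lra.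
have [v' [vB v'0 vs vb]] := basic_solution MB1 MB ee0 vge Bv.
have v'1 j : v' j 0 < 1.
  by apply: le_lt_trans (vb j) _; rewrite /ee mulrA ltr_pdivrMr // mul1r.
have {}vpos j : (e j <= Lb)%N -> 1 < v j 0 by exact: vpos.
clearbody v; exists (\col_j ((2 ^+ (e j))^-1 * (v j 0 - v' j 0))).
have p0 j : 0 < 2 ^+ e j :> R by rewrite exprn_gt0.
have d0 j : (Lb < e j)%N -> v j 0 - v' j 0 = 0 by move=> h; rewrite v0 // vs ?subr0 // v0.
split.
- have : B *m (v - v') = 0 by rewrite mulmxBr vB subrr.
  move=> h; apply/matrixP => i z; rewrite (ord1 z) [RHS]mxE.
  have e1 : (2 ^+ Lb)^-1 * (B *m (v - v')) i 0 = 0 by rewrite h mxE mulr0.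
  rewrite [LHS]mxE -[RHS]e1 [(B *m (v - v')) i 0]mxE mulr_sumr; apply: eq_bigr => j _; rewrite !mxE.
  case: leqP => hj; last by rewrite d0 // !mulr0.
  rewrite rmorphM rmorphXn /= -[in X in _ = (_ ^+ X)^-1 * _](subnK hj) exprD.
  by field; rewrite !expf_neq0 ?pnatr_eq0.
- move=> j; rewrite mxE; have [h|h] := leqP (e j) Lb; last by rewrite d0 // mulr0.
  by rewrite mulr_ge0 ?invr_ge0 ?(ltW (p0 j)) // subr_ge0 (le_trans (ltW (v'1 j))) // ltW ?vpos.
- move=> j; rewrite mxE; have [h|h] := leqP (e j) Lb; last by rewrite d0 // mulr0 ltxx.
  by split=> // _; rewrite mulr_gt0 ?invr_gt0 // subr_gt0 (lt_trans (v'1 j)) // vpos.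
Qed.

End Step.
End Rescaling.

(** * Rank-one updates of determinants and adjugates *)

Section ShermanMorrison.
Local Open Scope ring_scope.

(** The block matrix [P] has two triangular factorisations, one for each side. *)
Lemma det_rank1 (F : fieldType) n (u : 'cV[F]_n) (v : 'rV[F]_n) :
  \det (1%:M + u *m v) = 1 + (v *m u) 0 0.
Proof.
pose P := block_mx (1%:M : 'M[F]_n) (- u) v (1%:M : 'M[F]_1).
have e1 : P = block_mx 1%:M 0 v 1%:M *m block_mx 1%:M (- u) 0 (1%:M + v *m u).
  rewrite mulmx_block !mul1mx !mulmx1 !mulmx0 !mul0mx !addr0 mulmxN /P.
  by rewrite addrCA addNr addr0.
have e2 : P = block_mx (1%:M + u *m v) (- u) 0 1%:M *m block_mx 1%:M 0 v 1%:M.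
  rewrite mulmx_block !mul1mx !mulmx1 ?mulmx0 ?mul0mx ?add0r ?mulNmx /P.
  by rewrite ?add0r addrK.
have := congr1 determinant e1; rewrite {1}e2 !det_mulmx !det_ublock !det_lblock !det1 !mulr1 !mul1r.
by move=> ->; rewrite det_mx11 !mxE.
Qed.

Variables (n : nat) (G : 'M[int]_n) (b : 'rV[int]_n) (c : int).
Hypothesis G0 : \det G != 0.
Local Notation G' := (G + c *: (b^T *m b)).
Local Notation X := (\adj G).
Local Notation d := (\det G).

Lemma det_update : \det G' = d + c * (b *m X *m b^T) 0 0.
Proof.
apply: (@intr_inj rat); pose f : {rmorphism int -> rat} := intr.
rewrite -[RHS]/(f _) -[LHS]/(f (\det G')) -det_map_mx.
set Gf := map_mx f G; set bf := map_mx f b.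
have Gu : Gf \in unitmx by rewrite unitmxE unitfE det_map_mx intr_eq0.
have -> : map_mx f G' = Gf *m (1%:M + (f c *: (invmx Gf *m bf^T)) *m bf).
  rewrite mulmxDr mulmx1 -scalemxAl -scalemxAr !mulmxA mulmxV // mul1mx.
  by rewrite map_mxD map_mxZ map_mxM map_trmx.
rewrite det_mulmx det_rank1 mulrDr mulr1 det_map_mx /f rmorphD rmorphM /=; congr (_ + _).
rewrite -scalemxAr mxE mulrCA; congr (_ * _).
have -> : invmx Gf = (f d)^-1 *: map_mx f X.
  by rewrite /invmx Gu map_mx_adj det_map_mx.
rewrite -scalemxAl -scalemxAr mxE mulrA mulfV ?intr_eq0 // mul1r mulmxA.
by rewrite map_trmx -!map_mxM mxE.
Qed.

(** The Sherman-Morrison formula multiplied by both determinants. As an identity of integer matrices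
    it shows that dividing the left side by [d] is exact. *)
Lemma adj_update : \det G' != 0 ->
  \det G' *: X - c *: (X *m b^T *m (b *m X)) = d *: \adj G'.
Proof.
move=> G'0; set d' := \det G'.
apply/eqP; rewrite -subr_eq0; set Z := _ - _.
have : Z *m G' = 0.
  have e1 : (d *: \adj G') *m G' = (d * d')%:M.
    by rewrite -scalemxAl mul_adj_mx scale_scalar_mx.
  have e2 : X *m b^T *m (b *m X) *m G = d *: (X *m b^T *m b).
    by rewrite -mulmxA -(mulmxA b) mul_adj_mx mul_mx_scalar -scalemxAr.
  have e3 : X *m b^T *m (b *m X) *m (b^T *m b) = (b *m X *m b^T) 0 0 *: (X *m b^T *m b).
    rewrite -(mulmxA (X *m b^T)) (mulmxA (b *m X)) {1}(mx11_scalar (b *m X *m b^T)).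
    by rewrite mul_scalar_mx -scalemxAr.
  rewrite /Z mulmxBl e1 mulmxBl -!scalemxAl mulmxDr mul_adj_mx -scalemxAr mulmxDr -scalemxAr e2 e3.
  rewrite mulmxA; move: (b *m X *m b^T) (@det_update) => q du; set W := X *m b^T *m b.
  have -> : d' *: (d%:M + c *: W) = (d * d')%:M + (c *: (d *: W + c *: (q 0 0 *: W))).
    rewrite scalerDr scale_scalar_mx (mulrC d'); congr (_ + _).
    rewrite !scalerA -scalerDl scalerA /d' du; congr (_ *: _); ring.
  by rewrite addrK subrr.
move=> ZG; have := congr1 (mulmx^~ (\adj G')) ZG.
rewrite -mulmxA mul_mx_adj mul_mx_scalar mul0mx => /eqP.
by rewrite scalemx_eq0 (negbTE G'0).
Qed.

End ShermanMorrison.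

End Perceptron.
Import Perceptron.

(** * A polynomial-time solver for homogeneous linear systems *)

Module LinearSolver.

Local Open Scope ring_scope.

Definition zat (l : seq int) (j : nat) : int := nth 0 l j.
Definition mat_at (l : seq (seq int)) (i j : nat) : int := zat (nth [::] l i) j.
Definition vdot (n : seq nat) (a b : seq int) := sumz [seq zat a j * zat b j | j <- n].

(** The state is the adjugate and the determinant of the Gram matrix of the rows read so far;
    [adj_update] guarantees that the divisions are exact. *)
Definition smstep (n : seq nat) (c : int) (s : seq (seq int) * int) (b : seq int) :=
  let Xb := [seq vdot n r b | r <- s.1] in
  let bX := [seq sumz [seq zat b i * mat_at s.1 i j | i <- n] | j <- n] in
  let d' := s.2 + c * vdot n b Xb in
  ([seq [seq zdiv (d' * mat_at s.1 i j - c * (zat Xb i * zat bX j)) s.2 | j <- n] | i <- n], d').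

Definition idm (n : seq nat) : seq (seq int) := [seq [seq if i == j then 1 else 0 | j <- n] | i <- n].

Definition smor n c rows := foldl (smstep n c) (idm n, 1) rows.

Lemma sumz_iota n (F : nat -> int) : sumz [seq F j | j <- iota 0 n] = \sum_(j < n) F j.
Proof. by rewrite /sumz big_map -/(index_iota 0 n) -[n]subn0 big_mkord subn0. Qed.

Lemma zat_map n (F : nat -> int) (j : nat) : (j < n)%N -> zat [seq F j | j <- iota 0 n] j = F j.
Proof. by move=> jn; rewrite /zat (nth_map 0%N) ?size_iota // nth_iota. Qed.

Lemma mat_at_map n m (F : nat -> nat -> int) i j : (i < m)%N -> (j < n)%N ->
  mat_at [seq [seq F i j | j <- iota 0 n] | i <- iota 0 m] i j = F i j.
Proof. by move=> im jn; rewrite /mat_at (nth_map 0%N) ?size_iota // nth_iota // zat_map. Qed.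

Section SmorCorrect.
Variables (n : nat) (K : int).
Local Notation idxs := (iota 0 n).

Definition rowv (b : seq int) : 'rV[int]_n := \row_j zat b j.
Definition lmat (l : seq (seq int)) : 'M[int]_n := \matrix_(i, j) mat_at l i j.
Definition gramZ (rows : seq (seq int)) : 'M[int]_n :=
  1%:M + K ^+ 2 *: \sum_(b <- rows) ((rowv b)^T *m rowv b).
Definition rowsmx m (rows : seq (seq int)) : 'M[int]_(m, n) :=
  \matrix_(i, j) zat (nth [::] rows i) j.

Lemma gramZE (R : realFieldType) m rows : m = size rows ->
  map_mx (intr : int -> R) (gramZ rows) = gram (map_mx intr (rowsmx m rows)) K%:~R.
Proof.
move=> ->; apply/matrixP => i j; rewrite !mxE summxE rmorphD rmorphM rmorphXn /= rmorph_sum /=.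
congr (_ + _ * _); first by rewrite rmorphMn.
rewrite (big_nth [::]) big_mkord; apply: eq_bigr => k _.
by rewrite !mxE big_ord1 !mxE rmorphM.
Qed.

Lemma gramZ_rcons rows b :
  gramZ (rcons rows b) = gramZ rows + K ^+ 2 *: ((rowv b)^T *m rowv b).
Proof. by rewrite /gramZ -cats1 big_cat big_seq1 scalerDr addrA. Qed.

(** Supplies the nonzero determinants for the updates. Each new row adds to the determinant a value
    of the positive form given by the adjugate. *)
Lemma gramZ_det rows : 0 < \det (gramZ rows).
Proof.
elim/last_ind: rows => [|rows b IH].
  by rewrite /gramZ big_nil scaler0 addr0 det1.
rewrite gramZ_rcons det_update ?gt_eqF //; apply: ltr_wpDr => //.
rewrite mulr_ge0 ?sqr_ge0 // -(ler_int rat).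
pose f : {rmorphism int -> rat} := intr.
set G := map_mx f (gramZ rows).
have Gu : G \in unitmx by rewrite unitmxE unitfE det_map_mx /f /= intr_eq0 gt_eqF.
have XE : map_mx f (\adj (gramZ rows)) = f (\det (gramZ rows)) *: invmx G.
  rewrite /invmx Gu map_mx_adj det_map_mx scalerA mulfV ?scale1r //.
  by rewrite /f /= intr_eq0 gt_eqF.
have -> : ((rowv b *m \adj (gramZ rows) *m (rowv b)^T) 0 0)%:~R =
    (map_mx f (rowv b) *m map_mx f (\adj (gramZ rows)) *m (map_mx f (rowv b))^T) 0 0.
  by rewrite map_trmx -!map_mxM [RHS]mxE.
rewrite XE -scalemxAr -scalemxAl mxE mulr_ge0 //; first by rewrite /f /= ler0z ltW.
rewrite /G (@gramZE rat (size rows)) // -[X in X *m _ *m _]trmxK -mulmxA -dotE -/(pot _ _ _) potE.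
by apply: le_trans (gram_sq _ _ _); exact: dot_ge0.
Qed.

Lemma smorE rows : [/\ lmat (smor idxs (K ^+ 2) rows).1 = \adj (gramZ rows),
  (smor idxs (K ^+ 2) rows).2 = \det (gramZ rows) & size (smor idxs (K ^+ 2) rows).1 = n].
Proof.
rewrite /smor; elim/last_ind: rows => [|rows b [IH1 IH2 IH3]].
  rewrite /gramZ big_nil scaler0 addr0 det1 /=; split=> //; last by rewrite /idm size_map size_iota.
  rewrite -[RHS]mulmx1 mul_adj_mx det1; apply/matrixP => i j; rewrite !mxE mat_at_map //.
  by case: eqP => [/val_inj ->|/eqP ne]; rewrite ?eqxx // -val_eqE (negbTE ne).
rewrite -cats1 foldl_cat cats1 /=; move: (foldl _ _ _) IH1 IH2 IH3 => [X d] /= IH1 IH2 IH3.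
have G0 := gramZ_det rows; have G1 := gramZ_det (rcons rows b).
have XE (i j : 'I_n) : mat_at X i j = \adj (gramZ rows) i j by rewrite -IH1 mxE.
have Xb (i : 'I_n) : zat [seq vdot idxs r b | r <- X] i = (\adj (gramZ rows) *m (rowv b)^T) i 0.
  rewrite /zat (nth_map [::]) ?IH3 // /vdot sumz_iota mxE; apply: eq_bigr => k _.
  by rewrite -/(mat_at X i k) XE !mxE.
have bX (j : 'I_n) : zat [seq sumz [seq zat b i * mat_at X i j | i <- idxs] | j <- idxs] j =
    (rowv b *m \adj (gramZ rows)) 0 j.
  by rewrite zat_map // sumz_iota mxE; apply: eq_bigr => k _; rewrite XE !mxE.
have d'E : d + K ^+ 2 * vdot idxs b [seq vdot idxs r b | r <- X] = \det (gramZ (rcons rows b)).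
  rewrite gramZ_rcons det_update ?gt_eqF // IH2 -mulmxA mxE -[vdot _ b _]/(sumz _) sumz_iota.
  by congr (_ + _ * _); apply: eq_bigr => k _; rewrite Xb [rowv b 0 k]mxE.
split; [|by []|by rewrite size_map size_iota].
apply/matrixP => i j; rewrite mxE mat_at_map // Xb bX d'E XE IH2.
have := adj_update (b := rowv b) (c := K ^+ 2) (negbT (gt_eqF G0)).
rewrite -gramZ_rcons gt_eqF // => /(_ isT) /matrixP /(_ i j).
rewrite mxE [(_ *: \adj (gramZ rows)) i j]mxE [X in _ + X]mxE [X in _ - X]mxE [X in _ - _ * X]mxE big_ord1.
by move=> ->; rewrite mxE mulrC zdivK // gt_eqF.
Qed.

Lemma smor_shape rows i : (i < n)%N -> size (nth [::] (smor idxs (K ^+ 2) rows).1 i) = n.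
Proof.
move=> ni; rewrite /smor; elim/last_ind: rows => [|rows b _].
  by rewrite /= (nth_map 0%N) ?size_iota // size_map size_iota.
by rewrite -cats1 foldl_cat /= (nth_map 0%N) ?size_iota // size_map size_iota.
Qed.

(** All intermediate numbers are determinants or cofactors of a Gram matrix, hence of polynomial
    length however many rows have been processed. *)
Lemma smor_bound rows (Mb : nat) : (forall b j, b \in rows -> (`|zat b j| <= Mb)%N) ->
  let g := (1 + `|K| ^ 2 * (size rows * Mb ^ 2))%N in
  (`|(smor idxs (K ^+ 2) rows).2| <= n`! * g ^ n)%N /\
  forall i j, (i < n)%N -> (j < n)%N ->
    (`|mat_at (smor idxs (K ^+ 2) rows).1 i j| <= n`! * g ^ n)%N.
Proof.
move=> HM g; have [XE dE _] := smorE rows.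
have Gb (i j : 'I_n) : `|(gramZ rows i j)%:~R| <= g%:R :> rat.
  rewrite -intr_norm -[g%:R]/((Posz g)%:~R) ler_int !mxE summxE /g.
  apply: le_trans (ler_normD _ _) _; rewrite PoszD; apply: lerD; first by case: eqP.
  rewrite normrM normrX PoszM -abszX; apply: ler_pM; rewrite ?exprn_ge0 ?normr_ge0 //.
    by rewrite -abszE -normrX.
  apply: le_trans (ler_norm_sum _ _ _) _.
  apply: (@le_trans _ _ (\sum_(b <- rows) Posz (Mb ^ 2))).
    rewrite big_seq [X in _ <= X]big_seq; apply: ler_sum => b br.
    rewrite !mxE big_ord1 !mxE normrM -!abszE.
    have := HM b i br; have := HM b j br; rewrite lez_nat expnS expn1; nia.
  have -> : \sum_(b <- rows) Posz (Mb ^ 2) = Posz (size rows * Mb ^ 2) by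
    elim: (rows) => [|b l IH]; rewrite ?big_nil // big_cons IH /= mulSn PoszD.
  by [].
have g1 : 1 <= g%:R :> rat by rewrite ler1n /g.
have conv (z : int) : `|z%:~R| <= n`!%:R * g%:R ^+ n :> rat -> (`|z| <= n`! * g ^ n)%N.
  by rewrite -natrX -natrM -intr_norm -[X in _ <= X]/((Posz _)%:~R) ler_int -abszE lez_nat.
split.
  apply: conv; rewrite dE -(det_map_mx (intr : {rmorphism int -> rat})).
  by apply: det_bound; [rewrite ler0n|move=> i j; rewrite mxE; exact: Gb].
move=> i j ni nj; apply: conv.
have -> : mat_at (smor idxs (K ^+ 2) rows).1 i j = \adj (gramZ rows) (Ordinal ni) (Ordinal nj).
  by rewrite -XE mxE.
have -> : (\adj (gramZ rows) (Ordinal ni) (Ordinal nj))%:~R =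
   \adj (map_mx (intr : {rmorphism int -> rat}) (gramZ rows)) (Ordinal ni) (Ordinal nj) :> rat.
  by rewrite -map_mx_adj [RHS]mxE.
by apply: adj_bound => // a c; rewrite mxE; exact: Gb.
Qed.

End SmorCorrect.

(** Products of numbers in unary, to be used as iteration counts. *)
Definition umul (l1 l2 : seq bool) : seq bool := flatten [seq l2 | _ <- l1].

Lemma size_umul l1 l2 : size (umul l1 l2) = (size l1 * size l2)%N.
Proof. by rewrite /umul; elim: l1 => //= _ l1; rewrite size_cat => ->; rewrite mulSn. Qed.

Definition pow2 A (l : seq A) : int := Posz (bval (rcons [seq false | _ <- l] true)).

Lemma pow2E A (l : seq A) : pow2 l = 2 ^+ size l.
Proof.
rewrite /pow2; have -> : bval (rcons [seq false | _ <- l] true) = (2 ^ size l)%N.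
  by elim: l => //= _ l ->; rewrite expnS -addnn; lia.
by elim: (size l) => // k IH; rewrite expnS PoszM IH exprS.
Qed.

Lemma exp2z k : (2 : int) ^+ k = Posz (2 ^ k).
Proof. by elim: k => // k IH; rewrite exprS IH expnS PoszM. Qed.

Definition lpin := (seq (seq int) * seq bool)%type.

Section Solver.
Variable I : lpin.
Definition lp_n := idx I.2.
Definition lp_S := enc (code I).
(** Let s be the length of the code of the input; it bounds the number of variables, the number of
    rows and the bit length of entries. Then 5 s ^ 2 is an exponent beyond which a coordinate
    vanishes, 12 s ^ 3 is the phase length of [pot_cut], 2 ^ (20 s ^ 3) is a [K] large enough for
    rounding, and 15 s ^ 3 exceeds the number of phases. *)
Definition lp_L := umul lp_S (umul lp_S (nseq 5 true)).
Definition lp_T := umul lp_S (umul lp_S (umul lp_S (nseq 12 true))).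
Definition lp_K := pow2 (umul lp_S (umul lp_S (umul lp_S (nseq 20 true)))).
Definition lp_O := umul lp_S (umul lp_L (nseq 3 true)).

Definition lp_w (e : seq nat) (j : nat) : int :=
  if (nth 0%N e j <= size lp_L)%N then pow2 [seq a <- idx lp_L | (nth 0%N e j <= a)%N] else 0.
Definition lp_scaled (e : seq nat) :=
  [seq [seq zat r j * lp_w e j | j <- lp_n] | r <- I.1].
Definition lp_sm e := smor lp_n (lp_K ^+ 2) (lp_scaled e).
End Solver.

(** The surviving coordinates at which the inverse of [gram] applied to [y] is at most 1, a test
    cleared of its denominator, the determinant. *)
Definition lp_sel (q : lpin * seq nat * (seq (seq int) * int)) (y : seq int) :=
  [seq k <- lp_n q.1.1 | (nth 0%N q.1.2 k <= size (lp_L q.1.1))%N &&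
     (vdot (lp_n q.1.1) (nth [::] q.2.1 k) y <= q.2.2)].
Definition lp_ystep (q : lpin * seq nat * (seq (seq int) * int)) (y : seq int) :=
  if nilp (lp_sel q y) then y else
  [seq zat y j + (if j == head 0%N (lp_sel q y) then 1 else 0) | j <- lp_n q.1.1].
Definition lp_y (q : lpin * seq nat * (seq (seq int) * int)) :=
  iter (size (lp_T q.1.1)) (lp_ystep q) [seq 0 | _ <- lp_n q.1.1].
Definition lp_argmax (n : seq nat) (y : seq int) : nat :=
  head 0%N [seq k <- n | all (fun j => zat y j <= zat y k) n].
(** If some coordinate is still selected, the phase has made all its steps, so the largest
    coordinate of [y] is at least T / n and [pot_cut] halves the bound on it. *)
Definition lp_estep (I : lpin) (e : seq nat) :=
  let q := (I, e, lp_sm I e) in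
  if nilp (lp_sel q (lp_y q)) then e else
  [seq (if j == lp_argmax (lp_n I) (lp_y q) then (nth 0%N e j).+1 else nth 0%N e j) | j <- lp_n I].
Definition lp_e (I : lpin) := iter (size (lp_O I)) (lp_estep I) [seq 0%N | _ <- lp_n I].
(** The survivors are the support of a solution of largest support, so it remains to look up the
    coordinates required to be positive. *)
Definition lp_solve (I : lpin) : bool :=
  all (fun j => ~~ nth false I.2 j || (nth 0%N (lp_e I) j <= size (lp_L I))%N) (lp_n I).

Arguments lp_S : simpl never.
Arguments lp_L : simpl never.
Arguments lp_T : simpl never.
Arguments lp_K : simpl never.
Arguments lp_O : simpl never.
Arguments lp_sm : simpl never.

Lemma fact_pow2 n : (n`! <= 2 ^ (n * n))%N.
Proof.
elim: n => // n IH; rewrite factS.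
apply: leq_trans (leq_mul (ltn_expl n (ltnSn 1)) IH) _.
by rewrite -expnD leq_exp2l //; lia.
Qed.

Lemma cbound_pow2 (R : realFieldType) n s : cbound n (2 ^+ s : R) <= 2 ^+ (n * n + s * n + n).
Proof.
rewrite /cbound -exprM !exprD; apply: ler_pM; rewrite ?mulr_ge0 ?ler0n ?exprn_ge0 //.
  by apply: ler_pM; rewrite ?ler0n ?exprn_ge0 // -natrX ler_nat fact_pow2.
by rewrite -natrX ler_nat ltnW // ltn_expl.
Qed.

Lemma size_filter_ge N k : size [seq a <- iota 0 N | (k <= a)%N] = (N - k)%N.
Proof.
elim: N => // N IH; rewrite -addn1 iotaD filter_cat size_cat IH /= add0n.
by case: leqP => /=; lia.
Qed.

Section SolverCorrect.
Variables (R : realFieldType) (I : lpin).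
Local Notation n := (size I.2).
Local Notation m := (size I.1).
Local Notation sg := (size (lp_S I)).
Local Notation Lb := (size (lp_L I)).
Local Notation Tn := (size (lp_T I)).
Local Notation A := (rowsmx n m I.1).
Local Notation AR := (map_mx (intr : int -> R) A).
Definition ef (e : seq nat) (j : 'I_n) : nat := nth 0%N e j.

Lemma lp_nE : lp_n I = iota 0 n. Proof. by []. Qed.

Lemma sg_gt0 : (0 < sg)%N. Proof. exact: (sz_gt0 I). Qed.

Lemma sgE : sg = sz I. Proof. by []. Qed.

Lemma n_le_sg : (n <= sg)%N.
Proof.
rewrite sgE; case: I => a p; rewrite szP /=; pose proof (size_sz p); lia.
Qed.

Lemma m_le_sg : (m <= sg)%N.
Proof.
rewrite sgE; case: I => a p; rewrite szP /=; pose proof (size_sz a); lia.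
Qed.

Lemma zat_bound b j : b \in I.1 -> (`|zat b j| < 2 ^ sg)%N.
Proof.
move=> bI; have [jb|jb] := ltnP j (size b); last by rewrite /zat nth_default // expn_gt0.
apply: leq_trans (lt_sz_int _) _; rewrite leq_exp2l // sgE.
have h1 : (sz (zat b j) < sz b)%N by apply: mem_sz; exact: mem_nth.
have h2 : (sz b < sz I.1)%N by exact: mem_sz.
apply: leq_trans (ltnW h1) _; apply: leq_trans (ltnW h2) _.
by case: (I) => a p; rewrite szP; exact: leqW (leq_addr _ _).
Qed.

Lemma LbE : Lb = (sg * (sg * 5))%N. Proof. by rewrite !size_umul. Qed.
Lemma TnE : Tn = (sg * (sg * (sg * 12)))%N. Proof. by rewrite !size_umul. Qed.
Lemma KE : lp_K I = 2 ^+ (sg * (sg * (sg * 20)))%N. Proof. by rewrite /lp_K pow2E !size_umul. Qed.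

Lemma A_bound i j : `|A i j|%:~R <= 2 ^+ sg :> R.
Proof.
rewrite mxE -[2]/(2%:~R) -rmorphXn ler_int.
have := @zat_bound (nth [::] I.1 i) j (mem_nth _ (ltn_ord i)).
by rewrite exp2z -abszE lez_nat => /ltnW.
Qed.

Lemma HLb : cbound n (2 ^+ sg : R) * 2 ^+ sg + 1 <= 2 ^+ Lb.
Proof.
have h := cbound_pow2 R n sg.
apply: (@le_trans _ _ (2 ^+ (n * n + sg * n + n) * 2 ^+ sg + 2 ^+ (n * n + sg * n + n + sg))).
  apply: lerD; first by rewrite ler_wpM2r ?exprn_ge0.
  by rewrite exprn_ege1 //; lra.
rewrite -exprD; set e0 := (_ + sg)%N.
have -> : 2 ^+ e0 + 2 ^+ e0 = 2 ^+ e0.+1 :> R by rewrite exprS; ring.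
rewrite ler_weXn2l //; first lra.
rewrite /e0 LbE; have := n_le_sg; have := sg_gt0; nia.
Qed.

Lemma M_ge1 : 1 <= 2 ^+ sg :> R. Proof. by rewrite exprn_ege1 //; lra. Qed.

Lemma lp_wE e (j : 'I_n) : lp_w I e j = if (ef e j <= Lb)%N then 2 ^+ (Lb - ef e j) else 0.
Proof. by rewrite /lp_w; case: ifP => // _; rewrite pow2E size_filter_ge. Qed.

Lemma scaledE e : rowsmx n m (lp_scaled I e) = scaled A Lb (ef e).
Proof.
apply/matrixP => i j; rewrite !mxE -lp_wE /lp_scaled.
by rewrite (nth_map [::]) // zat_map.
Qed.

Local Notation Kz := (lp_K I).
Local Notation KR := (Kz%:~R : R).
Local Notation BR e := (map_mx (intr : int -> R) (scaled A Lb (ef e))).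

Lemma gramE e : map_mx (intr : int -> R) (gramZ n Kz (lp_scaled I e)) = gram (BR e) KR.
Proof. by rewrite (@gramZE n Kz R m) ?size_map // scaledE. Qed.

Definition ycol (y : seq int) : 'cV[R]_n := \col_j (zat y j)%:~R.

Lemma lp_testE e y (k : 'I_n) :
  (vdot (lp_n I) (nth [::] (lp_sm I e).1 k) y <= (lp_sm I e).2) =
  ((invmx (gram (BR e) KR) *m ycol y) k 0 <= 1).
Proof.
rewrite /lp_sm lp_nE; have [XE -> _] := smorE n Kz (lp_scaled I e).
have d0 := gramZ_det n Kz (lp_scaled I e).
set G := gramZ _ _ _ in XE d0 *.
have dR : 0 < (\det G)%:~R :> R by rewrite ltr0z.
have -> : invmx (gram (BR e) KR) = ((\det G)%:~R)^-1 *: map_mx intr (\adj G).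
  rewrite -gramE -/G /invmx unitmxE unitfE.
  rewrite (det_map_mx (intr : {rmorphism int -> R})) gt_eqF //=.
  by rewrite (map_mx_adj (intr : {rmorphism int -> R})).
rewrite -scalemxAl mxE mulrC ler_pdivrMr // mul1r.
rewrite -(ler_int R) /vdot sumz_iota mxE rmorph_sum /=; congr (_ <= _).
by apply: eq_bigr => j _; rewrite rmorphM -XE !mxE.
Qed.

Definition qof e := (I, e, lp_sm I e).

Lemma lp_selP e y (k : 'I_n) : (val k \in lp_sel (qof e) y) =
  (ef e k <= Lb)%N && ((invmx (gram (BR e) KR) *m ycol y) k 0 <= 1).
Proof. by rewrite mem_filter -lp_testE lp_nE mem_iota /= ltn_ord andbT. Qed.

Definition ygood e (c : nat) (y : seq int) :=
  [/\ forall j, 0 <= zat y j, forall j : 'I_n, (Lb < ef e j)%N -> zat y j = 0,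
      \sum_(j < n) zat y j = c%:Z & pot (BR e) KR (ycol y) <= 3 * c%:R].

Lemma lp_ystep_good e c y : ygood e c y -> ~~ nilp (lp_sel (qof e) y) ->
  ygood e c.+1 (lp_ystep (qof e) y).
Proof.
move=> [y0 ys yc yp] nn; rewrite /lp_ystep (negbTE nn).
have [k kE] : exists k : 'I_n, head 0%N (lp_sel (qof e) y) = val k.
  have : head 0%N (lp_sel (qof e) y) \in lp_sel (qof e) y.
    by case: (lp_sel _ _) nn => //= a l _; rewrite inE eqxx.
  by rewrite mem_filter lp_nE mem_iota => /andP [_ /andP [_ lk]]; exists (Ordinal lk).
have : val k \in lp_sel (qof e) y.
  by rewrite -kE; case: (lp_sel _ _) nn => //= a l _; rewrite inE eqxx.
rewrite lp_selP => /andP [ke kv]; rewrite kE lp_nE.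
have yE (j : 'I_n) : zat [seq zat y j + (if j == val k then 1 else 0) | j <- iota 0 n] j =
   zat y j + (if j == k then 1 else 0) by rewrite zat_map.
split.
- move=> j; have [jn|jn] := ltnP j n.
    by rewrite zat_map // addr_ge0 //; case: ifP.
  by rewrite /zat nth_default // size_map size_iota.
- move=> j hj; rewrite yE ys // add0r; case: eqP => // jk.
  by move: hj; rewrite jk ltnNge ke.
- under eq_bigr do rewrite yE.
  by rewrite big_split /= yc -big_mkcond big_pred1_eq -addn1 PoszD.
- have -> : ycol [seq zat y j + (if j == val k then 1 else 0) | j <- iota 0 n] =
      ycol y + delta_mx k 0.
    apply/matrixP => j z; rewrite (ord1 z) [LHS]mxE yE !mxE eqxx andbT rmorphD /=.
    by case: (j == k).
  apply: le_trans (pot_step kv) _; rewrite -natr1; lra.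
Qed.

Lemma lp_y_good e : exists c, [/\ ygood e c (lp_y (qof e)), (c <= Tn)%N &
  ~~ nilp (lp_sel (qof e) (lp_y (qof e))) -> c = Tn].
Proof.
rewrite /lp_y; elim: (size _) => [|t [c [gc ct cn]]].
  exists 0%N; split=> //; split=> [j|j _||].
  - have [jn|jn] := ltnP j n; first by rewrite zat_map.
    by rewrite /zat nth_default // size_map size_iota.
  - by rewrite zat_map.
  - by rewrite big1 // => j _; rewrite zat_map.
  - have -> : ycol [seq 0 | _ <- lp_n (qof e).1.1] = 0.
      by apply/matrixP => j z; rewrite !mxE zat_map.
    by rewrite pot0 mulr0.
rewrite iterS; set y := iter _ _ _ in gc ct cn *.
have [nn|nn] := boolP (nilp (lp_sel (qof e) y)).
  by exists c; rewrite /lp_ystep nn; split=> //; [lia|rewrite nn].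
by exists c.+1; split; [exact: lp_ystep_good|rewrite (cn nn)|rewrite (cn nn)].
Qed.

Definition lp_done e := nilp (lp_sel (qof e) (lp_y (qof e))).

Lemma T_ge : (0 < n)%N -> 12 * n%:R ^+ 3 <= Tn%:R :> R.
Proof.
move=> n0; rewrite -natrX -natrM ler_nat TnE !expnS expn0.
have h := n_le_sg; apply: (@leq_trans (12 * (sg * (sg * (sg * 1))))%N); last by lia.
by rewrite leq_mul2l /= !leq_mul.
Qed.

Lemma lp_estep_inv e : size e = n -> Inv R A (ef e) -> ~~ lp_done e ->
  [/\ Inv R A (ef (lp_estep I e)), size (lp_estep I e) = n &
    exists k : 'I_n, (ef e k <= Lb)%N /\
      forall j : 'I_n, ef (lp_estep I e) j = if j == k then (ef e j).+1 else ef e j].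
Proof.
move=> se ie nd; rewrite /lp_estep -/(qof e); rewrite /lp_done in nd; rewrite (negbTE nd).
have [c [[y0 ys yc yp] ct cn]] := lp_y_good e; rewrite (cn nd) in yc yp.
set y := lp_y (qof e) in y0 ys yc yp *.
have n0 : (0 < n)%N.
  rewrite lt0n; apply/negP => /eqP n0; move: nd; rewrite /lp_sel.
  by rewrite /qof /= lp_nE n0.
have [k [kE kmax]] : exists k : 'I_n, lp_argmax (lp_n I) y = val k /\
    forall j : 'I_n, zat y j <= zat y k.
  have [i0 _ i0max] := @Order.TotalTheory.arg_maxP _ int 'I_n (Ordinal n0) xpredT (fun j => zat y j) isT.
  have hin : val i0 \in [seq k <- lp_n I | all (fun j => zat y j <= zat y k) (lp_n I)].
    rewrite mem_filter lp_nE mem_iota /= ltn_ord andbT; apply/allP => j.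
    by rewrite mem_iota => /andP [_ lj]; exact: (i0max (Ordinal lj)).
  have : lp_argmax (lp_n I) y \in [seq k <- lp_n I | all (fun j => zat y j <= zat y k) (lp_n I)].
    by rewrite /lp_argmax; case: [seq _ <- _ | _] hin => //= a l _; rewrite inE eqxx.
  rewrite mem_filter lp_nE mem_iota => /andP [/allP h /andP [_ lk]].
  exists (Ordinal lk); split=> // j; apply: h.
  by rewrite mem_iota /= add0n ltn_ord.
have yk : Tn%:Z <= zat y k * n%:Z.
  rewrite -yc; apply: (@le_trans _ _ (\sum_(j < n) zat y k)); first exact: ler_sum.
  by rewrite sumr_const card_ord -mulr_natr natz.
have Tpos : (0 < Tn)%N by rewrite TnE; have := sg_gt0; nia.
have ke : (ef e k <= Lb)%N.
  rewrite leqNgt; apply/negP => /ys yk0; move: yk; rewrite yk0 mul0r.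
  by rewrite lez_nat leqNgt Tpos.
have eE (j : 'I_n) : ef [seq (if j == val k then (nth 0%N e j).+1 else nth 0%N e j) | j <- lp_n I] j =
   if j == k then (ef e j).+1 else ef e j.
  by rewrite /ef (nth_map 0%N) ?size_iota // lp_nE nth_iota.
rewrite kE; split.
- have W : Inv R A (fun j => if j == k then (ef e j).+1 else ef e j).
    apply: (@Inv_step R m n A (2 ^+ sg) Lb M_ge1 A_bound HLb (ef e) KR Tn%:R ie (ycol y) k) => //.
    + by move=> i; rewrite mxE ler0z.
    + exact: T_ge.
    + by rewrite mxE; move: yk; rewrite -(ler_int R) rmorphM /=.
  by move=> x Ax x01 j; rewrite eE; exact: W.
- by rewrite size_map size_iota.
- by exists k.
Qed.

(** An unfinished phase raises one exponent, and only one that is at most [Lb]. The exponents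
    therefore add up to at most n (Lb + 1), which bounds the number of such phases. *)
Lemma lp_e_spec : [/\ size (lp_e I) = n, Inv R A (ef (lp_e I)) & lp_done (lp_e I)].
Proof.
rewrite /lp_e.
have H t : [/\ size (iter t (lp_estep I) [seq 0%N | _ <- lp_n I]) = n,
    Inv R A (ef (iter t (lp_estep I) [seq 0%N | _ <- lp_n I])) &
    lp_done (iter t (lp_estep I) [seq 0%N | _ <- lp_n I]) \/
    (t <= \sum_j ef (iter t (lp_estep I) [seq 0%N | _ <- lp_n I]) j)%N /\
    forall j, (ef (iter t (lp_estep I) [seq 0%N | _ <- lp_n I]) j <= Lb.+1)%N].
  elim: t => [|t [se ie dt]].
    have e0 (j : 'I_n) : ef [seq 0%N | _ <- lp_n I] j = 0%N.
      by rewrite /ef (nth_map 0%N) // size_iota.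
    split; first by rewrite size_map size_iota.
      by move=> x Ax x01 j; rewrite e0; exact: (@Inv0 R m n A x Ax x01 j).
    by right; split=> // j; rewrite e0.
  rewrite iterS; set e := iter _ _ _ in se ie dt *.
  have [d|nd] := boolP (lp_done e).
    have -> : lp_estep I e = e by have := d; rewrite /lp_done /lp_estep -/(qof e) => ->.
    by split=> //; left.
  have [i2 s2 [k [ke e2]]] := lp_estep_inv se ie nd; split=> //.
  right; case: dt => [d|[tb eb]]; first by rewrite d in nd.
  split.
    under eq_bigr do rewrite e2.
    have -> : (\sum_(j < n) (if j == k then (ef e j).+1 else ef e j) = \sum_j ef e j + 1)%N.
      rewrite (bigD1 k) //= eqxx [in RHS](bigD1 k) //= addSn addn1; congr (_ + _).+1.
      by apply: eq_bigr => j /negbTE ->.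
    by rewrite addn1 ltnS.
  by move=> j; rewrite e2; case: eqP => [->|_] //; exact: eb.
have [se ie dt] := H (size (lp_O I)); split=> //.
case: dt => // -[tb eb]; exfalso.
have : (\sum_(j < n) ef (iter (size (lp_O I)) (lp_estep I) [seq 0%N | _ <- lp_n I]) j <= n * Lb.+1)%N.
  by rewrite -[X in (X * _)%N]card_ord -sum_nat_const; exact: leq_sum.
move: tb; rewrite /lp_O size_umul (size_umul (lp_L I)) [size (nseq 3 true)]/=.
move: (\sum_(j < n) _)%N => S0 h1 h2.
have h3 : (n * Lb.+1 <= sg * Lb.+1)%N by rewrite leq_mul2r n_le_sg orbT.
have h4 : (0 < Lb)%N by rewrite LbE; have := sg_gt0; nia.
have h5 : (sg * 1 <= sg * Lb)%N by rewrite leq_mul2l h4 orbT.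
have h6 := sg_gt0; rewrite mulnS in h3; lia.
Qed.

(** The procedure is integral and the field is arbitrary: this is the bridge from real schedulers to
    a computation. *)
Theorem lp_solveP : lp_solve I <-> exists x : 'cV[R]_n,
  [/\ AR *m x = 0, forall j, 0 <= x j 0 & forall j : 'I_n, nth false I.2 j -> 0 < x j 0].
Proof.
have [se ie dn] := lp_e_spec.
have K0 : 0 < KR by rewrite ltr0z KE exprn_gt0.
split=> [/allP H|[x [Ax x0 xp]]]; last first.
  apply/allP => j; rewrite mem_iota => /andP [_ jn].
  case E : (nth _ _ _) => //=; have := xp (Ordinal jn) E; rewrite leqNgt.
  apply: contraPN => h; have := Inv_vanish M_ge1 A_bound HLb ie (k := Ordinal jn) h Ax x0.
  by move=> ->; rewrite ltxx.
have [c [[y0 ys yc yp] ct cn]] := lp_y_good (lp_e I).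
have := @Done_feasible R m n A (2 ^+ sg) Lb M_ge1 A_bound (ef (lp_e I)) KR Tn%:R K0 (ycol (lp_y (qof (lp_e I)))).
case.
- by move=> j; rewrite mxE ler0z.
- by move=> j /ys; rewrite mxE => ->.
- by apply: le_trans yp _; rewrite ler_wpM2l // ler_nat.
- by rewrite ler1n TnE; have := sg_gt0; nia.
- have -> : KR = 2 ^+ (sg * (sg * (sg * 20))) by rewrite KE rmorphXn.
  rewrite -exprD.
  apply: (@le_lt_trans _ _ (2 ^+ (n * n + (sg + Lb) * n + n) * 2 ^+ (5 + 3 * sg))).
    apply: ler_pM; [by rewrite /cbound !mulr_ge0 ?ler0n ?exprn_ge0|by rewrite mulr_ge0 ?ler0n|exact: cbound_pow2|].
    rewrite -natrM -natrX ler_nat TnE expnD (mulnC 3) expnM.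
    have h : (sg <= 2 ^ sg)%N by rewrite ltnW // ltn_expl.
    move: (2 ^ sg)%N h => p h.
    apply: (@leq_trans (24 * (p * (p * (p * 1))))); last by rewrite !expnS expn0; lia.
    apply: (@leq_trans (24 * (sg * (sg * (sg * 1))))); first by lia.
    by rewrite leq_mul2l /= !leq_mul.
  rewrite -exprD ltr_eXn2l //; last by lra.
  rewrite LbE; have := n_le_sg; have := sg_gt0; nia.
- move=> j ej; rewrite ltNge; apply/negP => vj.
  have : val j \in lp_sel (qof (lp_e I)) (lp_y (qof (lp_e I))) by rewrite lp_selP ej vj.
  by move: dn; rewrite /lp_done; case: (lp_sel _ _).
move=> x [Ax x0 xp]; exists x; split=> // j pj; apply/xp.
by have := H j; rewrite lp_nE mem_iota /= ltn_ord pj => /(_ isT).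
Qed.

End SolverCorrect.

End LinearSolver.
Import LinearSolver.

(** * The solver runs in polynomial time *)

Module LinearSolverTime.

Local Open Scope ring_scope.

Lemma fpc_iter_env X S A {eX : Enc X} {eS : Enc S} {eA : Enc A} (f : X -> S -> S)
    (s : X -> S) (l : X -> seq A) (p : nat -> nat) :
  fpc (fun q : X * S => f q.1 q.2) -> fpc s -> fpc l -> pol p ->
  (forall x j, (j <= size (l x))%N -> (sz (iter j (f x) (s x)) <= p (sz x))%N) ->
  fpc (fun x => iter (size (l x)) (f x) (s x)).
Proof.
move=> hf hs hl hp H.
have E x (u : seq A) a : foldl (fun s _ => f x s) a u = iter (size u) (f x) a.
  by elim: u a => //= b u IH a; rewrite IH -iterSr.
apply: (eq_fpc (f := fun x => foldl (fun s (_ : A) => f x s) (s x) (l x))) => [x|].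
  exact: E.
apply: (fpc_foldl (f := fun x s (_ : A) => f x s) (p := p)) => //.
  by apply: (fpc_comp (f := fun q : X * S * A => (q.1.1, q.1.2))) hf; fpa.
by move=> x j lj; rewrite E size_take_min (minn_idPl lj); exact: H.
Qed.

Lemma fpc_umul : fpc (fun q : seq bool * seq bool => umul q.1 q.2).
Proof. by rewrite /umul; fpa. Qed.

Lemma fpc_pow2 A {eA : Enc A} : fpc (@pow2 A).
Proof.
apply: (eq_fpc (f := fun l : seq A => Posz (bval ([seq false | _ <- l] ++ [:: true])))) => [l|].
  by rewrite /pow2 cats1.
by fpa.
Qed.

Lemma fpc_zat : fpc (fun q : seq int * nat => zat q.1 q.2).
Proof. by rewrite /zat; fpa. Qed.

Lemma fpc_mat_at : fpc (fun q : seq (seq int) * nat * nat => mat_at q.1.1 q.1.2 q.2).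
Proof. by rewrite /mat_at /zat; fpa. Qed.

#[export] Hint Resolve fpc_umul fpc_pow2 fpc_zat fpc_mat_at : fpdb.

Lemma fpc_vdot : fpc (fun q : seq nat * seq int * seq int => vdot q.1.1 q.1.2 q.2).
Proof. by rewrite /vdot; fpa. Qed.

#[export] Hint Resolve fpc_vdot : fpdb.

Definition smenv := (seq nat * int * (seq (seq int) * int) * seq int)%type.

Lemma fpc_smstep : fpc (fun q : smenv => smstep q.1.1.1 q.1.1.2 q.1.2 q.2).
Proof. by rewrite /smstep; cbv zeta; fpa. Qed.

Lemma fpc_lp_n : fpc lp_n. Proof. by rewrite /lp_n; fpa. Qed.
Lemma fpc_lp_S : fpc lp_S. Proof. by rewrite /lp_S; fpa. Qed.
#[export] Hint Resolve fpc_lp_n fpc_lp_S : fpdb.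
Lemma fpc_lp_L : fpc lp_L. Proof. by rewrite /lp_L; fpa. Qed.
Lemma fpc_lp_T : fpc lp_T. Proof. by rewrite /lp_T; fpa. Qed.
Lemma fpc_lp_K : fpc lp_K. Proof. by rewrite /lp_K; fpa. Qed.
#[export] Hint Resolve fpc_lp_L fpc_lp_T fpc_lp_K : fpdb.
Lemma fpc_lp_O : fpc lp_O. Proof. by rewrite /lp_O; fpa. Qed.
#[export] Hint Resolve fpc_lp_O : fpdb.

Lemma fpc_lp_w : fpc (fun q : lpin * seq nat * nat => lp_w q.1.1 q.1.2 q.2).
Proof. by rewrite /lp_w; fpa. Qed.
#[export] Hint Resolve fpc_lp_w : fpdb.

Lemma fpc_lp_scaled : fpc (fun q : lpin * seq nat => lp_scaled q.1 q.2).
Proof. by rewrite /lp_scaled; fpa. Qed.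
#[export] Hint Resolve fpc_lp_scaled : fpdb.

Lemma sz_ints (l : seq int) k : (forall j, (`|zat l j| < 2 ^ k)%N) ->
  (sz l <= size l * (4 * k + 6) + 1)%N.
Proof.
move=> H; have := @sz_seq_bound _ _ l (4 * k + 5); rewrite -addnS; apply => i il d.
rewrite (set_nth_default 0) //; apply: sz_int_leq; exact: H.
Qed.

Lemma sz_nats (l : seq nat) k : (forall j, (nth 0%N l j < 2 ^ k)%N) ->
  (sz l <= size l * (4 * k + 2) + 1)%N.
Proof.
move=> H; have := @sz_seq_bound _ _ l (4 * k + 1); rewrite -addnS; apply => i il d.
rewrite (set_nth_default 0%N) //; apply: sz_nat_leq; exact: H.
Qed.

(** Bit length of the numbers in [smor_bound]: s ^ 2 comes from the factorial; in a Gram entry 40 s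
    ^ 3 comes from K ^ 2, and 2 s + 10 s ^ 2 from the product of two scaled entries, with a further
    s for the number of rows. *)
Definition sm_exp (s : nat) := (s * s + (2 + 40 * s * s * s + 3 * s + 10 * s * s) * s + 1)%N.

Lemma fpc_lp_sm : fpc (fun q : lpin * seq nat => lp_sm q.1 q.2).
Proof.
apply: (fpc_foldl (f := fun q : lpin * seq nat => smstep (lp_n q.1) (lp_K q.1 ^+ 2))
  (p := fun s => s * (s * (4 * sm_exp s + 6) + 2) + 1 + (4 * sm_exp s + 5) + 1)%N).
- apply: (fpc_comp (f := fun q : lpin * seq nat * (seq (seq int) * int) * seq int =>
     (lp_n q.1.1.1, lp_K q.1.1.1 ^+ 2, q.1.2, q.2))) fpc_smstep.
  apply: (eq_fpc (f := fun q : lpin * seq nat * (seq (seq int) * int) * seq int =>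
     (lp_n q.1.1.1, lp_K q.1.1.1 * lp_K q.1.1.1, q.1.2, q.2))) => [q|]; first by rewrite expr2.
  by fpa.
- by rewrite /idm; fpa.
- exact: fpc_lp_scaled.
- by rewrite /sm_exp; pols.
move=> [I e] j _; cbv beta; rewrite ![(I, e).1]/=.
set rows := take _ _.
rewrite -/(smor _ _ rows).
have [_ _ sX] := smorE (size I.2) (lp_K I) rows.
have sR := @smor_shape (size I.2) (lp_K I) rows.
have [] := @smor_bound (size I.2) (lp_K I) rows (2 ^ (size (lp_S I) + size (lp_L I))).
  move=> b k /mem_take /mapP [r rI ->].
  have [kn|kn] := ltnP k (size I.2); last by rewrite /zat nth_default ?size_map ?size_iota.
  rewrite zat_map // abszM expnD; apply: leq_mul; first exact: ltnW (zat_bound _ rI).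
  rewrite /lp_w; case: ifP => _ //; rewrite pow2E exp2z absz_nat leq_exp2l //.
  by rewrite size_filter_ge; lia.
rewrite -[iota 0 _]/(lp_n I) in sX sR *.
set g := (1 + _)%N.
case: (smor _ _ rows) sX sR => X d.
rewrite ![(X, d).1]/= ![(X, d).2]/= => sX sR dB XB.
have s1 : (size (lp_S I) <= sz (I, e))%N by rewrite szP; exact: leqW (leq_addr _ _).
set s := sz (I, e) in s1 *.
have gB : ((size I.2)`! * g ^ size I.2 < 2 ^ sm_exp s)%N.
  have h1 := fact_pow2 (size I.2); have nS := n_le_sg I.
  have gb : (g <= 2 ^ (2 + 40 * s * s * s + 3 * s + 10 * s * s))%N.
    have rs : (size rows <= 2 ^ s)%N.
      apply: leq_trans (ltnW (ltn_expl s (ltnSn 1))).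
      have := m_le_sg I; rewrite /rows size_take_min size_map; lia.
    rewrite /g KE exp2z absz_nat -!expnM.
    set a := (_ * 2)%N; set b := (_ * 2)%N.
    apply: (@leq_trans (1 + 2 ^ (a + s + b))%N).
      by rewrite leq_add2l !expnD -mulnA leq_mul2l leq_mul2r rs !orbT.
    apply: (@leq_trans (2 ^ (a + s + b).+1)%N).
      by have : (0 < 2 ^ (a + s + b))%N; [rewrite expn_gt0|rewrite expnS; lia].
    rewrite leq_exp2l // /a /b LbE.
    have := s1; move: (size (lp_S I)) => t ts.
    have t2 : (t * t <= s * s)%N by rewrite leq_mul.
    have t3 : (t * (t * t) <= s * (s * s))%N by rewrite leq_mul.
    by lia.
  have g0 : (g ^ size I.2 <= (2 ^ (2 + 40 * s * s * s + 3 * s + 10 * s * s)) ^ s)%N.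
    apply: leq_trans (leq_exp2rW _ gb) _; rewrite leq_pexp2l ?expn_gt0 //; lia.
  rewrite -expnM in g0.
  have h2 : (2 ^ (size I.2 * size I.2) <= 2 ^ (s * s))%N by rewrite leq_exp2l // leq_mul //; lia.
  rewrite /sm_exp addn1 expnS expnD.
  have := leq_mul (leq_trans h1 h2) g0.
  have : (0 < 2 ^ (s * s) * 2 ^ ((2 + 40 * s * s * s + 3 * s + 10 * s * s) * s))%N.
    by rewrite muln_gt0 !expn_gt0.
  lia.
rewrite szP.
have hd := sz_int_leq (leq_ltn_trans dB gB).
have ns : (size I.2 <= s)%N by apply: leq_trans (n_le_sg I) s1.
have hX : (sz X <= size X * (s * (4 * sm_exp s + 6) + 1).+1 + 1)%N.
  apply: sz_seq_bound => i iX dd; rewrite (set_nth_default [::]) //; rewrite sX in iX.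
  apply: leq_trans (sz_ints (k := sm_exp s) _) _; last first.
    by rewrite sR // leq_add2r leq_mul2r ns orbT.
  move=> k; have [kn|kn] := ltnP k (size I.2).
    exact: leq_ltn_trans (XB i k iX kn) gB.
  by rewrite /zat nth_default ?sR ?expn_gt0.
rewrite sX in hX.
have hs : (size I.2 * (s * (4 * sm_exp s + 6) + 1).+1 <= s * (s * (4 * sm_exp s + 6) + 1).+1)%N.
  by rewrite leq_mul2r ns orbT.
have {hs}hX := leq_trans hX (leq_add hs (leqnn 1)).
clearbody s; move: hX hd; clear.
move: (sz X) (sz d) (sm_exp s) => zx zd v.
have -> : ((s * (4 * v + 6) + 1).+1 = s * (4 * v + 6) + 2)%N by rewrite addn1 addn2.
move: (s * _)%N => w; lia.
Qed.


Definition lpq := (lpin * seq nat * (seq (seq int) * int))%type.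

#[export] Hint Resolve fpc_lp_sm : fpdb.

Lemma fpc_lp_sel : fpc (fun q : lpq * seq int => lp_sel q.1 q.2).
Proof. by rewrite /lp_sel; fpa. Qed.
#[export] Hint Resolve fpc_lp_sel : fpdb.

Lemma fpc_lp_ystep : fpc (fun q : lpq * seq int => lp_ystep q.1 q.2).
Proof. by rewrite /lp_ystep; fpa. Qed.

Lemma lp_y_bound (q : lpq) t : let y := iter t (lp_ystep q) [seq 0 | _ <- lp_n q.1.1] in
  size y = size q.1.1.2 /\ forall j, (`|zat y j| <= t)%N.
Proof.
elim: t => [|t] /=.
  split; first by rewrite size_map size_iota.
  move=> j; rewrite /zat; have [h|h] := ltnP j (size q.1.1.2).
    by rewrite (nth_map 0%N) // size_iota.
  by rewrite nth_default // size_map size_iota.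
move: (iter t _ _) => y [sy yb]; rewrite /lp_ystep; case: ifP => _.
  by split=> // j; exact: leqW.
split; first by rewrite size_map size_iota.
move=> j; have [h|h] := ltnP j (size q.1.1.2); last first.
  by rewrite /zat nth_default // size_map size_iota.
by rewrite zat_map //; have := yb j; case: ifP; lia.
Qed.

Lemma fpc_lp_y : fpc lp_y.
Proof.
have [k Hk] := fpc_sz fpc_lp_T.
apply: (fpc_iter_env (f := lp_ystep) (p := fun s => s * (4 * pb k s + 6) + 1)%N).
- exact: fpc_lp_ystep.
- by fpa.
- by fpa.
- by pols.
move=> q j jT; have [sy yb] := lp_y_bound q j.
have h1 : (sz q.1.1 <= sz q)%N by case: q {jT sy yb} => [[I e] s]; rewrite !szP /=; lia.
have h2 : (size q.1.1.2 <= sz q)%N by have := n_le_sg q.1.1; rewrite sgE; lia.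
have h3 : (j <= pb k (sz q))%N.
  apply: leq_trans jT _; apply: leq_trans (ltnW (size_sz _)) _.
  by apply: leq_trans (Hk _) (pb_mono _ _).
apply: leq_trans (sz_ints (k := pb k (sz q)) _) _.
  by move=> i; apply: leq_ltn_trans (leq_trans (yb i) h3) (ltn_expl _ _).
by rewrite sy leq_add2r leq_mul2r h2 orbT.
Qed.

#[export] Hint Resolve fpc_lp_y : fpdb.

Lemma fpc_lp_argmax : fpc (fun q : seq nat * seq int => lp_argmax q.1 q.2).
Proof. by rewrite /lp_argmax; fpa. Qed.
#[export] Hint Resolve fpc_lp_argmax : fpdb.

#[local] Opaque lp_y lp_sm lp_sel lp_argmax lp_n.

Lemma fpc_lp_estep : fpc (fun q : lpin * seq nat => lp_estep q.1 q.2).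
Proof.
have hQ : fpc (fun x : lpin * seq nat => (x.1, x.2, lp_sm x.1 x.2) : lpq) by fpa.
pose g (q : lpq) := if nilp (lp_sel q (lp_y q)) then q.1.2 else
  [seq (if j == lp_argmax (lp_n q.1.1) (lp_y q) then (nth 0%N q.1.2 j).+1 else nth 0%N q.1.2 j)
  | j <- lp_n q.1.1].
have hg : fpc g by rewrite /g; fpa.
exact: (fpc_comp hQ hg).
Qed.

#[local] Transparent lp_y lp_sm lp_sel lp_argmax lp_n.

Lemma lp_e_bound (I : lpin) t : let e := iter t (lp_estep I) [seq 0%N | _ <- lp_n I] in
  size e = size I.2 /\ forall j, (nth 0%N e j <= t)%N.
Proof.
elim: t => [|t] /=.
  split; first by rewrite size_map size_iota.
  move=> j; have [h|h] := ltnP j (size I.2).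
    by rewrite (nth_map 0%N) // size_iota.
  by rewrite nth_default // size_map size_iota.
move: (iter t _ _) => y [sy yb]; rewrite /lp_estep; case: ifP => _.
  by split=> // j; exact: leqW.
split; first by rewrite size_map size_iota.
move=> j; have [h|h] := ltnP j (size I.2); last first.
  by rewrite nth_default // size_map size_iota.
by rewrite (nth_map 0%N) ?size_iota // nth_iota // add0n; have := yb j; case: ifP; lia.
Qed.

Lemma fpc_lp_e : fpc lp_e.
Proof.
have [k Hk] := fpc_sz fpc_lp_O.
apply: (fpc_iter_env (f := lp_estep) (p := fun s => s * (4 * pb k s + 2) + 1)%N).
- exact: fpc_lp_estep.
- by fpa.
- exact: fpc_lp_O.
- by pols.
move=> I j jT; have [sy yb] := lp_e_bound I j.
have h2 : (size I.2 <= sz I)%N by have := n_le_sg I; rewrite sgE.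
have h3 : (j <= pb k (sz I))%N.
  by apply: leq_trans jT _; apply: leq_trans (ltnW (size_sz _)) (Hk _).
apply: leq_trans (sz_nats (k := pb k (sz I)) _) _.
  by move=> i; apply: leq_ltn_trans (leq_trans (yb i) h3) (ltn_expl _ _).
by rewrite sy leq_add2r leq_mul2r h2 orbT.
Qed.

#[export] Hint Resolve fpc_lp_e : fpdb.

#[local] Opaque lp_e lp_L lp_n.

Theorem fpc_lp_solve : fpc lp_solve.
Proof. by rewrite /lp_solve; fpa. Qed.

End LinearSolverTime.
Import LinearSolverTime.

(** * Finitely generated cones are closed *)

Module ClosedCones.

Local Open Scope ring_scope.

Section ClosedCone.
Variables (R : realType) (m n : nat) (B : 'M[R]_(m, n)) (b : 'cV[R]_m).

(* By the pigeonhole principle one support S serves arbitrarily small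
   tolerances; on S the matrix has a left inverse L, and L b is the solution. *)
Lemma closed_cone :
  (forall e : R, 0 < e -> exists v : 'cV[R]_n, (forall j, 0 <= v j 0) /\
     forall i, `|(B *m v - b) i 0| <= e) ->
  exists v : 'cV[R]_n, (forall j, 0 <= v j 0) /\ B *m v = b.
Proof.
move=> H.
pose ind (S : {set 'I_n}) := forall u : 'cV[R]_n, (forall j, j \notin S -> u j 0 = 0) ->
  B *m u = 0 -> u = 0.
pose app (S : {set 'I_n}) (e : R) := exists v : 'cV[R]_n, [/\ forall j, 0 <= v j 0,
  forall j, j \notin S -> v j 0 = 0 & forall i, `|(B *m v - b) i 0| <= e].
have [S iS aS] : exists2 S, ind S & forall e : R, 0 < e -> app S e.
  apply: contrapT => no.
  have /choice [eS eSP] : forall S, exists e : R, 0 < e /\ (ind S -> ~ app S e).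
    move=> S; apply: contrapT => h; apply: no; exists S.
      by apply: contrapT => ni; apply: h; exists 1; split.
    move=> e e0; apply: contrapT => na; apply: h; exists e; split=> //.
  (* There are finitely many supports; if each one failed at some tolerance, all would fail at the
     least of these. *)
  pose e := \big[Order.min/1]_S eS S.
  have e0 : 0 < e by rewrite /e; elim/big_ind: _ => // [x y x0 y0|S _]; [rewrite lt_min x0|case: (eSP S)].
  have [v [v0 ve]] := H e e0.
  have [w [wB w0 _ wi]] := support_minimal B v0.
  pose S : {set 'I_n} := [set j | w j 0 != 0]%SET.
  have [_] := eSP S; apply.
    move=> u uS; apply: wi => j wj; apply: uS; by rewrite inE wj eqxx.
  exists w; split=> //; first by move=> j; rewrite inE negbK => /eqP.
  move=> i; rewrite wB; apply: le_trans (ve i) _; rewrite /e.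
  by apply: bigmin_le_cond.
pose D : 'M[R]_n := diag_mx (\row_j (j \in S)%:R).
have DE (u : 'cV[R]_n) j : (D *m u) j 0 = (j \in S)%:R * u j 0.
  by rewrite mul_diag_mx !mxE.
have Dsub : (D <= B *m D)%MS.
  rewrite submxE; apply/eqP/matrixP => i k; rewrite [RHS]mxE.
  have := mulmx_coker (B *m D); move: (cokermx _) => C BC.
  have : D *m col k C = 0.
    apply: iS => [j jS|]; first by rewrite DE (negbTE jS) mul0r.
    by rewrite colE !mulmxA BC mul0mx.
  by move=> /matrixP /(_ i 0); rewrite colE mulmxA -colE !mxE.
(* Independence of the columns in [S] makes [L] a left inverse of [B] on the vectors supported
   there. *)
pose L : 'M[R]_(n, m) := D *m pinvmx (B *m D).
have LBD : L *m (B *m D) = D by rewrite /L mulmxKpV.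
have LB (v : 'cV[R]_n) : (forall j, j \notin S -> v j 0 = 0) -> L *m (B *m v) = v.
  move=> vS; have vD : v = D *m v.
    apply/matrixP => j z; rewrite (ord1 z) DE; have [jS|jS] := boolP (j \in S); first by rewrite mul1r.
    by rewrite vS // mulr0.
  by rewrite [in LHS]vD !mulmxA -(mulmxA L) LBD -vD.
pose c := 1 + \sum_i \sum_j `|L i j| + \sum_i \sum_j `|(B *m L) i j|.
have c0 : 0 < c by rewrite /c -addrA ltr_pwDl // addr_ge0 // sumr_ge0 // => i _; rewrite sumr_ge0.
have bnd k (A : 'M[R]_(k, m)) (r : 'cV[R]_m) e i : (\sum_i \sum_j `|A i j|) <= c - 1 -> 0 <= e ->
   (forall i, `|r i 0| <= e) -> `|(A *m r) i 0| <= (c - 1) * e.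
  move=> Ac e0 re; rewrite mxE; apply: le_trans (ler_norm_sum _ _ _) _.
  apply: (@le_trans _ _ (\sum_j `|A i j| * e)).
    by apply: ler_sum => j _; rewrite normrM ler_wpM2l.
  rewrite -mulr_suml ler_wpM2r //; apply: le_trans Ac.
  by rewrite (bigD1 i) //= lerDl sumr_ge0 // => j _; rewrite sumr_ge0.
have cL : \sum_i \sum_j `|L i j| <= c - 1.
  have h : 0 <= \sum_i \sum_j `|(B *m L) i j| by apply: sumr_ge0 => i _; rewrite sumr_ge0.
  by rewrite /c; lra.
have cBL : \sum_i \sum_j `|(B *m L) i j| <= c - 1.
  have h : 0 <= \sum_i \sum_j `|L i j| by apply: sumr_ge0 => i _; rewrite sumr_ge0.
  by rewrite /c; lra.
have c10 : 0 <= c - 1 by apply: le_trans cL; apply: sumr_ge0 => i _; rewrite sumr_ge0.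
have small (x : R) : (forall e, 0 < e -> x <= c * e) -> x <= 0.
  move=> h; rewrite leNgt; apply/negP => x0.
  have := h (x / c / 2) ltac:(by rewrite !divr_gt0).
  have -> : c * (x / c / 2) = x / 2 by field; rewrite gt_eqF.
  by lra.
exists (L *m b); split.
  move=> j; rewrite -oppr_le0; apply: small => e e0; have [v [v0 vS ve]] := aS e e0.
  have := bnd _ L (B *m v - b) e j cL (ltW e0) ve; rewrite mulmxBr LB // ler_norml => /andP [h1 h2].
  have := v0 j; move: h1 h2; rewrite !mxE; set z := \sum_j _; nra.
apply/matrixP => i z; rewrite (ord1 z); apply/eqP; rewrite -subr_eq0 -normr_le0.
apply: small => e e0; have [v [v0 vS ve]] := aS e e0.
have -> : (B *m (L *m b)) i 0 - b i 0 = (B *m v - b) i 0 - (B *m L *m (B *m v - b)) i 0.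
  by rewrite mulmxBr -!(mulmxA B L) LB // !mxE; ring.
apply: le_trans (ler_normB _ _) _.
have := bnd _ (B *m L) (B *m v - b) e i cBL (ltW e0) ve; have := ve i; nra.
Qed.

End ClosedCone.

Lemma big_tnth_uniq (R : nmodType) (V : eqType) (vs : seq V) (x : 'I_(size vs) -> R) j :
  uniq vs -> \sum_(k | tnth (in_tuple vs) k == tnth (in_tuple vs) j) x k = x j.
Proof.
move=> u; rewrite (big_pred1 j) // => k /=; apply/eqP/eqP => [|-> //].
by move/tuple_uniqP : (u : uniq (in_tuple vs)) => /[apply].
Qed.

Lemma closed_system (R : realType) (V K : eqType) (vs : seq V) (ks : seq K) (F : K -> V -> R)
    (b : K -> R) : uniq vs ->
  (forall e : R, 0 < e -> exists X : V -> R, (forall v, v \in vs -> 0 <= X v) /\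
     forall k, k \in ks -> `|\sum_(v <- vs) F k v * X v - b k| <= e) ->
  exists X : V -> R, (forall v, v \in vs -> 0 <= X v) /\
     forall k, k \in ks -> \sum_(v <- vs) F k v * X v = b k.
Proof.
move=> u H; set tv := tnth (in_tuple vs); set tk := tnth (in_tuple ks).
have [|x [x0 xe]] := @closed_cone R _ _ (\matrix_(i, j) F (tk i) (tv j)) (\col_i b (tk i)).
  move=> e e0; have [X [X0 XE]] := H e e0; exists (\col_j X (tv j)); split=> [j|i].
    by rewrite mxE X0 // mem_tnth.
  rewrite !mxE; under eq_bigr do rewrite !mxE.
  by have := XE (tk i) (mem_tnth _ _); rewrite (big_tnth _ _ vs).
exists (fun v => \sum_(j | tv j == v) x j 0); split=> [v _|k /seq_tnthP [i ->]].
  exact: sumr_ge0.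
rewrite (big_tnth _ _ vs) -/tk; move/matrixP: xe => /(_ i 0); rewrite !mxE => <-.
by apply: eq_bigr => j _; rewrite big_tnth_uniq // mxE.
Qed.

End ClosedCones.
Import ClosedCones.

(** * The linear program of an instance *)

Module InstancePrograms.

Local Open Scope ring_scope.


(** Rows and columns are addressed by structured keys, so that the coefficients of a program can be
    given by one formula on keys. *)
Definition keyed_lp (V K : eqType) (vs : seq V) (ks : seq K) (F : K -> V -> int) (st : V -> bool) : lpin :=
  ([seq [seq F k v | v <- vs] | k <- ks], [seq st v | v <- vs]).

Lemma keyed_lpP (R : realType) (V K : eqType) (vs : seq V) (ks : seq K) (F : K -> V -> int)
    (st : V -> bool) : uniq vs ->
  lp_solve (keyed_lp vs ks F st) <-> exists X : V -> R,
    [/\ forall v, v \in vs -> 0 <= X v, forall v, v \in vs -> st v -> 0 < X v &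
      forall k, k \in ks -> \sum_(v <- vs) (F k v)%:~R * X v = 0].
Proof.
move=> u; rewrite (lp_solveP R) /=; set n := size [seq st v | v <- vs].
have sn : size vs = n by rewrite /n size_map.
pose tv (j : 'I_n) := tnth (in_tuple vs) (cast_ord (esym sn) j).
have tvE v0 (j : 'I_n) : tv j = nth v0 vs j by rewrite /tv (tnth_nth v0).
have tvM j : tv j \in vs by exact: mem_tnth.
have tvi : injective tv.
  move=> i j; rewrite (tvE (tv i) j) => e; apply: val_inj; apply/eqP.
  rewrite -(@nth_uniq _ (tv i) vs i j) ?sn //; apply/eqP; rewrite -e; exact/esym/tvE.
have sumE (G : V -> R) : \sum_(v <- vs) G v = \sum_j G (tv j).
  rewrite (big_tnth _ _ vs) /tv (reindex (cast_ord (esym sn))) //=.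
  by exists (cast_ord sn) => x _; rewrite ?cast_ordK ?cast_ordKV.
have rowE k (v0 : V) (j : 'I_n) : nth 0 [seq F k v | v <- vs] j = F k (tv j).
  by rewrite (nth_map v0) ?sn // (tvE v0).
split=> [[x [Ax x0 xs]]|[X [X0 Xs XE]]]; last first.
  exists (\col_j X (tv j)); split=> [|j|j jst].
  - apply/matrixP => i z; rewrite (ord1 z) !mxE.
    have im : (i < size ks)%N.
      by rewrite -[X in (_ < X)%N](size_map (fun k => [seq F k v | v <- vs])); exact: ltn_ord i.
    have [k0 _] : exists k0, k0 \in ks.
      have : (0 < size ks)%N by exact: leq_ltn_trans im.
      by clear; case: ks => // k0 l _; exists k0; rewrite mem_head.
    rewrite -[RHS](XE (nth k0 ks i)) ?mem_nth // sumE; apply: eq_bigr => j _.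
    rewrite !mxE /mat_at /zat (nth_map k0) //; congr (_%:~R * _).
    exact: (rowE _ (tv j)).
  - by rewrite mxE X0.
  - by rewrite mxE Xs //; move: jst; rewrite (nth_map (tv j)) ?sn // -tvE.
pose X v := \sum_(j | tv j == v) x j 0.
have XE j : X (tv j) = x j 0 by rewrite /X (big_pred1 j) // => i /=; rewrite (inj_eq tvi).
exists X; split=> [v _|v|k kk].
- by apply: sumr_ge0.
- move=> vv sv; have vi : (index v vs < n)%N by rewrite -sn index_mem.
  have -> : v = tv (Ordinal vi) by rewrite (tvE v) nth_index.
  by rewrite XE; apply: xs; rewrite /= (nth_map v) ?sn // nth_index.
- have ki : (index k ks < size [seq [seq F k v | v <- vs] | k <- ks])%N by rewrite size_map index_mem.
  move/matrixP: Ax => /(_ (Ordinal ki) 0); rewrite !mxE => e; rewrite -[RHS]e sumE.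
  apply: eq_bigr => j _; rewrite XE !mxE /mat_at /zat /= (nth_map k) ?index_mem // nth_index //.
  by rewrite (rowE _ (tv j)).
Qed.

Definition rt := (int * nat)%type.
Definition opc := (bool * bool * rt)%type.
(** An instance stripped of proofs and dependent types, with all families flattened to lists: the
    form on which polynomial-time functions operate. *)
Definition raw := (nat * nat * seq rt * (nat * nat * nat) * (seq rt * seq rt) *
  (seq nat * seq nat * seq (seq bool)) * seq opc)%type.

Definition r_S (r : raw) : nat := r.1.1.1.1.1.1.
Definition r_A (r : raw) : nat := r.1.1.1.1.1.2.
Definition r_T (r : raw) : seq rt := r.1.1.1.1.2.
Definition r_l (r : raw) : nat := r.1.1.1.2.1.1.
Definition r_m (r : raw) : nat := r.1.1.1.2.1.2.
Definition r_n (r : raw) : nat := r.1.1.1.2.2.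
Definition r_C (r : raw) : seq rt := r.1.1.2.1.
Definition r_B (r : raw) : seq rt := r.1.1.2.2.
Definition r_s (r : raw) : seq nat := r.1.2.1.1.
Definition r_k (r : raw) : seq nat := r.1.2.1.2.
Definition r_g (r : raw) : seq (seq bool) := r.1.2.2.
Definition r_o (r : raw) : seq opc := r.2.

Lemma fpc_r_S : fpc r_S. Proof. by rewrite /r_S; fpa. Qed.
Lemma fpc_r_A : fpc r_A. Proof. by rewrite /r_A; fpa. Qed.
Lemma fpc_r_T : fpc r_T. Proof. by rewrite /r_T; fpa. Qed.
Lemma fpc_r_l : fpc r_l. Proof. by rewrite /r_l; fpa. Qed.
Lemma fpc_r_m : fpc r_m. Proof. by rewrite /r_m; fpa. Qed.
Lemma fpc_r_n : fpc r_n. Proof. by rewrite /r_n; fpa. Qed.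
Lemma fpc_r_C : fpc r_C. Proof. by rewrite /r_C; fpa. Qed.
Lemma fpc_r_B : fpc r_B. Proof. by rewrite /r_B; fpa. Qed.
Lemma fpc_r_s : fpc r_s. Proof. by rewrite /r_s; fpa. Qed.
Lemma fpc_r_k : fpc r_k. Proof. by rewrite /r_k; fpa. Qed.
Lemma fpc_r_g : fpc r_g. Proof. by rewrite /r_g; fpa. Qed.
Lemma fpc_r_o : fpc r_o. Proof. by rewrite /r_o; fpa. Qed.
#[export] Hint Resolve fpc_r_S fpc_r_A fpc_r_T fpc_r_l fpc_r_m fpc_r_n fpc_r_C fpc_r_B fpc_r_s
  fpc_r_k fpc_r_g fpc_r_o : fpdb.

(** The number [n] is coded in binary, so counting up to it could take exponential time; the
    enumeration is cut off at the length of a list at hand. *)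
Definition rng A (L : seq A) (n : nat) : seq nat := [seq i <- idx L | (i < n)%N].

Lemma rngE A (L : seq A) n : (n <= size L)%N -> rng L n = iota 0 n.
Proof.
move=> nL; rewrite /rng /idx -{1}(subnKC nL) iotaD filter_cat.
rewrite (_ : [seq i <- iota 0 n | _] = iota 0 n); last first.
  by apply/all_filterP/allP => i; rewrite mem_iota.
rewrite (_ : [seq i <- iota (0 + n) _ | _] = [::]) ?cats0 //.
apply: size0nil; rewrite size_filter; apply/eqP; rewrite -leqn0 leqNgt -has_count.
by apply/hasPn => i; rewrite mem_iota; lia.
Qed.

Lemma fpc_rng A {eA : Enc A} : fpc (fun q : seq A * nat => rng q.1 q.2).
Proof. by rewrite /rng; fpa. Qed.
#[export] Hint Resolve fpc_rng : fpdb.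

Definition rdef : rt := (0, 1%N).
(** A common denominator of all rationals of the instance; it makes every coefficient of the linear
    program an integer. *)
Definition r_D (r : raw) : nat :=
  prodl [seq x.2 | x <- r_T r ++ r_C r ++ r_B r ++ [seq o.2 | o <- r_o r]].
Definition scl (r : raw) (x : rt) : int := x.1 * Posz (r_D r %/ x.2).
Definition r_sts (r : raw) := rng (r_T r) (r_S r).+1.
Definition r_acts (r : raw) := rng (r_T r) (r_A r).+1.
Definition r_tr (r : raw) (s a t : nat) : rt :=
  nth rdef (r_T r) ((s * (r_A r).+1 + a) * (r_S r).+1 + t)%N.
Definition r_trs (r : raw) (x : nat * nat * nat) : int := scl r (r_tr r x.1.1 x.1.2 x.2).
Definition r_en (r : raw) (s a : nat) : bool :=
  sumz [seq r_trs r (s, a, t) | t <- r_sts r] == Posz (r_D r).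
Definition r_Tk (r : raw) (k : nat) : seq (seq bool) :=
  [seq nth [::] (r_g r) e | e <- [seq e <- idx (r_C r) | nth 0%N (r_k r) e == k]].

Lemma fpc_r_D : fpc r_D. Proof. by rewrite /r_D; fpa. Qed.
#[export] Hint Resolve fpc_r_D : fpdb.
Lemma fpc_scl : fpc (fun q : raw * rt => scl q.1 q.2). Proof. by rewrite /scl; fpa. Qed.
Lemma fpc_r_sts : fpc r_sts. Proof. by rewrite /r_sts; fpa. Qed.
Lemma fpc_r_acts : fpc r_acts. Proof. by rewrite /r_acts; fpa. Qed.
#[export] Hint Resolve fpc_scl fpc_r_sts fpc_r_acts : fpdb.
Lemma fpc_r_trs : fpc (fun q : raw * (nat * nat * nat) => r_trs q.1 q.2).
Proof. by rewrite /r_trs /r_tr; fpa. Qed.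
#[export] Hint Resolve fpc_r_trs : fpdb.
Lemma fpc_r_en : fpc (fun q : raw * nat * nat => r_en q.1.1 q.1.2 q.2).
Proof. by rewrite /r_en; fpa. Qed.
Lemma fpc_r_Tk : fpc (fun q : raw * nat => r_Tk q.1 q.2). Proof. by rewrite /r_Tk; fpa. Qed.
#[export] Hint Resolve fpc_r_en fpc_r_Tk : fpdb.

Definition pst := (nat * seq nat)%type.
Definition hitb (T : seq bool) (A : seq nat) : bool := has (fun t => nth false T t) A.

(** For fixed [c] the number of modes is polynomial in the number of states. This is where a
    constant bound on the number of target sets enters. *)
Fixpoint modes (c : nat) (L : seq nat) : seq (seq nat) :=
  if c is c'.+1 then [::] :: [seq t :: A | t <- L, A <- modes c' L] else [:: [::]].
Definition psts (c : nat) (r : raw) : seq pst := [seq (s, A) | s <- r_sts r, A <- modes c (r_sts r)].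
(** One block of flows for each scheduler and each start state: a scheduler sees in the history
    where the path began, so its behaviours from different states are independent. *)
Definition r_bs (r : raw) : seq (nat * nat) := [seq (k, s) | k <- rng (r_C r) (r_n r), s <- r_sts r].

Lemma fpc_hitb : fpc (fun q : seq bool * seq nat => hitb q.1 q.2). Proof. by rewrite /hitb; fpa. Qed.
#[export] Hint Resolve fpc_hitb : fpdb.

Lemma fpc_modes c : fpc (modes c).
Proof. by elim: c => [|c IH] /=; fpa. Qed.
#[export] Hint Resolve fpc_modes : fpdb.
Lemma fpc_psts c : fpc (psts c). Proof. by rewrite /psts; fpa. Qed.
Lemma fpc_r_bs : fpc r_bs. Proof. by rewrite /r_bs; fpa. Qed.
#[export] Hint Resolve fpc_psts fpc_r_bs : fpdb.

Section Mode.
Variable c : nat.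

(* The second component of a product state lists the states at which a new
   target was reached; the bound c cuts off unreachable modes. *)
Definition nxt (Ts : seq (seq bool)) (x : pst * nat) : pst :=
  (x.2, if (size x.1.2 < c)%N && has (fun T => nth false T x.2 && ~~ hitb T x.1.2) Ts
        then x.2 :: x.1.2 else x.1.2).
Definition ini (Ts : seq (seq bool)) (s : nat) : pst := nxt Ts ((0%N, [::]), s).

Lemma fpc_nxt : fpc (fun q : seq (seq bool) * (pst * nat) => nxt q.1 q.2).
Proof. by rewrite /nxt; fpa. Qed.
Hint Resolve fpc_nxt : fpdb.
Lemma fpc_ini : fpc (fun q : seq (seq bool) * nat => ini q.1 q.2).
Proof. by rewrite /ini; fpa. Qed.
Hint Resolve fpc_ini : fpdb.

(* ((tag, block), product state, action); tag 0 is the homogenising variable,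
   1 a slack, 2 and 3 the two components of a flow. *)
Definition var := (nat * (nat * nat) * pst * nat)%type.
Definition key := (nat * (nat * nat) * pst)%type.
(* (j, s, e, strict) stands for 0 <= s (value_j - bound_j) + e. *)
Definition con := (nat * bool * rt * bool)%type.
Definition cdef : con := (0%N, true, rdef, false).

Definition r_vars (x : raw * seq con) : seq var :=
  (0%N, (0, 0)%N, (0%N, [::]), 0%N) ::
  [seq (1%N, (i, 0%N), (0%N, [::]), 0%N) | i <- idx x.2] ++
  [seq v <- [seq (u, a) | u <- [seq (w, q) | w <- [seq (t, b) | t <- [:: 2; 3]%N, b <- r_bs x.1],
     q <- psts c x.1], a <- r_acts x.1] | r_en x.1 v.1.2.1 v.2].
Definition r_keys (x : raw * seq con) : seq key :=
  [seq (0%N, b, q) | b <- r_bs x.1, q <- psts c x.1] ++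
  [seq (1%N, b, q) | b <- r_bs x.1, q <- psts c x.1] ++
  [seq (2%N, (i, 0%N), (0%N, [::])) | i <- idx x.2].

Definition zsg (b : bool) (z : int) : int := if b then z else - z.
Definition zif (b : bool) (z : int) : int := if b then z else 0.

Definition cf_out (r : raw) (y : key * var) : int := zif (y.2.1.2 == y.1.2) (Posz (r_D r)).
Definition cf_in (r : raw) (y : key * var) : int :=
  zif (nxt (r_Tk r y.1.1.2.1) (y.2.1.2, y.1.2.1) == y.1.2) (r_trs r (y.2.1.2.1, y.2.2, y.1.2.1)).
Definition cf_val (r : raw) (y : nat * var) : int :=
  sumz [seq scl r (nth rdef (r_C r) e) | e <- [seq e <- idx (r_C r) | (e %% r_l r == y.1)%N &&
     ((nth 0%N (r_k r) e, nth 0%N (r_s r) e) == y.2.1.1.2) && hitb (nth [::] (r_g r) e) y.2.1.2.2]].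

(** Balance of the transient flow: the outflow of [y] and [r] together equals the inflow of [y] plus
    a unit at the initial product state. The rows of [cf_flow2] below say that [r] is a
    circulation. *)
Definition cf_flow1 (r : raw) (y : key * var) : int :=
  if y.2.1.1.1 == 0%N then
    zif (ini (r_Tk r y.1.1.2.1) y.1.1.2.2 == y.1.2) (- Posz (r_D r))
  else if y.2.1.1.1 == 1%N then 0
  else zif (y.2.1.1.2 == y.1.1.2)
    (if y.2.1.1.1 == 2%N then cf_out r y - cf_in r y else cf_out r y).
Definition cf_flow2 (r : raw) (y : key * var) : int :=
  zif ((y.2.1.1.1 == 3%N) && (y.2.1.1.2 == y.1.1.2)) (cf_out r y - cf_in r y).
(** Equates the left side of a constraint with its slack variable, so that strictness becomes
    positivity of a coordinate. *)
Definition cf_con (r : raw) (y : con * nat * var) : int :=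
  if y.2.1.1.1 == 0%N then
    scl r y.1.1.1.2 - zsg y.1.1.1.1.2 (scl r (nth rdef (r_B r) y.1.1.1.1.1))
  else if y.2.1.1.1 == 1%N then zif (y.2.1.1.2.1 == y.1.2) (- Posz (r_D r))
  else if y.2.1.1.1 == 3%N then zsg y.1.1.1.1.2 (cf_val r (y.1.1.1.1.1, y.2))
  else 0.
Definition r_F (x : raw * seq con) (y : key * var) : int :=
  if y.1.1.1 == 0%N then cf_flow1 x.1 y
  else if y.1.1.1 == 1%N then cf_flow2 x.1 y
  else cf_con x.1 (nth cdef x.2 y.1.1.2.1, y.1.1.2.1, y.2).
Definition r_st (x : raw * seq con) (v : var) : bool :=
  (v.1.1.1 == 0%N) || (v.1.1.1 == 1%N) && (nth cdef x.2 v.1.1.2.1).2.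

Definition r_lp (x : raw * seq con) : lpin :=
  keyed_lp (r_vars x) (r_keys x) (fun k v => r_F x (k, v)) (r_st x).

Lemma fpc_r_vars : fpc r_vars. Proof. by rewrite /r_vars; fpa. Qed.
Lemma fpc_r_keys : fpc r_keys. Proof. by rewrite /r_keys; fpa. Qed.
Lemma fpc_cf_out : fpc (fun q : raw * (key * var) => cf_out q.1 q.2). Proof. by rewrite /cf_out /zif; fpa. Qed.
Lemma fpc_cf_in : fpc (fun q : raw * (key * var) => cf_in q.1 q.2). Proof. by rewrite /cf_in /zif; fpa. Qed.
Lemma fpc_cf_val : fpc (fun q : raw * (nat * var) => cf_val q.1 q.2). Proof. by rewrite /cf_val; fpa. Qed.
Hint Resolve fpc_r_vars fpc_r_keys fpc_cf_out fpc_cf_in fpc_cf_val : fpdb.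
Lemma fpc_cf_flow1 : fpc (fun q : raw * (key * var) => cf_flow1 q.1 q.2). Proof. by rewrite /cf_flow1 /zif; fpa. Qed.
Lemma fpc_cf_flow2 : fpc (fun q : raw * (key * var) => cf_flow2 q.1 q.2). Proof. by rewrite /cf_flow2 /zif; fpa. Qed.
Lemma fpc_cf_con : fpc (fun q : raw * (con * nat * var) => cf_con q.1 q.2). Proof. by rewrite /cf_con /zif /zsg; fpa. Qed.
Hint Resolve fpc_cf_flow1 fpc_cf_flow2 fpc_cf_con : fpdb.
Lemma fpc_r_F : fpc (fun q : raw * seq con * (key * var) => r_F q.1 q.2). Proof. by rewrite /r_F; fpa. Qed.
Lemma fpc_r_st : fpc (fun q : raw * seq con * var => r_st q.1 q.2). Proof. by rewrite /r_st; fpa. Qed.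
Hint Resolve fpc_r_F fpc_r_st : fpdb.
Lemma fpc_r_lp : fpc r_lp. Proof. by rewrite /r_lp /keyed_lp; fpa. Qed.

End Mode.

End InstancePrograms.
Import InstancePrograms.

(** * Reachability probabilities and flows *)

Module Flows.

Import numFieldNormedType.Exports.


Local Open Scope classical_set_scope.
Local Open Scope ring_scope.

(** * Sums over histories and limits of reachability probabilities *)

Section PathSums.
Variables (R : realType) (nS nA : nat).
Local Notation X := ('I_nS.+1 * 'I_nA.+1)%type.
Implicit Types (G : seq X -> R) (h : seq X).

Fixpoint sumf (n : nat) G h : R :=
  if n is n'.+1 then \sum_x sumf n' G (rcons h x) else G h.

Lemma sumfSr n G h : sumf n.+1 G h = sumf n (fun h' => \sum_x G (rcons h' x)) h.
Proof. by elim: n h => //= n IH h; apply: eq_bigr => x _; rewrite -IH. Qed.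

Lemma eq_sumf n G G' h : (forall h, G h = G' h) -> sumf n G h = sumf n G' h.
Proof. by move=> e; elim: n h => //= n IH h; apply: eq_bigr => x _. Qed.

Lemma sumfD n G G' h : sumf n (fun h => G h + G' h) h = sumf n G h + sumf n G' h.
Proof. by elim: n h => //= n IH h; rewrite -big_split; apply: eq_bigr => x _. Qed.

Lemma sumf_sum n (I : Type) (r : seq I) (P : pred I) (G : I -> seq X -> R) h :
  sumf n (fun h => \sum_(i <- r | P i) G i h) h = \sum_(i <- r | P i) sumf n (G i) h.
Proof.
elim: n h => //= n IH h; rewrite exchange_big /=; apply: eq_bigr => x _; exact: IH.
Qed.

Lemma sumfM n G c h : sumf n (fun h => G h * c) h = sumf n G h * c.
Proof. by elim: n h => //= n IH h; rewrite mulr_suml; apply: eq_bigr => x _. Qed.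

Lemma sumf_ge0 n G h : (forall h, 0 <= G h) -> 0 <= sumf n G h.
Proof. by move=> e; elim: n h => //= n IH h; apply: sumr_ge0 => x _. Qed.

End PathSums.

Section ReachLimit.
Variables (R : realType) (nS nA : nat) (M : mdp nS nA).
Variables (sigma : scheduler M R) (s0 : 'I_nS.+1).
Local Notation X := ('I_nS.+1 * 'I_nA.+1)%type.
Local Notation mu := (path_measure sigma s0).
Local Notation cp := (cylinder_prob sigma s0).

Definition prefix_event (P : seq X -> bool) n h : set (path_space nS nA) :=
  [set u | mkseq u (size h) = h /\ P (mkseq u (size h + n))].

Lemma prefix_event0 P h : prefix_event P 0 h = if P h then cylinder h else set0.
Proof.
apply/seteqP; split=> u; rewrite /prefix_event /= addn0.
  by move=> [e]; rewrite e => ->.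
by case: ifP => // Ph e; split=> //; rewrite e.
Qed.

Lemma prefix_eventS P n h :
  prefix_event P n.+1 h = \bigcup_(x in [set: X]) prefix_event P n (rcons h x).
Proof.
apply/seteqP; split=> [u [e Pu]|u [x _ []]].
  exists (u (size h)) => //; rewrite /prefix_event /= size_rcons addSnnS; split=> //.
  by rewrite mkseqS e.
rewrite size_rcons mkseqS => /rcons_inj [e _]; rewrite addSnnS => Pu; by split.
Qed.

Lemma measurable_prefix P n h : measurable (prefix_event P n h).
Proof.
elim: n h => [|n IH] h.
  rewrite prefix_event0; case: ifP => _; last exact: measurable0.
  by apply: sub_sigma_algebra; exists h.
by rewrite prefix_eventS; apply: fin_bigcup_measurable => // x _; exact: IH.
Qed.

Lemma measure_prefix P n h :
  mu (prefix_event P n h) = (sumf n (fun h => cp h * (P h)%:R) h)%:E.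
Proof.
elim: n h => [|n IH] h.
  rewrite prefix_event0 /=; case: ifP => _; first by rewrite path_measure_cylinder mulr1.
  by rewrite measure0 mulr0.
rewrite prefix_eventS measure_fin_bigcup //=; last first.
- by move=> x _; exact: measurable_prefix.
- apply/trivIsetP => x y _ _ xy; apply/seteqP; split=> // u [[e1 _] [e2 _]].
  move: e1 e2; rewrite !size_rcons !mkseqS => /rcons_inj [_ e1] /rcons_inj [_ e2].
  by move/eqP: xy; apply; rewrite -e1 -e2.
rewrite fsbig_finite //= big_uniq ?finmap.fset_uniq //= -sumEFin.
apply: eq_big => [x|x _]; last exact: IH.
have fT : finite_set [set: X] by [].
by have := in_fset_set fT x; rewrite mem_setT => e; exact: e.
Qed.

Definition reachN (T : {set 'I_nS.+1}) n : R :=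
  sumf n (fun h => cp h * (has (fun x : X => x.1 \in T) h)%:R) [::].

(** Continuity of the path measure along the increasing events of a visit among the first n
    states. *)
Lemma reachN_cvg T (e : R) : 0 < e -> exists N, forall n, (N <= n)%N ->
  `|reachN T n - reach_prob sigma s0 T| <= e.
Proof.
move=> e0.
pose F n := prefix_event (fun h => has (fun x : X => x.1 \in T) h) n [::].
have FE n : mu (F n) = (reachN T n)%:E by exact: measure_prefix.
have UF : reach_event T = \bigcup_n F n :> set (path_space nS nA).
  apply/seteqP; split=> [u [i ui]|u [n _ [_ /hasP [x]]]].
    exists i.+1 => //; split=> //; apply/hasP; exists (u i) => //.
    by apply/mapP; exists i => //; rewrite mem_iota /= add0n.
  by move=> /mapP [i _ ->] xT; exists i.
have ndF : nondecreasing_seq F.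
  move=> m n mn; apply/subsetPset => u [_ h]; split=> //.
  rewrite /= !add0n in h *; move: h => /hasP [x /mapP [i]]; rewrite mem_iota => im -> xT.
  apply/hasP; exists (u i) => //; apply/mapP; exists i => //.
  by rewrite mem_iota; lia.
have := @nondecreasing_cvg_mu _ _ _ mu F.
move=> /(_ (fun n => measurable_prefix _ _ _)) /(_ _ ndF).
rewrite -UF => /(_ (measurable_reach_event T)) cv.
have cv' : (fun n => reachN T n : R^o) @ \oo --> (reach_prob sigma s0 T : R^o).
  have -> : (fun n => reachN T n : R^o) = fine \o (mu \o F).
    by apply/funext => n /=; rewrite FE.
  by apply: fine_cvg; rewrite fineK ?fin_num_measure //; exact: measurable_reach_event.
move/cvgrPdist_le : cv' => /(_ e e0) [N _ HN]; exists N => n Nn.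
by rewrite distrC; exact: HN.
Qed.

End ReachLimit.

(** * Schedulers from weights on histories *)

Section Kuhn.
Variables (R : realType) (nS nA : nat) (M : mdp nS nA) (s0 : 'I_nS.+1).
Local Notation X := ('I_nS.+1 * 'I_nA.+1)%type.
Local Notation nsp := (next_state_prob R M s0).
Variable W : seq X -> R.
Hypotheses (W0 : W [::] = 1) (Wge : forall h, 0 <= W h)
  (Wsum : forall h s, \sum_a W (rcons h (s, a)) = W h * nsp h s)
  (Wen : forall h s a, ~ enabled M s a -> W (rcons h (s, a)) = 0).

(** Kuhn's construction: the scheduler plays the conditional weights of the actions, and some
    enabled action where the weight is zero. Schedulers can thus be built as mixtures and as
    strategies with memory, by giving only weights. *)
Lemma weight_scheduler : exists sigma : scheduler M R,
  forall h, cylinder_prob sigma s0 h = W h.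
Proof.
have /choice [d dP] : forall s, exists a, enabled M s a by exact: trans_total.
pose ch h s a : R := if W h * nsp h s == 0 then (a == d s)%:R
  else W (rcons h (s, a)) / (W h * nsp h s).
have ch0 h s a : 0 <= ch h s a.
  rewrite /ch; case: ifP => _; first by rewrite ler0n.
  by rewrite divr_ge0 // -Wsum sumr_ge0.
have ch1 h s : \sum_a ch h s a = 1.
  rewrite /ch; have [e|ne] := eqVneq (W h * nsp h s) 0.
    by rewrite (bigD1 (d s)) //= eqxx big1 ?addr0 // => a /negbTE ->.
  by rewrite -mulr_suml Wsum mulfV.
have che h s a : ~ enabled M s a -> ch h s a = 0.
  move=> ne; rewrite /ch; case: ifP => _; last by rewrite Wen // mul0r.
  by case: eqP => // e; case: ne; rewrite e.
exists (Scheduler ch0 ch1 che) => h; elim/last_ind: h => [|h [s a] IH].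
  by rewrite /cylinder_prob big_ord0.
rewrite cylinder_prob_rcons IH /step_prob /= /ch; case: ifP => [/eqP e|/negbT ne].
  rewrite mulrA e mul0r; apply/esym/eqP; rewrite eq_le Wge andbT.
  by rewrite -e -Wsum (bigD1 a) //= lerDl sumr_ge0.
by rewrite mulrA mulrCA mulfV // mulr1.
Qed.

End Kuhn.

(** * Schedulers and flows on the product with a record *)

Section Flow.
Variables (R : realType) (nS nA : nat) (M : mdp nS nA) (s0 : 'I_nS.+1).
Local Notation S := 'I_nS.+1.
Local Notation Act := 'I_nA.+1.
Local Notation X := (S * Act)%type.
Local Notation nsp := (next_state_prob R M s0).
Local Notation p s a t := (ratr (trans M s a t) : R).
Variables (Q : eqType) (Qs : seq Q) (q0 : Q) (st : Q -> S) (nx : Q -> S -> Q).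
Variables (I : finType) (T : I -> {set S}) (hit : I -> Q -> bool) (rank : Q -> nat).
(** An invariant of the reachable product states. The record has to be right only there; elsewhere
    the cut-off of the modes may miss a visit. *)
Variable good : Q -> Prop.
Hypotheses (uQ : uniq Qs) (q0Q : q0 \in Qs) (st0 : st q0 = s0)
  (st_nx : forall q t, st (nx q t) = t) (nxQ : forall q t, q \in Qs -> nx q t \in Qs)
  (rank_nx : forall q t, (rank q <= rank (nx q t))%N)
  (rank_hit : forall i q t, rank (nx q t) = rank q -> hit i (nx q t) = hit i q)
  (good0 : good q0) (hit0 : forall i, hit i q0 = (s0 \in T i))
  (good_nx : forall q a t, good q -> enabled M (st q) a -> 0 < trans M (st q) a t ->
     good (nx q t) /\ forall i, hit i (nx q t) = hit i q || (t \in T i)).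
Implicit Types (w : seq X -> R) (h : seq X) (q : Q).

Lemma p_ge0 s a t : 0 <= p s a t.
Proof. by rewrite ler0q; case/andP: (trans_01 M s a t). Qed.

Lemma p_sum s a : enabled M s a -> \sum_t p s a t = 1.
Proof. by rewrite -rmorph_sum /= => ->; rewrite rmorph1. Qed.

(** [None] stands for the empty history: the first arrival is at [q0]. *)
Definition arr (o : option Q) (s : S) : Q := if o is Some q then nx q s else q0.
Definition qs h : option Q := foldl (fun o (x : X) => Some (arr o x.1)) None h.

Lemma qs_rcons h x : qs (rcons h x) = Some (arr (qs h) x.1).
Proof. by rewrite /qs -cats1 foldl_cat. Qed.

Lemma arrQ h s : arr (qs h) s \in Qs.
Proof.
elim/last_ind: h s => [|h x IH] s //=.
by rewrite qs_rcons /=; exact: nxQ.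
Qed.

Lemma nsp_rcons h s a t : nsp (rcons h (s, a)) t = p s a t.
Proof. by case: h => // x h; rewrite /= last_rcons. Qed.

(** The weight of histories that play [a] in [q] at time [n]; [Arv] below is the weight of arriving
    in [q] at that time, before an action is chosen. *)
Definition Occ w n q a : R :=
  sumf n (fun h => \sum_s w (rcons h (s, a)) * (arr (qs h) s == q)%:R) [::].
Definition Arv w n q : R :=
  sumf n (fun h => \sum_s w h * nsp h s * (arr (qs h) s == q)%:R) [::].

Lemma Arv0 w q : Arv w 0 q = w [::] * (q == q0)%:R.
Proof.
rewrite /Arv /= (bigD1 s0) //= eqxx mulr1 big1 ?addr0 1?eq_sym // => s ne.
by rewrite (negbTE ne) mulr0 mul0r.
Qed.

(** On histories that carry weight, the product state lies above the actual state. Only the start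
    could break this, since [q0] lies above [s0]. *)
Definition tied w := forall h s a, w (rcons h (s, a)) != 0 -> st (arr (qs h) s) = s.

Lemma ArvS w n q : tied w -> Arv w n.+1 q =
  \sum_(q' <- Qs | nx q' (st q) == q) \sum_a Occ w n q' a * p (st q') a (st q).
Proof.
move=> tw; rewrite /Arv sumfSr /Occ.
under [RHS]eq_bigr do under eq_bigr do rewrite -sumfM.
under [RHS]eq_bigr do rewrite -sumf_sum.
rewrite -sumf_sum; apply: eq_sumf => h.
under [LHS]eq_bigr => x _.
  rewrite (bigD1 (st q)) //= big1 ?addr0; last first.
    move=> s ne; rewrite qs_rcons /=; case: eqP => [e|_]; last by rewrite mulr0.
    by move: ne; rewrite -e st_nx eqxx.
  rewrite qs_rcons /=; over.
transitivity (\sum_(x : X) \sum_(q' <- Qs | nx q' (st q) == q)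
    w (rcons h x) * (arr (qs h) x.1 == q')%:R * p (st q') x.2 (st q)).
  apply: eq_bigr => -[s a] _ /=; rewrite nsp_rcons.
  have [->|w0] := eqVneq (w (rcons h (s, a))) 0.
    by rewrite !mul0r big1 // => q' _; rewrite !mul0r.
  have e := tw _ _ _ w0.
  rewrite big_mkcond (bigD1_seq (arr (qs h) s)) ?arrQ //= eqxx mulr1 big1 ?addr0; last first.
    by move=> q' ne; rewrite (eq_sym (arr _ _)) (negbTE ne) mulr0 mul0r; case: ifP.
  by rewrite e; case: eqP => _; rewrite ?mulr1 ?mulr0.
rewrite exchange_big /=; apply: eq_bigr => q' _.
pose F s a := w (rcons h (s, a)) * (arr (qs h) s == q')%:R * p (st q') a (st q).
rewrite (eq_bigr (fun x : X => F x.1 x.2)); last by case.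
rewrite -(pair_bigA _ F) /= /F.
rewrite exchange_big /=; apply: eq_bigr => a _.
by rewrite mulr_suml.
Qed.

Section Scheduler.
Variable sigma : scheduler M R.
Local Notation cp := (cylinder_prob sigma s0).

Lemma cp_Occ n q : \sum_a Occ cp n q a = Arv cp n q.
Proof.
rewrite /Occ -sumf_sum /Arv; apply: eq_sumf => h.
rewrite exchange_big /=; apply: eq_bigr => s _; rewrite -mulr_suml.
congr (_ * _); under eq_bigr do rewrite cylinder_prob_rcons /step_prob /=.
by rewrite -mulr_sumr -mulr_sumr choose_act_sum1 mulr1.
Qed.

Lemma cp_good h x : cp (rcons h x) != 0 -> exists q, [/\ qs (rcons h x) = Some q,
  st q = x.1, good q, enabled M x.1 x.2 &
  forall i, hit i q = has (fun y : X => y.1 \in T i) (rcons h x)].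
Proof.
elim/last_ind: h x => [|h y IH] [s a]; rewrite cylinder_prob_rcons mulf_eq0 negb_or => /andP [ch].
  rewrite /step_prob /= mulf_eq0 negb_or => /andP [ss0 ca].
  have es : s = s0 by apply/eqP; move: ss0; case: (s == s0) => //=; rewrite eqxx.
  exists q0; rewrite /qs /= st0 es; split=> //.
    by apply: contrapT => e; move: ca; rewrite es choose_act_enabled ?eqxx.
  by move=> i; rewrite orbF.
case: y ch => s1 a1 ch; rewrite /step_prob nsp_rcons /= mulf_eq0 negb_or => /andP [pp ca].
have [q [qh sq gq eq hq]] := IH _ ch.
have pos : 0 < trans M (st q) a1 s.
  rewrite sq lt_neqAle eq_sym; case/andP: (trans_01 M s1 a1 s) => -> _; rewrite andbT.
  by apply: contra pp => /eqP ->; rewrite rmorph0.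
have en : enabled M (st q) a1 by rewrite sq.
have [g' h'] := good_nx gq en pos.
exists (nx q s); rewrite qs_rcons qh /= st_nx; split=> //.
- by apply: contrapT => e; move: ca; rewrite choose_act_enabled // eqxx.
- by move=> i; rewrite h' hq -[in RHS]cats1 has_cat /= orbF.
Qed.

Lemma cp_tied : tied cp.
Proof. by move=> h s a /cp_good [q []]; rewrite qs_rcons => -[<-]. Qed.

Lemma reachN_Occ i n : reachN sigma s0 (T i) n.+1 = \sum_(q <- Qs | hit i q) Arv cp n q.
Proof.
rewrite /reachN sumfSr; under [RHS]eq_bigr do rewrite -cp_Occ /Occ -sumf_sum.
rewrite -sumf_sum; apply: eq_sumf => h.
pose F s a := cp (rcons h (s, a)) * (has (fun x : X => x.1 \in T i) (rcons h (s, a)))%:R.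
rewrite (eq_bigr (fun x : X => F x.1 x.2)); last by case.
rewrite -(pair_bigA _ F) /= /F.
rewrite exchange_big /= [RHS]exchange_big /=; apply: eq_bigr => a _.
rewrite [RHS]exchange_big /=; apply: eq_bigr => s _.
have [->|c0] := eqVneq (cp (rcons h (s, a))) 0.
  by rewrite mul0r big1 // => q _; rewrite mul0r.
have [q [qh sq gq eq hq]] := cp_good c0; rewrite -hq.
move: qh; rewrite qs_rcons => -[qh].
rewrite big_mkcond (bigD1_seq q) //= ?eqxx; last by rewrite -qh arrQ.
rewrite qh eqxx mulr1 big1 ?addr0; last first.
  by move=> q' ne; rewrite eq_sym (negbTE ne) mulr0; case: ifP.
by case: (hit i q); rewrite ?mulr1 ?mulr0.
Qed.

Lemma cp_total n : sumf n cp [::] = 1.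
Proof.
elim: n => [|n IH]; first by rewrite /= /cylinder_prob big_ord0.
by rewrite sumfSr -[RHS]IH; apply: eq_sumf => h; exact: cylinder_prob_sum.
Qed.

Lemma Arv_total n : \sum_(q <- Qs) Arv cp n q = 1.
Proof.
rewrite -(cp_total n.+1) sumfSr /Arv -sumf_sum; apply: eq_sumf => h.
rewrite exchange_big /=.
transitivity (\sum_s cp h * nsp h s).
  apply: eq_bigr => s _; rewrite -mulr_sumr (bigD1_seq (arr (qs h) s)) ?arrQ //= eqxx.
  by rewrite big1 ?addr0 ?mulr1 // => q; rewrite eq_sym => /negbTE ->.
rewrite -mulr_sumr -(step_prob_sum sigma) mulr_sumr.
by apply: eq_bigr => x _; rewrite cylinder_prob_rcons.
Qed.

End Scheduler.

(** At each product state the mass brought by [y] either continues in [y] or settles into [r]. It is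
    the condition [flow2 r q = 0], imposed separately, that turns [r] into a circulation. *)
Record flow (y r : Q -> Act -> R) : Prop := Flow {
  fl_y0 : forall q a, q \in Qs -> 0 <= y q a;
  fl_r0 : forall q a, q \in Qs -> 0 <= r q a;
  fl_ye : forall q a, q \in Qs -> ~ enabled M (st q) a -> y q a = 0;
  fl_re : forall q a, q \in Qs -> ~ enabled M (st q) a -> r q a = 0;
  fl_1 : forall q, q \in Qs -> \sum_a y q a + \sum_a r q a = (q == q0)%:R +
    \sum_(q' <- Qs | nx q' (st q) == q) \sum_a y q' a * p (st q') a (st q) }.

Definition flow2 (r : Q -> Act -> R) q : R :=
  \sum_a r q a - \sum_(q' <- Qs | nx q' (st q) == q) \sum_a r q' a * p (st q') a (st q).

(* y and r are the occupation measures of the scheduler stopped at a time that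
   is uniform on [0, N). *)
Lemma scheduler_flow (sigma : scheduler M R) N : (0 < N)%N -> exists y r,
  [/\ flow y r, forall q, q \in Qs -> `|flow2 r q| <= N%:R^-1 &
   forall i, \sum_(q <- Qs | hit i q) \sum_a r q a =
     N%:R^-1 * \sum_(n < N) reachN sigma s0 (T i) n.+1].
Proof.
move=> N0; have NR : 0 < N%:R :> R by rewrite ltr0n.
set cp := cylinder_prob sigma s0.
have O0 n q a : 0 <= Occ cp n q a.
  apply: sumf_ge0 => h; apply: sumr_ge0 => s _; rewrite mulr_ge0 ?ler0n //.
  exact: cylinder_prob_ge0.
have Oe n q a : q \in Qs -> ~ enabled M (st q) a -> Occ cp n q a = 0.
  move=> qQ ne; rewrite /Occ (@eq_sumf _ _ _ _ _ (fun=> 0)).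
    by elim: n [::] => //= n IH h; rewrite big1.
  move=> h; apply: big1 => s _; case: eqP => [e|_]; last by rewrite mulr0.
  have [->|c0] := eqVneq (cp (rcons h (s, a))) 0; first by rewrite mul0r.
  have [q' [qh sq _ en _]] := cp_good c0; case: ne; move: qh en; rewrite qs_rcons e => -[->] /=.
  by rewrite sq.
(* The coefficients in [y] and [r] are the probabilities that the stopping time is later than n and
   that it equals n. *)
pose y q a : R := \sum_(n < N) (1 - n.+1%:R / N%:R) * Occ cp n q a.
pose r q a : R := N%:R^-1 * \sum_(n < N) Occ cp n q a.
have AS n q : Arv cp n.+1 q = _ := ArvS _ _ (cp_tied (sigma := sigma)).
exists y, r; split.
- split=> [q a qQ|q a qQ|q a qQ ne|q a qQ ne|q qQ].
  + apply: sumr_ge0 => n _; rewrite mulr_ge0 // subr_ge0 ler_pdivrMr // mul1r ler_nat; exact: ltn_ord.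
  + by rewrite mulr_ge0 ?invr_ge0 ?ler0n // sumr_ge0.
  + by rewrite /y big1 // => n _; rewrite Oe // mulr0.
  + by rewrite /r big1 ?mulr0 // => n _; rewrite Oe.
  rewrite /y /r.
  have -> : \sum_(q' <- Qs | nx q' (st q) == q) \sum_a (\sum_(n < N) (1 - n.+1%:R / N%:R) * Occ cp n q' a) * p (st q') a (st q)
     = \sum_(n < N) (1 - n.+1%:R / N%:R) * Arv cp n.+1 q.
    under eq_bigr do under eq_bigr do rewrite mulr_suml.
    under eq_bigr do rewrite exchange_big /=.
    rewrite exchange_big /=; apply: eq_bigr => n _; rewrite AS mulr_sumr; apply: eq_bigr => q' _.
    rewrite [RHS]mulr_sumr; apply: eq_bigr => a _.
    by rewrite -[LHS]mulrA.
  have -> : \sum_a \sum_(n < N) (1 - n.+1%:R / N%:R) * Occ cp n q a =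
      \sum_(n < N) (1 - n.+1%:R / N%:R) * Arv cp n q.
    by rewrite exchange_big /=; apply: eq_bigr => n _; rewrite -mulr_sumr cp_Occ.
  have -> : \sum_a N%:R^-1 * \sum_(n < N) Occ cp n q a = \sum_(n < N) N%:R^-1 * Arv cp n q.
    by rewrite -mulr_sumr exchange_big /= mulr_sumr; apply: eq_bigr => n _; rewrite cp_Occ.
  rewrite -big_split /=.
  under eq_bigr => n _.
    rewrite -mulrDl.
    have -> : 1 - n.+1%:R / N%:R + N%:R^-1 = 1 - n%:R / N%:R :> R by rewrite -natr1; field; rewrite gt_eqF.
    over.
  case: N N0 NR {y r} => // N _ NR.
  rewrite big_ord_recl /= mul0r subr0 mul1r Arv0 /cp /cylinder_prob big_ord0 mul1r; congr (_ + _).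
  by rewrite [RHS]big_ord_recr /= mulfV ?gt_eqF // subrr mul0r addr0; apply: eq_bigr => n _.
- move=> q qQ; rewrite /flow2 /r.
  have -> : \sum_(q' <- Qs | nx q' (st q) == q) \sum_a (N%:R^-1 * \sum_(n < N) Occ cp n q' a) * p (st q') a (st q)
     = N%:R^-1 * \sum_(n < N) Arv cp n.+1 q.
    rewrite mulr_sumr.
    under eq_bigr do under eq_bigr do rewrite -mulrA mulr_suml mulr_sumr.
    under eq_bigr do rewrite exchange_big /=.
    rewrite exchange_big /=; apply: eq_bigr => n _; rewrite AS mulr_sumr; apply: eq_bigr => q' _.
    by rewrite [RHS]mulr_sumr.
  rewrite -mulr_sumr exchange_big /=.
  under eq_bigr do rewrite cp_Occ.
  rewrite -mulrBr.
  (* The defect of [r] telescopes to a difference of two probabilities divided by N. *)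
  have -> : \sum_(n < N) Arv cp n q - \sum_(n < N) Arv cp n.+1 q = Arv cp 0 q - Arv cp N q.
    by elim: (N) => [|k IH]; rewrite ?big_ord0 ?subrr // !big_ord_recr /=; move: IH; lra.
  rewrite normrM ger0_norm ?invr_ge0 ?ler0n // ler_piMr ?invr_ge0 ?ler0n //.
  have A0 n q' : 0 <= Arv cp n q' by rewrite -cp_Occ sumr_ge0.
  have A1 : Arv cp N q <= 1.
    by rewrite -(Arv_total sigma N) (bigD1_seq q) //= lerDl sumr_ge0.
  have := A0 N q; rewrite Arv0 /cp /cylinder_prob big_ord0 mul1r -/cp.
  by rewrite ler_norml; move: A1; case: (q == q0) => /=; lra.
- move=> i; rewrite /r; under eq_bigr do rewrite -mulr_sumr.
  rewrite -mulr_sumr; congr (_ * _).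
  under eq_bigr do rewrite exchange_big /=.
  rewrite exchange_big /=; apply: eq_bigr => n _; rewrite reachN_Occ; apply: eq_bigr => q _.
  exact: cp_Occ.
Qed.

Lemma reorg (G : Q -> Q -> R) :
  \sum_(q <- Qs) \sum_(q' <- Qs | nx q' (st q) == q) G q' q =
  \sum_(q' <- Qs) \sum_t G q' (nx q' t).
Proof.
rewrite (exchange_big_dep xpredT) //= big_seq [RHS]big_seq; apply: eq_bigr => q' q'Q.
transitivity (\sum_(q <- Qs) \sum_t (nx q' t == q)%:R * G q' q).
  rewrite big_mkcond; apply: eq_bigr => q _; case: eqP => [e|ne].
    rewrite (bigD1 (st q)) //= e eqxx mul1r big1 ?addr0 // => t ne.
    by case: eqP => [e'|_]; rewrite ?mul0r //; move: ne; rewrite -e' st_nx eqxx.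
  by rewrite big1 // => t _; case: eqP => [e|_]; rewrite ?mul0r //; case: ne; rewrite -e st_nx.
rewrite exchange_big /=; apply: eq_bigr => t _.
rewrite (bigD1_seq (nx q' t)) ?nxQ //= eqxx mul1r big1 ?addr0 // => q.
by rewrite eq_sym => /negbTE ->; rewrite mul0r.
Qed.

(** * From a pair of flows to a scheduler *)

Section Realise.
Variables (y r : Q -> Act -> R).
Hypotheses (fl : flow y r) (fl2 : forall q, q \in Qs -> flow2 r q = 0).
Definition rr q : R := \sum_a r q a.
Definition cc q : R := \sum_a y q a + rr q.

Lemma rr_ge0 q : q \in Qs -> 0 <= rr q.
Proof. by move=> qQ; apply: sumr_ge0 => a _; exact: fl_r0 fl _ _ qQ. Qed.

Lemma cc_ge0 q : q \in Qs -> 0 <= cc q.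
Proof. by move=> qQ; rewrite addr_ge0 ?rr_ge0 // sumr_ge0 // => a _; exact: fl_y0 fl _ _ qQ. Qed.

Lemma rrE q : q \in Qs -> rr q = \sum_(q' <- Qs | nx q' (st q) == q) \sum_a r q' a * p (st q') a (st q).
Proof. by move=> /fl2 /eqP; rewrite subr_eq0 => /eqP. Qed.

(** Weights of a history in the two phases of a strategy. In the first phase at [q] it plays [a] and
    stays with probability y q a / cc q, or plays [a] and switches with probability r q a / cc q; in
    the second phase it plays in proportion to [r] for ever. The history is reversed for the
    recursion. *)
Fixpoint wt (hr : seq X) : R * R :=
  if hr is x :: hr' then
    let h := rev hr' in let q := arr (qs h) x.1 in
    let n := nsp h x.1 in
    ((wt hr').1 * n * (y q x.2 / cc q),
     (wt hr').1 * n * (r q x.2 / cc q) + (wt hr').2 * n * (r q x.2 / rr q))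
  else (1, 0).
Definition wY h := (wt (rev h)).1.
Definition wR h := (wt (rev h)).2.

Lemma wY_rcons h s a : wY (rcons h (s, a)) =
  wY h * nsp h s * (y (arr (qs h) s) a / cc (arr (qs h) s)).
Proof. by rewrite /wY rev_rcons /= revK. Qed.

Lemma wR_rcons h s a : wR (rcons h (s, a)) =
  wY h * nsp h s * (r (arr (qs h) s) a / cc (arr (qs h) s)) +
  wR h * nsp h s * (r (arr (qs h) s) a / rr (arr (qs h) s)).
Proof. by rewrite /wR /wY rev_rcons /= revK. Qed.

Lemma nsp_ge0 h s : 0 <= nsp h s.
Proof.
case: (lastP h) => [|h' [t a]]; first by rewrite /= ler0n.
by rewrite nsp_rcons p_ge0.
Qed.

Lemma wYR_ge0 h : 0 <= wY h /\ 0 <= wR h.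
Proof.
elim/last_ind: h => [|h [s a] [h1 h2]]; first by rewrite /wY /wR /= ler01.
rewrite wY_rcons wR_rcons; have qQ := arrQ h s; have n0 := nsp_ge0 h s.
have c0 := cc_ge0 qQ; have r0 := rr_ge0 qQ.
have y1 := fl_y0 fl a qQ; have r1 := fl_r0 fl a qQ.
by split; rewrite ?addr_ge0 // !mulr_ge0 // ?divr_ge0 // invr_ge0.
Qed.

Lemma flow_in_le (z : Q -> Act -> R) q' a s : q' \in Qs -> (forall q a, q \in Qs -> 0 <= z q a) ->
  z q' a * p (st q') a s <=
  \sum_(q1 <- Qs | nx q1 (st (nx q' s)) == nx q' s) \sum_b z q1 b * p (st q1) b (st (nx q' s)).
Proof.
move=> qQ z0; rewrite st_nx big_mkcond (bigD1_seq q') //= eqxx (bigD1 a) //= -addrA lerDl.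
apply: addr_ge0; first by apply: sumr_ge0 => b _; rewrite mulr_ge0 ?p_ge0 ?z0.
rewrite big_seq_cond sumr_ge0 // => q1 /andP [q1Q _]; case: ifP => // _.
by rewrite sumr_ge0 // => b _; rewrite mulr_ge0 ?p_ge0 ?z0.
Qed.

(** Rules out that mass is lost in a division by zero: a product state that receives weight receives
    flow, so its outflow is positive by the balance equations. *)
Lemma weights_pos h s :
  (wY h * nsp h s != 0 -> 0 < cc (arr (qs h) s) /\ st (arr (qs h) s) = s) /\
  (wR h * nsp h s != 0 -> 0 < rr (arr (qs h) s) /\ st (arr (qs h) s) = s).
Proof.
elim/last_ind: h s => [|h [s1 a1] IH] s.
  rewrite /wY /wR /= !mul0r eqxx; split=> //; rewrite mul1r => ss.
  have -> : s = s0 by apply/eqP; move: ss; case: (s == s0) => //=; rewrite eqxx.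
  split=> //; rewrite /cc (fl_1 fl q0Q) eqxx; apply: ltr_pwDl; first exact: ltr01.
  rewrite big_seq_cond sumr_ge0 // => q1 /andP [q1Q _].
  by rewrite sumr_ge0 // => b _; rewrite mulr_ge0 ?p_ge0 // (fl_y0 fl).
have [IHY IHR] := IH s1; set q1 := arr (qs h) s1 in IHY IHR *.
have q1Q : q1 \in Qs by exact: arrQ.
have qQ : nx q1 s \in Qs by exact: nxQ.
rewrite qs_rcons /= -/q1 nsp_rcons wY_rcons wR_rcons -/q1 st_nx.
have pos (z : Q -> Act -> R) : (forall q a, q \in Qs -> 0 <= z q a) -> st q1 = s1 ->
    z q1 a1 != 0 -> p s1 a1 s != 0 -> 0 < z q1 a1 * p (st q1) a1 s.
  by move=> z0 -> zn pn; rewrite mulr_gt0 // lt_neqAle eq_sym ?zn ?pn ?z0 ?p_ge0.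
have rpos : r q1 a1 != 0 -> st q1 = s1 -> p s1 a1 s != 0 -> 0 < rr (nx q1 s).
  move=> rn es pn; apply: lt_le_trans (pos r (fun q a => fl_r0 fl a) es rn pn) _.
  by rewrite rrE //; apply: flow_in_le => // q a; exact: (fl_r0 fl).
split.
  rewrite mulf_eq0 negb_or => /andP [+ pn].
  rewrite mulf_eq0 negb_or => /andP [w1].
  rewrite mulf_eq0 negb_or => /andP [yn _].
  have [_ es] := IHY w1.
  split=> //; apply: lt_le_trans (pos y (fun q a => fl_y0 fl a) es yn pn) _.
  rewrite /cc (fl_1 fl qQ); apply: le_trans (flow_in_le _ _ q1Q (fun q a => fl_y0 fl a)) _.
  by rewrite lerDr ler0n.
rewrite mulf_eq0 negb_or => /andP [sn pn]; split=> //.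
have [w1|w1] := eqVneq (wY h * nsp h s1 * (r q1 a1 / cc q1)) 0.
  move: sn; rewrite w1 add0r mulf_eq0 negb_or => /andP [/IHR [_ es]].
  by rewrite mulf_eq0 negb_or => /andP [rn _]; exact: rpos.
move: w1; rewrite mulf_eq0 negb_or => /andP [/IHY [_ es]].
by rewrite mulf_eq0 negb_or => /andP [rn _]; exact: rpos.
Qed.

Lemma tied_wY : tied wY.
Proof.
move=> h s a; rewrite wY_rcons mulf_eq0 negb_or => /andP [n _].
by have [/(_ n) [_ ->]] := weights_pos h s.
Qed.

Lemma tied_wR : tied wR.
Proof.
move=> h s a; rewrite wR_rcons => n; have [h1 h2] := weights_pos h s.
have [e|/h1 [] //] := eqVneq (wY h * nsp h s) 0.
have [e'|/h2 [] //] := eqVneq (wR h * nsp h s) 0.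
by move: n; rewrite e e' !mul0r addr0 eqxx.
Qed.

Lemma Occ_wY n q a : Occ wY n q a = Arv wY n q * (y q a / cc q).
Proof.
rewrite /Occ /Arv -sumfM; apply: eq_sumf => h; rewrite mulr_suml; apply: eq_bigr => s _.
by rewrite wY_rcons; case: eqP => [->|_]; rewrite ?mulr1 // !mulr0 mul0r.
Qed.

Lemma Occ_wR n q a : Occ wR n q a = Arv wY n q * (r q a / cc q) + Arv wR n q * (r q a / rr q).
Proof.
rewrite /Occ /Arv -!sumfM -sumfD; apply: eq_sumf => h; rewrite !mulr_suml -big_split; apply: eq_bigr => s _ /=.
by rewrite wR_rcons; case: eqP => [->|_]; rewrite ?mulr1 // !mulr0 !mul0r addr0.
Qed.

Lemma Arv_ge0 w n q : (forall h, 0 <= w h) -> 0 <= Arv w n q.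
Proof.
move=> w0; apply: sumf_ge0 => h; apply: sumr_ge0 => s _.
by rewrite !mulr_ge0 ?ler0n ?nsp_ge0.
Qed.

Lemma AY0 n q : 0 <= Arv wY n q. Proof. by apply: Arv_ge0 => h; case: (wYR_ge0 h). Qed.
Lemma AR0 n q : 0 <= Arv wR n q. Proof. by apply: Arv_ge0 => h; case: (wYR_ge0 h). Qed.

Lemma frac_le (x c z : R) : 0 <= x -> x <= c -> 0 <= z -> x * (z / c) <= z.
Proof.
move=> x0 xc z0; have [c0|c0] := eqVneq c 0; first by rewrite c0 invr0 mulr0 mulr0.
have cp : 0 < c by rewrite lt_neqAle eq_sym c0 (le_trans x0).
by rewrite mulrA ler_pdivrMr // mulrC ler_wpM2l.
Qed.

(** Unrolling the balance equation up to a horizon bounds the expected visits in the first phase by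
    the flow, uniformly in the horizon. So the probability of still being in that phase tends to
    zero. *)
Lemma sumAY N q : q \in Qs -> \sum_(n < N.+1) Arv wY n q <= cc q.
Proof.
elim: N q => [|N IH] q qQ; rewrite big_ord_recl /= Arv0 /wY /= mul1r /cc (fl_1 fl qQ).
  rewrite big_ord0 addr0 lerDl big_seq_cond sumr_ge0 // => q1 /andP [q1Q _].
  by rewrite sumr_ge0 // => b _; rewrite mulr_ge0 ?p_ge0 // (fl_y0 fl).
apply: lerD => //; under eq_bigr do rewrite (ArvS _ _ tied_wY).
rewrite exchange_big /= big_seq_cond [X in _ <= X]big_seq_cond; apply: ler_sum => q1 /andP [q1Q _].
rewrite exchange_big /=; apply: ler_sum => a _; rewrite -mulr_suml ler_wpM2r ?p_ge0 //.
under eq_bigr do rewrite Occ_wY; rewrite -mulr_suml; apply: frac_le.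
- by apply: sumr_ge0 => n _; exact: AY0.
- exact: IH.
- exact: (fl_y0 fl).
Qed.

(** Along a circulation the average rank is the same before and after a step. Ranks never decrease,
    so no edge that carries flow raises the rank, and then [rank_hit] applies. *)
Lemma hit_preserved i q a t : q \in Qs -> r q a * p (st q) a t != 0 -> hit i (nx q t) = hit i q.
Proof.
move=> qQ rp; apply: rank_hit; apply/eqP; rewrite eqn_leq rank_nx andbT leqNgt; apply/negP => lt.
have e1 : \sum_(q <- Qs) (rank q)%:R * rr q =
    \sum_(q <- Qs) \sum_t \sum_a (rank (nx q t))%:R * (r q a * p (st q) a t).
  under [RHS]eq_bigr do under eq_bigr do rewrite -mulr_sumr.
  pose G q' q : R := (rank q)%:R * \sum_a r q' a * p (st q') a (st q).
  transitivity (\sum_(q <- Qs) \sum_(q' <- Qs | nx q' (st q) == q) G q' q).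
    rewrite big_seq [RHS]big_seq; apply: eq_bigr => q1 q1Q.
    by rewrite rrE // mulr_sumr.
  by rewrite reorg; apply: eq_bigr => q1 _; apply: eq_bigr => t1 _; rewrite /G st_nx.
have e2 : \sum_(q <- Qs) (rank q)%:R * rr q =
    \sum_(q <- Qs) \sum_t \sum_a (rank q)%:R * (r q a * p (st q) a t).
  rewrite big_seq [RHS]big_seq; apply: eq_bigr => q1 q1Q.
  rewrite exchange_big /= /rr mulr_sumr; apply: eq_bigr => b _.
  rewrite -mulr_sumr -mulr_sumr; have [en|en] := pselect (enabled M (st q1) b).
    by rewrite p_sum // mulr1.
  by rewrite (fl_re fl q1Q en) mul0r.
have := e1; rewrite e2 => /eqP; rewrite eq_sym -subr_eq0 -sumrB => /eqP e3.
have : 0 < \sum_(q <- Qs) (\sum_t \sum_a (rank (nx q t))%:R * (r q a * p (st q) a t) -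
   \sum_t \sum_a (rank q)%:R * (r q a * p (st q) a t)); last by rewrite e3 ltxx.
have t0 q1 a1 t1 : q1 \in Qs -> 0 <= (rank (nx q1 t1))%:R * (r q1 a1 * p (st q1) a1 t1) - (rank q1)%:R * (r q1 a1 * p (st q1) a1 t1).
  move=> q1Q; rewrite -mulrBl mulr_ge0 ?subr_ge0 ?ler_nat // mulr_ge0 ?p_ge0 //; exact: (fl_r0 fl _ q1Q).
have s0' q1 : q1 \in Qs -> 0 <= \sum_t \sum_a (rank (nx q1 t))%:R * (r q1 a * p (st q1) a t) -
   \sum_t \sum_a (rank q1)%:R * (r q1 a * p (st q1) a t).
  move=> q1Q; rewrite -sumrB sumr_ge0 // => t1 _; rewrite -sumrB sumr_ge0 // => a1 _; exact: t0.
rewrite (bigD1_seq q) //=; apply: ltr_pwDl; last first.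
  by rewrite big_seq_cond sumr_ge0 // => q1 /andP [q1Q _]; exact: s0'.
rewrite -sumrB (bigD1 t) //=; apply: ltr_pwDl; last first.
  by rewrite sumr_ge0 // => t1 _; rewrite -sumrB sumr_ge0 // => a1 _; exact: t0.
rewrite -sumrB (bigD1 a) //=; apply: ltr_pwDl; last first.
  by rewrite sumr_ge0 // => a1 _; exact: t0.
rewrite -mulrBl mulr_gt0 ?subr_gt0 ?ltr_nat // lt_neqAle eq_sym rp /=.
by rewrite mulr_ge0 ?p_ge0 // (fl_r0 fl _ qQ).
Qed.

(** The circulation does not cross the border of [P], so the second phase holds there only what has
    entered there. *)
Lemma sumAR (P : pred Q) : (forall q a t, q \in Qs -> r q a * p (st q) a t != 0 -> P (nx q t) = P q) ->
  forall N, \sum_(q <- Qs | P q) Arv wR N q <= \sum_(q <- Qs | P q) rr q.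
Proof.
move=> HP N.
(* The middle term is the mass that has switched phase inside [P] before time N; it is the bound
   that an induction on N can prove. *)
apply: (@le_trans _ _ (\sum_(q <- Qs | P q) (\sum_(n < N) Arv wY n q) * (rr q / cc q))); last first.
  rewrite big_seq_cond [X in _ <= X]big_seq_cond; apply: ler_sum => q /andP [qQ _].
  apply: frac_le; [by apply: sumr_ge0 => n _; exact: AY0| |exact: rr_ge0].
  case: N => [|N]; last exact: sumAY.
  by rewrite big_ord0 cc_ge0.
elim: N => [|N IH].
  rewrite big1; first by rewrite big1 // => q _; rewrite big_ord0 mul0r.
  by move=> q _; rewrite Arv0 /wR /= mul0r.
pose G q' q : R := (P q)%:R * \sum_a Occ wR N q' a * p (st q') a (st q).
have e1 : \sum_(q <- Qs | P q) Arv wR N.+1 q = \sum_(q' <- Qs) \sum_t G q' (nx q' t).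
  rewrite -reorg big_mkcond; apply: eq_bigr => q _; rewrite (ArvS _ _ tied_wR) /G.
  by case: (P q); rewrite ?mul1r //; [apply: eq_bigr => q1 _; rewrite mul1r|rewrite big1 // => q1 _; rewrite mul0r].
rewrite e1; apply: (@le_trans _ _ (\sum_(q' <- Qs | P q') \sum_a Occ wR N q' a)).
  rewrite [X in _ <= X]big_mkcond [X in X <= _]big_seq [X in _ <= X]big_seq; apply: ler_sum => q qQ.
  rewrite /G; under eq_bigr do rewrite mulr_sumr st_nx.
  rewrite exchange_big /=.
  have -> : (if P q then \sum_a Occ wR N q a else 0) = \sum_a (P q)%:R * Occ wR N q a.
    by case: (P q); rewrite ?mul1r; [apply: eq_bigr => a _; rewrite mul1r|rewrite big1 // => a _; rewrite mul0r].
  apply: ler_sum => a _.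
  have [r0|r0] := eqVneq (r q a) 0.
    by rewrite Occ_wR r0 !mul0r !mulr0 addr0 big1 ?mulr0 // => t _; rewrite mul0r mulr0.
  have O0 : 0 <= Occ wR N q a.
    by rewrite Occ_wR addr_ge0 // mulr_ge0 ?AY0 ?AR0 // divr_ge0 ?(fl_r0 fl _ qQ) ?cc_ge0 ?rr_ge0.
  apply: (@le_trans _ _ (\sum_t (P q)%:R * (Occ wR N q a * p (st q) a t))).
    apply: ler_sum => t _; have [->|pn] := eqVneq (p (st q) a t) 0; first by rewrite !mulr0.
    by rewrite (HP q a t) // mulf_neq0.
  rewrite -mulr_sumr -mulr_sumr; have [en|en] := pselect (enabled M (st q) a).
    by rewrite p_sum // mulr1.
  by move: r0; rewrite (fl_re fl qQ en) eqxx.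
under [X in _ <= X]eq_bigr do rewrite big_ord_recr /= mulrDl.
rewrite big_split /= addrC.
apply: (@le_trans _ _ (\sum_(q <- Qs | P q) (Arv wY N q * (rr q / cc q) + Arv wR N q))); last first.
  by rewrite big_split /= lerD2l.
rewrite big_seq_cond [X in _ <= X]big_seq_cond; apply: ler_sum => q /andP [qQ _].
under eq_bigr do rewrite Occ_wR; rewrite big_split /= -!mulr_sumr -!mulr_suml -/(rr q).
rewrite lerD2l; have [->|rn] := eqVneq (rr q) 0; first by rewrite mul0r mulr0 AR0.
by rewrite mulfV // mulr1.
Qed.

(** Summed over all product states, the in- and outflow of [y] cancel and the unit source
    remains. *)
Lemma sum_rr : \sum_(q <- Qs) rr q = 1.
Proof.
have : \sum_(q <- Qs) (\sum_a y q a + rr q) = 1 + \sum_(q <- Qs) \sum_a y q a.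
  rewrite big_seq; under eq_bigr => q qQ do rewrite (fl_1 fl qQ).
  rewrite -big_seq big_split /=; congr (_ + _).
    by rewrite (bigD1_seq q0) //= eqxx big1 ?addr0 // => q /negbTE ->.
  rewrite (reorg (fun q' q => \sum_a y q' a * p (st q') a (st q))) [LHS]big_seq [RHS]big_seq.
  apply: eq_bigr => q qQ /=; under eq_bigr do under eq_bigr do rewrite st_nx.
  rewrite exchange_big /=; apply: eq_bigr => a _; rewrite -mulr_sumr.
  have [en|en] := pselect (enabled M (st q) a); first by rewrite p_sum // mulr1.
  by rewrite (fl_ye fl qQ en) mul0r.
by rewrite big_split /= addrC => /addIr.
Qed.

(** In the second phase, states that record target [i] hold mass at most [v] and the others at most
    1 - v. Total mass being 1, the value within n steps deviates from [v] by no more than the mass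
    left in the first phase. These masses have a bounded sum over n, so they cannot stay away from
    zero. *)
Theorem flow_scheduler : exists sigma : scheduler M R, forall i,
  reach_prob sigma s0 (T i) = \sum_(q <- Qs | hit i q) \sum_a r q a.
Proof.
have [||||sigma cpE] := @weight_scheduler R nS nA M s0 (fun h => wY h + wR h).
- by rewrite /wY /wR /= addr0.
- by move=> h; case: (wYR_ge0 h) => *; rewrite addr_ge0.
- move=> h s; under eq_bigr do rewrite wY_rcons wR_rcons addrA -mulrDr -mulrDl.
  rewrite big_split /= -!mulr_sumr -!mulr_suml big_split /= -/(rr _) -/(cc _) [RHS]mulrDl.
  have [h1 h2] := weights_pos h s; congr (_ + _).
    have [->|/h1 [c0 _]] := eqVneq (wY h * nsp h s) 0; first by rewrite mul0r.
    by rewrite mulfV ?mulr1 // gt_eqF.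
  have [->|/h2 [c0 _]] := eqVneq (wR h * nsp h s) 0; first by rewrite mul0r.
  by rewrite mulfV ?mulr1 // gt_eqF.
- move=> h s a en; rewrite wY_rcons wR_rcons; have [h1 h2] := weights_pos h s.
  have qQ := arrQ h s.
  have [e1|/h1 [_ e1]] := eqVneq (wY h * nsp h s) 0; last by rewrite -e1 in en; rewrite (fl_ye fl qQ en) (fl_re fl qQ en) !mul0r !mulr0 !addr0.
  have [e2|/h2 [_ e2]] := eqVneq (wR h * nsp h s) 0; last by rewrite -e2 in en; rewrite (fl_ye fl qQ en) (fl_re fl qQ en) !mul0r !mulr0 !addr0.
  by rewrite e1 e2 !mul0r !addr0.
exists sigma => i; set v := \sum_(q <- Qs | hit i q) _.
have ArvE n q : Arv (cylinder_prob sigma s0) n q = Arv wY n q + Arv wR n q.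
  rewrite /Arv -sumfD; apply: eq_sumf => h; rewrite -big_split; apply: eq_bigr => s _ /=.
  by rewrite cpE !mulrDl.
have bound n : `|reachN sigma s0 (T i) n.+1 - v| <= \sum_(q <- Qs) Arv wY n q.
  have tot := Arv_total sigma n; rewrite (bigID (hit i)) /= -reachN_Occ in tot.
  have := sumAR (fun q a t => @hit_preserved i q a t) n; rewrite -/v => h1.
  have h2 := @sumAR (predC (hit i)) _ n.
  have {}h2 : \sum_(q <- Qs | ~~ hit i q) Arv wR n q <= \sum_(q <- Qs | ~~ hit i q) rr q.
    by apply: h2 => q a t qQ rp /=; rewrite (hit_preserved i qQ rp).
  have h3 := sum_rr; rewrite (bigID (hit i)) /= -/v in h3.
  have E1 : reachN sigma s0 (T i) n.+1 = \sum_(q <- Qs | hit i q) Arv wY n q + \sum_(q <- Qs | hit i q) Arv wR n q.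
    by rewrite reachN_Occ -big_split; apply: eq_bigr => q _; exact: ArvE.
  have E2 : \sum_(q <- Qs | ~~ hit i q) Arv (cylinder_prob sigma s0) n q =
     \sum_(q <- Qs | ~~ hit i q) Arv wY n q + \sum_(q <- Qs | ~~ hit i q) Arv wR n q.
    by rewrite -big_split; apply: eq_bigr => q _; exact: ArvE.
  rewrite [X in _ <= X](bigID (hit i)) /=.
  have p1 : 0 <= \sum_(q <- Qs | hit i q) Arv wY n q by apply: sumr_ge0 => q _; exact: AY0.
  have p2 : 0 <= \sum_(q <- Qs | ~~ hit i q) Arv wY n q by apply: sumr_ge0 => q _; exact: AY0.
  rewrite E2 in tot; rewrite ler_norml; move: E1 tot h1 h2 h3 p1 p2; lra.
apply/eqP; rewrite -subr_eq0; apply: contraT => ne.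
have d0 : 0 < `|reach_prob sigma s0 (T i) - v| by rewrite normr_gt0.
set d := `|_| in d0.
have [N HN] := @reachN_cvg R nS nA M sigma s0 (T i) (d / 2) ltac:(lra).
have low n : (N <= n)%N -> d / 2 <= \sum_(q <- Qs) Arv wY n q.
  move=> Nn; have := HN n.+1 (leqW Nn); have := bound n.
  have := ler_distD (reachN sigma s0 (T i) n.+1) (reach_prob sigma s0 (T i)) v.
  rewrite -/d (distrC (reach_prob _ _ _)); lra.
pose C : R := \sum_(q <- Qs) cc q.
have up K : \sum_(n < K.+1) \sum_(q <- Qs) Arv wY n q <= C.
  rewrite exchange_big /= big_seq [X in _ <= X]big_seq; apply: ler_sum => q qQ; exact: sumAY.
have all K : d / 2 * K%:R <= C.
  apply: le_trans (up (N + K)%N); rewrite -addnS big_split_ord /=.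
  apply: (@le_trans _ _ (\sum_(j < K.+1) d / 2)).
    by rewrite sumr_const card_ord -[X in _ <= X]mulr_natr ler_wpM2l ?ler_nat //; lra.
  rewrite -[X in X <= _]add0r lerD //.
    by apply: sumr_ge0 => n _; apply: sumr_ge0 => q _; exact: AY0.
  by apply: ler_sum => n _; apply: low; exact: leq_addr.
have := archi_boundP (_ : 0 <= C / (d / 2)).
have C0 : 0 <= C by apply: le_trans (all 0%N); rewrite mulr0.
move=> /(_ (divr_ge0 C0 (ltW _))) W.
have := W ltac:(lra); rewrite ltr_pdivrMr; last by lra.
by rewrite mulrC ltNge all.
Qed.

End Realise.

(** * The flow equations as a finite linear system, and passage to the limit *)

Definition flow_vars : seq (bool * (Q * Act)) :=
  let W := [seq x <- [seq (q, a) | q <- Qs, a <- enum Act] | `[< enabled M (st x.1) x.2 >]] in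
  map (pair false) W ++ map (pair true) W.

Lemma uniq_flow_vars : uniq flow_vars.
Proof.
rewrite /flow_vars; set W := seq.filter _ _.
have uW : uniq W.
  apply: filter_uniq; apply: allpairs_uniq => //; first exact: enum_uniq.
  by move=> [q a] [q' a'] _ _ /= [-> ->].
have pinj b : injective (@pair bool (Q * Act) b) by move=> x y [].
rewrite cat_uniq !(map_inj_uniq (pinj _)) uW andbT /=.
by apply/hasPn => x /mapP [z _ ->]; apply/negP => /mapP [z' _].
Qed.

Lemma mem_flow_vars b q a : ((b, (q, a)) \in flow_vars) = (q \in Qs) && `[< enabled M (st q) a >].
Proof.
rewrite /flow_vars; set W := seq.filter _ _.
have mW : ((q, a) \in W) = (q \in Qs) && `[< enabled M (st q) a >].
  rewrite mem_filter andbC; congr (_ && _); apply/allpairsP/idP => [[[q' a'] /= [h _ [-> _]]] //|h].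
  by exists (q, a); rewrite mem_enum.
have pinj c : injective (@pair bool (Q * Act) c) by move=> x y [].
rewrite -mW mem_cat; case: b; rewrite (mem_map (pinj _)) ?orbF //.
  by rewrite orbC; case: (_ \in W) => //=; apply/negbTE/mapP => -[].
by case: (_ \in W) => //=; apply/negbTE/mapP => -[].
Qed.

Lemma flow_vars_sum (G : bool * (Q * Act) -> R) :
  (forall b q a, q \in Qs -> ~ enabled M (st q) a -> G (b, (q, a)) = 0) ->
  \sum_(v <- flow_vars) G v = \sum_(q <- Qs) \sum_a G (false, (q, a)) + \sum_(q <- Qs) \sum_a G (true, (q, a)).
Proof.
move=> G0; rewrite /flow_vars big_cat /= !big_map !big_filter.
have E b : \sum_(i <- [seq (q, a) | q <- Qs, a <- enum Act] | `[< enabled M (st i.1) i.2 >]) G (b, i) =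
    \sum_(q <- Qs) \sum_a G (b, (q, a)).
  rewrite big_mkcond big_allpairs_dep big_seq [RHS]big_seq; apply: eq_bigr => q qQ /=.
  rewrite big_enum /=; apply: eq_bigr => a _; case: asboolP => // ne; by rewrite G0.
by rewrite !E.
Qed.

(** The three kinds of rows are balance, circulation and value. The flows stopped at a finite
    horizon satisfy the first exactly and the other two up to a small error. *)
Definition flow_row (k : (bool * Q) + I) (v : bool * (Q * Act)) : R :=
  let: (b, (q', a)) := v in
  match k with
  | inl (true, q) => (q' == q)%:R - (if b then 0 else (nx q' (st q) == q)%:R * p (st q') a (st q))
  | inl (false, q) => if b then (q' == q)%:R - (nx q' (st q) == q)%:R * p (st q') a (st q) else 0
  | inr i => (b && hit i q')%:R
  end.

Definition flow_rhs (v : I -> R) (k : (bool * Q) + I) : R :=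
  match k with inl (true, q) => (q == q0)%:R | inl _ => 0 | inr i => v i end.

Definition flow_fun (y r : Q -> Act -> R) (v : bool * (Q * Act)) : R :=
  if v.1 then r v.2.1 v.2.2 else y v.2.1 v.2.2.

Lemma sum_diag (F : Q -> Act -> R) q : q \in Qs ->
  \sum_(q' <- Qs) \sum_a (q' == q)%:R * F q' a = \sum_a F q a.
Proof.
move=> qQ; rewrite (bigD1_seq q) //= [X in _ + X]big1 ?addr0.
  by apply: eq_bigr => a _; rewrite eqxx mul1r.
by move=> q' /negbTE ->; rewrite big1 // => a _; rewrite mul0r.
Qed.

Lemma sum_in (F : Q -> Act -> R) q :
  \sum_(q' <- Qs) \sum_a (nx q' (st q) == q)%:R * p (st q') a (st q) * F q' a =
  \sum_(q' <- Qs | nx q' (st q) == q) \sum_a F q' a * p (st q') a (st q).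
Proof.
rewrite [RHS]big_mkcond; apply: eq_bigr => q' _; case: eqP => _.
  by apply: eq_bigr => a _; rewrite mul1r mulrC.
by rewrite big1 // => a _; rewrite !mul0r.
Qed.

Lemma flow_row_sum (y r : Q -> Act -> R) k :
  (forall q a, q \in Qs -> ~ enabled M (st q) a -> y q a = 0) ->
  (forall q a, q \in Qs -> ~ enabled M (st q) a -> r q a = 0) ->
  (if k is inl (_, q) then q \in Qs else true) ->
  \sum_(v <- flow_vars) flow_row k v * flow_fun y r v =
  match k with
  | inl (true, q) => \sum_a y q a + \sum_a r q a -
      \sum_(q' <- Qs | nx q' (st q) == q) \sum_a y q' a * p (st q') a (st q)
  | inl (false, q) => flow2 r q
  | inr i => \sum_(q <- Qs | hit i q) \sum_a r q a
  end.
Proof.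
move=> ye re kQ; rewrite flow_vars_sum; last first.
  by move=> [] q a qQ ne; rewrite /flow_fun /= ?ye ?re // mulr0.
rewrite /flow_fun /=; case: k kQ => [[[] q] qQ|i _] /=.
- under eq_bigr do under eq_bigr do rewrite mulrBl.
  under eq_bigr do rewrite sumrB.
  rewrite sumrB sum_in sum_diag //; under [X in _ + X]eq_bigr do under eq_bigr do rewrite subr0.
  by rewrite sum_diag // addrAC.
- rewrite big1 ?add0r; last by move=> q' _; rewrite big1 // => a _; rewrite mul0r.
  under eq_bigr do under eq_bigr do rewrite mulrBl.
  under eq_bigr do rewrite sumrB.
  by rewrite sumrB sum_in sum_diag.
- rewrite big1 ?add0r; last by move=> q' _; rewrite big1 // => a _; rewrite mul0r.
  rewrite [RHS]big_mkcond; apply: eq_bigr => q _; case: (hit i q).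
    by apply: eq_bigr => a _; rewrite mul1r.
  by rewrite big1 // => a _; rewrite mul0r.
Qed.

Lemma cesaro_mean (u : nat -> R) (l : R) :
  (forall e, 0 < e -> exists N, forall n, (N <= n)%N -> `|u n - l| <= e) ->
  forall e, 0 < e -> exists N, forall n, (N <= n)%N -> (0 < n)%N ->
    `|n%:R^-1 * \sum_(i < n) u i - l| <= e.
Proof.
move=> H e e0; have [N1 HN] := H (e / 2) ltac:(lra).
pose K := \sum_(i < N1) `|u i - l|.
have K0 : 0 <= K by exact: sumr_ge0.
exists (N1 + Num.bound (2 * K / e))%N => n nN n0.
have nR : 0 < n%:R :> R by rewrite ltr0n.
have -> : n%:R^-1 * \sum_(i < n) u i - l = n%:R^-1 * \sum_(i < n) (u i - l).
  by rewrite sumrB mulrBr sumr_const card_ord -[l *+ n]mulr_natl mulrA mulVf ?gt_eqF // mul1r.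
rewrite normrM ger0_norm ?invr_ge0 ?ler0n // mulrC ler_pdivrMr //.
apply: le_trans (ler_norm_sum _ _ _) _.
have hK : 2 * K / e <= n%:R.
  apply: le_trans (ltW (archi_boundP _)) _; first by rewrite divr_ge0 ?mulr_ge0 ?(ltW e0).
  by rewrite ler_nat; apply: leq_trans nN; exact: leq_addl.
rewrite ler_pdivrMr // in hK.
have [d nE] : exists d, n = (N1 + d)%N by exists (n - N1)%N; lia.
subst n; rewrite big_split_ord /= -/K.
have : \sum_(i < d) `|u (N1 + i)%N - l| <= \sum_(i < d) (e / 2).
  by apply: ler_sum => i _; apply: HN; exact: leq_addr.
rewrite sumr_const card_ord -mulr_natr => h.
have : d%:R <= (N1 + d)%:R :> R by rewrite ler_nat leq_addl.
by move: h hK; set a := \sum_(i < d) _; set D := d%:R; set N := (N1 + d)%:R; nra.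
Qed.

(** Late horizons solve the system up to any tolerance, the values being Cesàro means of convergent
    sequences; a closed cone then contains an exact solution. *)
Theorem scheduler_flow_exact (sigma : scheduler M R) : exists y r,
  [/\ flow y r, forall q, q \in Qs -> flow2 r q = 0 &
   forall i, \sum_(q <- Qs | hit i q) \sum_a r q a = reach_prob sigma s0 (T i)].
Proof.
pose ks : seq ((bool * Q) + I) := [seq inl (true, q) | q <- Qs] ++ [seq inl (false, q) | q <- Qs] ++
  [seq inr i | i <- enum I].
have ksP k : k \in ks -> if k is inl (_, q) then q \in Qs else true.
  rewrite !mem_cat => /or3P [] /mapP [q qQ ->] //.
have [|X [X0 XE]] := @closed_system R _ _ flow_vars ks flow_row
    (flow_rhs (fun i => reach_prob sigma s0 (T i))) uniq_flow_vars.
  move=> e e0.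
  have /choice [N HN] : forall i, exists N, forall n, (N <= n)%N -> (0 < n)%N ->
     `|n%:R^-1 * \sum_(j < n) reachN sigma s0 (T i) j.+1 - reach_prob sigma s0 (T i)| <= e.
    move=> i; apply: (@cesaro_mean (fun j => reachN sigma s0 (T i) j.+1)) => // d d0; have [N HN] := reachN_cvg sigma s0 (T i) d0.
    by exists N => n Nn; apply: HN; exact: leqW.
  pose n := (\max_i N i + Num.bound e^-1).+1.
  have [y [r [fl f2 fv]]] := @scheduler_flow sigma n isT.
  exists (flow_fun y r); split=> [[b [q a]]|k kk].
    rewrite mem_flow_vars => /andP [qQ _]; rewrite /flow_fun /=.
    by case: b; [exact: (fl_r0 fl)|exact: (fl_y0 fl)].
  rewrite flow_row_sum; [|exact: (fl_ye fl)|exact: (fl_re fl)|exact: ksP].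
  have ne : n%:R^-1 <= e.
    rewrite -[e]invrK lef_pV2 ?posrE ?invr_gt0 ?ltr0n //.
    apply: le_trans (ltW (archi_boundP _)) _; first by rewrite invr_ge0 ltW.
    by rewrite ler_nat /n; lia.
  case: k kk => [[[] q]|i] /ksP qQ /=.
  - by rewrite (fl_1 fl qQ) addrK subrr normr0 ltW.
  - by rewrite subr0; apply: le_trans (f2 q qQ) ne.
  - rewrite fv; apply: HN => //; rewrite /n; apply: leq_trans (leqW (leq_addr _ _)).
    exact: leq_bigmax.
pose z b q a := if (q \in Qs) && `[< enabled M (st q) a >] then X (b, (q, a)) else 0.
have z0 b q a : 0 <= z b q a by rewrite /z -(mem_flow_vars b); case: ifP => // /X0.
have ze b q a : ~ enabled M (st q) a -> z b q a = 0 by rewrite /z; case: asboolP; rewrite ?andbF.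
have rowS k : k \in ks -> \sum_(v <- flow_vars) flow_row k v * flow_fun (z false) (z true) v =
    flow_rhs (fun i => reach_prob sigma s0 (T i)) k.
  move=> kk; rewrite -(XE k kk); apply: eq_big_seq => -[b [q a]] vv; congr (_ * _).
  by rewrite /flow_fun /z /=; move: vv; rewrite mem_flow_vars => ->; case: b.
have rowE k (kk : k \in ks) := etrans (esym (@flow_row_sum (z false) (z true) k
  (fun q a _ => @ze false q a) (fun q a _ => @ze true q a) (ksP k kk))) (rowS k kk).
have k1 q : q \in Qs -> inl (true, q) \in ks by move=> qQ; rewrite mem_cat map_f.
have k2 q : q \in Qs -> inl (false, q) \in ks.
  by move=> qQ; rewrite !mem_cat (map_f (fun q => inl (false, q))) ?orbT.
have k3 i : inr i \in ks by rewrite !mem_cat (map_f inr) ?orbT // mem_enum.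
exists (z false), (z true); split.
- split=> // [q a _|q a _|q qQ]; try exact: ze.
  by have /= := rowE _ (k1 q qQ); move/eqP; rewrite subr_eq => /eqP ->.
- by move=> q qQ; exact: rowE _ (k2 q qQ).
- by move=> i; exact: rowE _ (k3 i).
Qed.

End Flow.

Lemma eq_reach_prob (R : realType) nS nA (M : mdp nS nA) (sigma tau : scheduler M R) s T :
  (forall h, cylinder_prob sigma s h = cylinder_prob tau s h) ->
  reach_prob sigma s T = reach_prob tau s T.
Proof.
move=> E; have E' n : reachN sigma s T n = reachN tau s T n.
  by apply: eq_sumf => h; rewrite E.
apply/eqP; rewrite -subr_eq0; apply: contraT => ne.
have d0 : 0 < `|reach_prob sigma s T - reach_prob tau s T| by rewrite normr_gt0.
set d := `|_| in d0.
have h4 : 0 < d / 4 by lra.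
have [N1 H1] := reachN_cvg sigma s T h4.
have [N2 H2] := reachN_cvg tau s T h4.
have := H1 _ (leq_maxl N1 N2); have := H2 _ (leq_maxr N1 N2); rewrite E'.
move: d0 h4; rewrite /d; set u := reachN _ _ _ _; move: (reach_prob _ _ _) (reach_prob _ _ _) => x y.
by have := ler_distD u y x; rewrite (distrC y u); lra.
Qed.

(** The start state can be read off the history, and the current state serves when the history is
    empty. *)
Lemma combine_schedulers (R : realType) nS nA (M : mdp nS nA) (sg : 'I_nS.+1 -> scheduler M R) :
  exists sigma : scheduler M R, forall s T, reach_prob sigma s T = reach_prob (sg s) s T.
Proof.
pose ini (h : seq ('I_nS.+1 * 'I_nA.+1)) s := if h is x :: _ then x.1 else s.
pose sigma : scheduler M R := @Scheduler _ _ M R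
  (fun h s a => choose_act (sg (ini h s)) h s a)
  (fun h s a => choose_act_ge0 (sg (ini h s)) h s a)
  (fun h s => choose_act_sum1 (sg (ini h s)) h s)
  (fun h s a => @choose_act_enabled _ _ M R (sg (ini h s)) h s a).
exists sigma => s T; apply: eq_reach_prob => h.
suff [] : cylinder_prob sigma s h = cylinder_prob (sg s) s h /\
    (cylinder_prob (sg s) s h != 0 -> ini h s = s) by [].
elim/last_ind: h => [|h y [IH1 IH2]]; first by rewrite /cylinder_prob !big_ord0.
rewrite !cylinder_prob_rcons IH1 /step_prob.
have [->|c0] := eqVneq (cylinder_prob (sg s) s h) 0; first by rewrite !mul0r eqxx.
have {}IH2 := IH2 c0; case: h IH1 IH2 c0 => [|x h] IH1 IH2 c0 /=.
  case: eqP => [->|ne]; first by [].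
  by rewrite !mul0r !mulr0 eqxx.
by move: IH2; rewrite /= => ->.
Qed.

End Flows.
Import Flows.

(** * Instances as raw data *)

Module RawInstances.

Local Open Scope ring_scope.

Definition fam1 A n (f : 'I_n -> A) : seq A := [seq f i | i <- enum 'I_n].
Definition fam2 A m n (f : 'I_m -> 'I_n -> A) : seq A := flatten (fam1 (fun i => fam1 (f i))).

Lemma size_fam1 A n (f : 'I_n -> A) : size (fam1 f) = n.
Proof. by rewrite size_map size_enum_ord. Qed.

Lemma nth_fam1 A d n (f : 'I_n -> A) i : nth d (fam1 f) (nat_of_ord i) = f i.
Proof. by rewrite (nth_map i) ?size_enum_ord // nth_ord_enum. Qed.

Lemma nth_flatten_uniform A (d : A) k (ss : seq (seq A)) i j : all (fun s => size s == k) ss ->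
  (j < k)%N -> nth d (flatten ss) (i * k + j) = nth d (nth [::] ss i) j.
Proof.
elim: ss i => [|s ss IH] [|i] //=; rewrite ?nth_nil //; move=> /andP [/eqP sk al] jk; rewrite nth_cat sk.
  by rewrite mul0n add0n jk.
rewrite ifN; first by rewrite -(IH i al jk); congr nth; rewrite mulSn; lia.
by rewrite mulSn; lia.
Qed.

Lemma all_fam1 A (P : pred A) n (f : 'I_n -> A) : (forall i, P (f i)) -> all P (fam1 f).
Proof. by move=> H; rewrite all_map; apply/allP => x _; exact: H. Qed.

Lemma size_flatten_uniform A k (ss : seq (seq A)) : all (fun s => size s == k) ss ->
  size (flatten ss) = (size ss * k)%N.
Proof. by elim: ss => //= s ss IH /andP [/eqP sk al]; rewrite size_cat sk IH // mulSn. Qed.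

Lemma size_fam2 A m n (f : 'I_m -> 'I_n -> A) : size (fam2 f) = (m * n)%N.
Proof.
rewrite /fam2 (@size_flatten_uniform _ n) ?size_fam1 //.
by apply: all_fam1 => i; rewrite size_fam1.
Qed.

Lemma nth_fam2 A d m n (f : 'I_m -> 'I_n -> A) (i : 'I_m) (j : 'I_n) :
  nth d (fam2 f) (i * n + j) = f i j.
Proof.
rewrite nth_flatten_uniform //; last by apply: all_fam1 => k; rewrite size_fam1.
by rewrite nth_fam1 nth_fam1.
Qed.

Definition rq (q : rat) : rt := (numq q, `|denq q|%N).
Definition rop (o : comparison) : opc :=
  match o with
  | CmpGt => (false, false, rdef) | CmpGe => (false, true, rdef)
  | CmpApprox e => (true, false, rq e) | CmpNapprox e => (true, true, rq e)
  end.

Definition raw_of (I : instance) : raw :=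
  (max_state I, max_action I, flatten (fam2 (fun s a => fam1 (fun t => rq (trans (model I) s a t)))),
   (num_preds I, num_terms I, num_scheds I),
   (fam2 (fun i j => rq (@coef I i j)), fam1 (fun j => rq (@bound I j))),
   (fam2 (fun i j => val (@start_state I i j)), fam2 (fun i j => val (@sched I i j)),
    fam2 (fun i j => enc_set (@target I i j))),
   fam1 (fun j => rop (@op I j))).

Lemma nth_enc_set k (A : {set 'I_k}) (i : 'I_k) : nth false (enc_set A) (nat_of_ord i) = (i \in A).
Proof. exact: (@nth_fam1 bool false k (fun i => i \in A)). Qed.

(** Term [i] of predicate [j] is stored at position i l + j, so the terms of a predicate form a
    residue class modulo [l]. *)
Lemma sum_terms (R : nmodType) m l j (g : nat -> R) : (j < l)%N ->
  \sum_(e <- iota 0 (m * l) | (e %% l == j)%N) g e = \sum_(i < m) g (i * l + j)%N.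
Proof.
move=> jl; elim: m => [|m IH]; first by rewrite mul0n big_nil big_ord0.
rewrite mulSn addnC iotaD big_cat IH big_ord_recr /=; congr (_ + _).
rewrite add0n -[X in iota X _]addn0 iotaDl big_map.
rewrite (eq_bigl (fun e => e %% l == j)%N); last by move=> e; rewrite modnMDl.
rewrite big_mkcond (bigD1_seq j) ?mem_iota ?iota_uniq //= modn_small // eqxx big_seq_cond big1 ?addr0 //.
by move=> e /andP [el ne]; rewrite modn_small ?(negbTE ne) //; move: el; rewrite mem_iota.
Qed.

Section Inst.
Variables (R : realType) (I : instance).
Local Notation r := (raw_of I).
Local Notation N := (max_state I).+1.
Local Notation A := (max_action I).+1.
Local Notation M := (model I).
Local Notation D := (r_D (raw_of I)).

Definition rv (x : rt) : R := x.1%:~R / x.2%:R.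

Lemma rv_rq q : rv (rq q) = ratr q.
Proof.
rewrite /rv /rq /= /ratr; congr (_ / _).
by rewrite -[in RHS](gez0_abs (ltW (denq_gt0 q))).
Qed.

Lemma size_rT : size (r_T r) = (N * A * N)%N.
Proof.
rewrite /r_T /= (@size_flatten_uniform _ N) ?size_fam2 //.
rewrite /fam2; apply/allP => x /flattenP [y /mapP [s _ ->] /mapP [a _ ->]].
by rewrite size_fam1.
Qed.

Lemma stsE : r_sts r = iota 0 N.
Proof. by rewrite /r_sts rngE // size_rT -mulnA leq_pmulr. Qed.

Lemma actsE : r_acts r = iota 0 A.
Proof. by rewrite /r_acts rngE // size_rT mulnAC leq_pmull. Qed.

Lemma trE (s : 'I_N) (a : 'I_A) (t : 'I_N) : r_tr r s a t = rq (trans M s a t).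
Proof.
rewrite /r_tr /r_T /= nth_flatten_uniform //; last first.
  rewrite /fam2; apply/allP => x /flattenP [y /mapP [s' _ ->] /mapP [a' _ ->]].
  by rewrite size_fam1.
by rewrite nth_fam2 nth_fam1.
Qed.

Lemma D_dvd x : x \in r_T r ++ r_C r ++ r_B r ++ [seq o.2 | o <- r_o r] -> (x.2 %| D)%N.
Proof.
move=> xm; rewrite /r_D /prodl big_map (perm_big _ (perm_to_rem xm)) big_cons.
exact: dvdn_mulr.
Qed.

Lemma rq2_gt0 q : (0 < (rq q).2)%N.
Proof. by rewrite /= absz_gt0 denq_neq0. Qed.

Lemma D_gt0 : (0 < D)%N.
Proof.
rewrite /r_D /prodl big_map big_seq; apply: prodn_cond_gt0 => x.
rewrite !mem_cat => /or4P [] xm.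
- move: xm; rewrite /r_T /= /fam2 => /flattenP [y /flattenP [z /mapP [s _ ->] /mapP [a _ ->]] /mapP [t _ ->]].
  exact: rq2_gt0.
- by move: xm; rewrite /r_C /= /fam2 => /flattenP [z /mapP [s _ ->] /mapP [a _ ->]]; exact: rq2_gt0.
- by move: xm => /mapP [j _ ->]; exact: rq2_gt0.
- move: xm => /mapP [x' /mapP [j _ ->] ->]; case: (op j) => [| |e|e] //; exact: rq2_gt0.
Qed.

Definition okx (x : rt) := (0 < x.2)%N && (x.2 %| D)%N.

Lemma sclE x : okx x -> (scl r x)%:~R = D%:R * rv x :> R.
Proof.
move=> /andP [x0 xD]; rewrite /scl rmorphM /= /rv -[in RHS](divnK xD) natrM mulrA.
have nz : x.2%:R != 0 :> R by rewrite pnatr_eq0 -lt0n.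
rewrite -!pmulrn; by field.
Qed.

Lemma okx_T s a t : okx (rq (trans M s a t)).
Proof.
apply/andP; split; [exact: rq2_gt0|apply: D_dvd]; rewrite mem_cat; apply/orP; left; rewrite -trE; apply: mem_nth.
rewrite size_rT; have := ltn_ord s; have := ltn_ord a; have := ltn_ord t.
rewrite /r_A /r_S /=; move: (nat_of_ord s) (nat_of_ord a) (nat_of_ord t) => x y z; clear.
move: (max_state I) (max_action I) => n k; nia.
Qed.

Lemma okx_C i j : okx (rq (@coef I i j)).
Proof.
apply/andP; split; [exact: rq2_gt0|apply: D_dvd]; rewrite !mem_cat; apply/orP; right; apply/orP; left.
by apply/flattenP; exists (fam1 (fun j => rq (@coef I i j))); apply/mapP; [exists i|exists j]; rewrite ?mem_enum.
Qed.

Lemma okx_B j : okx (rq (@bound I j)).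
Proof.
apply/andP; split; [exact: rq2_gt0|apply: D_dvd]; rewrite !mem_cat; do 2 (apply/orP; right); apply/orP; left.
by apply/mapP; exists j; rewrite ?mem_enum.
Qed.

Lemma okx_O j : okx (rop (@op I j)).2.
Proof.
apply/andP; split; first by case: (op j) => [| |e|e] //; exact: rq2_gt0.
apply: D_dvd; rewrite !mem_cat; do 3 (apply/orP; right).
by apply/mapP; exists (rop (@op I j)) => //; apply/mapP; exists j; rewrite ?mem_enum.
Qed.

Lemma enE (s : 'I_N) (a : 'I_A) : r_en r s a <-> enabled M s a.
Proof.
have DR : D%:R != 0 :> R by rewrite pnatr_eq0 -lt0n D_gt0.
have E : (sumz [seq r_trs r (val s, val a, t) | t <- r_sts r])%:~R =
    D%:R * ratr (\sum_t trans M s a t) :> R.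
  rewrite /sumz big_map stsE.
  have -> : iota 0 N = index_iota 0 N by rewrite /index_iota subn0.
  rewrite big_mkord rmorph_sum /= rmorph_sum mulr_sumr; apply: eq_bigr => t _; rewrite /r_trs /= trE sclE ?okx_T // rv_rq.
  by [].
rewrite /r_en; split=> [/eqP h|h].
  have := E; rewrite h => /esym /eqP; rewrite -[X in _ == X]mulr1 (inj_eq (mulfI DR)) => /eqP.
  by rewrite -[X in _ = X](rmorph1 (ratr : rat -> R)) => /fmorph_inj.
apply/eqP; apply: (@intr_inj R); rewrite E (_ : \sum_t _ = 1) // rmorph1 mulr1.
by [].
Qed.

End Inst.

End RawInstances.
Import RawInstances.

(** * Correctness of the linear program *)

Module ProgramCorrectness.

Local Open Scope ring_scope.

Section Block.
Variables (R : realType) (I : instance) (c : nat).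
Hypothesis c0 : (0 < c)%N.
Local Notation r := (raw_of I).
Local Notation N := (max_state I).+1.
Local Notation A := (max_action I).+1.
Local Notation M := (model I).
Local Notation D := (r_D (raw_of I)).
Local Notation Qs := (psts c (raw_of I)).

Definition trm (k : nat) := {x : 'I_(num_terms I) * 'I_(num_preds I) | val (sched x.1 x.2) == k}.
Definition tgt (x : 'I_(num_terms I) * 'I_(num_preds I)) := @target I x.1 x.2.
Definition pst_st (q : pst) : 'I_N := inord q.1.
Definition pst_nx (k : nat) (q : pst) (t : 'I_N) : pst := nxt c (r_Tk r k) (q, val t).
Definition pst_hit (T : {set 'I_N}) (q : pst) : bool := hitb (enc_set T) q.2.

(* The modes of length at most c record all visits to the targets used by a
   scheduler. *)
Definition adequate := forall k : nat, exists good : pst -> Prop,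
  (forall s : 'I_N, good (ini c (r_Tk r k) s)) /\
  forall q (a : 'I_A) (t : 'I_N), good q -> enabled M (pst_st q) a -> 0 < trans M (pst_st q) a t ->
    good (pst_nx k q t) /\
    forall x : trm k, pst_hit (tgt (val x)) (pst_nx k q t) = pst_hit (tgt (val x)) q || (t \in tgt (val x)).

Lemma mem_modes n L X : (X \in modes n L) = (size X <= n)%N && all (fun t => t \in L) X.
Proof.
elim: n X => [|n IH] [|t X] //=; rewrite in_cons /=.
apply/allpairsP/idP => [[[t' X'] /= [tL XL [-> ->]]]|/and3P [sX tL aX]].
  by rewrite tL; move: XL; rewrite IH.
by exists (t, X); rewrite IH /= -ltnS sX aX tL.
Qed.

Lemma uniq_modes n L : uniq L -> uniq (modes n L).
Proof.
move=> uL; elim: n => //= n IH; apply/andP; split.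
  by apply/negP => /allpairsP [[t X] [_ _]].
by apply: allpairs_uniq => // -[t X] [t' X'] _ _ /= [-> ->].
Qed.

Lemma mem_psts q : (q \in Qs) = [&& (q.1 < N)%N, (size q.2 <= c)%N & all (fun t => t < N)%N q.2].
Proof.
case: q => s X /=; rewrite /psts stsE.
have mI t : (t \in iota 0 N) = (t < N)%N by rewrite mem_iota.
apply/allpairsP/idP => [[[s' X'] /= [sL XL [-> ->]]]|/and3P [sN sX aX]].
  by move: XL; rewrite mem_modes -mI sL => /andP [-> h] /=; apply: sub_all h => t; rewrite mI.
exists (s, X); rewrite /= mem_modes sX mI sN; split=> //=.
by apply: sub_all aX => t; rewrite mI.
Qed.

Lemma uniq_psts : uniq Qs.
Proof.
rewrite /psts stsE; apply: allpairs_uniq; [exact: iota_uniq|exact: uniq_modes (iota_uniq _ _)|].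
by move=> [s X] [s' X'] _ _ /= [-> ->].
Qed.

Lemma nxtQ Ts q (t : 'I_N) : q \in Qs -> nxt c Ts (q, val t) \in Qs.
Proof.
rewrite !mem_psts /= ltn_ord /= => /and3P [_ sX aX].
by case: ifP => [/andP [h _]|_] /=; rewrite ?ltn_ord ?sX ?aX ?h.
Qed.

Section Fixed.
Variables (k : nat) (s : 'I_N).
Local Notation q0 := (ini c (r_Tk r k) s).
Local Notation hit := (fun (x : trm k) q => pst_hit (tgt (val x)) q).

Lemma q0Q : q0 \in Qs.
Proof. by apply: nxtQ; rewrite mem_psts. Qed.

Lemma st_nx q t : pst_st (pst_nx k q t) = t.
Proof. by rewrite /pst_st /pst_nx /= inord_val. Qed.

Lemma tgt_Tk (x : trm k) : enc_set (tgt (val x)) \in r_Tk r k.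
Proof.
case: x => [[i j] /= /eqP e]; apply/mapP; exists (i * num_preds I + j)%N; last first.
  by rewrite /r_g /= nth_fam2.
rewrite mem_filter /r_k /= nth_fam2 e eqxx /= mem_iota /= add0n /r_C /= size_fam2.
have := ltn_ord i; have := ltn_ord j; move: (nat_of_ord i) (nat_of_ord j) => y z; nia.
Qed.

Lemma hit0 (x : trm k) : hit x q0 = (s \in tgt (val x)).
Proof.
rewrite /pst_hit /ini /nxt /= c0 /=; case: ifP => [_|/negbT] /=.
  by rewrite /hitb /= orbF nth_enc_set.
rewrite -all_predC => /allP /(_ _ (tgt_Tk x)) /=; rewrite andbT nth_enc_set => /negbTE ->.
by [].
Qed.

Lemma rank_nx q t : (size q.2 <= size (pst_nx k q t).2)%N.
Proof. by rewrite /pst_nx /=; case: ifP. Qed.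

Lemma rank_hit (x : trm k) q t : size (pst_nx k q t).2 = size q.2 -> hit x (pst_nx k q t) = hit x q.
Proof. by rewrite /pst_nx /pst_hit /=; case: ifP => //= _; lia. Qed.

Definition block_flow (y z : pst -> 'I_A -> R) :=
  flow M Qs q0 pst_st (pst_nx k) y z /\
  forall q, q \in Qs -> flow2 M Qs pst_st (pst_nx k) z q = 0.

Lemma block_scheduler y z : adequate -> block_flow y z ->
  exists sigma : scheduler M R, forall x : trm k,
    reach_prob sigma s (tgt (val x)) = \sum_(q <- Qs | hit x q) \sum_a z q a.
Proof.
move=> ad [fl fl2]; have [good [g0 gn]] := ad k.
exact: (@flow_scheduler R _ _ M s pst Qs q0 pst_st (pst_nx k) (trm k) (fun x => tgt (val x))
  hit (fun q => size q.2) good uniq_psts q0Q (inord_val s) st_nx (fun q t => @nxtQ _ q t)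
  rank_nx rank_hit (g0 s) hit0 gn y z fl fl2).
Qed.

Lemma scheduler_block (sigma : scheduler M R) : adequate ->
  exists y z, block_flow y z /\ forall x : trm k,
    \sum_(q <- Qs | hit x q) \sum_a z q a = reach_prob sigma s (tgt (val x)).
Proof.
move=> ad; have [good [g0 gn]] := ad k.
have [y [z [fl fl2 v]]] := (@scheduler_flow_exact R _ _ M s pst Qs q0 pst_st (pst_nx k) (trm k) (fun x => tgt (val x))
  hit good uniq_psts q0Q (inord_val s) st_nx (fun q t => @nxtQ _ q t) (g0 s) hit0 gn sigma).
by exists y, z.
Qed.

End Fixed.

(** Makes the cut-off in [r_bs] harmless; it comes from the requirement that every scheduler index
    occurs. *)
Lemma num_scheds_le : (num_scheds I <= num_terms I * num_preds I)%N.
Proof.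
pose f (x : 'I_(num_terms I) * 'I_(num_preds I)) := sched x.1 x.2.
have : (#|codom f| <= #|{: 'I_(num_terms I) * 'I_(num_preds I)}|)%N by exact: leq_image_card.
rewrite card_prod !card_ord; apply: leq_trans; rewrite -{1}(card_ord (num_scheds I)).
apply: subset_leq_card; apply/fintype.subsetP => k _; have [i [j <-]] := sched_onto k.
by apply/codomP; exists (i, j).
Qed.

Lemma mem_bs k s : ((k, s) \in r_bs r) = (k < num_scheds I)%N && (s < N)%N.
Proof.
rewrite /r_bs stsE rngE; last by rewrite /r_n /r_C /= size_fam2 num_scheds_le.
apply/allpairsP/idP => [[[k' s'] [kL sL [-> ->]]]|/andP [kL sL]].
  by move: kL sL; rewrite !mem_iota !add0n => /= -> ->.
by exists (k, s); rewrite !mem_iota /= !add0n.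
Qed.

Lemma uniq_bs : uniq (r_bs r).
Proof.
rewrite /r_bs stsE rngE; last by rewrite /r_n /r_C /= size_fam2 num_scheds_le.
by apply: allpairs_uniq; rewrite ?iota_uniq // => -[k s] [k' s'] _ _ /= [-> ->].
Qed.

Section Rows.
Variable cs : seq con.
Local Notation x := (raw_of I, cs).
Local Notation vs := (r_vars c (raw_of I, cs)).
Definition v0 : var := (0%N, (0%N, 0%N), (0%N, [::]), 0%N).
Definition vsl (i : nat) : var := (1%N, (i, 0%N), (0%N, [::]), 0%N).

Lemma uniq_vars : uniq vs.
Proof.
rewrite /r_vars; set W := seq.filter _ _.
have WP v : v \in W -> (1 < v.1.1.1)%N.
  rewrite mem_filter => /andP [_ /allpairsP [[u a] /= [uP _ ->]]] /=.
  move: uP => /allpairsP [[w q] /= [wP _ ->]] /=.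
  by move: wP; rewrite !mem_cat => /or3P [/mapP [b _ ->]|/mapP [b _ ->]|].
have uW : uniq W.
  apply: filter_uniq; apply: allpairs_uniq.
  - apply: allpairs_uniq; [|exact: uniq_psts|by move=> [a b] [a' b'] _ _ /= [-> ->]].
    by apply: allpairs_uniq; [|exact: uniq_bs|move=> [a b] [a' b'] _ _ /= [-> ->]].
  - by rewrite actsE iota_uniq.
  - by move=> [a b] [a' b'] _ _ /= [-> ->].
rewrite /= mem_cat negb_or -andbA; apply/and3P; split.
- by apply/negP => /mapP [].
- by apply/negP => /WP.
rewrite cat_uniq uW andbT; apply/andP; split.
  by rewrite map_inj_uniq ?iota_uniq // => i j [].
by apply/hasPn => v /WP h; apply/negP => /mapP [i _ vE]; move: h; rewrite vE.
Qed.

Lemma vars_sum (G : var -> R) : \sum_(v <- vs) G v = G v0 + \sum_(i <- idx cs) G (vsl i) +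
  \sum_(b <- r_bs r) \sum_(q <- Qs) \sum_(a < A | r_en r q.1 a)
    (G (2%N, b, q, val a) + G (3%N, b, q, val a)).
Proof.
rewrite /r_vars big_cons big_cat /= -addrA; congr (_ + (_ + _)); first by rewrite big_map.
rewrite big_filter big_mkcond 2!big_allpairs_dep /= !big_cat big_nil /= addr0 !big_map -big_split; apply: eq_bigr => b _.
rewrite -big_split; apply: eq_bigr => q _ /=; rewrite actsE.
have -> : iota 0 A = index_iota 0 A by rewrite /index_iota subn0.
by rewrite -big_split big_mkord /= [RHS]big_mkcond; apply: eq_bigr => a _; case: ifP; rewrite ?addr0.
Qed.

Lemma pick_bs (F : nat * nat -> R) b : b \in r_bs r -> (forall b', b' != b -> F b' = 0) ->
  \sum_(b' <- r_bs r) F b' = F b.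
Proof. by move=> bb F0; rewrite (bigD1_seq b) ?uniq_bs //= big1 ?addr0. Qed.

Lemma enP (q : pst) (a : 'I_A) : q \in Qs -> r_en r q.1 a = `[< enabled M (pst_st q) a >].
Proof.
rewrite mem_psts => /andP [qN _]; have := @enE R I (pst_st q) a.
by rewrite /pst_st /= inordK // => h; apply/idP/asboolP => /h.
Qed.

Lemma fvars_sum (H : bool * (pst * 'I_A) -> R) : \sum_(v <- flow_vars M Qs pst_st) H v =
  \sum_(q <- Qs) \sum_(a < A | r_en r q.1 a) (H (false, (q, a)) + H (true, (q, a))).
Proof.
pose H' v := if `[< enabled M (pst_st v.2.1) v.2.2 >] then H v else 0.
transitivity (\sum_(v <- flow_vars M Qs pst_st) H' v).
  by apply: eq_big_seq => -[b [q a]]; rewrite mem_flow_vars /H' => /andP [_ ->].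
rewrite flow_vars_sum; last by move=> b q a _ ne; rewrite /H' /=; case: asboolP.
rewrite -big_split big_seq [RHS]big_seq; apply: eq_bigr => q qQ /=.
rewrite -big_split [RHS]big_mkcond; apply: eq_bigr => a _ /=; rewrite enP // /H' /=.
by case: ifP; rewrite ?addr0.
Qed.

Lemma trsE q q' (a : 'I_A) : q \in Qs -> q' \in Qs ->
  (r_trs r (q'.1, nat_of_ord a, q.1))%:~R = D%:R * ratr (trans M (pst_st q') a (pst_st q)) :> R.
Proof.
rewrite !mem_psts => /andP [h _] /andP [h' _]; rewrite /r_trs /=.
have -> : r_tr r q'.1 a q.1 = rq (trans M (pst_st q') a (pst_st q)).
  by rewrite -trE /pst_st /= !inordK.
by rewrite sclE ?okx_T // rv_rq.
Qed.

Definition ff (X : var -> R) (b : nat * nat) (v : bool * (pst * 'I_A)) : R :=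
  X (if v.1 then 3%N else 2%N, b, v.2.1, val v.2.2).

Lemma zifE b z : (zif b z)%:~R = b%:R * z%:~R :> R.
Proof. by case: b; rewrite ?mul1r ?mul0r. Qed.

Lemma zsgE b z : (zsg b z)%:~R = (if b then 1 else -1) * z%:~R :> R.
Proof. by case: b; rewrite ?mul1r ?mulN1r ?rmorphN. Qed.

Lemma cf_outE b q b' t q' a : (cf_out r ((b, q), (t, b', q', a)))%:~R = D%:R * (q' == q)%:R :> R.
Proof. by rewrite /cf_out /= zifE mulrC. Qed.

Lemma cf_inE u k s q b' t q' (a : 'I_A) : q \in Qs -> q' \in Qs ->
  (cf_in c r ((u, (k, s), q), (t, b', q', nat_of_ord a)))%:~R =
  D%:R * ((pst_nx k q' (pst_st q) == q)%:R * ratr (trans M (pst_st q') a (pst_st q))) :> R.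
Proof.
move=> qQ qQ'; rewrite /cf_in /= zifE trsE // mulrCA; congr (_ * (_ * _)).
rewrite /pst_nx; have -> // : val (pst_st q) = q.1.
by apply: inordK; move: qQ; rewrite mem_psts => /andP [].
Qed.

Lemma row_flow (b : bool) X k (s : 'I_N) q : (k < num_scheds I)%N -> q \in Qs ->
  \sum_(v <- vs) (r_F c x ((if b then 0%N else 1%N, (k, val s), q), v))%:~R * X v =
  D%:R * (\sum_(v <- flow_vars M Qs pst_st)
    flow_row R M pst_st (pst_nx k) (fun (i : trm k) q => pst_hit (tgt (val i)) q) (inl (b, q)) v *
      ff X (k, val s) v
    - (if b then (ini c (r_Tk r k) s == q)%:R else 0) * X v0).
Proof.
move=> kn qQ; rewrite vars_sum (@pick_bs _ (k, val s)); last first.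
- move=> b' ne; apply: big1 => q' _; apply: big1 => a _.
  by case: b; rewrite /r_F /= /cf_flow1 /cf_flow2 /= (negbTE ne) /= !mul0r addr0.
- by rewrite mem_bs kn ltn_ord.
rewrite [X in _ + X + _]big1; last first.
  by move=> i _; case: b; rewrite /r_F /= /cf_flow1 /cf_flow2 /= mul0r.
rewrite addr0 addrC mulrBr; congr (_ + _).
  rewrite fvars_sum mulr_sumr big_seq [RHS]big_seq; apply: eq_bigr => q' qQ'.
  rewrite mulr_sumr; apply: eq_bigr => a _; rewrite /ff /= mulrDr; congr (_ + _).
    case: b; rewrite /r_F /= /cf_flow1 /cf_flow2 /= ?eqxx /=; last by rewrite !mul0r mulr0.
    by rewrite /zif /= rmorphB /= cf_outE cf_inE //; ring.
  case: b; rewrite /r_F /= /cf_flow1 /cf_flow2 /= eqxx /zif /= ?subr0.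
    by rewrite cf_outE mulrA.
  by rewrite rmorphB /= cf_outE cf_inE //; ring.
case: b; rewrite /r_F /= /cf_flow1 /cf_flow2 /= ?mul0r ?mulr0 ?oppr0 //.
by rewrite zifE rmorphN /= -[(Posz D)%:~R]/(D%:R); ring.
Qed.

Definition sgr (b : bool) : R := if b then 1 else -1.

Lemma row_con X i (j : 'I_(num_preds I)) sg e st : (i < size cs)%N -> okx I e ->
  nth cdef cs i = (val j, sg, e, st) ->
  \sum_(v <- vs) (r_F c x ((2%N, (i, 0%N), (0%N, [::])), v))%:~R * X v =
  D%:R * ((rv R e - sgr sg * ratr (@bound I j)) * X v0 - X (vsl i) +
    sgr sg * \sum_(i' < num_terms I) ratr (@coef I i' j) *
      \sum_(q <- Qs | pst_hit (target i' j) q) \sum_(a < A | r_en r q.1 a)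
         X (3%N, (val (sched i' j), val (start_state i' j)), q, val a)).
Proof.
move=> ics oe csi; rewrite vars_sum !mulrDr -!addrA; congr (_ + _).
  rewrite /r_F /= /cf_con /= csi /= rmorphB /= sclE // zsgE /r_B /= nth_fam1 sclE ?okx_B // rv_rq.
  by rewrite /sgr; case: (sg); ring.
congr (_ + _).
  rewrite (bigD1_seq i) ?iota_uniq ?mem_iota //= big1 ?addr0.
    by rewrite /r_F /= /cf_con /= zifE eqxx mul1r rmorphN /= mulNr mulrN.
  by move=> i1 ne; rewrite /r_F /= /cf_con /= zifE (negbTE ne) !mul0r.
pose P e q := (hitb (nth [::] (r_g r) e) q).
pose be e := (nth 0%N (r_k r) e, nth 0%N (r_s r) e).
pose ce e : R := (scl r (nth rdef (r_C r) e))%:~R.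
transitivity (sgr sg * \sum_(e <- iota 0 (num_terms I * num_preds I) | (e %% num_preds I == j)%N)
   ce e * \sum_(q <- Qs | P e q.2) \sum_(a < A | r_en r q.1 a) X (3%N, be e, q, val a)).
  transitivity (\sum_(b <- r_bs r) \sum_(q <- Qs) \sum_(a < A | r_en r q.1 a)
     \sum_(e <- iota 0 (num_terms I * num_preds I) | (e %% num_preds I == j)%N)
       sgr sg * (ce e * ((be e == b)%:R * ((P e q.2)%:R * X (3%N, b, q, val a))))).
    apply: eq_bigr => b _; apply: eq_bigr => q _; apply: eq_bigr => a _.
    rewrite /r_F /= /cf_con /= mul0r add0r csi /= zsgE -/(sgr sg) -mulrA -mulr_sumr; congr (_ * _).
    rewrite /cf_val /sumz big_map big_filter /= rmorph_sum /= mulr_suml /idx /r_C /= size_fam2.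
    rewrite big_mkcond [RHS]big_mkcond; apply: eq_bigr => e1 _; rewrite /be /P /ce.
    by case: ifP => [/andP [/andP [-> ->] ->]|]; rewrite ?mul1r //; case: eqP => //= _;
      case: eqP => //= _; case: hitb => //=; rewrite ?mul0r ?mulr0.
  under eq_bigr do under eq_bigr do rewrite exchange_big /=.
  under eq_bigr do rewrite exchange_big /=.
  rewrite exchange_big /= mulr_sumr big_seq_cond [RHS]big_seq_cond.
  apply: eq_bigr => e1 /andP [e1m _].
  have be1 : be e1 \in r_bs r.
    have l0 : (0 < num_preds I)%N by exact: leq_ltn_trans (ltn_ord j).
    have e1d : (e1 %/ num_preds I < num_terms I)%N by rewrite ltn_divLR //; move: e1m; rewrite mem_iota.
    have e1r : (e1 %% num_preds I < num_preds I)%N by rewrite ltn_mod.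
    have eE : e1 = (Ordinal e1d * num_preds I + Ordinal e1r)%N by rewrite /= -divn_eq.
    have K1 : nth 0%N (r_k r) e1 = val (sched (Ordinal e1d) (Ordinal e1r)).
      by rewrite [in LHS]eE; exact: nth_fam2.
    have K2 : nth 0%N (r_s r) e1 = val (start_state (Ordinal e1d) (Ordinal e1r)).
      by rewrite [in LHS]eE; exact: nth_fam2.
    by rewrite /be K1 K2 mem_bs !ltn_ord.
  rewrite (@pick_bs _ (be e1) be1); last first.
    move=> b ne; apply: big1 => q _; apply: big1 => a _.
    by rewrite eq_sym (negbTE ne) mul0r !mulr0.
  rewrite !mulr_sumr [RHS]big_mkcond; apply: eq_bigr => q _; rewrite eqxx.
  case: (P e1 q.2); rewrite ?mulr_sumr; last by rewrite big1 // => a _; rewrite mul0r !mulr0.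
  by apply: eq_bigr => a _; rewrite !mul1r.
rewrite sum_terms // mulrCA; congr (_ * _); rewrite mulr_sumr; apply: eq_bigr => i' _.
rewrite /ce /be /P /r_C /r_k /r_s /r_g /= !nth_fam2 sclE ?okx_C // rv_rq -mulrA.
by [].
Qed.

End Rows.

Definition cval (P : 'I_(num_terms I) -> 'I_(num_preds I) -> R) (x : con) : R :=
  if insub x.1.1.1 is Some j then
    sgr x.1.1.2 * (\sum_i ratr (@coef I i j) * P i j - ratr (@bound I j)) + rv R x.1.2
  else 0.

Definition okcon (x : con) := (x.1.1.1 < num_preds I)%N && okx I x.1.2.

Definition holds P (x : con) : Prop := 0 <= cval P x /\ (x.2 -> 0 < cval P x).

Definition reach_of (sigma : 'I_(num_scheds I) -> scheduler M R) i j : R :=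
  reach_prob (sigma (sched i j)) (start_state i j) (target i j).

Lemma sum_enabled (z : pst -> 'I_A -> R) (q : pst) : q \in Qs ->
  (forall a, ~ enabled M (pst_st q) a -> z q a = 0) ->
  \sum_(a < A | r_en r q.1 a) z q a = \sum_a z q a.
Proof.
move=> qQ z0; rewrite big_mkcond; apply: eq_bigr => a _; rewrite enP //.
by case: asboolP => // ne; rewrite z0.
Qed.

(** Dividing a solution by its positive homogenising coordinate gives a pair of flows for each
    block; the schedulers of the blocks with the same index are then glued over the start states.
    Conversely, the exact flows of given schedulers form a solution with homogenising coordinate
    1. *)
Theorem r_lpP cs : adequate -> all okcon cs ->
  lp_solve (r_lp c (r, cs)) <-> exists sigma, forall x, x \in cs -> holds (reach_of sigma) x.
Proof.
move=> ad /allP ok; have DR : D%:R != 0 :> R by rewrite pnatr_eq0 -lt0n D_gt0.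
rewrite /r_lp (keyed_lpP R) ?uniq_vars //.
have v0v : v0 \in r_vars c (r, cs) by rewrite mem_head.
have slv i : (i < size cs)%N -> vsl i \in r_vars c (r, cs).
  move=> ics; rewrite /r_vars in_cons mem_cat; apply/orP; right; apply/orP; left.
  by apply/mapP; exists i => //; rewrite mem_iota.
have flv (t : bool) k (s : 'I_N) q (a : 'I_A) : (k < num_scheds I)%N -> q \in Qs -> enabled M (pst_st q) a ->
    (if t then 3%N else 2%N, (k, val s), q, val a) \in r_vars c (r, cs).
  move=> kn qQ en; rewrite /r_vars in_cons mem_cat; do 2 (apply/orP; right).
  rewrite mem_filter /= enP //; apply/andP; split; first exact/asboolP.
  apply/allpairsP; exists ((if t then 3%N else 2%N, (k, val s), q), val a); split=> //=; last first.
    by rewrite actsE mem_iota add0n ltn_ord.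
  apply/allpairsP; exists ((if t then 3%N else 2%N, (k, val s)), q); split=> //=.
  rewrite !mem_cat; case: t; last by rewrite (map_f (pair 2%N)) // mem_bs kn ltn_ord.
  by rewrite (map_f (pair 3%N)) ?orbT // mem_bs kn ltn_ord.
have flk (t : bool) k (s : 'I_N) q : (k < num_scheds I)%N -> q \in Qs ->
    (if t then 0%N else 1%N, (k, val s), q) \in r_keys c (r, cs).
  move=> kn qQ; rewrite /r_keys !mem_cat.
  have h u : (u, (k, val s), q) \in [seq (u, b, q) | b <- r_bs r, q <- Qs].
    by apply/allpairsP; exists ((k, val s), q); rewrite mem_bs kn ltn_ord.
  by case: t; rewrite h ?orbT.
have cok i : (i < size cs)%N -> (2%N, (i, 0%N), (0%N, [::])) \in r_keys c (r, cs).
  move=> ics; rewrite /r_keys !mem_cat; do 2 (apply/orP; right).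
  by apply/mapP; exists i => //; rewrite mem_iota.
have csE i : (i < size cs)%N -> exists (j : 'I_(num_preds I)) sg e st,
    [/\ nth cdef cs i = (val j, sg, e, st), okx I e & forall P, cval P (nth cdef cs i) =
      sgr sg * (\sum_i ratr (@coef I i j) * P i j - ratr (@bound I j)) + rv R e].
  move=> ics; have := ok _ (mem_nth cdef ics); case: (nth cdef cs i) => [[[j sg] e] st] /andP [/= jl oe].
  exists (Ordinal jl), sg, e, st; split=> // P; rewrite /cval /=.
  by case: insubP => [j' _ jj|]; [congr (_ * (_ - _) + _); rewrite (_ : j' = Ordinal jl) //; exact: val_inj|rewrite jl].
split=> [[X [X0 Xs XE]]|[sigma H]].
  have x0 : 0 < X v0 by apply: Xs.
  pose z t k s (q : pst) (a : 'I_A) : R :=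
    if (q \in Qs) && `[< enabled M (pst_st q) a >] then X (t, (k, s), q, val a) / X v0 else 0.
  have ze t k s q a : ~ enabled M (pst_st q) a -> z t k s q a = 0.
    by rewrite /z; case: asboolP; rewrite ?andbF.
  have z0 (t : bool) k (s : 'I_N) q a : (k < num_scheds I)%N -> 0 <= z (if t then 3%N else 2%N) k (val s) q a.
    move=> kn; rewrite /z; case: ifP => // /andP [qQ /asboolP en].
    by rewrite divr_ge0 ?(ltW x0) // X0 // flv.
  have rowz (t : bool) k (s : 'I_N) q : (k < num_scheds I)%N -> q \in Qs ->
      \sum_(v <- flow_vars M Qs pst_st)
        flow_row R M pst_st (pst_nx k) (fun (i : trm k) q => pst_hit (tgt (val i)) q) (inl (t, q)) v *
        flow_fun (z 2%N k (val s)) (z 3%N k (val s)) v = (if t then (ini c (r_Tk r k) s == q)%:R else 0).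
    move=> kn qQ; have := XE _ (flk t k s q kn qQ); rewrite row_flow // => /eqP.
    rewrite mulf_eq0 (negbTE DR) /= subr_eq0 => /eqP e.
    apply: (mulIf (lt0r_neq0 x0)); rewrite -[RHS]e mulr_suml; apply: eq_big_seq => -[b [q' a]] vv.
    rewrite -mulrA; congr (_ * _); move: vv; rewrite mem_flow_vars => h; rewrite /flow_fun /ff /z /= h.
    by case: b; rewrite divfK // lt0r_neq0.
  have fl k (s : 'I_N) : (k < num_scheds I)%N -> block_flow k s (z 2%N k (val s)) (z 3%N k (val s)).
    move=> kn; split=> [|q qQ].
      split=> [q a _|q a _|q a _|q a _|q qQ]; [exact: (z0 false)|exact: (z0 true)|exact: ze|exact: ze|].
      have := rowz true k s q kn qQ.
      rewrite flow_row_sum //=; [|exact: uniq_psts|by move=> *; exact: ze|by move=> *; exact: ze].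
      by move=> /eqP; rewrite subr_eq eq_sym => /eqP <-; rewrite eq_sym.
    have := rowz false k s q kn qQ.
    by rewrite flow_row_sum //=; [exact: uniq_psts|by move=> *; exact: ze|by move=> *; exact: ze].
  have /choice [sg sgP] : forall ks : 'I_(num_scheds I) * 'I_N, exists sigma : scheduler M R, forall x : trm ks.1,
     reach_prob sigma ks.2 (tgt (val x)) = \sum_(q <- Qs | pst_hit (tgt (val x)) q) \sum_a z 3%N ks.1 (val ks.2) q a.
    move=> [k s]; exact: (block_scheduler ad (fl k s (ltn_ord k))).
  have /choice [sigma sigmaP] : forall k, exists sigma : scheduler M R,
      forall s T, reach_prob sigma s T = reach_prob (sg (k, s)) s T.
    by move=> k; exact: (combine_schedulers (fun s => sg (k, s))).
  have vE i j : reach_of sigma i j = \sum_(q <- Qs | pst_hit (target i j) q)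
      \sum_(a < A | r_en r q.1 a) X (3%N, (val (sched i j), val (start_state i j)), q, val a) / X v0.
    have xP : val (sched (i, j).1 (i, j).2) == val (sched i j) by [].
    rewrite /reach_of sigmaP (sgP (sched i j, start_state i j) (Sub (i, j) xP)) /=.
    rewrite big_seq_cond [RHS]big_seq_cond; apply: eq_bigr => q /andP [qQ _].
    rewrite -(@sum_enabled _ q qQ); last by move=> a; exact: ze.
    by apply: eq_bigr => a en; rewrite /z qQ -enP // en.
  exists sigma => x /(nthP cdef) [i ics <-].
  have [j [sgn [e [st [nE oe cE]]]]] := csE i ics.
  have := XE _ (cok i ics); rewrite (row_con _ ics oe nE) => /eqP.
  rewrite mulf_eq0 (negbTE DR) /= => /eqP e1.
  have sE : cval (reach_of sigma) (nth cdef cs i) = X (vsl i) / X v0.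
    rewrite cE; apply: (mulIf (lt0r_neq0 x0)); rewrite divfK ?lt0r_neq0 //.
    have -> : \sum_i0 ratr (coef i0 j) * reach_of sigma i0 j = (\sum_(i' < num_terms I) ratr (@coef I i' j) *
      \sum_(q <- Qs | pst_hit (target i' j) q) \sum_(a < A | r_en r q.1 a)
         X (3%N, (val (sched i' j), val (start_state i' j)), q, val a)) / X v0.
      rewrite mulr_suml; apply: eq_bigr => i' _; rewrite vE -mulrA; congr (_ * _).
      by rewrite mulr_suml; apply: eq_bigr => q _; rewrite mulr_suml.
    move: e1; set Y := \sum_(i' < _) _ => e1.
    have -> : (sgr sgn * (Y / X v0 - ratr (bound j)) + rv R e) * X v0 =
       sgr sgn * Y + (rv R e - sgr sgn * ratr (bound j)) * X v0 by field; rewrite lt0r_neq0.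
    by move: e1; set u := _ * X v0; lra.
  rewrite /holds sE; split=> [|st1].
    by rewrite divr_ge0 ?(ltW x0) // X0 // slv.
  by rewrite divr_gt0 // Xs ?slv // /r_st /= st1.
have /choice [y yP] : forall ks : 'I_(num_scheds I) * 'I_N, exists yz : (pst -> 'I_A -> R) * (pst -> 'I_A -> R),
    block_flow ks.1 ks.2 yz.1 yz.2 /\ forall x : trm ks.1,
    \sum_(q <- Qs | pst_hit (tgt (val x)) q) \sum_a yz.2 q a = reach_prob (sigma ks.1) ks.2 (tgt (val x)).
  by move=> [k s]; have [u [w [h1 h2]]] := @scheduler_block k s (sigma k) ad; exists (u, w).
have y0 (t : bool) ks q a : q \in Qs -> 0 <= (if t then (y ks).2 else (y ks).1) q a.
  by move=> qQ; have [[fl _] _] := yP ks; case: t; [exact: (fl_r0 fl)|exact: (fl_y0 fl)].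
have ye (t : bool) ks q a : q \in Qs -> ~ enabled M (pst_st q) a -> (if t then (y ks).2 else (y ks).1) q a = 0.
  by move=> qQ; have [[fl _] _] := yP ks; case: t; [exact: (fl_re fl)|exact: (fl_ye fl)].
pose X (v : var) : R :=
  if v.1.1.1 == 0%N then 1 else
  if v.1.1.1 == 1%N then cval (reach_of sigma) (nth cdef cs v.1.1.2.1) else
  if insub v.1.1.2.1 is Some k then (if v.1.1.1 == 3%N then (y (k, inord v.1.1.2.2)).2 else (y (k, inord v.1.1.2.2)).1) v.1.2 (inord v.2)
  else 0.
have Xf (t : bool) (k : 'I_(num_scheds I)) (s : 'I_N) q (a : 'I_A) :
    X (if t then 3%N else 2%N, (val k, val s), q, val a) = (if t then (y (k, s)).2 else (y (k, s)).1) q a.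
  rewrite /X /=; case: insubP => [k' _ kk|]; last by rewrite ltn_ord.
  by rewrite (val_inj kk) !inord_val; case: t.
exists X; split.
- move=> v; rewrite /r_vars in_cons mem_cat => /or3P [/eqP ->|/mapP [i ics ->]|].
  + by rewrite /X /= ler01.
  + rewrite mem_iota add0n /= in ics; rewrite /X /=; have [h _] := H _ (mem_nth cdef ics); exact: h.
  rewrite mem_filter => /andP [_ /allpairsP [[u a] [uP aP ->]]].
  case/allpairsP: uP => [[w q] [wP qP E]]; rewrite /= in E; rewrite E /=.
  have w1 : w.1 != 0%N /\ w.1 != 1%N.
    by move: wP; rewrite /= !mem_cat => /or3P [/mapP [b _ ->]|/mapP [b _ ->]|].
  rewrite /X /= (negbTE w1.1) (negbTE w1.2); case: insubP => [k _ _|] //.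
  by have := y0 (w.1 == 3%N) (k, inord w.2.2) q (inord a) qP; case: (w.1 == 3%N).
- move=> v; rewrite /r_vars in_cons mem_cat => /or3P [/eqP ->|/mapP [i ics ->]|].
  + by rewrite /X /= ltr01.
  + rewrite mem_iota add0n /= in ics; rewrite /X /r_st /= => st1; have [_ h] := H _ (mem_nth cdef ics); exact: h.
  rewrite mem_filter => /andP [_ /allpairsP [[u a] [uP aP ->]]].
  case/allpairsP: uP => [[w q] [wP qP E]]; rewrite /= in E; rewrite E /r_st /=.
  have [/negbTE -> /negbTE -> //] : w.1 != 0%N /\ w.1 != 1%N.
    by move: wP; rewrite /= !mem_cat => /or3P [/mapP [b _ ->]|/mapP [b _ ->]|].
have rowX (t : bool) (k : 'I_(num_scheds I)) (s : 'I_N) q : q \in Qs ->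
   \sum_(v <- r_vars c (r, cs)) (r_F c (r, cs) ((if t then 0%N else 1%N, (val k, val s), q), v))%:~R * X v = 0.
  move=> qQ; have kn : (val k < num_scheds I)%N by exact: ltn_ord.
  rewrite row_flow //.
  rewrite (eq_bigr (fun v => flow_row R M pst_st (pst_nx k) (fun (i : trm k) q => pst_hit (tgt (val i)) q) (inl (t, q)) v *
     flow_fun (y (k, s)).1 (y (k, s)).2 v)); last first.
    by move=> [b [q' a]] _; rewrite /ff Xf /flow_fun /=; case: b.
  have [[fl fl2] _] := yP (k, s).
  rewrite flow_row_sum //=; [|exact: uniq_psts|exact: (fl_ye fl)|exact: (fl_re fl)].
  rewrite /X /= mulr1; case: t; last by rewrite fl2 // subr0 mulr0.
  by rewrite (fl_1 fl qQ) addrK eq_sym subrr mulr0.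
move=> key; rewrite /r_keys !mem_cat => /or3P [].
- move=> /allpairsP [[[k s] q] [bP qQ ->]]; rewrite mem_bs in bP; case/andP: bP => kn sN.
  exact: (rowX true (Ordinal kn) (Ordinal sN) q qQ).
- move=> /allpairsP [[[k s] q] [bP qQ ->]]; rewrite mem_bs in bP; case/andP: bP => kn sN.
  exact: (rowX false (Ordinal kn) (Ordinal sN) q qQ).
move=> /mapP [i ics ->]; rewrite mem_iota add0n /= in ics.
have [j [sgn [e [st [nE oe cE]]]]] := csE i ics.
rewrite (row_con _ ics oe nE); apply/eqP; rewrite mulf_eq0 (negbTE DR) /=; apply/eqP.
have -> : X (vsl i) = cval (reach_of sigma) (nth cdef cs i) by [].
rewrite cE; have -> : X v0 = 1 by [].
have -> : \sum_(i' < num_terms I) ratr (@coef I i' j) *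
      \sum_(q <- Qs | pst_hit (target i' j) q) \sum_(a < A | r_en r q.1 a)
         X (3%N, (val (sched i' j), val (start_state i' j)), q, val a) =
   \sum_i0 ratr (coef i0 j) * reach_of sigma i0 j.
  apply: eq_bigr => i' _; congr (_ * _).
  have [[fl _] h] := yP (sched i' j, start_state i' j).
  have xP : val (sched (i', j).1 (i', j).2) == val (sched i' j) by [].
  rewrite /reach_of -(h (Sub (i', j) xP)) /= big_seq_cond [RHS]big_seq_cond.
  apply: eq_bigr => q /andP [qQ _]; rewrite -(@sum_enabled _ q qQ); last by move=> a; exact: (fl_re fl).
  by apply: eq_bigr => a _; exact: (Xf true).
by ring.
Qed.

End Block.

End ProgramCorrectness.
Import ProgramCorrectness.

(** * Adequate records, convexity and the decision procedures *)

Module Decision.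

Local Open Scope ring_scope.

Section Adequate.
Variable I : instance.
Local Notation r := (raw_of I).
Local Notation N := (max_state I).+1.
Local Notation M := (model I).

Lemma Tk_tgt k T : T \in r_Tk r k -> exists x : trm I k, T = enc_set (tgt (val x)).
Proof.
move=> /mapP [e]; rewrite mem_filter /idx mem_iota add0n /r_C /= size_fam2 => /andP [ek em] ->.
have l0 : (0 < num_preds I)%N by move: em; case: (num_preds I) => //; rewrite muln0.
have e1d : (e %/ num_preds I < num_terms I)%N by rewrite ltn_divLR.
have e1r : (e %% num_preds I < num_preds I)%N by rewrite ltn_mod.
have eE : e = (Ordinal e1d * num_preds I + Ordinal e1r)%N by rewrite /= -divn_eq.
have K1 : nth 0%N (r_k r) e = val (sched (Ordinal e1d) (Ordinal e1r)).
  by rewrite [in LHS]eE; exact: nth_fam2.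
have K2 : nth [::] (r_g r) e = enc_set (target (Ordinal e1d) (Ordinal e1r)).
  by rewrite [in LHS]eE; exact: nth_fam2.
have xP : val (sched (Ordinal e1d, Ordinal e1r).1 (Ordinal e1d, Ordinal e1r).2) == k by rewrite /= -K1.
by exists (Sub (Ordinal e1d, Ordinal e1r) xP); rewrite K2.
Qed.

(** A state is recorded only when it lies in a target not hit before, so a record is never longer
    than the number of targets it hits. When its length reaches [c], all targets have been hit and
    ignoring later visits is harmless. *)
Lemma adequate_targets c : (num_targets I <= c)%N -> adequate I c.
Proof.
move=> tc k; pose Tset := [set target i j | i : 'I_(num_terms I), j : 'I_(num_preds I)]%SET.
pose H A := [set T in Tset | hitb (enc_set T) A]%SET.
exists (fun q => size q.2 <= #|H q.2|)%N.
have step q (t : 'I_N) : (size q.2 <= #|H q.2|)%N ->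
    (size (pst_nx c k q t).2 <= #|H (pst_nx c k q t).2|)%N /\
    forall x : trm I k, pst_hit (tgt (val x)) (pst_nx c k q t) = pst_hit (tgt (val x)) q || (t \in tgt (val x)).
  move=> gq; rewrite /pst_nx /pst_hit /nxt /=; case: ifP => [/andP [_ /hasP [T TT /andP [tT nT]]]|/negbT no] /=.
    split=> [|x]; last by rewrite nth_enc_set orbC.
    have [x xE] := Tk_tgt TT; rewrite xE nth_enc_set in tT; rewrite xE in nT.
    have TS : tgt (val x) \in Tset by apply/imset2P; exists (val x).1 (val x).2.
    apply: leq_ltn_trans gq _; apply: proper_card; apply/properP; split.
      apply/fintype.subsetP => U; rewrite !inE => /andP [-> h] /=; by rewrite h orbT.
    by exists (tgt (val x)); rewrite !inE TS /= ?nth_enc_set ?tT ?(negbTE nT).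
  split=> // x; case: (boolP (t \in _)) => // tx; rewrite ?orbF // orbT.
  move: no; rewrite negb_and => /orP [sc|].
    have e : H q.2 = Tset.
      apply/eqP; rewrite eqEcard; apply/andP; split; first by apply/fintype.subsetP => U; rewrite inE => /andP [].
      by apply: leq_trans tc _; apply: leq_trans gq; rewrite leqNgt.
    have : tgt (val x) \in H q.2 by rewrite e; apply/imset2P; exists (val x).1 (val x).2.
    by rewrite inE => /andP [].
  rewrite -all_predC => /allP /(_ _ (tgt_Tk (isT : (0 < 1)%N) x)) /=.
  by rewrite nth_enc_set tx /= negbK.
split=> [s|q a t gq _ _]; last exact: step.
by have [] := step (0%N, [::]) s (leq0n _).
Qed.

(** The path never leaves the first target state it meets, so that single state determines all
    targets ever hit. *)
Lemma adequate_absorbing : absorbing_targets I -> adequate I 1.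
Proof.
move=> ab k.
pose good (q : pst) := q.2 = [::] \/ exists s : 'I_N, [/\ q.2 = [:: val s], q.1 = val s & absorbing M s].
exists good.
have step0 n (t : 'I_N) : good (pst_nx 1 k (n, [::]) t) /\
    forall x : trm I k, pst_hit (tgt (val x)) (pst_nx 1 k (n, [::]) t) = (t \in tgt (val x)).
  rewrite /pst_nx /pst_hit /nxt /=; case: ifP => [/hasP [T TT /andP [tT _]]|/negbT no] /=.
    split=> [|x]; last by rewrite nth_enc_set orbF.
    right; exists t; split=> //; have [x xE] := Tk_tgt TT; rewrite xE nth_enc_set in tT.
    exact: ab tT.
  split=> [|x]; first by left.
  move: no; rewrite -all_predC => /allP /(_ _ (tgt_Tk (isT : (0 < 1)%N) x)) /=.
  by rewrite nth_enc_set andbT => /negbTE ->.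
split=> [s|q a t]; first by have [] := step0 0%N s.
case: q => n A [/= ->|[s [/= -> -> sab]]] en pos; first exact: step0.
rewrite /pst_st /= inord_val in en pos.
have ts : t = s.
  apply/eqP/negPn/negP => ne; move: (en); rewrite /enabled (bigD1 s) //= (bigD1 t) //= (sab a en) => e.
 have h : 0 <= \sum_(i | (i != s) && (i != t)) trans M s a i.
    by apply: sumr_ge0 => i _; case/andP: (trans_01 M s a i).
  by move: e pos h; lra.
rewrite ts /pst_nx /pst_hit /nxt /=; split=> [|x]; first by right; exists s.
by rewrite /hitb /= orbF nth_enc_set orbb.
Qed.

Lemma sched_inj : num_scheds I = (num_terms I * num_preds I)%N ->
  injective (fun x : 'I_(num_terms I) * 'I_(num_preds I) => sched x.1 x.2).
Proof.
move=> e; pose f (x : 'I_(num_terms I) * 'I_(num_preds I)) := sched x.1 x.2.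
have /fintype.image_injP h : #|codom f| == #|{: 'I_(num_terms I) * 'I_(num_preds I)}|.
  rewrite card_prod !card_ord -e -[X in _ == X]card_ord; apply/eqP/eq_card => k.
  have [i [j <-]] := sched_onto k; rewrite !inE; apply/idP; apply/mapP; exists (i, j) => //.
  by rewrite mem_enum.
by move=> x y; apply: h.
Qed.

(** A surjection between sets of equal size is injective, so each scheduler has just one target to
    record. *)
Lemma adequate_own : num_scheds I = (num_terms I * num_preds I)%N -> adequate I 1.
Proof.
move=> e k; have inj := sched_inj e.
have one (x y : trm I k) : x = y.
  apply: val_inj; apply: inj; apply: val_inj; case: x y => [x /= /eqP hx] [y /= /eqP hy].
  by rewrite hx hy.
pose good (q : pst) := q.2 = [::] \/ (size q.2 = 1%N /\ forall x : trm I k, pst_hit (tgt (val x)) q).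
exists good.
have step0 n (t : 'I_N) : good (pst_nx 1 k (n, [::]) t) /\
    forall x : trm I k, pst_hit (tgt (val x)) (pst_nx 1 k (n, [::]) t) = (t \in tgt (val x)).
  rewrite /pst_nx /pst_hit /nxt /=; case: ifP => [/hasP [T TT /andP [tT _]]|/negbT no] /=.
    split=> [|x]; last by rewrite nth_enc_set orbF.
    right; split=> // x; rewrite /pst_hit /= nth_enc_set orbF.
    by have [y yE] := Tk_tgt TT; rewrite (one x y); rewrite yE nth_enc_set in tT.
  split=> [|x]; first by left.
  move: no; rewrite -all_predC => /allP /(_ _ (tgt_Tk (isT : (0 < 1)%N) x)) /=.
  by rewrite nth_enc_set andbT => /negbTE ->.
split=> [s|q a t]; first by have [] := step0 0%N s.
case: q => n A [/= ->|[/= sA h]] en pos; first exact: step0.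
have E : pst_nx 1 k (n, A) t = (val t, A) by rewrite /pst_nx /nxt /= sA.
rewrite E; split=> [|x]; first by right.
by have := h x; rewrite /pst_hit /= => ->.
Qed.

End Adequate.

(** Weights on histories are mixed, rather than choices of actions, and [weight_scheduler] turns the
    mixture into a scheduler. It makes the set of achievable values convex. *)
Lemma mix_schedulers (R : realType) nS nA (M : mdp nS nA) (s1 s2 : scheduler M R) (t : R) : 0 <= t <= 1 ->
  exists s3 : scheduler M R, forall s T,
    reach_prob s3 s T = (1 - t) * reach_prob s1 s T + t * reach_prob s2 s T.
Proof.
move=> /andP [t0 t1].
have cps (sg : scheduler M R) s h u : \sum_a cylinder_prob sg s (rcons h (u, a)) =
    cylinder_prob sg s h * next_state_prob R M s h u.
  under eq_bigr do rewrite cylinder_prob_rcons /step_prob /=.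
  by rewrite -mulr_sumr -mulr_sumr choose_act_sum1 mulr1.
have cpe (sg : scheduler M R) s h u a : ~ enabled M u a -> cylinder_prob sg s (rcons h (u, a)) = 0.
  by move=> ne; rewrite cylinder_prob_rcons /step_prob /= choose_act_enabled // !mulr0.
have /choice [sg sgP] : forall s, exists s3 : scheduler M R, forall T,
    reach_prob s3 s T = (1 - t) * reach_prob s1 s T + t * reach_prob s2 s T.
  move=> s; pose W h := (1 - t) * cylinder_prob s1 s h + t * cylinder_prob s2 s h.
  have [||||s3 cE] := @weight_scheduler R nS nA M s W.
  - by rewrite /W /cylinder_prob !big_ord0; ring.
  - by move=> h; rewrite /W addr_ge0 // mulr_ge0 ?cylinder_prob_ge0 ?subr_ge0.
  - by move=> h u; rewrite /W big_split /= -!mulr_sumr !cps; ring.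
  - by move=> h u a ne; rewrite /W !cpe // !mulr0 addr0.
  exists s3 => T; have E n : reachN s3 s T n = (1 - t) * reachN s1 s T n + t * reachN s2 s T n.
    rewrite /reachN ![_ * sumf _ _ _]mulrC -!sumfM -sumfD; apply: eq_sumf => h.
    by rewrite cE /W; ring.
  apply/eqP; rewrite -subr_eq0; apply: contraT => ne.
  have : 0 < `|reach_prob s3 s T - ((1 - t) * reach_prob s1 s T + t * reach_prob s2 s T)| by rewrite normr_gt0.
  set d := `|_| => d0; have d4 : 0 < d / 4 by lra.
  have [N1 H1] := reachN_cvg s1 s T d4; have [N2 H2] := reachN_cvg s2 s T d4; have [N3 H3] := reachN_cvg s3 s T d4.
  pose n := maxn N1 (maxn N2 N3).
  have := H1 n (leq_maxl _ _); have := H2 n _; have := H3 n _; rewrite E.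
  rewrite /n !leq_max !leqnn !orbT => /(_ isT) h3 /(_ isT) h2 h1.
  move: h1 h2 h3 d4; rewrite -/n; move: (reachN s1 s T n) (reachN s2 s T n) => u1 u2.
  rewrite /d; move: (reach_prob s1 s T) (reach_prob s2 s T) (reach_prob s3 s T) => v1 v2 v3 h1 h2 h3 d4.
  set D := v3 - _ in h1 h2 h3 d4 *.
  have a1 : `|(1 - t) * (u1 - v1)| <= (1 - t) * (`|D| / 4) by rewrite normrM ger0_norm ?subr_ge0 // ler_wpM2l ?subr_ge0.
  have a2 : `|t * (u2 - v2)| <= t * (`|D| / 4) by rewrite normrM ger0_norm // ler_wpM2l.
  have DE : D = ((1 - t) * (u1 - v1) + t * (u2 - v2)) - ((1 - t) * u1 + t * u2 - v3) by rewrite /D; ring.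
  have := ler_normB ((1 - t) * (u1 - v1) + t * (u2 - v2)) ((1 - t) * u1 + t * u2 - v3).
  rewrite -DE; have := ler_normD ((1 - t) * (u1 - v1)) (t * (u2 - v2)).
  move: a1 a2 h3 d4; set x := `|D|; lra.
have [s3 h3] := combine_schedulers sg; exists s3 => s T; by rewrite h3 sgP.
Qed.

Definition odef : opc := (false, false, rdef).
Definition is_nap (o : opc) : bool := o.1.1 && o.1.2.
Definition r_op (r : raw) (j : nat) : opc := nth odef (r_o r) j.
Definition r_cons (r : raw) (j : nat) : seq con :=
  if (r_op r j).1.1 then
    if (r_op r j).1.2 then [::] else [:: (j, true, (r_op r j).2, false); (j, false, (r_op r j).2, false)]
  else [:: (j, true, rdef, ~~ (r_op r j).1.2)].
Definition r_nap (r : raw) (x : nat * bool) : con :=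
  (x.1, x.2, (- (r_op r x.1).2.1, (r_op r x.1).2.2), true).
Definition r_base (r : raw) : seq con := flatten [seq r_cons r j | j <- idx (r_o r)].
(** Here [u] is the certificate: its bits choose a side for each predicate that excludes an
    interval. *)
Definition r_sgn (r : raw) (u : seq bool) : seq con :=
  flatten [seq (if is_nap (r_op r j) then [:: r_nap r (j, nth false u j)] else r_cons r j) | j <- idx (r_o r)].

Definition dec_np (c : nat) (x : raw * seq bool) : bool := lp_solve (r_lp c (x.1, r_sgn x.1 x.2)).
(** With tolerance zero, each excluded hyperplane is tested alone against the remaining constraints;
    convexity combines the separate witnesses. *)
Definition dec_ab (c : nat) (r : raw) : bool :=
  lp_solve (r_lp c (r, r_base r)) &&
  all (fun j => ~~ is_nap (r_op r j) ||
    has (fun b => lp_solve (r_lp c (r, r_nap r (j, b) :: r_base r))) [:: true; false]) (idx (r_o r)).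
Definition dec_own (r : raw) : bool :=
  all (fun j => if is_nap (r_op r j)
    then has (fun b => lp_solve (r_lp 1 (r, [:: r_nap r (j, b)]))) [:: true; false]
    else lp_solve (r_lp 1 (r, r_cons r j))) (idx (r_o r)).

#[export] Hint Resolve fpc_lp_solve fpc_r_lp : fpdb.
Lemma fpc_r_op : fpc (fun q : raw * nat => r_op q.1 q.2). Proof. by rewrite /r_op; fpa. Qed.
#[export] Hint Resolve fpc_r_op : fpdb.
Lemma fpc_is_nap : fpc is_nap. Proof. by rewrite /is_nap; fpa. Qed.
Lemma fpc_r_cons : fpc (fun q : raw * nat => r_cons q.1 q.2). Proof. by rewrite /r_cons; fpa. Qed.
Lemma fpc_r_nap : fpc (fun q : raw * (nat * bool) => r_nap q.1 q.2). Proof. by rewrite /r_nap; fpa. Qed.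
#[export] Hint Resolve fpc_is_nap fpc_r_cons fpc_r_nap : fpdb.
Lemma fpc_r_base : fpc r_base. Proof. by rewrite /r_base; fpa. Qed.
Lemma fpc_r_sgn : fpc (fun q : raw * seq bool => r_sgn q.1 q.2). Proof. by rewrite /r_sgn; fpa. Qed.
#[export] Hint Resolve fpc_r_base fpc_r_sgn : fpdb.

#[local] Opaque lp_solve r_lp.
Lemma fpc_dec_np c : fpc (dec_np c). Proof. by rewrite /dec_np; fpa. Qed.
Lemma fpc_dec_ab c : fpc (dec_ab c). Proof. by rewrite /dec_ab; fpa. Qed.
Lemma fpc_dec_own : fpc dec_own. Proof. by rewrite /dec_own; fpa. Qed.

Section Decide.
Variables (R : realType) (I : instance).
Local Notation r := (raw_of I).
Local Notation l := (num_preds I).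
Implicit Types (P : 'I_(num_terms I) -> 'I_(num_preds I) -> R) (j : 'I_(num_preds I)).

Definition pval P j : R := \sum_i ratr (@coef I i j) * P i j.

Lemma cvalE P j b e st : cval P (val j, b, e, st) = sgr R b * (pval P j - ratr (bound j)) + rv R e.
Proof. by rewrite /cval /=; case: insubP => [j' _ /val_inj -> //|]; rewrite ltn_ord. Qed.

Lemma idx_o : idx (r_o r) = iota 0 l.
Proof. by rewrite /idx /r_o /= size_fam1. Qed.

Lemma r_opE j : r_op r j = rop (op j).
Proof. exact: nth_fam1. Qed.

Lemma rv_def : rv R rdef = 0. Proof. by rewrite /rv /= mul0r. Qed.

Lemma compare_cons P j : ~~ is_nap (r_op r j) ->
  compare (op j) (pval P j) (ratr (bound j)) <-> forall x, x \in r_cons r j -> holds P x.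
Proof.
rewrite /r_cons r_opE; case: (op j) => [| |e|e] //= _.
- split=> [h x|/(_ _ (mem_head _ _)) []].
    by rewrite inE => /eqP ->; rewrite /holds cvalE rv_def addr0 mul1r subr_ge0 subr_gt0 (ltW h).
  by move=> _ /(_ isT); rewrite cvalE rv_def addr0 mul1r subr_gt0.
- split=> [h x|/(_ _ (mem_head _ _)) []].
    by rewrite inE => /eqP ->; rewrite /holds cvalE rv_def addr0 mul1r subr_ge0.
  by rewrite cvalE rv_def addr0 mul1r subr_ge0.
- rewrite ler_norml; split=> [/andP [h1 h2] x|h].
    by rewrite !inE => /orP [] /eqP ->; rewrite /holds cvalE rv_rq /sgr; split=> //; lra.
  have [h1 _] := h _ (mem_head _ _).
  have [h2 _] := h (val j, false, rq e, false) ltac:(by rewrite !inE eqxx orbT).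
  by move: h1 h2; rewrite !cvalE rv_rq /sgr => *; apply/andP; split; lra.
Qed.

Lemma rv_opp (x : rt) : rv R (- x.1, x.2) = - rv R x.
Proof. by rewrite /rv /= rmorphN mulNr. Qed.

Lemma compare_nap P j : is_nap (r_op r j) ->
  compare (op j) (pval P j) (ratr (bound j)) <-> exists b, holds P (r_nap r (val j, b)).
Proof.
rewrite /r_nap /= r_opE; case: (op j) => [| |e|e] //= _.
have cE b : cval P (val j, b, (- numq e, `|denq e|%N), true) = sgr R b * (pval P j - ratr (bound j)) - ratr e.
  by rewrite cvalE -[(- numq e, _)]/(- (rq e).1, (rq e).2) rv_opp rv_rq.
have hE b : holds P (val j, b, (- numq e, `|denq e|%N), true) <-> 0 < sgr R b * (pval P j - ratr (bound j)) - ratr e.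
  by rewrite /holds cE; split=> [[_ /(_ isT)]|h] //; split=> //; exact: ltW.
split=> [|[b /hE]].
  rewrite lter_normr => /orP [] h; [exists true|exists false]; apply/hE; rewrite /sgr; lra.
by case: b; rewrite /sgr lter_normr => h; apply/orP; [left|right]; lra.
Qed.

Lemma okcon_cons j : all (okcon I) (r_cons r j).
Proof.
have o1 : okx I rdef by rewrite /okx /= dvd1n.
have o2 := okx_O j; rewrite /r_cons r_opE; case: (op j) o2 => [| |e|e] /= o2; rewrite /okcon /= ?ltn_ord //= ?o1 ?o2 //.
Qed.

Lemma okcon_nap j b : okcon I (r_nap r (val j, b)).
Proof. by rewrite /r_nap /= /okcon /= ltn_ord /= r_opE; exact: okx_O. Qed.

Lemma mem_base x : x \in r_base r <-> exists j, x \in r_cons r j.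
Proof.
rewrite /r_base idx_o; split=> [/flattenP [u /mapP [j]]|[j xj]].
  by rewrite mem_iota add0n => /andP [_ jl] -> xj; exists (Ordinal jl).
by apply/flattenP; exists (r_cons r j) => //; apply/mapP; exists (val j) => //; rewrite mem_iota /= add0n ltn_ord.
Qed.

Lemma mem_sgn u x : x \in r_sgn r u <-> exists j,
  x \in (if is_nap (r_op r j) then [:: r_nap r (val j, nth false u j)] else r_cons r j).
Proof.
rewrite /r_sgn idx_o; split=> [/flattenP [v /mapP [j]]|[j xj]].
  by rewrite mem_iota add0n => /andP [_ jl] -> xj; exists (Ordinal jl).
apply/flattenP; exists (if is_nap (r_op r j) then [:: r_nap r (val j, nth false u j)] else r_cons r j) => //.
by apply/mapP; exists (val j) => //; rewrite mem_iota /= add0n ltn_ord.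
Qed.

Lemma okcon_base : all (okcon I) (r_base r).
Proof. by apply/allP => x /mem_base [j xj]; move/allP: (okcon_cons j) => /(_ x xj). Qed.

Theorem dec_npP c : (0 < c)%N -> adequate I c ->
  (satisfiable R I -> exists2 u : seq bool, size u = l & dec_np c (r, u)) /\
  forall u, dec_np c (r, u) -> satisfiable R I.
Proof.
move=> c0 ad; have ok u : all (okcon I) (r_sgn r u).
  apply/allP => x /mem_sgn [j]; case: ifP => _; first by rewrite inE => /eqP ->; exact: okcon_nap.
  by move/allP: (okcon_cons j) => /(_ x).
split=> [[sigma H]|u /(r_lpP R c0 ad (ok u)) [sigma H]].
  have /choice [sg sgP] : forall j, exists b, is_nap (r_op r j) -> holds (@reach_of R I sigma) (r_nap r (val j, b)).
    move=> j; have [nj|nj] := boolP (is_nap (r_op r j)); last by exists true.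
    by have [b hb] := (compare_nap (@reach_of R I sigma) nj).1 (H j); exists b.
  exists (fam1 sg); first exact: size_fam1.
  apply/(r_lpP R c0 ad (ok _)); exists sigma => x /mem_sgn [j].
  case: ifP => nj; first by rewrite inE nth_fam1 => /eqP ->; exact: sgP.
  by apply: (compare_cons _ (negbT nj)).1; exact: H.
exists sigma => j; have [nj|nj] := boolP (is_nap (r_op r j)).
  apply/(compare_nap (@reach_of R I sigma) nj); exists (nth false u j); apply: H; apply/mem_sgn; exists j.
  by rewrite nj mem_head.
by apply/(compare_cons (@reach_of R I sigma) nj) => x xj; apply: H; apply/mem_sgn; exists j; rewrite (negbTE nj).
Qed.

Theorem dec_ownP : num_scheds I = (num_terms I * num_preds I)%N -> satisfiable R I <-> dec_own r.
Proof.
move=> e; have ad := adequate_own e; have inj := sched_inj e.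
rewrite /dec_own idx_o; split=> [[sigma H]|/allP H].
  apply/allP => j; rewrite mem_iota add0n => /andP [_ jl].
  have Hj := H (Ordinal jl); case: ifP => nj.
    have [b hb] := (compare_nap (@reach_of R I sigma) (nj : is_nap (r_op r (Ordinal jl)))).1 Hj.
    apply/hasP; exists b; first by case: (b).
    apply/(r_lpP R (isT : (0 < 1)%N) ad); first by rewrite /= (okcon_nap (Ordinal jl)).
    by exists sigma => x; rewrite inE => /eqP ->.
  apply/(r_lpP R (isT : (0 < 1)%N) ad); first exact: (okcon_cons (Ordinal jl)).
  by exists sigma; exact: ((compare_cons _ (negbT nj : ~~ is_nap (r_op r (Ordinal jl)))).1 Hj).
have /choice [sg sgP] : forall j, exists sigma, compare (op j) (pval (@reach_of R I sigma) j) (ratr (bound j)).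
  move=> j; have := H (val j); rewrite mem_iota leq0n add0n ltn_ord => /(_ isT); case: ifP => nj.
    move=> /hasP [b _] /(r_lpP R (isT : (0 < 1)%N) ad) [|sigma h]; first by rewrite /= okcon_nap.
    by exists sigma; apply/(compare_nap _ nj); exists b; apply: h; rewrite mem_head.
  move=> /(r_lpP R (isT : (0 < 1)%N) ad) [|sigma h]; first exact: okcon_cons.
  by exists sigma; apply/(compare_cons _ (negbT nj)).
have /choice [jk jkP] : forall k : 'I_(num_scheds I), exists ij, sched ij.1 ij.2 = k.
  by move=> k; have [i [j ij]] := sched_onto k; exists (i, j).
(* Scheduler [k] is taken from a solution for the only predicate in which it occurs. *)
exists (fun k => sg (jk k).2 k) => j; have := sgP j; congr compare.
apply: eq_bigr => i _; congr (_ * _); rewrite /reach_of.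
by have -> : jk (sched i j) = (i, j) by apply: inj; rewrite jkP.
Qed.

Lemma small_pos (s : seq R) : (forall x, x \in s -> 0 < x) -> exists t, 0 < t < 1 /\ forall x, x \in s -> t < x.
Proof.
elim: s => [|x s IH] H; first by exists (2^-1); split=> //; lra.
have [|t [/andP [t0 t1] tP]] := IH; first by move=> y ys; apply: H; rewrite in_cons ys orbT.
have x0 := H x (mem_head _ _).
exists (Order.min t x / 2); have m0 : 0 < Order.min t x by rewrite lt_min t0.
have h1 : Order.min t x <= t by rewrite ge_min lexx.
have h2 : Order.min t x <= x by rewrite ge_min lexx orbT.
split; first by apply/andP; split; lra.
by move=> y; rewrite in_cons => /orP [/eqP ->|/tP]; lra.
Qed.

Lemma pval_mix P1 P2 P3 t j : (forall i j, P3 i j = (1 - t) * P1 i j + t * P2 i j) ->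
  pval P3 j - ratr (bound j) = (1 - t) * (pval P1 j - ratr (bound j)) + t * (pval P2 j - ratr (bound j)).
Proof.
move=> E; have -> : pval P3 j = (1 - t) * pval P1 j + t * pval P2 j; last by ring.
by rewrite /pval !mulr_sumr -big_split; apply: eq_bigr => i _ /=; rewrite E; ring.
Qed.

(* The achievable values form a convex set, and finitely many hyperplanes none
   of which contains it do not cover it. *)
Theorem dec_abP c : (0 < c)%N -> adequate I c -> num_napprox I = 0%N -> satisfiable R I <-> dec_ab c r.
Proof.
move=> c0 ad nap0.
have e0 j e : op j = CmpNapprox e -> e = 0.
  move=> oj; have := op_ge0 j; rewrite oj /= le_eqVlt => /orP [/eqP <- //|ep].
  by have /eqP := nap0; rewrite cards_eq0 => /eqP/setP /(_ j); rewrite !inE oj ep.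
have napE P j : is_nap (r_op r j) -> compare (op j) (pval P j) (ratr (bound j)) <-> pval P j - ratr (bound j) != 0.
  rewrite r_opE; case E: (op j) => [| |e|e] //= _; rewrite (e0 _ _ E) rmorph0 normr_gt0; by [].
rewrite /dec_ab idx_o; split=> [[sigma H]|/andP [/(r_lpP R c0 ad okcon_base) [sg0 H0] /allP Hn]].
  have hb x : x \in r_base r -> holds (@reach_of R I sigma) x.
    move=> /mem_base [j xj]; have [nj|nj] := boolP (is_nap (r_op r j)).
      by move: xj nj; rewrite /r_cons r_opE; case: (op j).
    by apply: (compare_cons _ nj).1 xj; exact: H.
  apply/andP; split; first by apply/(r_lpP R c0 ad okcon_base); exists sigma.
  apply/allP => j; rewrite mem_iota add0n => /andP [_ jl]; have Hj := H (Ordinal jl).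
  have [nj|//] := boolP (is_nap (r_op r j)).
  have [b hbj] := (compare_nap (@reach_of R I sigma) (nj : is_nap (r_op r (Ordinal jl)))).1 Hj.
  apply/hasP; exists b; first by case: (b).
  apply/(r_lpP R c0 ad); first by rewrite /= (okcon_nap (Ordinal jl)) okcon_base.
  by exists sigma => x; rewrite in_cons => /orP [/eqP ->|/hb].
pose good sigma := forall x, x \in r_base r -> holds (@reach_of R I sigma) x.
pose f sigma j : R := pval (@reach_of R I sigma) j - ratr (bound j).
have mix s1 s2 t : 0 <= t <= 1 -> good s1 -> good s2 -> exists2 s3, good s3 & forall j, f s3 j = (1 - t) * f s1 j + t * f s2 j.
  move=> t01 g1 g2; have /choice [s3 s3P] : forall k, exists s3 : scheduler (model I) R, forall s T,
      reach_prob s3 s T = (1 - t) * reach_prob (s1 k) s T + t * reach_prob (s2 k) s T.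
    by move=> k; exact: mix_schedulers.
  have fE j : f s3 j = (1 - t) * f s1 j + t * f s2 j by apply: pval_mix => i j'; exact: s3P.
  exists s3 => // x xb; have [j xj] := (mem_base x).1 xb.
  have [b [e [st xE]]] : exists b e st, x = (val j, b, e, st).
    move: xj; rewrite /r_cons; case: ifP => _; first case: ifP => // _.
      by rewrite !inE => /orP [] /eqP ->; do 3 eexists.
    by rewrite inE => /eqP ->; do 3 eexists.
  have [h1 h1'] := g1 x xb; have [h2 h2'] := g2 x xb.
  move: h1 h1' h2 h2'; rewrite /holds xE !cvalE -!/(f _ j) fE /= => h1 h1' h2 h2'.
  set S := sgr R b in h1 h1' h2 h2' *; set E := rv R e in h1 h1' h2 h2' *.
  have -> : S * ((1 - t) * f s1 j + t * f s2 j) + E = (1 - t) * (S * f s1 j + E) + t * (S * f s2 j + E) by ring.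
  case/andP: t01 => t0 t1; split=> [|st1]; first by rewrite addr_ge0 // mulr_ge0 // subr_ge0.
  have {}h1' := h1' st1; have {}h2' := h2' st1.
  have [->|tn] := eqVneq t 0; first by rewrite subr0 mul1r mul0r addr0.
  by rewrite ltr_wpDl ?mulr_ge0 ?subr_ge0 // mulr_gt0 // lt_neqAle eq_sym tn.
have pt j : is_nap (r_op r j) -> exists2 s, good s & f s j != 0.
  move=> nj; have := Hn (val j); rewrite mem_iota leq0n add0n ltn_ord => /(_ isT) /orP [|/hasP [b _]]; first by rewrite nj.
  move=> /(r_lpP R c0 ad) [|s hs]; first by rewrite /= okcon_nap okcon_base.
  exists s; first by move=> x xb; apply: hs; rewrite in_cons xb orbT.
  by apply/(napE _ _ nj)/(compare_nap _ nj); exists b; apply: hs; rewrite mem_head.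
have [s gs fs] : exists2 s, good s & forall j, j \in enum 'I_l -> is_nap (r_op r j) -> f s j != 0.
  elim: (enum 'I_l) => [|j J [s gs fs]]; first by exists sg0.
  have [nj|nj] := boolP (is_nap (r_op r j)); last first.
    by exists s => // j'; rewrite in_cons => /orP [/eqP -> h|]; [rewrite h in nj|exact: fs].
  have [fj|fj] := eqVneq (f s j) 0; last first.
    by exists s => // j'; rewrite in_cons => /orP [/eqP ->|] //; exact: fs.
  have [s' gs' fs'] := pt j nj.
  (* As long as t is below this ratio, (1 - t) |f s i| exceeds t |f s' i|, so moving from [s]
     towards [s'] does not cancel coordinate [i]. *)
  pose g (i : 'I_l) : R := `|f s i| / (`|f s i| + `|f s' i|).
  pose K := [seq g i | i <- seq.filter (fun i : 'I_l => is_nap (r_op r (nat_of_ord i))) J].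
  have [|t [/andP [t0 t1] tP]] := @small_pos K.
    move=> x /mapP [j']; rewrite mem_filter => /andP [nj' jJ] ->.
    by rewrite /g divr_gt0 ?normr_gt0 ?fs // ltr_pwDl ?normr_gt0 ?fs.
  have [|s3 g3 f3] := mix s s' t _ gs gs'; first by rewrite !ltW.
  exists s3 => // j'; rewrite in_cons f3 => /orP [/eqP -> _|jJ nj'].
    by rewrite fj mulr0 add0r mulf_neq0 // gt_eqF.
  have /tP : g j' \in K.
    by apply/mapP; exists j' => //; rewrite mem_filter nj'.
  have a0 : 0 < `|f s j'| by rewrite normr_gt0 fs.
  rewrite /g ltr_pdivlMr ?ltr_pwDl // => h.
  rewrite -normr_gt0.
  have : (1 - t) * `|f s j'| <= `|(1 - t) * f s j' + t * f s' j'| + t * `|f s' j'|.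
    have := ler_normB ((1 - t) * f s j' + t * f s' j') (t * f s' j').
    by rewrite addrK !normrM (ger0_norm (ltW t0)) ger0_norm // subr_ge0 ltW.
  by move: h; rewrite mulrDr; set A := `|_ + _|; lra.
exists s => j; have [nj|nj] := boolP (is_nap (r_op r j)).
  by apply/(napE (@reach_of R I s) _ nj); apply: fs => //; rewrite mem_enum.
by apply/(compare_cons (@reach_of R I s) nj) => x xj; apply: gs; apply/mem_base; exists j.
Qed.

End Decide.

End Decision.
Import Decision.

(** * Parsing encoded instances *)

Module Parsing.

(** The binary code spells zero with one digit, whereas [nbits] gives the empty list. *)
Definition nbb (k : nat) : seq bool := if k == 0 then [:: false] else nbits k.
Definition e_num (k : nat) : seq bool := flatten [seq [:: true; b] | b <- nbb k] ++ [:: false].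

Lemma bits_nbits k : 0 < k -> [seq odd (k %/ 2 ^ i) | i <- iota 0 (trunc_log 2 k).+1] = nbits k.
Proof.
elim/nat_half_ind: k => // k k0 IH _.
rewrite nbitsE (negbTE (lt0n_neq0 k0)) -(addn1 (trunc_log 2 k)) addnC iotaD map_cat /= expn0 divn1; congr cons.
have [k1|k1] := ltnP 1 k; last first.
  have -> : k = 1 by lia.
  by [].
rewrite trunc_log2S // -(IH _); last by rewrite half_gt0.
rewrite -[X in iota X _]addn0 iotaDl -map_comp; apply: eq_map => i /=.
by rewrite add1n expnS divnMA divn2.
Qed.

Lemma e_numE k : binary_code k = e_num k.
Proof.
rewrite /binary_code /e_num cats1; congr rcons; congr flatten; rewrite /nbb; case: eqP => [->|/eqP k0].
  by rewrite trunc_log0 /=.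
by rewrite -bits_nbits ?lt0n // -map_comp.
Qed.

Lemma bval_nbb k : bval (nbb k) = k.
Proof. by rewrite /nbb; case: eqP => [->|_] //; exact: bval_nbits. Qed.

Arguments e_num : simpl never.

Lemma fpc_e_num : fpc e_num. Proof. by rewrite /e_num /nbb; fpa. Qed.
#[export] Hint Resolve fpc_e_num : fpdb.

Definition un_step (x : seq bool * seq bool) : seq bool * seq bool :=
  if head false x.2 then (head false (behead x.2) :: x.1, behead (behead x.2)) else x.
(** Reads bits that are each preceded by a continuation bit. Numbers and [pair_code] share this
    format, so one scanner decodes both. *)
Definition unpair (r : seq bool) : seq bool * seq bool :=
  let y := iter (size r) un_step ([::], r) in (rev y.1, behead y.2).

Lemma un_step_size r j : size (iter j un_step ([::], r)).1 <= j /\ size (iter j un_step ([::], r)).2 <= size r.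
Proof.
elim: j => //= j; case: (iter j _ _) => x y /= [h1 h2]; rewrite /un_step /=; case: ifP => /= _; last by split; lia.
by split=> //; rewrite !size_behead; lia.
Qed.

Lemma unpairK bs r : unpair (flatten [seq [:: true; b] | b <- bs] ++ false :: r) = (bs, r).
Proof.
rewrite /unpair; set w := _ ++ _.
have E m acc cs : size cs <= m ->
    iter m un_step (acc, flatten [seq [:: true; b] | b <- cs] ++ false :: r) = (catrev cs acc, false :: r).
  elim: cs m acc => [|b cs IH] m acc /=.
    by move=> _; elim: m => // m IHm; rewrite iterS IHm.
  by case: m => // m sm; rewrite iterSr /un_step /= IH.
rewrite E /=; first by rewrite -[catrev bs [::]]/(rev bs) revK.
have h : size bs <= size (flatten [seq [:: true; b] | b <- bs]) by elim: (bs) => //= b s IH; lia.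
by rewrite /w size_cat; lia.
Qed.

Lemma unpair_size r : size (unpair r).2 <= size r.
Proof. by have [_ h] := un_step_size r (size r); rewrite /unpair /= size_behead; lia. Qed.

Lemma fpc_unpair : fpc unpair.
Proof.
have h : fpc (fun r : seq bool => iter (size r) un_step ([::], r)).
  apply: (@fpc_iter_env _ _ _ _ _ _ (fun _ : seq bool => un_step) (fun r => ([::], r)) (fun r : seq bool => r)
    (fun n => 8 * n + 3)).
  - by rewrite /un_step; fpa.
  - by fpa.
  - by fpa.
  - by pols.
  move=> r j jr; have [h1 h2] := un_step_size r j; pose proof (size_sz r).
  case: (iter j _ _) h1 h2 => x y /= h1 h2; rewrite szP.
  by have := sz_bits x; have := sz_bits y; lia.
by rewrite /unpair; cbv zeta; fpa.
Qed.
#[export] Hint Resolve fpc_unpair : fpdb.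

Definition psr A := seq bool -> A * seq bool.
Definition p_bit : psr bool := fun r => (head false r, behead r).
Definition p_num : psr nat := fun r => (bval (unpair r).1, (unpair r).2).
Definition p_int : psr int := fun r => (zmk (head false r) (p_num (behead r)).1, (p_num (behead r)).2).
Definition p_rat : psr rt := fun r =>
  (((p_int r).1, (p_num (p_int r).2).1), (p_num (p_int r).2).2).
Definition p_op : psr opc := fun r =>
  if head false r then ((true, head false (behead r), (p_rat (behead (behead r))).1), (p_rat (behead (behead r))).2)
  else ((false, head false (behead r), rdef), behead (behead r)).
(** The list of numbers serves only as a counter for how many items to read. *)
Definition p_list A (p : psr A) (x : seq nat * seq bool) : seq A * seq bool :=
  let y := foldl (fun s (_ : nat) => ((p s.2).1 :: s.1, (p s.2).2)) ([::], x.2) x.1 in (rev y.1, y.2).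

Arguments p_num : simpl never.
Arguments p_int : simpl never.
Arguments p_rat : simpl never.

Definition e_int (z : int) : seq bool := (z < 0)%R :: e_num `|z|%N.
Definition e_rat (x : rt) : seq bool := e_int x.1 ++ e_num x.2.
Arguments e_rat : simpl never.
Definition e_op (o : opc) : seq bool := [:: o.1.1; o.1.2] ++ (if o.1.1 then e_rat o.2 else [::]).

Lemma p_numK k r : p_num (e_num k ++ r) = (k, r).
Proof. by rewrite /p_num /e_num -catA unpairK bval_nbb. Qed.

#[local] Opaque e_num p_num.

Lemma p_intK z r : p_int (e_int z ++ r) = (z, r).
Proof. by rewrite /p_int /e_int /= p_numK -zmkE. Qed.

#[local] Opaque e_int p_int.

Lemma p_ratK x r : p_rat (e_rat x ++ r) = (x, r).
Proof. by rewrite /p_rat /e_rat -catA p_intK /= p_numK; case: x. Qed.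

#[local] Opaque e_rat p_rat.

Lemma p_opK o r : (~~ o.1.1 -> o.2 = rdef) -> p_op (e_op o ++ r) = (o, r).
Proof.
case: o => [[[] b] x] /= h; rewrite /p_op /e_op /=; first by rewrite p_ratK.
by rewrite h.
Qed.

Lemma p_listK A (p : psr A) (e : A -> seq bool) (Q : A -> Prop) (c : seq nat) (l : seq A) r :
  (forall a r, Q a -> p (e a ++ r) = (a, r)) -> (forall i d, i < size l -> Q (nth d l i)) -> size c = size l ->
  p_list p (c, flatten [seq e a | a <- l] ++ r) = (l, r).
Proof.
move=> pK; rewrite /p_list /=.
have E (acc : seq A) : (forall i d, i < size l -> Q (nth d l i)) -> size c = size l ->
  foldl (fun s (_ : nat) => ((p s.2).1 :: s.1, (p s.2).2)) (acc, flatten [seq e a | a <- l] ++ r) c = (catrev l acc, r).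
  elim: l c acc => [|a l IH] [|n c] acc //= Ql [sc].
  rewrite -catA pK; last exact: (Ql 0 a).
  by rewrite /= IH // => i d il; exact: (Ql i.+1 d).
by move=> Ql sc; rewrite E //= -[catrev l [::]]/(rev l) revK.
Qed.

#[local] Transparent e_num p_num e_int p_int e_rat p_rat.

Lemma p_num_size r : size (p_num r).2 <= size r. Proof. exact: unpair_size. Qed.
Lemma p_int_size r : size (p_int r).2 <= size r.
Proof. by rewrite /p_int /=; apply: leq_trans (p_num_size _) _; rewrite size_behead leq_pred. Qed.
Lemma p_rat_size r : size (p_rat r).2 <= size r.
Proof. by rewrite /p_rat /=; apply: leq_trans (p_num_size _) (p_int_size _). Qed.
Lemma p_bit_size r : size (p_bit r).2 <= size r. Proof. by rewrite size_behead leq_pred. Qed.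
Lemma p_op_size r : size (p_op r).2 <= size r.
Proof.
rewrite /p_op; case: ifP => _ /=; last by rewrite !size_behead; lia.
by apply: leq_trans (p_rat_size _) _; rewrite !size_behead; lia.
Qed.

Lemma fpc_p_bit : fpc p_bit. Proof. by rewrite /p_bit; fpa. Qed.
Lemma fpc_p_num : fpc p_num. Proof. by rewrite /p_num; fpa. Qed.
#[export] Hint Resolve fpc_p_bit fpc_p_num : fpdb.
#[local] Opaque p_num.
Lemma fpc_p_int : fpc p_int. Proof. by rewrite /p_int; fpa. Qed.
#[export] Hint Resolve fpc_p_int : fpdb.
#[local] Opaque p_int.
Lemma fpc_p_rat : fpc p_rat. Proof. by rewrite /p_rat; fpa. Qed.
#[export] Hint Resolve fpc_p_rat : fpdb.
#[local] Opaque p_rat.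
Lemma fpc_p_op : fpc p_op. Proof. by rewrite /p_op; fpa. Qed.
#[export] Hint Resolve fpc_p_op : fpdb.
#[local] Opaque p_op.

Lemma fpc_p_list A {eA : Enc A} (p : psr A) : fpc p -> (forall r, size (p r).2 <= size r) -> fpc (p_list p).
Proof.
move=> hp ps; have [k Hk] := fpc_sz hp.
have h : fpc (fun x : seq nat * seq bool =>
   foldl (fun s (_ : nat) => ((p s.2).1 :: s.1, (p s.2).2)) ([::] : seq A, x.2) x.1).
  apply: (fpc_foldl (f := fun _ s (_ : nat) => ((p s.2).1 :: s.1, (p s.2).2))
     (p := fun n => n * (pb k (4 * n + 1) + 1) + 1 + (4 * n + 1) + 1)) => //.
  - by fpa.
  - by fpa.
  - by fpa.
  - by pols.
  move=> [c r] j jc; have sc : size (take j c) <= sz (c, r).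
    pose proof (size_sz c); rewrite size_take_min szP; lia.
  rewrite [(c, r).1]/= [(c, r).2]/=.
  have E (cc : seq nat) (acc : seq A) r' B : size r' <= size r -> (forall r'', size r'' <= size r -> sz (p r'').1 <= B) ->
     let y := foldl (fun s (_ : nat) => ((p s.2).1 :: s.1, (p s.2).2)) (acc, r') cc in
     size y.2 <= size r /\ sz y.1 <= sz acc + size cc * (B + 1).
    elim: cc acc r' => [|n cc IH] acc r' hr hB /=; first by rewrite addn0.
    have [h1 h2] := IH ((p r').1 :: acc) (p r').2 (leq_trans (ps _) hr) hB; split=> //.
    by apply: leq_trans h2 _; rewrite sz_cons mulSn; have := hB r' hr; lia.
  have [r'' hr|h1 h2] := E (take j c) [::] r (pb k (4 * sz (c, r) + 1)) (leqnn _) _.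
    have h0 : sz (p r'').1 <= sz (p r'') by case: (p r'') => x y; rewrite szP /=; lia.
    apply: leq_trans h0 (leq_trans (Hk r'') _).
    apply: pb_mono; have := sz_bits r''; pose proof (size_sz r); rewrite szP; lia.
  move: h1 h2; case: (foldl _ _ _) => y1 y2 /= h1 h2; rewrite sz_nil in h2.
  have Zr : sz r <= sz (c, r) by rewrite szP; lia.
  rewrite [sz (y1, y2)]szP; have := sz_bits y2; pose proof (size_sz r).
  have : size (take j c) * (pb k (4 * sz (c, r) + 1) + 1) <= sz (c, r) * (pb k (4 * sz (c, r) + 1) + 1).
    by rewrite leq_mul2r sc orbT.
  by move: h1 h2 Zr; clear -H; move: (sz (c, r)) (size (take j c) * _)%N => z u; move: (z * _)%N => v; lia.
rewrite /p_list; cbv zeta.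
apply: (fpc_comp h (g := fun y => (rev y.1, y.2))); fpa.
Qed.

Definition raw1 := (nat * nat * seq rt)%type.
Definition ps1 (w : seq bool) : nat * nat * seq bool :=
  ((p_num w).1, (p_num (p_num w).2).1, (p_num (p_num w).2).2).
Definition ps2 (w : seq bool) (x : nat * nat * seq bool) : raw1 * seq bool :=
  let y := p_list p_rat (rng w (x.1.1.+1 * x.1.2.+1 * x.1.1.+1), x.2) in ((x.1.1, x.1.2, y.1), y.2).
Definition ps3 (x : raw1 * seq bool) : raw1 * (nat * nat * nat) * seq bool :=
  let a := p_num x.2 in let b := p_num a.2 in let d := p_num b.2 in (x.1, (a.1, b.1, d.1), d.2).
Definition ps4 (w : seq bool) (x : raw1 * (nat * nat * nat) * seq bool) :
    raw1 * (nat * nat * nat) * (seq rt * seq rt) * seq bool :=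
  let a := p_list p_rat (rng w (x.1.2.1.2 * x.1.2.1.1), x.2) in
  let b := p_list p_rat (rng w x.1.2.1.1, a.2) in (x.1, (a.1, b.1), b.2).
Definition ps5 (w : seq bool) (x : raw1 * (nat * nat * nat) * (seq rt * seq rt) * seq bool) :
    raw1 * (nat * nat * nat) * (seq rt * seq rt) * (seq nat * seq nat * seq (seq bool)) * seq bool :=
  let c := rng w (x.1.1.2.1.2 * x.1.1.2.1.1) in
  let a := p_list p_num (c, x.2) in
  let b := p_list p_num (c, a.2) in
  let d := p_list p_bit (rng w (x.1.1.2.1.2 * x.1.1.2.1.1 * x.1.1.1.1.1.+1), b.2) in
  (x.1, (a.1, b.1, [seq [seq nth false d.1 (e * x.1.1.1.1.1.+1 + t) | t <- rng w x.1.1.1.1.1.+1] | e <- c]), d.2).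
Definition ps6 (w : seq bool) (x : raw1 * (nat * nat * nat) * (seq rt * seq rt) *
    (seq nat * seq nat * seq (seq bool)) * seq bool) : raw :=
  (x.1, (p_list p_op (rng w x.1.1.1.2.1.1, x.2)).1).
(** A total function; that [w] really is a code is checked afterwards by encoding the result again.
    The word itself bounds all list lengths. *)
Definition parse (w : seq bool) : raw := ps6 w (ps5 w (ps4 w (ps3 (ps2 w (ps1 w))))).

Definition e_raw (r : raw) : seq bool :=
  e_num (r_S r) ++ e_num (r_A r) ++ flatten [seq e_rat x | x <- r_T r] ++
  e_num (r_l r) ++ e_num (r_m r) ++ e_num (r_n r) ++
  flatten [seq e_rat x | x <- r_C r] ++ flatten [seq e_rat x | x <- r_B r] ++
  flatten [seq e_num x | x <- r_s r] ++ flatten [seq e_num x | x <- r_k r] ++ flatten (r_g r) ++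
  flatten [seq e_op x | x <- r_o r].

Definition shape_ok (r : raw) : bool :=
  [&& size (r_T r) == ((r_S r).+1 * (r_A r).+1 * (r_S r).+1)%N, size (r_C r) == (r_m r * r_l r)%N, size (r_B r) == r_l r,
   size (r_s r) == (r_m r * r_l r)%N, size (r_k r) == (r_m r * r_l r)%N, size (r_g r) == (r_m r * r_l r)%N,
   all (fun T : seq bool => size T == (r_S r).+1) (r_g r), size (r_o r) == r_l r &
   all (fun o : opc => o.1.1 || (o.2 == rdef)) (r_o r)].

Lemma size_flat_ge A (e : A -> seq bool) (l : seq A) : (forall a, 0 < size (e a)) -> size l <= size (flatten (map e l)).
Proof. by move=> H; elim: l => //= a l IH; rewrite size_cat; have := H a; lia. Qed.

Lemma e_num_gt0 k : 0 < size (e_num k). Proof. by rewrite /e_num size_cat addn1. Qed.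
Lemma e_rat_gt0 x : 0 < size (e_rat x). Proof. by rewrite /e_rat. Qed.
Lemma e_op_gt0 x : 0 < size (e_op x). Proof. by []. Qed.
#[local] Opaque e_num p_num e_int p_int e_rat p_rat e_op p_op.


Lemma p_bitK b r : p_bit ([:: b] ++ r) = (b, r). Proof. by []. Qed.
#[local] Opaque p_list p_bit rng.

Lemma ps1K S A r : ps1 (e_num S ++ e_num A ++ r) = (S, A, r).
Proof. by rewrite /ps1 p_numK p_numK. Qed.

Lemma p_ratsK c l r : size c = size l -> p_list p_rat (c, flatten [seq e_rat x | x <- l] ++ r) = (l, r).
Proof. by move=> sc; apply: (@p_listK _ _ _ (fun=> True)) => // a r' _; exact: p_ratK. Qed.

Lemma p_numsK c l r : size c = size l -> p_list p_num (c, flatten [seq e_num x | x <- l] ++ r) = (l, r).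
Proof. by move=> sc; apply: (@p_listK _ _ _ (fun=> True)) => // a r' _; exact: p_numK. Qed.

Lemma size_rng A (w : seq A) n : n <= size w -> size (rng w n) = n.
Proof. by move=> h; rewrite rngE // size_iota. Qed.

Lemma p_bitsK c (T : seq bool) r : size c = size T -> p_list p_bit (c, T ++ r) = (T, r).
Proof.
move=> sc; have {1}<- : flatten [seq [:: b] | b <- T] = T by elim: (T) => //= b l ->.
by apply: (@p_listK _ _ _ (fun=> True)) => // b r' _; exact: p_bitK.
Qed.

Lemma ps2K w S A T r : size T = (S.+1 * A.+1 * S.+1)%N -> size T <= size w ->
  ps2 w (S, A, flatten [seq e_rat x | x <- T] ++ r) = ((S, A, T), r).
Proof. by move=> sT lT; rewrite /ps2 p_ratsK //= size_rng -?sT. Qed.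

Lemma ps3K x l m n r : ps3 (x, e_num l ++ e_num m ++ e_num n ++ r) = (x, (l, m, n), r).
Proof. by rewrite /ps3 p_numK p_numK p_numK. Qed.

Lemma ps4K w x l m n C B r : size C = (m * l)%N -> size B = l -> size C <= size w -> size B <= size w ->
  ps4 w (x, (l, m, n), flatten [seq e_rat x | x <- C] ++ flatten [seq e_rat x | x <- B] ++ r) =
  (x, (l, m, n), (C, B), r).
Proof.
move=> sC sB lC lB; rewrite /ps4 /=.
rewrite (p_ratsK (l := C)) /=; last by rewrite size_rng -?sC.
by rewrite (p_ratsK (l := B)) /= ?size_rng -?sB.
Qed.

Lemma unflatten k (g : seq (seq bool)) : all (fun t : seq bool => size t == k) g ->
  [seq [seq nth false (flatten g) (e * k + t) | t <- iota 0 k] | e <- iota 0 (size g)] = g.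
Proof.
move=> ag; apply: (@eq_from_nth _ [::]) => [|i]; rewrite size_map size_iota // => ig.
rewrite (nth_map 0) ?size_iota // nth_iota // add0n.
have sk : size (nth [::] g i) = k by apply/eqP; move/allP: ag; apply; exact: mem_nth.
apply: (@eq_from_nth _ false) => [|t]; rewrite size_map size_iota ?sk // => tk.
by rewrite (nth_map 0) ?size_iota // nth_iota // add0n nth_flatten_uniform.
Qed.

Lemma ps5K w S A T l m n CB s k g r : size s = (m * l)%N -> size k = (m * l)%N -> size g = (m * l)%N ->
  all (fun t : seq bool => size t == S.+1) g -> size s <= size w -> S < size w -> size (flatten g) <= size w ->
  ps5 w ((S, A, T), (l, m, n), CB, flatten [seq e_num x | x <- s] ++ flatten [seq e_num x | x <- k] ++ flatten g ++ r) =
  ((S, A, T), (l, m, n), CB, (s, k, g), r).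
Proof.
move=> ss sk sg ag ls lS lg; rewrite /ps5 /=; have sr : size (rng w (m * l)) = (m * l)%N by rewrite size_rng -?ss.
rewrite (p_numsK (l := s)) /= ?sr //.
rewrite (p_numsK (l := k)) /= ?sr //.
have fg := size_flatten_uniform ag; rewrite sg in fg.
rewrite p_bitsK /=; last by rewrite size_rng -fg.
have lm : m * l <= size w by rewrite -ss.
by rewrite (rngE lS) (rngE lm) -sg (unflatten ag).
Qed.

Lemma ps6K w x l m n CB skg o : size o = l -> size o <= size w -> all (fun o : opc => o.1.1 || (o.2 == rdef)) o ->
  ps6 w (x, (l, m, n), CB, skg, flatten [seq e_op x | x <- o]) = (x, (l, m, n), CB, skg, o).
Proof.
move=> so lo /allP ao; rewrite /ps6 /= -[flatten [seq e_op x | x <- o]]cats0.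
rewrite (@p_listK _ p_op e_op (fun o => ~~ o.1.1 -> o.2 = rdef)) //=.
- by move=> a r' h; exact: p_opK.
- move=> i d io; have := ao _ (mem_nth d io); case: (nth d o i).1.1 => //= /eqP.
  by [].
- by rewrite size_rng -?so.
Qed.

Lemma parseK r : shape_ok r -> parse (e_raw r) = r.
Proof.
case/and5P => /eqP sT /eqP sC /eqP sB /eqP ss /and5P [/eqP sk /eqP sg ag /eqP so ao].
have szs : [/\ size (r_T r) <= size (e_raw r), size (r_C r) <= size (e_raw r), size (r_B r) <= size (e_raw r),
    size (r_s r) <= size (e_raw r) & size (r_o r) <= size (e_raw r)].
  have hT : size (r_T r) <= size (flatten [seq e_rat x | x <- r_T r]) by exact: (size_flat_ge _ e_rat_gt0).
  have hC : size (r_C r) <= size (flatten [seq e_rat x | x <- r_C r]) by exact: (size_flat_ge _ e_rat_gt0).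
  have hB : size (r_B r) <= size (flatten [seq e_rat x | x <- r_B r]) by exact: (size_flat_ge _ e_rat_gt0).
  have hs : size (r_s r) <= size (flatten [seq e_num x | x <- r_s r]) by exact: (size_flat_ge _ e_num_gt0).
  have ho : size (r_o r) <= size (flatten [seq e_op x | x <- r_o r]) by exact: (size_flat_ge _ e_op_gt0).
  by rewrite /e_raw !size_cat; clear -hT hC hB hs ho; split; lia.
case: szs => lT lC lB ls lo.
rewrite /parse {5}/e_raw ps1K ps2K // ps3K ps4K //.
rewrite ps5K //; last 2 first.
- by apply: leq_trans lT; rewrite sT -mulnA; exact: leq_pmulr.
- by rewrite /e_raw !size_cat; clear; lia.
rewrite ps6K //; by move: r {sT sC sB ss sk sg ag so ao lT lC lB ls lo} => [[[[[[S A] T] [[l m] n]] [C B]] [[s k] g]] o].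
Qed.

#[export] Hint Resolve fpc_p_list : fpdb.
Lemma fpc_p_rats : fpc (p_list p_rat). Proof. exact: fpc_p_list fpc_p_rat p_rat_size. Qed.
Lemma fpc_p_nums : fpc (p_list p_num). Proof. exact: fpc_p_list fpc_p_num p_num_size. Qed.
Lemma fpc_p_ops : fpc (p_list p_op). Proof. exact: fpc_p_list fpc_p_op p_op_size. Qed.
Lemma fpc_p_bits : fpc (p_list p_bit). Proof. exact: fpc_p_list fpc_p_bit p_bit_size. Qed.
#[export] Hint Resolve fpc_p_rats fpc_p_nums fpc_p_ops fpc_p_bits : fpdb.

Lemma fpc_ps1 : fpc ps1. Proof. by rewrite /ps1; fpa. Qed.
Lemma fpc_ps2 : fpc (fun q : seq bool * (nat * nat * seq bool) => ps2 q.1 q.2).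
Proof. by rewrite /ps2; cbv zeta; fpa. Qed.
Lemma fpc_ps3 : fpc ps3. Proof. by rewrite /ps3; cbv zeta; fpa. Qed.
Lemma fpc_ps4 : fpc (fun q : seq bool * (raw1 * (nat * nat * nat) * seq bool) => ps4 q.1 q.2).
Proof. by rewrite /ps4; cbv zeta; fpa. Qed.

Lemma fpc_ps5 : fpc (fun q : seq bool * (raw1 * (nat * nat * nat) * (seq rt * seq rt) * seq bool) => ps5 q.1 q.2).
Proof. by rewrite /ps5; cbv zeta; fpa. Qed.
Lemma fpc_ps6 : fpc (fun q : seq bool * (raw1 * (nat * nat * nat) * (seq rt * seq rt) *
    (seq nat * seq nat * seq (seq bool)) * seq bool) => ps6 q.1 q.2).
Proof. by rewrite /ps6; fpa. Qed.
#[export] Hint Resolve fpc_ps1 fpc_ps2 fpc_ps3 fpc_ps4 fpc_ps5 fpc_ps6 : fpdb.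
#[local] Opaque ps1 ps2 ps3 ps4 ps5 ps6.
Lemma fpc_parse : fpc parse. Proof. by rewrite /parse; fpa. Qed.
#[local] Transparent ps1 ps2 ps3 ps4 ps5 ps6.
#[export] Hint Resolve fpc_parse : fpdb.

#[local] Transparent e_num e_int e_rat e_op.
Lemma fpc_e_int : fpc e_int. Proof. by rewrite /e_int; apply: fpc_cons; [apply: fpc_sgz; fpa|fpa]. Qed.
#[export] Hint Resolve fpc_e_int : fpdb.
Lemma fpc_e_rat : fpc e_rat. Proof. by rewrite /e_rat; fpa. Qed.
#[export] Hint Resolve fpc_e_rat : fpdb.
Lemma fpc_e_op : fpc e_op. Proof. by rewrite /e_op; fpa. Qed.
#[export] Hint Resolve fpc_e_op : fpdb.
#[local] Opaque e_num e_int e_rat e_op.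
Lemma fpc_e_raw : fpc e_raw. Proof. by rewrite /e_raw; fpa. Qed.
#[export] Hint Resolve fpc_e_raw : fpdb.
#[local] Transparent e_num e_int e_rat e_op.

(** * Euclid's algorithm and the validity of raw data *)

Definition g_step (x : nat * nat) : nat * nat := if x.2 == 0 then x else (x.2, x.1 %% x.2).
(** Two steps at least halve the second component, so twice the code length is enough. *)
Definition gcdf (x : nat * nat) : nat := (iter (size (enc (code x) ++ enc (code x))) g_step x).1.

Lemma g_step_gcd x : gcdn (g_step x).1 (g_step x).2 = gcdn x.1 x.2.
Proof. by rewrite /g_step; case: eqP => //= _; rewrite gcdn_modr gcdnC. Qed.

Lemma g_step2 x : (g_step (g_step x)).2 * 2 <= x.2.
Proof.
case: x => a b; rewrite /g_step /=; case: (eqVneq b 0) => [-> //|b0] /=.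
case: (eqVneq (a %% b) 0) => [-> //|r0] /=.
have h1 : a %% b < b by rewrite ltn_mod lt0n.
have h2 : b %% (a %% b) < a %% b by rewrite ltn_mod lt0n.
have := divn_eq b (a %% b); have : 0 < b %/ (a %% b) by rewrite divn_gt0 ?lt0n // ltnW.
move: (b %% (a %% b)) (b %/ (a %% b)) (a %% b) h1 h2 {b0 r0} => u v r; nia.
Qed.

Lemma gcdfE x : gcdf x = gcdn x.1 x.2.
Proof.
have G m : gcdn (iter m g_step x).1 (iter m g_step x).2 = gcdn x.1 x.2.
  by elim: m => //= m IH; rewrite g_step_gcd.
have Z k y : y.2 < 2 ^ k -> (iter (k * 2) g_step y).2 = 0.
  elim: k y => [|k IH] y; first by rewrite expn0 mul0n /=; lia.
  rewrite mulSn add2n !iterSr => h; apply: IH.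
  by have := g_step2 y; rewrite expnS in h; lia.
have S m y : y.2 = 0 -> iter m g_step y = y by move=> y0; elim: m => //= m ->; rewrite /g_step y0.
rewrite /gcdf size_cat; set k := size _.
have h : (iter (k + k) g_step x).2 = 0.
  have -> : k + k = k * 2 by lia.
  apply: Z; apply: leq_trans (lt_sz x.2) _; rewrite leq_exp2l //.
  by have -> : k = sz x by []; case: x {G k} => a b; rewrite szP /=; lia.
by have := G (k + k); rewrite h gcdn0.
Qed.

Lemma fpc_gcdf : fpc gcdf.
Proof.
apply: fpc_fst; apply: (@fpc_iter_env _ _ _ _ _ _ (fun _ => g_step) (fun x => x)
   (fun x : nat * nat => enc (code x) ++ enc (code x)) (fun n => 16 * n + 20)).
- by rewrite /g_step; fpa.
- by fpa.
- by fpa.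
- by pols.
move=> x j _; have : (iter j g_step x).1 <= maxn x.1 x.2 /\ (iter j g_step x).2 <= maxn x.1 x.2.
  elim: j => [|j [h1 h2]] /=; first by rewrite leq_maxl leq_maxr.
  rewrite {1 3}/g_step; case: ifP => [_|/negbT b0] //=; split=> //.
  by apply: leq_trans h2; rewrite ltnW // ltn_mod lt0n.
have hx : maxn x.1 x.2 < 2 ^ sz x.
  have k1 := lt_sz x.1; have k2 := lt_sz x.2; case: x k1 k2 => a b /= k1 k2.
  rewrite gtn_max; apply/andP; split; [apply: leq_trans k1 _|apply: leq_trans k2 _]; rewrite leq_exp2l // szP; lia.
case: (iter j g_step x) => a b /= [h1 h2]; rewrite szP.
have := sz_nat_leq (leq_ltn_trans h1 hx); have := sz_nat_leq (leq_ltn_trans h2 hx); lia.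
Qed.
#[export] Hint Resolve fpc_gcdf : fpdb.
#[local] Opaque gcdf.

Local Open Scope ring_scope.

(** Codes of rationals are in lowest terms, so a word with an unreduced fraction must be
    rejected. *)
Definition okq (x : rt) : bool := (0 < x.2)%N && (gcdf (`|x.1|%N, x.2) == 1%N).
Definition ok01 (x : rt) : bool := (0 <= x.1) && (x.1 <= Posz x.2).
Definition rowz (r : raw) (s a : nat) : int := sumz [seq r_trs r (s, a, t) | t <- r_sts r].
Definition valid (r : raw) : bool :=
  [&& shape_ok r, all okq (r_T r ++ r_C r ++ r_B r ++ [seq o.2 | o <- r_o r]), all ok01 (r_T r),
   all (fun s => all (fun a => (rowz r s a == Posz (r_D r)) || (rowz r s a == 0)) (r_acts r)) (r_sts r),
   all (fun s => has (fun a => rowz r s a == Posz (r_D r)) (r_acts r)) (r_sts r),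
   all (fun s => s <= r_S r)%N (r_s r), all (fun k => k < r_n r)%N (r_k r),
   (r_n r <= size (r_C r))%N && all (fun k => k \in r_k r) (rng (r_C r) (r_n r)) &
   all (fun o : opc => 0 <= o.2.1) (r_o r)].

Lemma fpc_okq : fpc okq. Proof. by rewrite /okq; fpa. Qed.
Lemma fpc_ok01 : fpc ok01. Proof. by rewrite /ok01; fpa. Qed.
#[export] Hint Resolve fpc_okq fpc_ok01 : fpdb.
Lemma fpc_rowz : fpc (fun q : raw * nat * nat => rowz q.1.1 q.1.2 q.2). Proof. by rewrite /rowz; fpa. Qed.
Lemma fpc_shape_ok : fpc shape_ok. Proof. by rewrite /shape_ok; fpa. Qed.
#[export] Hint Resolve fpc_rowz fpc_shape_ok : fpdb.
#[local] Opaque shape_ok rowz okq ok01.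
Lemma fpc_valid : fpc valid. Proof. by rewrite /valid; fpa. Qed.
#[export] Hint Resolve fpc_valid : fpdb.
#[local] Transparent shape_ok rowz okq ok01.

Definition qv (x : rt) : rat := x.1%:~R / x.2%:R.

Lemma okqK x : okq x -> rq (qv x) = x.
Proof.
rewrite /okq gcdfE => /andP [x0 /eqP cp]; case: x x0 cp => z d /= d0 cp; rewrite /rq /qv /=.
have c : coprime `|z| `|Posz d| by rewrite /coprime /= cp.
rewrite -[d%:R]/((Posz d)%:~R) coprimeq_num // coprimeq_den //.
have dn : Posz d != 0 by rewrite eqz_nat -lt0n.
by rewrite (negbTE dn) gtr0_sg ?mul1r // ltz_nat.
Qed.

Lemma okq_rq q : okq (rq q).
Proof.
rewrite /okq gcdfE rq2_gt0 /=; have := coprime_num_den q; rewrite /coprime => /eqP ->.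
by [].
Qed.

Lemma fam2_nth A B (d : A) (h : A -> B) m n (L : seq A) : size L = (m * n)%N ->
  fam2 (fun (i : 'I_m) (j : 'I_n) => h (nth d L (i * n + j))) = map h L.
Proof.
move=> sL; have E k : k = size (fam2 (fun (i : 'I_m) (j : 'I_n) => h (nth d L (i * n + j)))) -> k = (m * n)%N.
  by rewrite size_fam2.
apply: (@eq_from_nth _ (h d)) => [|e]; first by rewrite size_fam2 size_map sL.
rewrite size_fam2 => em; have n0 : (0 < n)%N by move: em; case: (n) => //; rewrite muln0.
have e1 : (e %/ n < m)%N by rewrite ltn_divLR.
have e2 : (e %% n < n)%N by rewrite ltn_mod.
rewrite {1}(_ : e = Ordinal e1 * n + Ordinal e2)%N; last by rewrite /= -divn_eq.
by rewrite nth_fam2 /= -divn_eq (nth_map d) // sL.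
Qed.

Lemma fam1_nth A B (d : A) (h : A -> B) n (L : seq A) : size L = n ->
  fam1 (fun i : 'I_n => h (nth d L i)) = map h L.
Proof.
move=> sL; apply: (@eq_from_nth _ (h d)) => [|e]; first by rewrite size_fam1 size_map.
rewrite size_fam1 => en; have := @nth_fam1 _ (h d) _ (fun i : 'I_n => h (nth d L i)) (Ordinal en).
by move=> ->; rewrite (nth_map d) // sL.
Qed.

Lemma map_all_id A (h : A -> A) (L : seq A) : (forall i d, (i < size L)%N -> h (nth d L i) = nth d L i) -> map h L = L.
Proof.
by elim: L => //= a L IH H; rewrite (H 0%N a isT) IH // => i d il; exact: (H i.+1 d).
Qed.

End Parsing.
Import Parsing.

(** * Words, raw data and instances correspond *)

Module Encodings.

Local Open Scope ring_scope.

Lemma flat_flat A (e : A -> seq bool) (ss : seq (seq A)) :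
  flatten [seq e x | x <- flatten ss] = flatten [seq flatten [seq e x | x <- t] | t <- ss].
Proof. by elim: ss => //= t ss <-; rewrite map_cat flatten_cat. Qed.

Lemma enc_fam2 A m n (f : 'I_m -> 'I_n -> A) (e : A -> seq bool) :
  enc_family2 (fun i j => e (f i j)) = flatten [seq e x | x <- fam2 f].
Proof.
rewrite /enc_family2 /enc_family /fam2 flat_flat /fam1 -map_comp; congr flatten.
by apply: eq_map => i /=; rewrite -map_comp.
Qed.

Lemma enc_fam1 A n (f : 'I_n -> A) (e : A -> seq bool) :
  enc_family (fun i => e (f i)) = flatten [seq e x | x <- fam1 f].
Proof. by rewrite /enc_family /fam1 -map_comp. Qed.

Lemma eq_enc_family n (f g : 'I_n -> seq bool) : (forall i, f i = g i) -> enc_family f = enc_family g.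
Proof. by move=> e; rewrite /enc_family; congr flatten; exact: eq_map. Qed.

Lemma eq_enc_family2 m n (f g : 'I_m -> 'I_n -> seq bool) : (forall i j, f i j = g i j) -> enc_family2 f = enc_family2 g.
Proof. by move=> e; apply: eq_enc_family => i; apply: eq_enc_family => j. Qed.

Lemma e_ratE q : enc_rat binary_code q = e_rat (rq q).
Proof. by rewrite /enc_rat /enc_int !e_numE. Qed.

Lemma e_opE o : enc_comparison binary_code o = e_op (rop o).
Proof. by case: o => [| |e|e] //=; rewrite e_ratE. Qed.

#[local] Opaque e_num.

Lemma enc_instanceE I : enc_instance binary_code I = e_raw (raw_of I).
Proof.
rewrite /enc_instance /enc_mdp -catA -catA /e_raw !e_numE; congr (_ ++ (_ ++ (_ ++ (_ ++ (_ ++ (_ ++ _)))))).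
  rewrite flat_flat -(enc_fam2 _ (fun t => flatten [seq e_rat x | x <- t])).
  by apply: eq_enc_family2 => s a; rewrite -enc_fam1; apply: eq_enc_family => t; exact: e_ratE.
congr (_ ++ (_ ++ (_ ++ (_ ++ (_ ++ _))))).
- by rewrite -enc_fam2; apply: eq_enc_family2 => i j; exact: e_ratE.
- by rewrite -enc_fam1; apply: eq_enc_family => j; exact: e_ratE.
- by rewrite -enc_fam2; apply: eq_enc_family2 => i j; exact: e_numE.
- by rewrite -enc_fam2; apply: eq_enc_family2 => i j; exact: e_numE.
- by rewrite -[r_g _]map_id -enc_fam2.
- by rewrite -enc_fam1; apply: eq_enc_family => j; exact: e_opE.
Qed.

Lemma shape_raw_of I : shape_ok (raw_of I).
Proof.
apply/and5P; split; rewrite ?size_rT /r_S /r_A /r_C /r_B /r_s /r_l /r_m /= ?size_fam2 ?size_fam1 //.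
apply/and5P; split; rewrite /r_k /r_g /r_o /= ?size_fam2 ?size_fam1 //.
- apply/allP => T /flattenP [u /mapP [i _ ->] /mapP [j _ ->]].
  by rewrite /enc_set size_map size_enum_ord.
- by apply/allP => x /mapP [j _ ->]; case: (op j).
Qed.

Section ValidRaw.
Variables (R : realType) (I : instance).
Local Notation r := (raw_of I).

Lemma rowzE (s : 'I_(max_state I).+1) (a : 'I_(max_action I).+1) :
  (rowz r s a)%:~R = (r_D r)%:R * ratr (\sum_t trans (model I) s a t) :> R.
Proof.
rewrite /rowz /sumz big_map stsE.
have -> : iota 0 (max_state I).+1 = index_iota 0 (max_state I).+1 by rewrite /index_iota subn0.
rewrite big_mkord rmorph_sum /= rmorph_sum mulr_sumr; apply: eq_bigr => t _.
by rewrite /r_trs /= trE sclE ?okx_T // rv_rq.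
Qed.

Lemma rowz1 s a : \sum_t trans (model I) s a t = 1 -> rowz r (nat_of_ord s) (nat_of_ord a) == Posz (r_D r).
Proof. by move=> h; apply/eqP; apply: (@intr_inj R); rewrite rowzE h rmorph1 mulr1. Qed.

Lemma rowz0 s a : \sum_t trans (model I) s a t = 0 -> rowz r (nat_of_ord s) (nat_of_ord a) == 0.
Proof. by move=> h; apply/eqP; apply: (@intr_inj R); rewrite rowzE h rmorph0 mulr0. Qed.

Lemma valid_raw_of : valid r.
Proof.
apply/and5P; split; first exact: shape_raw_of.
- apply/allP => x; rewrite !mem_cat => /or4P [] xm.
  + move: xm; rewrite /r_T /= /fam2 => /flattenP [y /flattenP [z /mapP [s _ ->] /mapP [a _ ->]] /mapP [t _ ->]].
    exact: okq_rq.
  + by move: xm; rewrite /r_C /= /fam2 => /flattenP [z /mapP [s _ ->] /mapP [a _ ->]]; exact: okq_rq.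
  + by move: xm => /mapP [j _ ->]; exact: okq_rq.
  + move: xm => /mapP [y /mapP [j _ ->] ->]; case: (op j) => [| |e|e]; rewrite /= ?okq_rq //.
- apply/allP => x; rewrite /r_T /= /fam2 => /flattenP [y /flattenP [z /mapP [s _ ->] /mapP [a _ ->]] /mapP [t _ ->]].
  have /andP [h0 h1] := trans_01 (model I) s a t; rewrite /ok01 /= numq_ge0 h0 /=.
  have d0 := denq_gt0 (trans (model I) s a t); rewrite gez0_abs ?(ltW d0) //.
  move: h1; rewrite -{1}[trans _ _ _ _]divq_num_den ler_pdivrMr ?ltr0z // mul1r ler_int.
  by [].
- apply/allP => s; rewrite stsE mem_iota add0n => /andP [_ sN]; apply/allP => a; rewrite actsE mem_iota add0n => /andP [_ aA].
  have [h|h] := trans_sum (model I) (Ordinal sN) (Ordinal aA).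
    by rewrite (rowz1 h).
  by rewrite (rowz0 h) orbT.
apply/and5P; split.
- apply/allP => s; rewrite stsE mem_iota add0n => /andP [_ sN]; have [a h] := trans_total (model I) (Ordinal sN).
  apply/hasP; exists (val a); first by rewrite actsE mem_iota add0n ltn_ord.
  exact: (rowz1 h).
- by apply/allP => s /flattenP [z /mapP [i _ ->] /mapP [j _ ->]]; rewrite -ltnS ltn_ord.
- by apply/allP => s /flattenP [z /mapP [i _ ->] /mapP [j _ ->]]; exact: ltn_ord.
- have nC : (r_n r <= size (r_C r))%N by rewrite /r_n /r_C /= size_fam2 num_scheds_le.
  rewrite nC rngE //; apply/allP => k; rewrite mem_iota add0n => /andP [_ kn].
  have [i [j ij]] := sched_onto (Ordinal kn); apply/flattenP; exists (fam1 (fun j => val (sched i j))).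
    by apply/mapP; exists i; rewrite ?mem_enum.
  by apply/mapP; exists j; rewrite ?mem_enum //= ij.
- by apply/allP => x /mapP [j _ ->]; have := op_ge0 j; case: (op j) => [| |e|e] //=; rewrite numq_ge0.
Qed.

End ValidRaw.

Definition cop (o : opc) : comparison :=
  if o.1.1 then if o.1.2 then CmpNapprox (qv o.2) else CmpApprox (qv o.2)
  else if o.1.2 then CmpGe else CmpGt.

Lemma qv_ge0 x : 0 <= x.1 -> 0 <= qv x.
Proof. by move=> h; rewrite /qv divr_ge0 ?ler0n // ler0z. Qed.

(** Each check in [valid] or in the shape supplies a proof field of an instance or a range bound for
    an index; reducedness of the fractions makes the way back exact. *)
Lemma valid_instance r : valid r -> exists I : instance, raw_of I = r.
Proof.
case/and5P => sh /allP oq /allP o01 /allP rows /and5P [/allP tot /allP ss /allP sk /andP [nC /allP onto] /allP oge].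
case/and5P: (sh) => /eqP sT /eqP sC /eqP sB /eqP s_s /and5P [/eqP s_k /eqP s_g /allP ag /eqP so /allP ao].
set N := (r_S r).+1; set A := (r_A r).+1.
pose tr (s : 'I_N) (a : 'I_A) (t : 'I_N) : rat := qv (r_tr r s a t).
have NT : (N <= size (r_T r))%N by rewrite sT -mulnA leq_pmulr.
have AT : (A <= size (r_T r))%N by rewrite sT mulnAC leq_pmull.
have stsE : r_sts r = iota 0 N by rewrite /r_sts rngE.
have actsE : r_acts r = iota 0 A by rewrite /r_acts rngE.
have trT (s : 'I_N) (a : 'I_A) (t : 'I_N) : r_tr r s a t \in r_T r.
  apply: mem_nth; rewrite sT; have := ltn_ord s; have := ltn_ord a; have := ltn_ord t; rewrite /N /A.
  move: (nat_of_ord s) (nat_of_ord a) (nat_of_ord t) => x y z; clear; move: (r_S r) (r_A r) => n k; nia.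
have D0 : (0 < r_D r)%N.
  rewrite /r_D /prodl big_map big_seq; apply: prodn_cond_gt0 => x /oq /andP [h _]; exact: h.
have rowE (s : 'I_N) (a : 'I_A) : (rowz r s a)%:~R = (r_D r)%:R * \sum_t tr s a t :> rat.
  rewrite /rowz /sumz big_map stsE.
  have -> : iota 0 N = index_iota 0 N by rewrite /index_iota subn0.
  rewrite big_mkord rmorph_sum mulr_sumr; apply: eq_bigr => t _ /=; rewrite /r_trs /tr /scl /=.
  have xm := trT s a t; have xm' : r_tr r s a t \in r_T r ++ r_C r ++ r_B r ++ [seq o.2 | o <- r_o r] by rewrite mem_cat xm.
  have xD : ((r_tr r s a t).2 %| r_D r)%N.
    by rewrite /r_D /prodl big_map (perm_big _ (perm_to_rem xm')) big_cons; exact: dvdn_mulr.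
  have /andP [x0 _] := oq _ xm'; move: (r_tr r s a t) xD x0 => x xD x0.
  rewrite rmorphM /= /qv -[in RHS](divnK xD) natrM.
  have nz : x.2%:R != 0 :> rat by rewrite pnatr_eq0 -lt0n.
  rewrite -!pmulrn; by field.
have DR : (r_D r)%:R != 0 :> rat by rewrite pnatr_eq0 -lt0n.
have one (s : 'I_N) (a : 'I_A) : rowz r s a == Posz (r_D r) -> \sum_t tr s a t = 1.
  by move=> /eqP h; apply: (mulfI DR); rewrite -rowE h mulr1.
have zero (s : 'I_N) (a : 'I_A) : rowz r s a == 0 -> \sum_t tr s a t = 0.
  by move=> /eqP h; apply: (mulfI DR); rewrite -rowE h mulr0.
have t01 s a t : 0 <= tr s a t <= 1.
  have /andP [h0 h1] := o01 _ (trT s a t); have xm : r_tr r s a t \in r_T r ++ r_C r ++ r_B r ++ [seq o.2 | o <- r_o r] by rewrite mem_cat trT.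
  have /andP [d0 _] := oq _ xm.
  rewrite /tr qv_ge0 //= /qv ler_pdivrMr ?ltr0n // mul1r.
  by move: h1; rewrite -(ler_int rat).
have tsum s a : \sum_t tr s a t = 1 \/ \sum_t tr s a t = 0.
  have := rows (val s); rewrite stsE mem_iota add0n ltn_ord => /(_ isT) /allP /(_ (val a)).
  by rewrite actsE mem_iota add0n ltn_ord => /(_ isT) /orP [/one|/zero]; [left|right].
have ttot s : exists a, \sum_t tr s a t = 1.
  have := tot (val s); rewrite stsE mem_iota add0n ltn_ord => /(_ isT) /hasP [a].
  by rewrite actsE mem_iota add0n => /andP [_ aA] h; exists (Ordinal aA); exact: one.
pose M : mdp (r_S r) (r_A r) := @MDP (r_S r) (r_A r) tr t01 tsum ttot.
have idx (m l : nat) (i : 'I_m) (j : 'I_l) : (i * l + j < m * l)%N.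
  have := ltn_ord i; have := ltn_ord j; move: (nat_of_ord i) (nat_of_ord j) => y z; nia.
pose ix (i : 'I_(r_m r)) (j : 'I_(r_l r)) := (i * r_l r + j)%N.
have kP i j : (nth 0%N (r_k r) (ix i j) < r_n r)%N by apply: sk; apply: mem_nth; rewrite s_k idx.
have sP i j : (nth 0%N (r_s r) (ix i j) < N)%N by rewrite ltnS; apply: ss; apply: mem_nth; rewrite s_s idx.
pose sch i j : 'I_(r_n r) := Ordinal (kP i j).
have sonto k : exists i j, sch i j = k.
  have := onto (val k); rewrite rngE // mem_iota add0n ltn_ord => /(_ isT) /(nthP 0%N) [e]; rewrite s_k => em ek.
  have l0 : (0 < r_l r)%N by move: em; case: (r_l r) => //; rewrite muln0.
  have e1 : (e %/ r_l r < r_m r)%N by rewrite ltn_divLR.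
  have e2 : (e %% r_l r < r_l r)%N by rewrite ltn_mod.
  by exists (Ordinal e1), (Ordinal e2); apply: val_inj; rewrite /= /ix /= -divn_eq.
pose tg i j : {set 'I_N} := [set t : 'I_N | nth false (nth [::] (r_g r) (ix i j)) t]%SET.
have oge' j : tolerance_ge0 (cop (nth odef (r_o r) j)).
  have [jo|jo] := ltnP j (size (r_o r)); last by rewrite nth_default.
  have := oge _ (mem_nth odef jo); case: (nth odef (r_o r) j) => [[[] []] x] //= h; exact: qv_ge0.
pose I := @Instance (r_S r) (r_A r) M (r_l r) (r_m r) (r_n r) (fun i j => qv (nth rdef (r_C r) (ix i j)))
  (fun j => qv (nth rdef (r_B r) j)) (fun i j => Ordinal (sP i j)) sch sonto tg (fun j => cop (nth odef (r_o r) j)) (fun j => oge' j).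
exists I; rewrite /raw_of /=.
have ix2 := idx (r_m r) (r_l r).
have qid (L : seq rt) : {subset L <= r_T r ++ r_C r ++ r_B r ++ [seq o.2 | o <- r_o r]} -> map (fun x => rq (qv x)) L = L.
  by move=> sub; apply: map_all_id => i d il; apply: okqK; apply: oq; apply: sub; exact: mem_nth.
have -> : flatten (fam2 (fun s a => fam1 (fun t => rq (tr s a t)))) = r_T r.
  rewrite -[RHS](qid (r_T r)); last by move=> x xm; rewrite mem_cat xm.
  apply: (@eq_from_nth _ (rq (qv rdef))) => [|e].
    rewrite (@size_flatten_uniform _ N) ?size_fam2 ?size_map ?sT //.
    by apply/allP => x /flattenP [y /mapP [s _ ->] /mapP [a _ ->]]; rewrite size_fam1.
  rewrite (@size_flatten_uniform _ N) ?size_fam2; last first.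
    by apply/allP => x /flattenP [y /mapP [s _ ->] /mapP [a _ ->]]; rewrite size_fam1.
  move=> em; have e1 : (e %% N < N)%N by rewrite ltn_mod.
  have e2 : (e %/ N %% A < A)%N by rewrite ltn_mod.
  have e3 : (e %/ N %/ A < N)%N by rewrite ltn_divLR // ltn_divLR // mulnAC in em *; rewrite // mulnAC.
  have eE : e = ((e %/ N %/ A * A + e %/ N %% A) * N + e %% N)%N by rewrite -divn_eq -divn_eq.
  rewrite {1}eE nth_flatten_uniform //; last first.
    by apply/allP => x /flattenP [y /mapP [s _ ->] /mapP [a _ ->]]; rewrite size_fam1.
  have := @nth_fam2 _ [::] N A (fun s a => fam1 (fun t => rq (tr s a t))) (Ordinal e3) (Ordinal e2) => /= ->.
  have := @nth_fam1 _ (rq (qv rdef)) N (fun t => rq (tr (Ordinal e3) (Ordinal e2) t)) (Ordinal e1) => /= ->.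
  by rewrite (nth_map rdef) ?sT // /tr /r_tr /= -eE.
have -> : fam2 (fun i j => rq (qv (nth rdef (r_C r) (ix i j)))) = r_C r.
  rewrite (@fam2_nth _ _ rdef (fun x => rq (qv x))) //; apply: qid => x xm; by rewrite !mem_cat xm orbT.
have -> : fam1 (fun j : 'I_(r_l r) => rq (qv (nth rdef (r_B r) j))) = r_B r.
  rewrite (@fam1_nth _ _ rdef (fun x => rq (qv x))) //; apply: qid => x xm; by rewrite !mem_cat xm !orbT.
have -> : fam2 (fun i j => nth 0%N (r_s r) (ix i j)) = r_s r by rewrite (@fam2_nth _ _ 0%N id) // map_id.
have -> : fam2 (fun i j => nth 0%N (r_k r) (ix i j)) = r_k r by rewrite (@fam2_nth _ _ 0%N id) // map_id.
have -> : fam2 (fun i j => enc_set (tg i j)) = r_g r.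
  have -> : fam2 (fun i j => enc_set (tg i j)) = fam2 (fun i j => nth [::] (r_g r) (ix i j)).
    congr flatten; apply: eq_map => i; apply: eq_map => j.
    have sz1 : size (nth [::] (r_g r) (ix i j)) = N by apply/eqP/ag/mem_nth; rewrite s_g ix2.
    apply: (@eq_from_nth _ false) => [|t]; first by rewrite /enc_set size_map size_enum_ord sz1.
    rewrite /enc_set size_map size_enum_ord => tN.
    by have := nth_enc_set (tg i j) (Ordinal tN) => /= ->; rewrite inE.
  by rewrite (@fam2_nth _ _ [::] id) // map_id.
have -> : fam1 (fun j : 'I_(r_l r) => rop (cop (nth odef (r_o r) j))) = r_o r.
  rewrite (@fam1_nth _ _ odef (fun x => rop (cop x))) //; apply: map_all_id => i d il.
  have h1 := ao _ (mem_nth d il); have h2 : okq (nth d (r_o r) i).2.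
    by apply: oq; rewrite !mem_cat; do 3 (apply/orP; right); apply/mapP; exists (nth d (r_o r) i) => //; exact: mem_nth.
  by case: (nth d (r_o r) i) h1 h2 => [[[] []] x] //= => [_ h2|_ h2|/eqP -> //|/eqP -> //]; rewrite okqK.
by case: r {sh oq o01 rows tot ss sk nC onto oge sT sC sB s_s s_k s_g ag so ao N A tr NT AT stsE actsE trT D0 rowE DR one zero t01 tsum ttot M ix kP sP sch sonto tg oge' I ix2 qid} => [[[[[[S A] T] [[l m] n]] [C B]] [[s k] g]] o].
Qed.

End Encodings.
Import Encodings.

(** * Membership in NP and in PTIME *)

Module Membership.

Lemma fpc_PTIME (d : seq bool -> bool) (L : language) : fpc d -> (forall w, d w <-> L w) -> PTIME L.
Proof.
move=> hd H; apply: (@fpr_PTIME (fun w => code (d w))) => // w; rewrite -H.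
by rewrite /code /=; case: (d w).
Qed.

Definition uq (l : seq (seq bool)) := foldl (fun acc x => if x \in acc then acc else x :: acc) [::] l.

Lemma uqP l : uniq (uq l) /\ uq l =i l.
Proof.
rewrite /uq; have E acc : uniq acc -> let u := foldl (fun acc x => if x \in acc then acc else x :: acc) acc l in
    uniq u /\ u =i acc ++ l.
  elim: l acc => [|x l IH] acc ua /=; first by rewrite cats0.
  case: ifP => xa.
    have [h1 h2] := IH acc ua; split=> // y; rewrite h2 !mem_cat in_cons.
    by case: eqP => [->|]; rewrite ?xa ?orbT.
  have [|h1 h2] := IH (x :: acc); first by rewrite /= xa.
  by split=> // y; rewrite h2 !mem_cat !in_cons orbCA orbA.
by have [h1 h2] := E [::] isT.
Qed.

Lemma fpc_uq : fpc uq.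
Proof.
apply: (fpc_foldl (f := fun _ (acc : seq (seq bool)) x => if x \in acc then acc else x :: acc)
  (s := fun _ => [::]) (l := fun l => l) (p := fun n => n * (n + 1) + 1)).
- by fpa.
- by fpa.
- by fpa.
- by pols.
move=> l j jl; rewrite -/(uq (take j l)); have [uu um] := uqP (take j l).
have ss : size (uq (take j l)) <= size l.
  apply: leq_trans (uniq_leq_size uu _) (_ : size (take j l) <= _); first by move=> x; rewrite um.
  by rewrite size_take_min geq_minr.
pose proof (size_sz l).
apply: leq_trans (@sz_seq_bound _ _ _ (sz l) _) _.
  move=> i iu d; apply: ltnW; apply: mem_sz.
  have : nth d (uq (take j l)) i \in take j l by rewrite -um mem_nth.
  exact: mem_take.
by rewrite leq_add2r addn1 leq_mul2r (leq_trans ss (ltnW H)) orbT.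
Qed.
#[export] Hint Resolve fpc_uq : fpdb.

Lemma enc_set_inj k : injective (@enc_set k).
Proof. by move=> A B e; apply/setP => i; rewrite -!nth_enc_set e. Qed.

Lemma num_targetsE I : num_targets I = size (uq (r_g (raw_of I))).
Proof.
have [uu um] := uqP (r_g (raw_of I)).
pose Tset := [set target i j | i : 'I_(num_terms I), j : 'I_(num_preds I)]%SET.
rewrite /num_targets -/Tset cardE -(size_map (@enc_set _)); apply: perm_size; apply: uniq_perm => //.
  by rewrite (map_inj_uniq (@enc_set_inj _)) enum_uniq.
move=> x; rewrite um; apply/mapP/flattenP => [[T]|[u /mapP [i _ ->] /mapP [j _ ->]]].
  rewrite mem_enum => /imset2P [i j _ _ ->] ->; exists (fam1 (fun j => enc_set (target i j))).
    by apply/mapP; exists i; rewrite ?mem_enum.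
  by apply/mapP; exists j; rewrite ?mem_enum.
by exists (target i j) => //; rewrite mem_enum; apply/imset2P; exists i j.
Qed.

Definition absb (r : raw) : bool := all (fun e => all (fun t => ~~ nth false (nth [::] (r_g r) e) t ||
  all (fun a => ~~ r_en r t a || (r_trs r (t, a, t) == Posz (r_D r))) (r_acts r)) (r_sts r)) (idx (r_g r)).
Definition nonap (r : raw) : bool := all (fun o : opc => ~~ (is_nap o && ~~ (o.2.1 <= 0)%R)) (r_o r).

#[local] Opaque r_en r_trs.
Lemma fpc_absb : fpc absb. Proof. by rewrite /absb; fpa. Qed.
Lemma fpc_nonap : fpc nonap. Proof. by rewrite /nonap; fpa. Qed.
#[export] Hint Resolve fpc_absb fpc_nonap : fpdb.
#[local] Transparent r_en r_trs.

Lemma absbP (R : realType) I : absorbing_targets I <-> absb (raw_of I).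
Proof.
have DR : ((r_D (raw_of I))%:R != 0 :> R)%R by rewrite pnatr_eq0 -lt0n D_gt0.
have trsE (s : 'I_(max_state I).+1) (a : 'I_(max_action I).+1) :
    r_trs (raw_of I) (nat_of_ord s, nat_of_ord a, nat_of_ord s) == Posz (r_D (raw_of I)) <-> trans (model I) s a s = 1%R.
  have E : ((r_trs (raw_of I) (nat_of_ord s, nat_of_ord a, nat_of_ord s))%:~R = (r_D (raw_of I))%:R * ratr (trans (model I) s a s) :> R)%R.
    by rewrite /r_trs /= trE sclE ?okx_T // rv_rq.
  split=> [/eqP h|h].
    have := E; rewrite h => /esym /eqP; rewrite -[X in _ == X]mulr1 (inj_eq (mulfI DR)) => /eqP.
    by rewrite -[X in _ = X](rmorph1 (ratr : rat -> R)) => /fmorph_inj.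
  by apply/eqP; apply: (@intr_inj R); rewrite E h rmorph1 mulr1.
have gE : r_g (raw_of I) = fam2 (fun i j => enc_set (@target I i j)) by [].
rewrite /absb stsE actsE gE /idx size_fam2; split=> [ab|/allP ab i j s sT a en].
  apply/allP => e; rewrite mem_iota add0n => /andP [_ em].
  have l0 : 0 < num_preds I by move: em; case: (num_preds I) => //; rewrite muln0.
  have e1 : e %/ num_preds I < num_terms I by rewrite ltn_divLR.
  have e2 : e %% num_preds I < num_preds I by rewrite ltn_mod.
  have -> : nth [::] (fam2 (fun i j => enc_set (@target I i j))) e = enc_set (target (Ordinal e1) (Ordinal e2)).
    have eE : e = Ordinal e1 * num_preds I + Ordinal e2 by rewrite /= -divn_eq.
    by rewrite [in LHS]eE nth_fam2.
  apply/allP => t; rewrite mem_iota add0n => /andP [_ tN].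
  have -> : nth false (enc_set (target (Ordinal e1) (Ordinal e2))) t = (Ordinal tN \in target (Ordinal e1) (Ordinal e2)).
    exact: (nth_enc_set _ (Ordinal tN)).
  case: (boolP (_ \in _)) => // tT; rewrite orFb; apply/allP => a; rewrite mem_iota add0n => /andP [_ aA].
  apply/orP; case: (boolP (r_en (raw_of I) t a)) => en; [right|by left].
  by apply/(trsE (Ordinal tN) (Ordinal aA)); apply: (ab _ _ _ tT); apply/(enE R).
have := ab (i * num_preds I + j); rewrite mem_iota add0n nth_fam2.
have -> : (0 <= i * num_preds I + j < num_terms I * num_preds I)%N.
  by have := ltn_ord i; have := ltn_ord j; move: (nat_of_ord i) (nat_of_ord j) => y z; nia.
move=> /(_ isT) /allP /(_ (nat_of_ord s)); rewrite mem_iota add0n ltn_ord nth_enc_set sT => /(_ isT); rewrite orFb => /allP /(_ (nat_of_ord a)).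
rewrite mem_iota add0n ltn_ord => /(_ isT) /orP [/negP|/trsE //].
by case; apply/(enE R).
Qed.

Lemma nonapP I : num_napprox I = 0 <-> nonap (raw_of I).
Proof.
rewrite /num_napprox /nonap; split=> [/eqP|/allP h].
  rewrite cards_eq0 => /eqP /setP h; apply/allP => o /mapP [j _ ->]; have := h j; rewrite !inE.
  case: (op j) => [| |e|e] //= /negbT; rewrite /is_nap /= -leNgt => e0.
  by rewrite negbK numq_le0.
apply/eqP; rewrite cards_eq0; apply/eqP/setP => j; rewrite !inE.
have := h (rop (op j)) (map_f _ (mem_enum _ j)); case: (op j) => [| |e|e] //=.
by rewrite /is_nap /= negbK numq_le0 leNgt => /negbTE.
Qed.

Lemma num_preds_le I : num_preds I <= size (enc_instance binary_code I).
Proof.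
have h : size (r_B (raw_of I)) <= size (flatten [seq e_rat x | x <- r_B (raw_of I)]) by exact: (size_flat_ge _ e_rat_gt0).
by rewrite enc_instanceE /e_raw !size_cat; move: h; rewrite {1}/r_B /= size_fam1; lia.
Qed.

Section Membership.
Variables (R : realType) (P : instance -> Prop) (pb : raw -> bool).
Hypotheses (pbP : forall I, P I <-> pb (raw_of I)) (fpb : fpc pb).

Lemma parse_enc I : parse (enc_instance binary_code I) = raw_of I.
Proof. by rewrite enc_instanceE parseK // shape_raw_of. Qed.

Lemma parse_valid w : e_raw (parse w) == w -> valid (parse w) -> pb (parse w) ->
  exists I, [/\ w = enc_instance binary_code I, P I & raw_of I = parse w].
Proof.
move=> /eqP we /valid_instance [I IE] pw; exists I; split=> //; first by rewrite enc_instanceE IE we.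
by apply/pbP; rewrite IE.
Qed.

Lemma PTIME_ConjRelReach (d : raw -> bool) : fpc d ->
  (forall I, P I -> satisfiable R I <-> d (raw_of I)) -> PTIME (ConjRelReach R P binary_code).
Proof.
move=> fd dP; apply: (@fpc_PTIME (fun w => [&& e_raw (parse w) == w, valid (parse w), pb (parse w) & d (parse w)])).
  by fpa.
move=> w; split=> [/and4P [we vw pw dw]|[I [-> PI sI]]].
  have [I [wI PI IE]] := parse_valid we vw pw; exists I; split=> //.
  by apply/(dP I PI); rewrite IE.
rewrite parse_enc -enc_instanceE eqxx (valid_raw_of R) /=; apply/andP; split; first exact/pbP.
exact/(dP I PI).
Qed.

Definition verify (c : nat) (q : seq bool * seq bool) : bool :=
  [&& e_raw (parse q.1) == q.1, valid (parse q.1), pb (parse q.1) & dec_np c (parse q.1, q.2)].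

Lemma fpc_verify c : fpc (verify c).
Proof.
apply: fpc_andb; first by fpa.
apply: fpc_andb; first by fpa.
apply: fpc_andb; first by fpa.
by apply: (fpc_comp (f := fun q : seq bool * seq bool => (parse q.1, q.2)) _ (fpc_dec_np c)); fpa.
Qed.

Lemma verifyE c w u : verify c (w, u) =
  [&& e_raw (parse w) == w, valid (parse w), pb (parse w) & dec_np c (parse w, u)].
Proof. by []. Qed.

#[local] Opaque verify.

Lemma NP_ConjRelReach c : 0 < c -> (forall I, P I -> adequate I c) -> NP (ConjRelReach R P binary_code).
Proof.
move=> c0 ad.
(* Since [unpair] is total, words that are not pair codes are rejected by pairing again. *)
pose dv (x : seq bool) := (pair_code (unpair x).1 (unpair x).2 == x) && verify c (unpair x).
exists (fun x => dv x), 1; split.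
  apply: (@fpc_PTIME dv) => //; apply: fpc_andb; first by rewrite /pair_code; fpa.
  exact: (fpc_comp fpc_unpair (fpc_verify c)).
have pairK w u : unpair (pair_code w u) = (w, u) by exact: unpairK.
have dvE w u : dv (pair_code w u) = verify c (w, u) by rewrite /dv pairK eqxx.
move=> w; split=> [[I [wE PI sI]]|[u _]].
  have [h _] := dec_npP R c0 (ad I PI); have [u su du] := h sI; exists u.
    rewrite su wE /poly_bound expn1; apply: leq_trans (num_preds_le I) (leq_addr _ _).
  rewrite dvE verifyE wE parse_enc -enc_instanceE eqxx (valid_raw_of R) du andbT andTb.
  exact/pbP.
rewrite dvE verifyE => /and4P [we vw pw du].
have [I [wI PI IE]] := parse_valid we vw pw; exists I; split=> //.
by have [_ h] := dec_npP R c0 (ad I PI); apply: (h u); rewrite IE.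
Qed.

End Membership.

Definition ptg c (r : raw) : bool := size (uq (r_g r)) <= c.
Definition pown (r : raw) : bool := r_n r == r_m r * r_l r.
Lemma fpc_ptg c : fpc (ptg c). Proof. by rewrite /ptg; fpa. Qed.
Lemma fpc_pown : fpc pown. Proof. by rewrite /pown; fpa. Qed.

Lemma NP_targets R c : 0 < c -> NP (ConjRelReach R (fun I => num_targets I <= c) binary_code).
Proof.
move=> c0; apply: (@NP_ConjRelReach R _ (ptg c) _ (fpc_ptg c) c c0) => [I|I h].
  by rewrite num_targetsE.
exact: adequate_targets.
Qed.

Lemma PTIME_targets R c : 0 < c ->
  PTIME (ConjRelReach R (fun I => num_targets I <= c /\ num_napprox I = 0) binary_code).
Proof.
move=> c0; pose proof (fpc_ptg c).
apply: (@PTIME_ConjRelReach R _ (fun r => ptg c r && nonap r) _ _ (dec_ab c) (fpc_dec_ab c)).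
- move=> I; rewrite num_targetsE; split=> [[h1 /nonapP h2]|/andP [h1 /nonapP h2]] //.
  by apply/andP.
- by fpa.
- by move=> I [h1 h2]; exact: dec_abP c0 (adequate_targets h1) h2.
Qed.

Lemma NP_absorbing R : NP (ConjRelReach R absorbing_targets binary_code).
Proof.
apply: (@NP_ConjRelReach R _ absb _ fpc_absb 1 isT) => [I|I h]; first exact: absbP.
exact: adequate_absorbing.
Qed.

Lemma PTIME_absorbing R :
  PTIME (ConjRelReach R (fun I => absorbing_targets I /\ num_napprox I = 0) binary_code).
Proof.
apply: (@PTIME_ConjRelReach R _ (fun r => absb r && nonap r) _ _ (dec_ab 1) (fpc_dec_ab 1)).
- move=> I; split=> [[/(absbP R) h1 /nonapP h2]|/andP [/(absbP R) h1 /nonapP h2]] //.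
  by apply/andP.
- by fpa.
- by move=> I [h1 h2]; exact: (@dec_abP R I 1 isT (adequate_absorbing h1) h2).
Qed.

Lemma PTIME_own R :
  PTIME (ConjRelReach R (fun I => num_scheds I = num_terms I * num_preds I) binary_code).
Proof.
apply: (@PTIME_ConjRelReach R _ pown _ fpc_pown dec_own fpc_dec_own) => [I|I].
  by split=> [h|/eqP //]; apply/eqP.
exact: dec_ownP.
Qed.

End Membership.
Import Membership.

(** * Satisfiability reduces to ConjRelReach *)

Module SatReduction.

Local Open Scope ring_scope.

(** From state 0 an action names the next state, and state 1 is absorbing. The probability of
    reaching 1 acts as a fractional truth value, set by the scheduler. *)
Definition coin_dest (s a : 'I_2) : 'I_2 := if s == ord_max then ord_max else a.
Definition coin_tr (s a t : 'I_2) : rat := (t == coin_dest s a)%:R.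

Lemma coin_01 s a t : 0 <= coin_tr s a t <= 1.
Proof. by rewrite /coin_tr; case: (_ == _). Qed.

Lemma coin_1 s a : \sum_t coin_tr s a t = 1.
Proof. by rewrite (bigD1 (coin_dest s a)) //= /coin_tr eqxx big1 ?addr0 // => t /negbTE ->. Qed.

Definition coin : mdp 1 1 :=
  @MDP 1 1 coin_tr coin_01 (fun s a => or_introl (coin_1 s a)) (fun s => ex_intro _ ord0 (coin_1 s ord0)).

Section Coin.
Variable R : realType.

Lemma always_sum (b : 'I_2) : \sum_(a : 'I_2) (a == b)%:R = 1 :> R.
Proof. by rewrite (bigD1 b) //= eqxx big1 ?addr0 // => a /negbTE ->. Qed.

Definition always (b : 'I_2) : scheduler coin R :=
  @Scheduler _ _ coin R (fun _ _ a => (a == b)%:R) (fun _ _ a => ler0n _ _) (fun _ _ => always_sum b)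
    (fun _ s a ne => False_ind _ (ne (coin_1 s a))).

Lemma always_step b h i : cylinder_prob (always b) ord0 h != 0 -> (i < size h)%N ->
  (nth point h i).2 = b /\ (nth point h i).1 = (if i is 0 then ord0 else if b == ord_max then ord_max else ord0).
Proof.
rewrite /cylinder_prob prodf_seq_neq0 => /allP H; elim: i => [|i IH] ih.
  have := H (Ordinal ih) (mem_index_enum _); rewrite /= /step_prob /= take0 mulf_eq0 negb_or => /andP [h1 h2].
  split; first by apply/eqP; move: h2; case: (_ == b) => //; rewrite eqxx.
  by apply/eqP; move: h1; rewrite /next_state_prob; case: (_ == ord0) => //; rewrite eqxx.
have [a1 s1] := IH (ltnW ih).
have := H (Ordinal ih) (mem_index_enum _); rewrite /= /step_prob /= mulf_eq0 negb_or => /andP [h1 h2].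
split; first by apply/eqP; move: h2; case: (_ == b) => //; rewrite eqxx.
move: h1; rewrite (take_nth point (ltnW ih)).
have -> : next_state_prob R coin ord0 (rcons (take i h) (nth point h i)) (nth point h i.+1).1 =
   ratr (coin_tr (nth point h i).1 (nth point h i).2 (nth point h i.+1).1).
  case: (take i h) => [|x l] /=; rewrite ?last_rcons; by case: (nth point h i).
rewrite s1 a1 /coin_tr ratr_nat => h1.
have -> : (nth point h i.+1).1 = coin_dest (if i is 0 then ord0 else if b == ord_max then ord_max else ord0) b.
  by apply/eqP; move: h1; case: (_ == coin_dest _ _) => //; rewrite eqxx.
have bb (c : 'I_2) : c = ord_max \/ c = ord0.
  by case: c => [[|[|c]] cb] //; [right|left]; exact: val_inj.
by rewrite /coin_dest; case: (bb b) => ->; case: (i).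
Qed.

Lemma reach_const (sigma : scheduler coin R) s T (v : R) :
  (forall n, (1 < n)%N -> reachN sigma s T n = v) -> reach_prob sigma s T = v.
Proof.
move=> H; apply/eqP; rewrite -subr_eq0; apply: contraT => ne.
have d0 : 0 < `|reach_prob sigma s T - v| / 2 by rewrite divr_gt0 ?normr_gt0.
have [N HN] := reachN_cvg sigma s T d0.
have := HN (maxn N 2) (leq_maxl _ _); rewrite H ?leq_maxr // distrC.
by move: d0; set x := `|_|; lra.
Qed.

Lemma sumf_eq n (G G' : seq ('I_2 * 'I_2) -> R) h :
  (forall h', size h' = (size h + n)%N -> G h' = G' h') -> sumf n G h = sumf n G' h.
Proof.
elim: n h => [|n IH] h H /=; first by apply: H; rewrite addn0.
by apply: eq_bigr => x _; apply: IH => h' sh; apply: H; rewrite sh size_rcons addnS.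
Qed.

Lemma reach_always (b : bool) :
  reach_prob (always (if b then ord_max else ord0)) ord0 [set ord_max]%SET = b%:R.
Proof.
apply: reach_const => n n1; case: b; last first.
  rewrite /reachN (@sumf_eq _ _ (fun=> 0)); first by elim: n [::] {n1} => //= n IH h; rewrite big1.
  move=> h sh; case: (eqVneq (cylinder_prob (always ord0) ord0 h) 0) => [->|c0]; first by rewrite mul0r.
  case: hasP => [[x /(nthP point) [i ih <-]]|_]; last by rewrite mulr0.
  by have [_ ->] := always_step c0 ih; rewrite inE; case: i {ih}.
rewrite /reachN -[RHS](cp_total ord0 (always ord_max) n); apply: sumf_eq => h sh.
case: (eqVneq (cylinder_prob (always ord_max) ord0 h) 0) => [->|c0]; first by rewrite mul0r.
rewrite (_ : has _ _) ?mulr1 //; apply/hasP; exists (nth point h 1); first by rewrite mem_nth // sh.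
have ih : (1 < size h)%N by rewrite sh.
by have [_ ->] := always_step c0 ih; rewrite inE.
Qed.

End Coin.

Definition skey := (nat * nat * nat * nat)%type.
Definition lit := (bool * skey)%type.
Definition kdef : skey := (0, 0, 0, 0)%N.
Definition spred := (bool * seq lit)%type.
Definition pdef : spred := (true, [::]).
Definition sat (Vs : seq skey) (a : skey -> bool) (c : seq lit) : bool :=
  has (fun l => (l.2 \in Vs) && (a l.2 == l.1)) c.

(** * Clauses as predicates on reachability probabilities *)

Section Reduce.
Variables (eps : rat) (K : nat).
Hypotheses (eps0 : 0 <= eps) (epsK : eps = 2^-1 - K.+2%:R^-1).
Variables (Vs : seq skey) (Cs : seq (seq lit)).
Hypotheses (uV : uniq Vs) (cK : forall c, c \in Cs -> (size c <= K.+1)%N).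

(** The flag tells the predicates that force a variable to be nearly Boolean from those that express
    a clause. *)
Definition spreds : seq spred := [seq (true, [:: (true, v)]) | v <- Vs] ++ [seq (false, c) | c <- Cs].
Definition co (v : skey) (p : spred) : int := Posz ((true, v) \in p.2) - Posz ((false, v) \in p.2).
Definition nneg (p : spred) : nat := size [seq v <- Vs | (false, v) \in p.2].
(** A clause demands at least 1 from the sum of x over its positive and of 1 - x over its negative
    literals; the constants of the latter are moved to the bound. *)
Definition bnd (p : spred) : rat := if p.1 then 2^-1 else (1 - Posz (nneg p))%:~R.
Definition cmp (p : spred) : comparison := if p.1 then CmpNapprox eps else CmpGe.

Lemma cmp_ge0 p : tolerance_ge0 (cmp p). Proof. by rewrite /cmp; case: p.1. Qed.

Lemma sat_onto (k : 'I_(size Vs)) : exists (i : 'I_(size Vs)) (j : 'I_(size spreds)), i = k.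
Proof.
have h : (0 < size spreds)%N.
  by rewrite size_cat !size_map; apply: leq_trans (leq_addr _ _); exact: leq_ltn_trans (ltn_ord k).
by exists k, (Ordinal h).
Qed.

Definition sat_inst : instance := @Instance 1 1 coin (size spreds) (size Vs) (size Vs)
  (fun i j => (co (nth kdef Vs i) (nth pdef spreds j))%:~R) (fun j => bnd (nth pdef spreds j))
  (fun _ _ => ord0) (fun i _ => i) sat_onto (fun _ _ => [set ord_max]%SET)
  (fun j => cmp (nth pdef spreds j)) (fun j => cmp_ge0 (nth pdef spreds j)).

Lemma sat_targets : (num_targets sat_inst <= 1)%N.
Proof.
rewrite /num_targets; apply: leq_trans (_ : #|[set [set ord_max]%SET : {set 'I_2}]%SET| <= 1)%N; last by rewrite cards1.
by apply: subset_leq_card; apply/fintype.subsetP => T /imset2P [i j _ _ ->]; rewrite inE.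
Qed.

Lemma sat_absorbing : absorbing_targets sat_inst.
Proof. by move=> i j s; rewrite inE => /eqP -> a _; rewrite /= /coin_tr /coin_dest eqxx. Qed.

Section Values.
Variable R : realType.

Lemma sum_co (x : skey -> R) (p : spred) :
  \sum_(v <- Vs) (co v p)%:~R * x v + (nneg p)%:R =
  \sum_(v <- Vs | (true, v) \in p.2) x v + \sum_(v <- Vs | (false, v) \in p.2) (1 - x v).
Proof.
have -> : (nneg p)%:R = \sum_(v <- Vs | (false, v) \in p.2) 1 :> R.
  by rewrite /nneg -big_filter big_const_seq count_predT iter_addr addr0.
rewrite (big_mkcond (fun v => (true, v) \in p.2)) !(big_mkcond (fun v => (false, v) \in p.2)) -!big_split /=.
apply: eq_bigr => v _; rewrite /co rmorphB /=.
by case: (_ \in _); case: (_ \in _) => /=; ring.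
Qed.

(** Every value is within 1 / (K + 2) of 0 or 1, so a literal that is false after rounding
    contributes less than that. At most K + 1 of them stay below 1 in total, and a clause without a
    true literal would violate its predicate. *)
Lemma satisfiable_sat : satisfiable R sat_inst <-> exists a, all (sat Vs a) Cs.
Proof.
have r2 : ratr (2^-1 : rat) = 2^-1 :> R by rewrite fmorphV rmorph_nat.
have rK : ratr (K.+2%:R^-1 : rat) = K.+2%:R^-1 :> R by rewrite fmorphV rmorph_nat.
have rE : ratr (2^-1 - K.+2%:R^-1 : rat) = 2^-1 - K.+2%:R^-1 :> R by rewrite -r2 -rK; exact: rmorphB.
have spE (j : 'I_(size spreds)) : nth pdef spreds j \in spreds by exact: mem_nth.
split=> [[sigma H]|[a /allP H]]; last first.
  exists (fun i => always R (if a (nth kdef Vs i) then ord_max else ord0)) => j /=.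
  under eq_bigr do rewrite reach_always ratr_int.
  have -> : \sum_(i < size Vs) (co (nth kdef Vs i) (nth pdef spreds j))%:~R * (a (nth kdef Vs i))%:R =
     \sum_(v <- Vs) (co v (nth pdef spreds j))%:~R * (a v)%:R :> R.
    by rewrite [RHS](big_nth kdef) big_mkord.
  move: (spE j); rewrite mem_cat => /orP [/mapP [v vV ->]|/mapP [c cC ->]] /=.
    rewrite (bigD1_seq v) //= big1 ?addr0; last first.
      by move=> v' ne; rewrite /co /= !inE !xpair_eqE /= (negbTE ne) mul0r.
    rewrite /co /= !inE !xpair_eqE /= eqxx subr0 mul1r /bnd /= epsK.
    rewrite rE r2.
    have k0 : 0 < K.+2%:R^-1 :> R by rewrite invr_gt0 ltr0n.
    have -> : `|(a v)%:R - 2^-1| = 2^-1 :> R.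
      case: (a v); last by rewrite mulr0n sub0r normrN ger0_norm // invr_ge0.
      by rewrite mulr1n ger0_norm; lra.
    by rewrite ltrBlDr ltrDl.
  have := sum_co (fun v => (a v)%:R) (false, c); rewrite /bnd /= => E.
  rewrite ratr_int rmorphB /= lerBlDr E.
  have /hasP [[b v] bc /andP [/= vV /eqP av]] := H c cC.
  have p1 : 0 <= \sum_(v <- Vs | (true, v) \in c) (a v)%:R :> R by apply: sumr_ge0 => *; rewrite ler0n.
  have p2 : 0 <= \sum_(v <- Vs | (false, v) \in c) (1 - (a v)%:R) :> R.
    by apply: sumr_ge0 => u _; case: (a u); rewrite ?subrr ?subr0.
  case: b bc av => bc av.
    suff : 1 <= \sum_(v <- Vs | (true, v) \in c) (a v)%:R :> R by lra.
    rewrite big_mkcond (bigD1_seq v) //= bc av lerDl; apply: sumr_ge0 => u _.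
    by case: ifP => // _; rewrite ler0n.
  suff : 1 <= \sum_(v <- Vs | (false, v) \in c) (1 - (a v)%:R) :> R by lra.
  rewrite big_mkcond (bigD1_seq v) //= bc av subr0 lerDl; apply: sumr_ge0 => u _.
  by case: ifP => // _; case: (a u); rewrite ?subrr ?subr0.
pose xi (i : 'I_(size Vs)) : R := reach_prob (sigma i) ord0 [set ord_max]%SET.
pose x v : R := if insub (index v Vs) is Some i then xi i else 0.
have xE (i : 'I_(size Vs)) : x (nth kdef Vs i) = xi i.
  by rewrite /x index_uniq //; case: insubP => [i' _ /val_inj -> //|]; rewrite ltn_ord.
have {}H p : p \in spreds -> compare (cmp p) (\sum_(v <- Vs) (co v p)%:~R * x v) (ratr (bnd p)).
  move=> /(nthP pdef) [j jp <-]; have := H (Ordinal jp) => /=.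
  rewrite [\sum_(v <- Vs) _](big_nth kdef) big_mkord.
  by under [X in compare _ X _ -> _]eq_bigr => i _ do rewrite ratr_int -/(xi i) -xE.
have [k [kE k0 kM]] : exists k : R, [/\ k = K.+2%:R^-1, 0 < k & K.+1%:R * k + k = 1].
  exists K.+2%:R^-1; split=> //.
  by rewrite -[X in _ + X]mul1r -mulrDl natr1 mulfV // pnatr_eq0.
have near v : v \in Vs -> x v < k \/ 1 - k < x v.
  move=> vV; have /= := H (true, [:: (true, v)]) _; rewrite mem_cat map_f // => /(_ isT).
  rewrite (bigD1_seq v) //= big1 ?addr0; last first.
    by move=> v' ne; rewrite /co /= !inE !xpair_eqE /= (negbTE ne) mul0r.
  rewrite /co /= !inE !xpair_eqE /= eqxx subr0 mul1r /bnd /= epsK rE r2 -kE.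
  by rewrite lter_normr => /orP [] h; [right|left]; lra.
exists (fun v => 1 - k < x v); apply/allP => c cC; apply: contraT => /hasPn no.
have /= := H (false, c) _; rewrite mem_cat map_f ?orbT // => /(_ isT).
rewrite /bnd /= ratr_int rmorphB /= lerBlDr (sum_co x (false, c)) /=.
have l1 v : v \in Vs -> (true, v) \in c -> x v < k.
  move=> vV vc; have [//|h] := near v vV; have := no _ vc; by rewrite /= vV h eqxx.
have l2 v : v \in Vs -> (false, v) \in c -> 1 - x v < k.
  move=> vV vc; have [h|h] := near v vV; last by lra.
  have := no _ vc; rewrite /= vV /= => h2; move: h2; case: ltP => // h3 _.
  by move: h3; lra.
pose n1 := size [seq v <- Vs | (true, v) \in c]; pose n2 := size [seq v <- Vs | (false, v) \in c].
have nn : (n1 + n2 <= K.+1)%N.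
  apply: leq_trans (cK cC).
  have u1 : uniq ([seq (true, v) | v <- Vs & (true, v) \in c] ++ [seq (false, v) | v <- Vs & (false, v) \in c]).
    have pinj b : injective (@pair bool skey b) by move=> ? ? [].
    rewrite cat_uniq !(map_inj_uniq (pinj _)) !filter_uniq // andbT /=.
    by apply/hasPn => u /mapP [v _ ->]; apply/negP => /mapP [].
  rewrite /n1 /n2 -(size_map (pair true)) -[X in (_ + X)%N](size_map (pair false)) -size_cat.
  apply: uniq_leq_size u1 _ => u; rewrite mem_cat => /orP [] /mapP [v]; rewrite mem_filter => /andP [h _] -> //.
have sumle (P : pred skey) (f : skey -> R) (e : R) (L : seq skey) : (forall v, v \in L -> P v -> f v <= e) ->
    \sum_(v <- L | P v) f v <= (size (seq.filter P L))%:R * e.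
  elim: L => [|v L IH] h; first by rewrite big_nil mul0r.
  have {}IH := IH (fun u uL => h u (mem_behead (s := v :: L) uL)).
  rewrite big_cons /=; case: ifP => Pv //=; rewrite -natr1 mulrDl mul1r addrC lerD //.
  by apply: h => //; exact: mem_head.
have b1 : \sum_(v <- Vs | (true, v) \in c) x v <= n1%:R * k.
  by apply: sumle => v h1 h2; exact: ltW (l1 v h1 h2).
have b2 : \sum_(v <- Vs | (false, v) \in c) (1 - x v) <= n2%:R * k.
  by apply: sumle => v h1 h2; exact: ltW (l2 v h1 h2).
have b3 : (n1 + n2)%:R * k <= K.+1%:R * k :> R by rewrite ler_wpM2r ?ler_nat // ltW.
by move: b1 b2 b3 kM k0; rewrite natrD mulrDl; lra.
Qed.

End Values.

Definition unl A (l : seq A) : seq bool := [seq true | _ <- l] ++ [:: false].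
Definition e_co (z : int) : seq bool := [:: z < 0] ++ (if z == 0 then [:: false] else [:: true; false]) ++ [:: true; false].
(** The entry in front of [Vs] gives [rng] enough room: the absolute value can be 1 when [Vs] is
    empty. *)
Definition e_bnd (p : spred) : seq bool :=
  if p.1 then enc_rat unary_code 2^-1 else
  [:: 1 - Posz (nneg p) < 0] ++ unl (rng (true :: [seq true | _ <- Vs]) `|1 - Posz (nneg p)|%N) ++ [:: true; false].
Definition e_cmp (p : spred) : seq bool :=
  if p.1 then [:: true, true & enc_rat unary_code eps] else [:: false; true].
Definition sat_enc : seq bool :=
  enc_mdp unary_code coin ++ unl spreds ++ unl Vs ++ unl Vs ++
  flatten [seq flatten [seq e_co (co v p) | p <- spreds] | v <- Vs] ++
  flatten [seq e_bnd p | p <- spreds] ++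
  flatten [seq flatten [seq [:: false] | _ <- spreds] | _ <- Vs] ++
  flatten [seq flatten [seq unl (rng Vs i) | _ <- spreds] | i <- idx Vs] ++
  flatten [seq flatten [seq [:: false; true] | _ <- spreds] | _ <- Vs] ++
  flatten [seq e_cmp p | p <- spreds].

Lemma unlE A (l : seq A) : unl l = unary_code (size l).
Proof. by rewrite /unl /unary_code cats1; congr rcons; elim: l => //= a l ->. Qed.

Lemma enc_family_nth A (d : A) (L : seq A) (h : A -> seq bool) :
  enc_family (fun i : 'I_(size L) => h (nth d L i)) = flatten [seq h x | x <- L].
Proof. by congr flatten; exact: (fam1_nth d h (erefl (size L))). Qed.

Lemma enc_family2_nth A B (d : A) (e : B) (L : seq A) (J : seq B) (h : A -> B -> seq bool) :
  enc_family2 (fun (i : 'I_(size L)) (j : 'I_(size J)) => h (nth d L i) (nth e J j)) =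
  flatten [seq flatten [seq h x y | y <- J] | x <- L].
Proof.
rewrite -(enc_family_nth d L (fun x => flatten [seq h x y | y <- J])).
by apply: eq_enc_family => i; rewrite -(enc_family_nth e J (h _)).
Qed.

Lemma enc_ratz (z : int) : enc_rat unary_code z%:~R = enc_int unary_code z ++ [:: true; false].
Proof. by rewrite /enc_rat numq_int denq_int. Qed.

Lemma sat_encE : enc_instance unary_code sat_inst = sat_enc.
Proof.
rewrite /enc_instance /sat_enc !unlE.
have q0 : (max_state sat_inst).+1 = 2%N by [].
congr (_ ++ (_ ++ (_ ++ (_ ++ (_ ++ (_ ++ (_ ++ (_ ++ (_ ++ _))))))))).
- rewrite -(enc_family2_nth kdef pdef Vs spreds (fun v p => e_co (co v p))); apply: eq_enc_family2 => i j /=.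
  rewrite enc_ratz /e_co /enc_int /co /=.
  by case: (_ \in _); case: (_ \in _).
- rewrite -(enc_family_nth pdef spreds e_bnd); apply: eq_enc_family => j /=; rewrite /bnd /e_bnd.
  case: ifP => _ //; rewrite enc_ratz /enc_int unlE; congr (_ :: _ ++ _); congr unary_code.
  set p := nth _ _ _; have h : (nneg p <= size Vs)%N by rewrite /nneg size_filter count_size.
  by rewrite rngE ?size_iota //= size_map; lia.
- by rewrite -(enc_family2_nth kdef pdef Vs spreds (fun _ _ => [:: false])).
- rewrite /enc_family2 /enc_family /idx -val_enum_ord -map_comp; congr flatten; apply: eq_map => i /=.
  rewrite -(enc_family_nth pdef spreds (fun _ => unl (rng Vs i))) /enc_family; congr flatten; apply: eq_map => j.
  by rewrite unlE rngE ?size_iota //; exact: ltnW.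
- rewrite -(enc_family2_nth kdef pdef Vs spreds (fun _ _ => [:: false; true])); apply: eq_enc_family2 => i j.
  apply: (@eq_from_nth _ false) => [|k]; rewrite /enc_set size_map size_enum_ord // => k2.
  have := nth_enc_set [set ord_max : 'I_2]%SET (Ordinal k2); rewrite /enc_set inE => ->.
  by case: k k2 => [|[|]].
- rewrite -(enc_family_nth pdef spreds e_cmp); apply: eq_enc_family => j /=.
  by rewrite /cmp /e_cmp; case: ifP.
Qed.

End Reduce.

Lemma fpc_unl X A {eX : Enc X} {eA : Enc A} (f : X -> seq A) : fpc f -> fpc (fun x => unl (f x)).
Proof. by move=> hf; rewrite /unl; fpa. Qed.

Lemma fpc_spreds : fpc (fun q : seq skey * seq (seq lit) => spreds q.1 q.2).
Proof. by rewrite /spreds; fpa. Qed.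
Lemma fpc_co : fpc (fun q : skey * spred => co q.1 q.2).
Proof.
apply: (eq_fpc (f := fun q : skey * spred => Posz (if (true, q.1) \in q.2.2 then 1%N else 0%N) - Posz (if (false, q.1) \in q.2.2 then 1%N else 0%N))) => [q|].
  by rewrite /co; case: (_ \in _); case: (_ \in _).
by fpa.
Qed.
Lemma fpc_nneg : fpc (fun q : seq skey * spred => nneg q.1 q.2). Proof. by rewrite /nneg; fpa. Qed.
#[export] Hint Resolve fpc_spreds fpc_co fpc_nneg : fpdb.
Lemma fpc_e_co : fpc e_co.
Proof.
rewrite /e_co; apply: fpc_cat; last by fpa.
by apply: fpc_cons; [apply: fpc_sgz; fpa|fpa].
Qed.
Lemma fpc_e_bnd : fpc (fun q : seq skey * spred => e_bnd q.1 q.2).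
Proof.
rewrite /e_bnd; apply: fpc_if; [by fpa|by fpa|]; apply: fpc_cat.
  by apply: fpc_cons; [apply: fpc_sgz; fpa|fpa].
by apply: fpc_cat; [apply: fpc_unl; fpa|fpa].
Qed.
Lemma fpc_e_cmp eps : fpc (e_cmp eps). Proof. by rewrite /e_cmp; fpa. Qed.
#[export] Hint Resolve fpc_e_co fpc_e_bnd fpc_e_cmp : fpdb.

Lemma fpc_sat_enc eps : fpc (fun q : seq skey * seq (seq lit) => sat_enc eps q.1 q.2).
Proof.
have h4 : fpc (fun q : seq skey * nat => unl (rng q.1 q.2)) by apply: fpc_unl; fpa.
pose g (q : seq skey * seq spred) := flatten [seq flatten [seq unl (rng q.1 i) | _ <- q.2] | i <- idx q.1].
have hg : fpc g.
  rewrite /g; apply: fpc_flatten; apply: fpc_map; last by fpa.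
  apply: fpc_flatten; apply: fpc_map; last by fpa.
  by apply: (fpc_comp (f := fun q : seq skey * seq spred * nat * spred => (q.1.1.1, q.1.2))) h4; fpa.
rewrite /sat_enc; apply: fpc_cat; first by fpa.
apply: fpc_cat; first by apply: fpc_unl; fpa.
apply: fpc_cat; first by apply: fpc_unl; fpa.
apply: fpc_cat; first by apply: fpc_unl; fpa.
apply: fpc_cat; first by fpa.
apply: fpc_cat; first by fpa.
apply: fpc_cat; first by fpa.
apply: fpc_cat; last by fpa.
by apply: (fpc_comp (f := fun q : seq skey * seq (seq lit) => (q.1, spreds q.1 q.2))) hg; fpa.
Qed.

End SatReduction.
Import SatReduction.

(** * Turing machine runs as satisfiability *)

Module MachineFormulas.

Definition mvn (m : move) : nat :=
  match m with MoveLeft => 0 | MoveStay => 1 | MoveRight => 2 end.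

(* Contents relative to the head, which is at position [W]. *)
Definition rel (G : finType) (W : nat) (t : tape G) (z : nat) : cell G :=
  if W <= z then nth None t.2 (z - W) else nth None t.1 (W - z).-1.

Lemma relW G W (t : tape G) : rel W t W = tape_read t.
Proof. by rewrite /rel leqnn subnn nth0. Qed.

(** The head stays at [W] and the contents shift instead, so a formula needs no variables for head
    positions. *)
Lemma rel_act G W (t : tape G) x z : 0 < z + mvn x.2 ->
  rel W (tape_act t x) z = if z + mvn x.2 == W.+1 then x.1 else rel W t (z + mvn x.2).-1.
Proof.
case: t x => l r [x []] /=; rewrite /rel /tape_act /= => z0.
- rewrite addn0 in z0 *; case: leqP => h.
    case: eqP => [->|ne]; first by rewrite subSnn.
    case: leqP => h1.
      have -> : z - W = (z - W).-2.+2 by lia.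
      by rewrite /= nth_behead; congr nth; lia.
    have e : z = W by lia.
    by rewrite e subnn /= -nth0; congr nth; lia.
  case: eqP => [|_]; first by lia.
  case: leqP => [|_]; first by lia.
  by rewrite nth_behead; congr nth; lia.
- rewrite addn1 /= eqSS; case: eqP => [->|ne]; first by rewrite leqnn subnn.
  case: leqP => h //; have -> : z - W = (z - W).-1.+1 by lia.
  by rewrite /= nth_behead.
- rewrite addn2 /= eqSS; case: leqP => h.
    case: eqP => [|_]; first by lia.
    case: leqP => h1; last by lia.
    by rewrite nth_behead; congr nth; lia.
  case: eqP => [e|ne]; first by have -> : (W - z).-1 = 0 by lia.
  case: leqP => h1; first by lia.
  by have -> : (W - z).-1 = (W - z.+1).-1.+1 by lia.
Qed.

Definition rule := (nat * seq nat * nat * seq (nat * nat))%type.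
Definition env := (seq bool * seq bool * seq bool * seq nat)%type.

Section Machine.
Variable M : TM.
Local Notation d1 := (tm_tapes M).+1.
Local Notation Cl := (cell (tm_sym M)).
Local Notation Qs := (tm_state M).

Definition cc (x : Cl) : nat := enum_rank x.
Definition qc (x : Qs) : nat := enum_rank x.
Definition Sn : nat := #|{: Cl}| + #|{: Qs}|.

Lemma cc_inj : injective cc. Proof. by move=> x y /val_inj/enum_rank_inj. Qed.
Lemma qc_inj : injective qc. Proof. by move=> x y /val_inj/enum_rank_inj. Qed.
Lemma cc_lt x : cc x < Sn. Proof. exact: leq_trans (ltn_ord _) (leq_addr _ _). Qed.
Lemma qc_lt x : qc x < Sn. Proof. exact: leq_trans (ltn_ord _) (leq_addl _ _). Qed.

(** A halted machine keeps stepping in place, so that acceptance is read at one fixed time. *)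
Definition stepf (q : Qs) (sg : {ffun 'I_d1 -> Cl}) : Qs * ('I_d1 -> Cl * move) :=
  if tm_verdict q != None then (q, fun i => (sg i, MoveStay)) else tm_delta q sg.

Lemma step_rel W (c : config M) : let sg := [ffun i => tape_read (c.2 i)] in
  (tm_step c).1 = (stepf c.1 sg).1 /\
  forall i z, 0 < z + mvn ((stepf c.1 sg).2 i).2 ->
    rel W ((tm_step c).2 i) z = if z + mvn ((stepf c.1 sg).2 i).2 == W.+1 then ((stepf c.1 sg).2 i).1
      else rel W (c.2 i) (z + mvn ((stepf c.1 sg).2 i).2).-1.
Proof.
rewrite /tm_step /stepf /halted /=; case: ifP => _.
  split=> // i z _; rewrite /= addn1 eqSS ffunE; case: eqP => // ->; exact: relW.
by case: tm_delta => q act /=; split=> // i z z0; exact: rel_act.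
Qed.

Definition rule_of (q : Qs) (sg : {ffun 'I_d1 -> Cl}) : rule :=
  (qc q, mkseq (fun i => cc (sg (inord i))) d1, qc (stepf q sg).1,
   mkseq (fun i => (cc ((stepf q sg).2 (inord i)).1, mvn ((stepf q sg).2 (inord i)).2)) d1).
Definition rules : seq rule :=
  [seq rule_of q sg | q <- enum {: Qs}, sg <- enum {: {ffun 'I_d1 -> Cl}}].
Definition bad : seq nat := [seq qc q | q <- enum {: Qs} & tm_verdict q != Some true].

Lemma rulesP ru : reflect (exists q sg, ru = rule_of q sg) (ru \in rules).
Proof.
apply: (iffP allpairsP) => [[[q sg] [_ _ ->]]|[q [sg ->]]]; first by exists q, sg.
by exists (q, sg); rewrite !mem_enum.
Qed.

Section Cnf.
Variable q : env.
Local Notation T := (size q.1.1.1).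
Local Notation W := (size q.1.1.2).
Local Notation B := (size q.1.2).
Local Notation pre := q.2.

Definition Zs : seq nat := idx (true :: q.1.1.2 ++ q.1.1.2).
Definition cnf_vars : seq skey :=
  [seq (p, s) | p <- [seq (p, z) | p <- [seq (t, i) | t <- idx (true :: q.1.1.1), i <- iota 0 d1.+1], z <- Zs],
    s <- iota 0 Sn].

(* Tape [i] holds [s] at relative position [z] at time [t]; tape number [d1]
   stands for the state. *)
Definition ante (t : nat) (ru : rule) : seq lit :=
  (false, (t, d1, 0, ru.1.1.1)) :: [seq (false, (t, i, W, nth 0 ru.1.1.2 i)) | i <- iota 0 d1].
(** A clause has one conclusion, at most one source cell, the state and a symbol per tape: its width
    depends on the number of tapes only. Positions whose source is outside the window get no clause;
    [- 1] compensates that [mvn] counts no move as 1. *)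
Definition cell_cl (t : nat) (ru : rule) (i z : nat) : seq (seq lit) :=
  if (0 < z + (nth (0, 0) ru.2 i).2) && (z + (nth (0, 0) ru.2 i).2 - 1 <= W + W) then
    if z + (nth (0, 0) ru.2 i).2 == W.+1 then [:: (true, (t.+1, i, z, (nth (0, 0) ru.2 i).1)) :: ante t ru]
    else [seq (true, (t.+1, i, z, s)) :: (false, (t, i, z + (nth (0, 0) ru.2 i).2 - 1, s)) :: ante t ru
         | s <- iota 0 Sn]
  else [::].
Definition step_cl (t : nat) (ru : rule) : seq (seq lit) :=
  ((true, (t.+1, d1, 0, ru.1.2)) :: ante t ru) ::
  flatten [seq flatten [seq cell_cl t ru i z | z <- Zs] | i <- iota 0 d1].
(** Three zones: known blanks, the known prefix of the input, and the cells of the certificate. The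
    latter hold a blank or a bit, and blanks propagate to the right, so that the certificate is
    contiguous. *)
Definition init_cl (i z : nat) : seq (seq lit) :=
  if (i != 0) || (z < W) || (size pre + B <= z - W) then [:: [:: (true, (0, i, z, cc None))]]
  else if z - W < size pre then [:: [:: (true, (0, 0, z, nth 0 pre (z - W)))]]
  else [:: [:: (true, (0, 0, z, cc None)); (true, (0, 0, z, cc (Some (inl false))));
               (true, (0, 0, z, cc (Some (inl true))))];
           [:: (true, (0, 0, z.+1, cc None)); (false, (0, 0, z, cc None))]].
Definition cnf : seq (seq lit) :=
  [:: (true, (0, d1, 0, qc (tm_init M)))] ::
  flatten [seq flatten [seq init_cl i z | z <- Zs] | i <- iota 0 d1] ++
  flatten [seq flatten [seq step_cl t ru | ru <- rules] | t <- idx q.1.1.1] ++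
  [seq [:: (false, (T, d1, 0, s))] | s <- bad].

Lemma mem_Zs z : (z \in Zs) = (z <= W + W).
Proof. by rewrite /Zs /idx mem_iota /= add0n size_cat ltnS. Qed.

Lemma mem_cnf_vars t i z s : t <= T -> i <= d1 -> z <= W + W -> s < Sn -> (t, i, z, s) \in cnf_vars.
Proof.
move=> tT id zW sS; apply: allpairs_f; last by rewrite mem_iota.
apply: allpairs_f; last by rewrite mem_Zs.
by apply: allpairs_f; rewrite /idx mem_iota.
Qed.

Lemma uniq_cnf_vars : uniq cnf_vars.
Proof.
have u (A B' : eqType) (l : seq A) (l' : seq B') : uniq l -> uniq l' -> uniq [seq (x, y) | x <- l, y <- l'].
  by move=> ul ul'; apply: allpairs_uniq => // -[? ?] [? ?] _ _ /=.
by rewrite /cnf_vars /Zs /idx !u // ?iota_uniq.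
Qed.

Lemma cnf_init i z c : i < d1 -> z <= W + W -> c \in init_cl i z -> c \in cnf.
Proof.
move=> id zW cI; rewrite inE mem_cat; apply/orP; right; apply/orP; left.
apply/flatten_mapP; exists i; first by rewrite mem_iota.
by apply/flatten_mapP; exists z; rewrite ?mem_Zs.
Qed.

Lemma cnf_step t ru c : t < T -> ru \in rules -> c \in step_cl t ru -> c \in cnf.
Proof.
move=> tT rr cI; rewrite inE !mem_cat; apply/orP; right; apply/orP; right; apply/orP; left.
apply/flatten_mapP; exists t; first by rewrite /idx mem_iota.
by apply/flatten_mapP; exists ru.
Qed.

Lemma step_cell t ru i z c : i < d1 -> z <= W + W -> c \in cell_cl t ru i z -> c \in step_cl t ru.
Proof.
move=> id zW cI; rewrite inE; apply/orP; right.
apply/flatten_mapP; exists i; first by rewrite mem_iota.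
by apply/flatten_mapP; exists z; rewrite ?mem_Zs.
Qed.

Lemma size_cnf c : c \in cnf -> size c <= d1.+3.
Proof.
have sa t ru : size (ante t ru) = d1.+1 by rewrite /= size_map size_iota.
rewrite inE mem_cat => /orP [/eqP -> //|/orP [/flatten_mapP [i _ /flatten_mapP [z _]]|]]; last (rewrite mem_cat => /orP []).
- rewrite /init_cl; case: ifP => _; first by rewrite inE => /eqP ->.
  case: ifP => _; first by rewrite inE => /eqP ->.
  by rewrite !inE => /orP [] /eqP ->.
- move=> /flatten_mapP [t _ /flatten_mapP [ru _]]; rewrite inE => /orP [/eqP ->|].
    by rewrite -[size _]/(size (ante t ru)).+1 sa.
  move=> /flatten_mapP [i _ /flatten_mapP [z _]]; rewrite /cell_cl; case: ifP => // _; case: ifP => _.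
    by rewrite inE => /eqP ->; rewrite -[size _]/(size (ante t ru)).+1 sa.
  by move=> /mapP [s _ ->]; rewrite -[size _]/(size (ante t ru)).+2 sa.
- by move=> /mapP [s _ ->].
Qed.

Lemma rule_read s sg i : i < d1 -> nth 0 (rule_of s sg).1.1.2 i = cc (sg (inord i)).
Proof. by move=> id; rewrite nth_mkseq. Qed.

Lemma all_ante t ru (P : lit -> bool) : all P (ante t ru) <->
  P (false, (t, d1, 0, ru.1.1.1)) /\ forall i, i < d1 -> P (false, (t, i, W, nth 0 ru.1.1.2 i)).
Proof.
rewrite /ante -cat1s all_cat all_seq1; split=> [/andP [h /allP H]|[h H]].
  split=> // i id; apply: H; apply: (map_f (fun i => (false, (t, i, W, nth 0 ru.1.1.2 i)))).
  by rewrite mem_iota.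
by apply/andP; split=> //; apply/allP => l /mapP [i]; rewrite mem_iota add0n => /andP [_ id] ->; exact: H.
Qed.

Lemma horn_head (Vs : seq skey) a k A : sat Vs a ((true, k) :: A) -> all (fun l : lit => ~~ l.1 && a l.2) A -> a k.
Proof.
case/orP => [/andP [_ /eqP ->] //|/hasP [l lA /andP [_ /eqP al]]] /allP /(_ l lA).
by rewrite al; case: l.1.
Qed.

Lemma sat_horn (Vs : seq skey) a k A : k \in Vs -> all (fun l : lit => ~~ l.1 && (l.2 \in Vs)) A ->
  (all (fun l : lit => a l.2) A -> a k) -> sat Vs a ((true, k) :: A).
Proof.
case: (boolP (all (fun l : lit => a l.2) A)) => [aA|/allPn [l lA nl]] kV VA H; rewrite /sat /=.
  by rewrite kV (H isT).
apply/orP; right; apply/hasP; exists l => //; have /andP [h ->] := allP VA l lA.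
by rewrite (negbTE nl) (negbTE h).
Qed.

Section Semantics.
Variable w0 : seq bool.
Hypotheses (TW : T <= W) (PB : size pre + B <= W).
Hypothesis preE : pre = [seq cc (Some (inl b)) | b <- w0].

Lemma rel_start i u z : i < d1 -> rel W ((tm_start M (w0 ++ u)).2 (inord i)) z =
  if (i != 0) || (z < W) then None
  else if z - W < size w0 then Some (inl (nth false w0 (z - W)))
  else if z - W - size w0 < size u then Some (inl (nth false u (z - W - size w0))) else None.
Proof.
move=> id; rewrite /rel /tm_start /= -val_eqE /= inordK // leqNgt.
case: eqP => /= [_|_]; last by case: ifP => _; rewrite nth_nil.
case: ltnP => h /=; first by rewrite nth_nil.
rewrite map_cat nth_cat size_map; case: ltnP => h1; first by rewrite (nth_map false).
by case: ltnP => h2; [rewrite (nth_map false)|rewrite nth_default // size_map].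
Qed.

(** * From a satisfying assignment to an accepting run *)

Section Sound.
Variable a : skey -> bool.
Hypothesis sa : forall c, c \in cnf -> sat cnf_vars a c.

Lemma unit_true k : [:: (true, k)] \in cnf -> a k.
Proof. by move=> /sa /horn_head; apply. Qed.

Let o := W + size pre.
(** The certificate is read up to the first cell marked blank. *)
Let n := find (fun i => a (0, 0, o + i, cc None)) (iota 0 B).
Definition guess : seq bool := mkseq (fun i => a (0, 0, W + size pre + i, cc (Some (inl true)))) n.

Lemma guess_le : n <= B.
Proof. by rewrite -[X in _ <= X](size_iota 0 B) find_size. Qed.

Lemma blank_tail i : n <= i -> o + i <= W + W -> a (0, 0, o + i, cc None).
Proof.
have far j : B <= j -> o + j <= W + W -> a (0, 0, o + j, cc None).
  move=> Bj jW; apply: unit_true; apply: (cnf_init (i := 0) _ jW) => //.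
  by rewrite /init_cl (_ : size pre + B <= o + j - W) ?orbT ?inE // /o; lia.
have base : o + n <= W + W -> a (0, 0, o + n, cc None).
  move=> nW; have [nB|] := ltnP n B; last by move=> h; exact: far.
  have hs : has (fun i => a (0, 0, o + i, cc None)) (iota 0 B) by rewrite has_find size_iota.
  by have := nth_find 0 hs; rewrite nth_iota.
elim: i => [|i IH] ni iW.
  by move: base; rewrite (_ : n = 0); [apply|lia].
have [e|ne] := eqVneq n i.+1; first by rewrite -e; apply: base; rewrite e.
have ai : a (0, 0, o + i, cc None) by apply: IH; lia.
have [iB|] := ltnP i B; last by move=> h; apply: far => //; lia.
rewrite addnS; have zW : o + i <= W + W by lia.
suff h : [:: (true, (0, 0, (o + i).+1, cc None)); (false, (0, 0, o + i, cc None))] \in cnf.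
  by apply: (horn_head (sa h)); rewrite /= ai.
apply: (cnf_init (i := 0) _ zW) => //; rewrite /init_cl.
have -> : (o + i < W) = false by rewrite /o; lia.
have -> : (size pre + B <= o + i - W) = false by rewrite /o; lia.
have -> : (o + i - W < size pre) = false by rewrite /o; lia.
by rewrite !inE eqxx orbT.
Qed.

Lemma sound_init i z : i < d1 -> z <= W + W -> a (0, i, z, cc (rel W ((tm_start M (w0 ++ guess)).2 (inord i)) z)).
Proof.
move=> id zW; rewrite rel_start //.
have hI c : c \in init_cl i z -> sat cnf_vars a c by move=> h; apply: sa; exact: cnf_init h.
have szp : size pre = size w0 by rewrite preE size_map.
case: ifP => [h|/negbT].
  by apply: unit_true; apply: (cnf_init id zW); rewrite /init_cl h inE.
rewrite negb_or negbK -leqNgt => /andP [/eqP i0 Wz]; subst i.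
have nlt : (z < W) = false by lia.
case: ltnP => h1.
  apply: unit_true; apply: (cnf_init id zW); rewrite /init_cl nlt /=.
  have -> : (size pre + B <= z - W) = false by rewrite szp; lia.
  by rewrite szp h1 inE preE (nth_map false).
have e : z = o + (z - W - size w0) by rewrite /o szp; lia.
rewrite size_mkseq; case: ltnP => h2; last by rewrite e; apply: blank_tail; rewrite -?e.
rewrite nth_mkseq //; have nB := guess_le.
have := hI [:: (true, (0, 0, z, cc None)); (true, (0, 0, z, cc (Some (inl false))));
               (true, (0, 0, z, cc (Some (inl true))))].
rewrite /init_cl nlt /=.
have -> : (size pre + B <= z - W) = false by rewrite szp; lia.
have -> : (z - W < size pre) = false by rewrite szp; lia.
rewrite inE eqxx /= => /(_ isT).
have nb : a (0, 0, z, cc None) = false.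
  have := before_find 0 h2; rewrite nth_iota ?add0n -?e //; exact: leq_trans h2 nB.
have -> : W + size pre + (z - W - size w0) = z by rewrite -/o -e.
rewrite /sat /= !eqb_id nb andbF orbF /=.
case h3: (a (0, 0, z, cc (Some (inl true)))); first by rewrite h3.
by rewrite andbF orbF => /andP [].
Qed.

(** Step clauses are implications, so truth passes from each configuration of the actual run to the
    next. The part of the window that is known shrinks by one cell per step at both ends, and T <= W
    keeps the head inside. *)
Lemma sound_run t : t <= T -> let c := tm_run M t (w0 ++ guess) in
  a (t, d1, 0, qc c.1) /\
  forall i z, i < d1 -> t <= z -> z + t <= W + W -> a (t, i, z, cc (rel W (c.2 (inord i)) z)).
Proof.
elim: t => [|t IH] tT.
  split; first by apply: unit_true; rewrite inE eqxx.
  by move=> i z id _; rewrite addn0; exact: sound_init.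
have [IH1 IH2] := IH (ltnW tT); move: IH1 IH2; rewrite /tm_run iterS.
set c := iter t _ _ => IH1 IH2.
pose sg := [ffun i => tape_read (c.2 i)] : {ffun 'I_d1 -> Cl}.
have [s1 s2] := step_rel W c; rewrite -/sg in s1 s2.
have rr : rule_of c.1 sg \in rules by apply/rulesP; exists c.1, sg.
have aA : all (fun l : lit => ~~ l.1 && a l.2) (ante t (rule_of c.1 sg)).
  apply/all_ante; split=> [|i id]; first by rewrite /= IH1.
  by rewrite rule_read // ffunE -(relW W) /=; apply: IH2 => //; lia.
split.
  rewrite s1; apply: (horn_head (A := ante t (rule_of c.1 sg))) aA; apply: sa.
  by apply: (cnf_step tT rr); exact: mem_head.
move=> i z id tz zW.
have z0 : 0 < z + mvn ((stepf c.1 sg).2 (inord i)).2 by lia.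
have m2 : mvn ((stepf c.1 sg).2 (inord i)).2 <= 2 by case: (_.2).
rewrite (s2 _ _ z0).
have sc A : A \in cell_cl t (rule_of c.1 sg) i z -> sat cnf_vars a A.
  move=> h; apply: sa; apply: (cnf_step tT rr); apply: step_cell h => //; lia.
move: sc; rewrite /cell_cl nth_mkseq // [(_, _).1]/= [(_, _).2]/= z0.
have -> : z + mvn ((stepf c.1 sg).2 (inord i)).2 - 1 <= W + W by lia.
rewrite andTb; case: ifP => _ sc.
  by apply: (horn_head (A := ante t (rule_of c.1 sg))) aA; apply: sc; rewrite inE.
set s := cc _; set y := z + _ - 1 in sc.
have [y1 y2] : t <= y /\ y + t <= W + W.
  by rewrite /y; move: (mvn _) z0 m2 => m z0 m2; lia.
have ys : a (t, i, y, s) by rewrite /s -subn1 -/y; apply: IH2.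
apply: (horn_head (A := (false, (t, i, y, s)) :: ante t (rule_of c.1 sg))); last by rewrite [all _ _]/= ys.
apply: sc; apply/mapP; exists s => //; rewrite mem_iota; exact: cc_lt.
Qed.

Lemma sound_accept : accepting (tm_run M T (w0 ++ guess)).
Proof.
have [h _] := sound_run (leqnn T); apply: contraT => na.
have : [:: (false, (T, d1, 0, qc (tm_run M T (w0 ++ guess)).1))] \in cnf.
  rewrite inE !mem_cat; apply/orP; right; apply/orP; right; apply/orP; right.
  apply: (map_f (fun s => [:: (false, (T, d1, 0, s))])); apply: map_f.
  by rewrite mem_filter mem_enum andbT.
by move=> /sa; rewrite /sat /= h eqbF_neg andbF.
Qed.

End Sound.

Lemma cnf_sound a : all (sat cnf_vars a) cnf ->
  exists2 u, size u <= B & accepting (tm_run M T (w0 ++ u)).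
Proof.
move=> /allP sa; exists (guess a); last exact: sound_accept.
by rewrite size_mkseq; exact: guess_le.
Qed.

(** * From an accepting run to a satisfying assignment *)

Section Complete.
Variable u : seq bool.
Hypotheses (uB : size u <= B) (acc : accepting (tm_run M T (w0 ++ u))).

Let c t := tm_run M t (w0 ++ u).
Definition facts (k : skey) : bool :=
  if k.1.1.2 == d1 then k.2 == qc (c k.1.1.1).1 else k.2 == cc (rel W ((c k.1.1.1).2 (inord k.1.1.2)) k.1.2).

Lemma facts_state t s : facts (t, d1, 0, s) = (s == qc (c t).1).
Proof. by rewrite /facts /= eqxx. Qed.

Lemma facts_cell t i z s : i < d1 -> facts (t, i, z, s) = (s == cc (rel W ((c t).2 (inord i)) z)).
Proof. by move=> id; rewrite /facts /= (ltn_eqF id). Qed.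

Lemma ante_vars t s sg : t <= T -> all (fun l : lit => ~~ l.1 && (l.2 \in cnf_vars)) (ante t (rule_of s sg)).
Proof.
move=> tT; apply/all_ante; split=> [|i id]; first by rewrite /= mem_cnf_vars ?qc_lt.
by rewrite rule_read //=; apply: mem_cnf_vars; rewrite ?cc_lt ?leq_addr //; exact: ltnW.
Qed.

Lemma ante_facts t s sg : all (fun l : lit => facts l.2) (ante t (rule_of s sg)) ->
  s = (c t).1 /\ sg = [ffun i => tape_read ((c t).2 i)].
Proof.
case/all_ante; rewrite facts_state => /eqP /qc_inj -> H; split=> //.
apply/ffunP => i; rewrite ffunE; have := H i (ltn_ord i).
rewrite rule_read ?ltn_ord // facts_cell ?ltn_ord // inord_val => /eqP /cc_inj ->.
exact: relW.
Qed.

Lemma facts_init i z cl : i < d1 -> z <= W + W -> cl \in init_cl i z -> sat cnf_vars facts cl.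
Proof.
move=> id zW.
have szp : size pre = size w0 by rewrite preE size_map.
have E z' x : facts (0, i, z', cc x) = (x == rel W ((tm_start M (w0 ++ u)).2 (inord i)) z').
  by rewrite facts_cell // (inj_eq cc_inj).
have inV z' x : z' <= W + W -> (0, i, z', cc x) \in cnf_vars.
  by move=> h; apply: mem_cnf_vars; rewrite ?cc_lt //; exact: ltnW.
rewrite /init_cl; case: ifP => [h|/negbT].
  rewrite inE => /eqP ->; rewrite /sat /= inV // E rel_start //.
  move: h; case: ((i != 0) || (z < W)) => //= h.
  by case: ltnP => [|_]; [lia|case: ltnP => //; lia].
rewrite !negb_or negbK -!leqNgt -ltnNge => /andP [/andP [/eqP i0 Wz] zB]; subst i.
have nlt : (z < W) = false by lia.
case: ifP => h1.
  rewrite inE => /eqP ->.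
  have -> : nth 0 pre (z - W) = cc (Some (inl (nth false w0 (z - W)))).
    by rewrite preE (nth_map false) // -szp.
  by rewrite /sat /= inV // E rel_start // nlt /= -szp h1 !eqxx.
rewrite !inE => /orP [] /eqP ->.
  rewrite /sat /= !inV // !E rel_start // nlt /= -szp h1.
  by case: ifP => //; case: (nth _ _ _).
rewrite /sat /= !inV // ?E; last by lia.
rewrite !rel_start // nlt /= -szp h1.
have -> : (z.+1 < W) = false by lia.
have -> : (z.+1 - W < size pre) = false by lia.
case: ifP => h2 //=; case: ifP => h3 //; lia.
Qed.

Lemma facts_step t ru cl : t < T -> ru \in rules -> cl \in step_cl t ru -> sat cnf_vars facts cl.
Proof.
move=> tT /rulesP [s [sg ->]].
have [s1 s2] := step_rel W (c t).
have cS : c t.+1 = tm_step (c t) by [].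
rewrite inE => /orP [/eqP ->|].
  apply: sat_horn; [by apply: mem_cnf_vars; rewrite ?qc_lt|by apply: ante_vars; exact: ltnW|].
  by move=> /ante_facts [-> ->]; rewrite facts_state cS s1.
move=> /flatten_mapP [i]; rewrite mem_iota add0n => /andP [_ id] /flatten_mapP [z].
rewrite mem_Zs => zW; rewrite /cell_cl nth_mkseq // [(_, _).1]/= [(_, _).2]/=.
case: ifP => // /andP [y0 yW]; case: ifP => yW1.
  rewrite inE => /eqP ->.
  apply: sat_horn; [by apply: mem_cnf_vars; rewrite ?cc_lt //; exact: ltnW|by apply: ante_vars; exact: ltnW|].
  move=> /ante_facts [es eg]; subst s sg; rewrite facts_cell // cS s2 // yW1; exact: eqxx.
move=> /mapP [x]; rewrite mem_iota add0n => /andP [_ xS] ->.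
apply: sat_horn; first by apply: mem_cnf_vars => //; exact: ltnW.
  rewrite [all _ _]/= mem_cnf_vars ?(ltnW tT) ?(ltnW id) // andTb.
  by apply: ante_vars; exact: ltnW.
rewrite [all _ _]/= => /andP [hx /ante_facts [es eg]]; subst s sg.
by move: hx; rewrite !facts_cell // cS s2 // yW1 subn1.
Qed.

Lemma cnf_complete : all (sat cnf_vars facts) cnf.
Proof.
apply/allP => cl; rewrite inE mem_cat => /orP [/eqP ->|/orP [/flatten_mapP [i]|]]; last (rewrite mem_cat => /orP []).
- by rewrite /sat /= mem_cnf_vars ?qc_lt // facts_state /= eqxx.
- rewrite mem_iota add0n => /andP [_ id] /flatten_mapP [z]; rewrite mem_Zs; exact: facts_init.
- move=> /flatten_mapP [t]; rewrite /idx mem_iota add0n => /andP [_ tT] /flatten_mapP [ru rr].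
  exact: facts_step.
- move=> /mapP [s /mapP [x]]; rewrite mem_filter => /andP [nx _] -> ->.
  rewrite /sat /= mem_cnf_vars ?qc_lt // facts_state eqbF_neg orbF /=.
  by apply: contra nx => /eqP /qc_inj ->.
Qed.

End Complete.
End Semantics.
End Cnf.

Lemma fpc_Zs : fpc Zs. Proof. by rewrite /Zs; fpa. Qed.
Hint Resolve fpc_Zs : fpdb.
Lemma fpc_cnf_vars : fpc cnf_vars. Proof. by rewrite /cnf_vars; fpa. Qed.
Lemma fpc_ante : fpc (fun x : env * nat * rule => ante x.1.1 x.1.2 x.2). Proof. by rewrite /ante; fpa. Qed.
Hint Resolve fpc_ante : fpdb.
Lemma fpc_cell_cl : fpc (fun x : env * nat * rule * nat * nat => cell_cl x.1.1.1.1 x.1.1.1.2 x.1.1.2 x.1.2 x.2).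
Proof. by rewrite /cell_cl; fpa. Qed.
Lemma fpc_step_cl : fpc (fun x : env * nat * rule => step_cl x.1.1 x.1.2 x.2).
Proof.
rewrite /step_cl; apply: fpc_cons; first by fpa.
apply: fpc_flatten; apply: fpc_map; last by fpa.
apply: fpc_flatten; apply: fpc_map; last by fpa.
by apply: (fpc_comp (f := fun x : env * nat * rule * nat * nat => x)) fpc_cell_cl; fpa.
Qed.
Lemma fpc_init_cl : fpc (fun x : env * nat * nat => init_cl x.1.1 x.1.2 x.2).
Proof. by rewrite /init_cl; fpa. Qed.
Hint Resolve fpc_step_cl fpc_init_cl : fpdb.
#[local] Opaque step_cl init_cl rules bad.
Lemma fpc_cnf : fpc cnf. Proof. by rewrite /cnf; fpa. Qed.

End Machine.

Definition upow (l : seq bool) (k : nat) : seq bool := iter k (umul l) [:: true].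
Definition upoly (k : nat) (l : seq bool) : seq bool := upow l k ++ nseq k true.

Lemma size_upoly k l : size (upoly k l) = poly_bound k (size l).
Proof.
rewrite /upoly /poly_bound size_cat size_nseq; congr addn.
by elim: k => //= k IH; rewrite size_umul IH expnS.
Qed.

Lemma fpc_upoly k : fpc (upoly k).
Proof.
have h : fpc (fun l : seq bool => upow l k).
  elim: k => [|k IH]; first by rewrite /upow /=; fpa.
  apply: (eq_fpc (f := fun l => umul l (upow l k))) => [//|]; by fpa.
by rewrite /upoly; fpa.
Qed.

End MachineFormulas.
Import MachineFormulas.

(** * Hardness *)

Module Hardness.

Lemma unary_prefix m n r s : unary_code m ++ r = unary_code n ++ s -> m = n /\ r = s.
Proof.
rewrite /unary_code !cat_rcons; elim: m n => [|m IH] [|n] //=; first by case.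
by case=> /IH [-> ->].
Qed.

Lemma flatten_prefix (A : eqType) (Q : pred A) (e : A -> seq bool) :
  (forall x y r s, Q x -> Q y -> e x ++ r = e y ++ s -> x = y /\ r = s) ->
  forall l l' r s, all Q l -> all Q l' -> size l = size l' ->
    flatten [seq e x | x <- l] ++ r = flatten [seq e x | x <- l'] ++ s -> l = l' /\ r = s.
Proof.
move=> H; elim=> [|x l IH] [|y l'] r s //= /andP [Qx Ql] /andP [Qy Ql'] [sl].
by rewrite -!catA => /(H _ _ _ _ Qx Qy) [-> /(IH _ _ _ Ql Ql' sl) [-> ->]].
Qed.

Definition u_rat (x : rt) : seq bool := ((x.1 < 0)%R :: unary_code `|x.1|%N) ++ unary_code x.2.
Definition u_op (x : opc) : seq bool := [:: x.1.1; x.1.2] ++ (if x.1.1 then u_rat x.2 else [::]).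

Lemma u_rat_prefix x y r s : u_rat x ++ r = u_rat y ++ s -> x = y /\ r = s.
Proof.
case: x y => [z d] [z' d'] /=; rewrite /u_rat /= -!catA => -[hz] /unary_prefix [ha /unary_prefix [-> ->]].
by have -> : z = z' by move: hz ha; lia.
Qed.

Lemma u_op_prefix x y r s : x.1.1 || (x.2 == rdef) -> y.1.1 || (y.2 == rdef) ->
  u_op x ++ r = u_op y ++ s -> x = y /\ r = s.
Proof.
case: x y => [[b c] x] [[b' c'] y] /= hx hy [eb ec]; subst b' c'.
case: b hx hy => /= [_ _ /u_rat_prefix [-> ->] //|/eqP -> /eqP -> -> //].
Qed.

Lemma enc_set_size k (A : {set 'I_k}) : size (enc_set A) = k.
Proof. by rewrite size_map size_enum_ord. Qed.

Lemma enc_unaryE I : enc_instance unary_code I = (unary_code (r_S (raw_of I)) ++ unary_code (r_A (raw_of I)) ++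
  flatten [seq u_rat x | x <- r_T (raw_of I)]) ++
  unary_code (r_l (raw_of I)) ++ unary_code (r_m (raw_of I)) ++ unary_code (r_n (raw_of I)) ++
  flatten [seq u_rat x | x <- r_C (raw_of I)] ++ flatten [seq u_rat x | x <- r_B (raw_of I)] ++
  flatten [seq unary_code x | x <- r_s (raw_of I)] ++ flatten [seq unary_code x | x <- r_k (raw_of I)] ++
  flatten [seq x | x <- r_g (raw_of I)] ++ flatten [seq u_op x | x <- r_o (raw_of I)].
Proof.
rewrite /enc_instance /enc_mdp.
have eR q : enc_rat unary_code q = u_rat (rq q) by [].
congr ((_ ++ (_ ++ _)) ++ (_ ++ (_ ++ (_ ++ (_ ++ (_ ++ (_ ++ (_ ++ (_ ++ _))))))))).
- rewrite flat_flat -(enc_fam2 _ (fun t => flatten [seq u_rat x | x <- t])).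
  by apply: eq_enc_family2 => s a; rewrite -enc_fam1.
- by rewrite -enc_fam2.
- by rewrite -enc_fam1.
- by rewrite -(enc_fam2 _ unary_code).
- by rewrite -(enc_fam2 _ unary_code).
- by rewrite -(enc_fam2 _ (fun x => x)).
- by rewrite -enc_fam1; apply: eq_enc_family => j; case: (op j).
Qed.

(** A word belongs to the language as soon as some instance has it as its code, so the reduction
    must control every instance with the code that it produces. *)
Lemma enc_unary_inj I J : enc_instance unary_code I = enc_instance unary_code J -> raw_of I = raw_of J.
Proof.
have pr := @flatten_prefix _ predT u_rat (fun x y r s _ _ => @u_rat_prefix x y r s).
have pn := @flatten_prefix _ predT unary_code (fun x y r s _ _ => @unary_prefix x y r s).
rewrite !enc_unaryE -!catA => /unary_prefix [eS /unary_prefix [eA]].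
move=> /(pr _ _ _ _ (all_predT _) (all_predT _)) []; first by rewrite !size_rT; move: eS eA; rewrite /r_S /r_A /= => -> ->.
move=> eT /unary_prefix [el /unary_prefix [em /unary_prefix [en]]].
have sz2 A (f : forall K, 'I_(num_terms K) -> 'I_(num_preds K) -> A) : size (fam2 (f I)) = size (fam2 (f J)).
  by rewrite !size_fam2; move: el em; rewrite /r_l /r_m /= => -> ->.
have sz1 A (f : forall K, 'I_(num_preds K) -> A) : size (fam1 (f I)) = size (fam1 (f J)).
  by rewrite !size_fam1; move: el; rewrite /r_l /= => ->.
move=> /(pr _ _ _ _ (all_predT _) (all_predT _) (sz2 _ (fun K i j => rq (@coef K i j)))) [eC].
move=> /(pr _ _ _ _ (all_predT _) (all_predT _) (sz1 _ (fun K j => rq (@bound K j)))) [eB].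
move=> /(pn _ _ _ _ (all_predT _) (all_predT _) (sz2 _ (fun K i j => val (@start_state K i j)))) [es].
move=> /(pn _ _ _ _ (all_predT _) (all_predT _) (sz2 _ (fun K i j => val (@sched K i j)))) [ek].
have gS K : all (fun x : seq bool => size x == (r_S (raw_of K)).+1) (r_g (raw_of K)).
  by apply/allP => x /flattenP [l /mapP [i _ ->] /mapP [j _ ->]]; rewrite enc_set_size.
have gI := gS I; have gJ := gS J; rewrite -eS in gJ.
have pg : forall x y r s : seq bool, size x == (r_S (raw_of I)).+1 -> size y == (r_S (raw_of I)).+1 ->
    x ++ r = y ++ s -> x = y /\ r = s.
  move=> x y r s /eqP sx /eqP sy /eqP; rewrite eqseq_cat ?sx ?sy // => /andP [/eqP -> /eqP ->] //.
move=> /(flatten_prefix pg gI gJ) []; first exact: (sz2 _ (fun K i j => enc_set (@target K i j))).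
move=> eg eo.
have oK K : all (fun x : opc => x.1.1 || (x.2 == rdef)) (r_o (raw_of K)).
  by apply/allP => x /mapP [j _ ->]; case: (op j) => *; rewrite /= ?eqxx.
have [eop _] : r_o (raw_of I) = r_o (raw_of J) /\ [::] = [::] :> seq bool.
  apply: (flatten_prefix u_op_prefix (oK I) (oK J)); last by rewrite !cats0.
  exact: (sz1 _ (fun K j => rop (@op K j))).
move: (eC : r_C (raw_of I) = r_C (raw_of J)) (eB : r_B (raw_of I) = r_B (raw_of J)).
move: (es : r_s (raw_of I) = r_s (raw_of J)) (ek : r_k (raw_of I) = r_k (raw_of J)).
move: eS eA eT el em en eg eop.
case: (raw_of I) => [[[[[[? ?] ?] [[? ?] ?]] [? ?]] [[? ?] ?]] ?].
case: (raw_of J) => [[[[[[? ?] ?] [[? ?] ?]] [? ?]] [[? ?] ?]] ?].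
rewrite /r_S /r_A /r_T /r_l /r_m /r_n /r_C /r_B /r_s /r_k /r_g /r_o /=.
by move=> -> -> -> -> -> -> -> -> -> -> -> ->.
Qed.

Lemma NP_hard_unary R (P : instance -> Prop) c : 0 < c -> (forall I, P I -> adequate I c) ->
  (forall I, num_targets I <= 1 -> absorbing_targets I -> P I) ->
  NP_hard (ConjRelReach R P unary_code).
Proof.
move=> c0 ad HP L' [V [k' [[M [kV HV]] HL]]].
(* [K.+1] is the clause width of [size_cnf]; it depends on the machine only, hence the tolerance is
   a constant of the reduction. *)
pose K := (tm_tapes M).+3; pose eps : rat := (2^-1 - K.+2%:R^-1)%R.
have eps0 : (0 <= eps)%R by rewrite /eps subr_ge0 lef_pV2 ?posrE ?ltr0n // ler_nat.
(* The code of a pair is this prefix followed by the certificate, which therefore occupies free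
   cells at the end of the input. *)
pose pr w := pair_code w [::]; pose bl w := upoly k' w.
pose g (b : bool) : nat := cc (M := M) (Some (inl b)).
(* A running time that suffices for the longest admissible certificate, hence for all of them, since
   halted configurations do not change. *)
pose tl w := upoly kV (pr w ++ bl w).
pose e w : env := (tl w, tl w ++ pr w ++ bl w, bl w, [seq g b | b <- pr w]).
pose f w := sat_enc eps (cnf_vars M (e w)) (cnf M (e w)).
have TW w : size (tl w) <= size (tl w ++ pr w ++ bl w) by rewrite size_cat leq_addr.
have PB w : size [seq g b | b <- pr w] + size (bl w) <= size (tl w ++ pr w ++ bl w).
  by rewrite size_map !size_cat leq_addl.
have pairE w u : pair_code w u = pr w ++ u by rewrite /pr /pair_code -catA.
have acc w u : size u <= size (bl w) -> accepting (tm_run M (size (tl w)) (pr w ++ u)) <-> V (pair_code w u).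
  move=> su; have [hh hv] := HV (pair_code w u); rewrite -hv -pairE.
  rewrite /tm_run (iter_halted _ hh) // size_upoly size_cat pairE size_cat /poly_bound leq_add2r.
  by apply: leq_exp2rW; rewrite leq_add2l.
have cK w cl : cl \in cnf M (e w) -> size cl <= K.+1 by exact: size_cnf.
exists f.
  apply: fpr_poly_computable; change (fpc f).
  pose proof (fpc_upoly k'); pose proof (fpc_upoly kV).
  have hp : fpc pr by rewrite /pr /pair_code; fpa.
  have hb : fpc bl by [].
  have ht : fpc tl by rewrite /tl; fpa.
  have hc : fpc g.
    apply: (eq_fpc (f := fun b : bool => if b then cc (M := M) (Some (inl true)) else cc (M := M) (Some (inl false)))).
      by case.
    by fpa.
  have he : fpc e by rewrite /e; fpa.
  have h1 := fpc_comp he (fpc_cnf_vars M); have h2 := fpc_comp he (fpc_cnf M).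
  exact: (fpc_comp (fpc_pair h1 h2) (fpc_sat_enc eps)).
move=> w; have sS := @satisfiable_sat eps K eps0 erefl _ _ (uniq_cnf_vars M (e w)) (cK w) R.
have PJ := HP _ (sat_targets eps0 (cnf_vars M (e w)) (cnf M (e w)))
             (@sat_absorbing eps eps0 _ _).
have fE : f w = enc_instance unary_code (sat_inst eps0 (cnf_vars M (e w)) (cnf M (e w))).
  by rewrite sat_encE // uniq_cnf_vars.
rewrite HL -size_upoly -/(bl w); split=> [[u su /(acc _ _ su) au]|[I [wE PI sI]]].
  exists (sat_inst eps0 (cnf_vars M (e w)) (cnf M (e w))); split=> //; apply/sS.
  by exists (@facts M (e w) (pr w) u); apply: cnf_complete => //; [exact: TW|exact: PB].
have [u su au] : exists2 u, size u <= size (bl w) & accepting (tm_run M (size (tl w)) (pr w ++ u)).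
  have : satisfiable R (sat_inst eps0 (cnf_vars M (e w)) (cnf M (e w))).
    (* The given instance has the same raw form as the constructed one, and satisfiability is
       decided on raw forms. *)
    have rE := enc_unary_inj (etrans (esym fE) wE).
    have [_ hJ] := dec_npP R c0 (ad _ PJ); have [hI _] := dec_npP R c0 (ad _ PI).
    by have [x _ hx] := hI sI; apply: (hJ x); rewrite rE.
  by move=> /sS [a ha]; apply: (@cnf_sound M (e w)) ha => //; [exact: TW|exact: PB].
by exists u => //; apply/(acc _ _ su).
Qed.

End Hardness.
Import Hardness.

Theorem theorem7p28 (R : realType) :
  (forall c : nat, (0 < c)%N ->
     strongly_NP_complete
       (ConjRelReach R (fun I => num_targets I <= c)%N) /\
     PTIME
       (ConjRelReach R (fun I => (num_targets I <= c)%N /\ num_napprox I = 0%N)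
          binary_code)) /\
  (strongly_NP_complete (ConjRelReach R absorbing_targets) /\
   PTIME
     (ConjRelReach R (fun I => absorbing_targets I /\ num_napprox I = 0%N)
        binary_code)) /\
  PTIME (ConjRelReach R (fun I => num_scheds I = (num_terms I * num_preds I)%N) binary_code).
Proof.
split=> [c c0|]; last split.
- split; last exact: PTIME_targets.
  split; first exact: NP_targets.
  apply: (@NP_hard_unary R _ c c0) => [I h|I h _]; first exact: adequate_targets.
  exact: leq_trans h c0.
- split; last exact: PTIME_absorbing.
  split; first exact: NP_absorbing.
  by apply: (@NP_hard_unary R _ 1 isT) => [I h|//]; exact: adequate_absorbing.
- exact: PTIME_own.
Qed.
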